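(* Let $G$ be a $3$-leg star graph and let $M$ be a positive definite plumbing matrix of $G$. Then $Z(q)$ is a linear combination of quantum modular forms (up to $q$-powers) of weight $\frac12$ and quantum set $\mathbb{Q}$; that is, $Z(q)=\sum_{j=1}^r\lambda_jq^{\varrho_j}f_j(\tau)$ for finitely many $\lambda_j\in\mathbb{C}$, $\varrho_j\in\mathbb{Q}$ and quantum modular forms $f_j$ of weight $\frac12$ with quantum set $\mathbb{Q}$. In particular, if $M$ is unimodular ($\det M=1$), then $\widehat Z_{0}(q)$ is a quantum modular form, up to multiplication by a rational power of $q$.
   Context: **Plumbing data.** A $3$-leg star graph is a tree obtained from one central vertex by attaching three legs, where each leg is a path with at least one vertex, joined to the central vertex by one of its ends. For a tree $G=(V,E)$ with vertices $1,\dots,N$, a plumbing matrix is a symmetric integral matrix $M=(m_{jk})$ such that for $j\ne k$, $m_{jk}=-1$ if $j,k$ are joined by an edge and $m_{jk}=0$ otherwise; the diagonal entries are arbitrary integers subject to positive definiteness of $M$. **The series.** Let $\tau\in\mathbb{H}$, $q=e^{2\pi i\tau}$, $q^r:=e^{2\pi i r\tau}$ for $r\in\mathbb{Q}$; PV denotes the Cauchy principal value. Let $$R(\boldsymbol w):=\prod_{j=1}^N (w_j-w_j^{-1})^2\prod_{(k,\ell)\in E}\frac{1}{(w_k-w_k^{-1})(w_\ell-w_\ell^{-1})}.$$ Define $$Z(q):=\frac{q^{\frac{-3N+\mathrm{tr}(M)}{2}}}{(2\pi i)^N}\,\mathrm{PV}\int_{|w_1|=1}\cdots\int_{|w_N|=1}R(\boldsymbol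 w)\,\Theta_M(q;\boldsymbol w)\prod_{j=1}^N\frac{dw_j}{w_j},\qquad \Theta_M(q;\boldsymbol w):=\sum_{\boldsymbol m\in M\mathbb{Z}^N}q^{\frac12\boldsymbol m^TM^{-1}\boldsymbol m}\prod_{j=1}^N w_j^{m_j}.$$ Let $\boldsymbol\delta=(\delta_j)\in\{0,1\}^N$ with $\delta_j\equiv\deg(v_j)\pmod2$ (degree of the $j$-th vertex), and $$\widehat Z_0(q):=\frac{q^{\frac{-3N+\mathrm{tr}(M)}{4}}}{(2\pi i)^N}\,\mathrm{PV}\int_{|w_1|=1}\cdots\int_{|w_N|=1}R(\boldsymbol w)\sum_{\boldsymbol\ell\in 2M\mathbb{Z}^N+\boldsymbol\delta}q^{\frac14\boldsymbol\ell^TM^{-1}\boldsymbol\ell}\prod_{j=1}^Nw_j^{\ell_j}\prod_{j=1}^N\frac{dw_j}{w_j}.$$ **Quantum modular forms.** A function $f$ on $\mathbb{H}$ is called a quantum modular form of weight $k\in\frac12\mathbb{Z}$ with quantum set $\mathcal Q$ ($\emptyset\neq\mathcal Q\subseteq\mathbb{Q}$) if there are a finite-index subgroup $\Gamma\subseteq \mathrm{SL}_2(\mathbb{Z})$ preserving $\mathcal Q$ (i.e. $\gamma x\in\mathcal Q$ whenever $x\in\mathcal Q$ and $\gamma x\neq\infty$) and a multiplier $\chi:\Gamma\to\mathbb{C}^*$ such that the limits $f(x):=\lim_{t\to0^+}f(x+it)$ exist for all $x\in\mathcal Q$ and, for every $\gamma=\begin{pmatrix}a&b\\c&d\end{pmatrix}\in\Gamma$,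 the function $$x\mapsto f(x)-\chi(\gamma)^{-1}(cx+d)^{-k}f(\gamma x)\qquad(x\in\mathcal Q,\ cx+d\ne0)$$ (principal branch) is the restriction of a real-analytic function on $\mathbb{R}\setminus\{-d/c\}$ (on $\mathbb{R}$ if $c=0$).
   Formalization: For cx+d<0 the power (cx+d)^{-k} is taken as the principal branch's boundary value from the lower half-plane (arg = -pi if c>0, pi otherwise); with arg = pi always, as ''principal branch'' literally says, the claim is false. *)

(* Defs.v *)
(* Matrices, finite graphs and rationals are those of MathComp; analysis is done
   over Stdlib's R with Coquelicot's complex numbers C.  Rstruct makes R a
   MathComp field, so that integer and rational data embed by [intr] and [ratr]. *)
From HB Require Import structures.
From Stdlib Require Import Reals.
From Coquelicot Require Import Coquelicot.
From mathcomp Require Import all_boot all_order all_algebra.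
From mathcomp Require Import Rstruct.

Set Implicit Arguments.
Unset Strict Implicit.
Unset Printing Implicit Defensive.

(* Both scopes claim the key R; from here on %R is ring_scope. *)
Delimit Scope R_scope with coqR.
Delimit Scope ring_scope with R.

Local Open Scope ring_scope.

HB.instance Definition _ :=
  Monoid.isComLaw.Build C (RtoC 0) Cplus Cplus_assoc Cplus_comm Cplus_0_l.
HB.instance Definition _ :=
  Monoid.isComLaw.Build C (RtoC 1) Cmult Cmult_assoc Cmult_comm Cmult_1_l.

Definition Cexp (z : C) : C :=
  (RtoC (exp (Re z)) * (RtoC (cos (Im z)) + Ci * RtoC (sin (Im z))))%C.

Definition Cpowz (z : C) (m : int) : C :=
  match m with Posz n => Cpow z n | Negz n => Cinv (Cpow z n.+1) end.

(* q^r with q = exp(2 PI i tau). *)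
Definition qpow (tau : C) (r : R) : C :=
  Cexp (RtoC 2 * RtoC PI * Ci * RtoC r * tau)%C.

(* Unconditional sum of f over the set P: the net of its finite partial sums
   converges to l. *)
Definition is_sum_over (T : eqType) (P : T -> Prop) (f : T -> C) (l : C) : Prop :=
  forall eps : R, (0 < eps)%coqR ->
  exists s0 : seq T,
    [/\ uniq s0, forall x, x \in s0 -> P x &
        forall s : seq T, uniq s -> (forall x, x \in s -> P x) ->
          {subset s0 <= s} ->
          (Cmod (\big[Cplus/RtoC 0]_(x <- s) f x - l)%C < eps)%coqR].

Definition sum_over (T : eqType) (P : T -> Prop) (f : T -> C) : C :=
  Hierarchy.iota (T := C_R_CompleteNormedModule) (is_sum_over P f).

Definition Cis (t : R) : C := (RtoC (cos t) + Ci * RtoC (sin t))%C.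

(* Contour integral of f over the unit circle with the arcs of angular radius
   eps around 1 and -1 removed. *)
Definition circle_int (eps : R) (f : C -> C) : C :=
  let g (t : R) : C := (f (Cis t) * (Ci * Cis t))%C in
  (RInt (V := C_R_CompleteNormedModule) g eps (PI - eps)%coqR
   + RInt (V := C_R_CompleteNormedModule) g (PI + eps)%coqR (2 * PI - eps)%coqR)%C.

Definition fcons (n : nat) (z : C) (w : 'I_n -> C) (i : 'I_n.+1) : C :=
  oapp w z (unlift ord0 i).

Fixpoint torus_int (eps : R) (n : nat) : (('I_n -> C) -> C) -> C :=
  match n with
  | 0 => fun F => F (fun=> RtoC 1)
  | k.+1 => fun F =>
      circle_int eps (fun z => torus_int eps (fun w : 'I_k -> C => F (fcons z w)))
  end.

(* Cauchy principal value of the N-fold integral over |w_1| = ... = |w_N| = 1,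
   for integrands whose singularities on the torus lie in the loci w_j = 1 and
   w_j = -1 (those of the rational function [Rfun] below). *)
Definition PV_torus (n : nat) (F : ('I_n -> C) -> C) : C :=
  Hierarchy.iota (T := C_R_CompleteNormedModule) (fun l : C =>
    filterlim (fun eps : R => torus_int eps F : C_UniformSpace)
      (at_right 0%coqR) (locally (l : C_UniformSpace))).

Definition consecutive (T : eqType) (s : seq T) (x y : T) : bool :=
  infix [:: x; y] s || infix [:: y; x] s.

Definition three_leg_star (N : nat) (e : rel 'I_N) : Prop :=
  exists (c : 'I_N) (p1 p2 p3 : seq 'I_N),
    [/\ [/\ p1 != [::], p2 != [::] & p3 != [::]],
        uniq (c :: p1 ++ p2 ++ p3),
        forall v, v \in c :: p1 ++ p2 ++ p3 &
        forall x y, e x y = [|| consecutive (c :: p1) x y,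
                                consecutive (c :: p2) x y |
                                consecutive (c :: p3) x y]].

Definition deg (N : nat) (e : rel 'I_N) (j : 'I_N) : nat := #|[set k | e j k]|.

Definition mxR (m n : nat) (A : 'M[int]_(m, n)) : 'M[R]_(m, n) := map_mx intr A.

Definition positive_definite (N : nat) (A : 'M[R]_N) : Prop :=
  forall x : 'cV[R]_N, x != 0 -> 0 < (x^T *m A *m x) ord0 ord0.

Definition plumbing_matrix (N : nat) (e : rel 'I_N) (M : 'M[int]_N) : Prop :=
  [/\ M^T = M,
      forall j k, j != k -> M j k = if e j k then - 1 else 0 &
      positive_definite (mxR M)].

(* m^T M^{-1} m *)
Definition invform (N : nat) (M : 'M[int]_N) (m : 'cV[int]_N) : R :=
  ((mxR m)^T *m invmx (mxR M) *m mxR m) ord0 ord0.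

Definition monomial (N : nat) (w : 'I_N -> C) (m : 'cV[int]_N) : C :=
  \big[Cmult/RtoC 1]_(j < N) Cpowz (w j) (m j ord0).

(* The edge set is enumerated by the pairs (k, l) with k < l. *)
Definition Rfun (N : nat) (e : rel 'I_N) (w : 'I_N -> C) : C :=
  (\big[Cmult/RtoC 1]_(j < N) Cpow (w j - Cinv (w j)) 2 *
   \big[Cmult/RtoC 1]_(p : 'I_N * 'I_N | (p.1 < p.2)%N && e p.1 p.2)
      (RtoC 1 / ((w p.1 - Cinv (w p.1)) * (w p.2 - Cinv (w p.2)))))%C.

Definition Theta (N : nat) (M : 'M[int]_N) (tau : C) (w : 'I_N -> C) : C :=
  sum_over (fun m : 'cV[int]_N => exists k : 'cV[int]_N, m = M *m k)
    (fun m => (qpow tau (invform M m / 2)%coqR * monomial w m)%C).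

Definition Zser (N : nat) (e : rel 'I_N) (M : 'M[int]_N) (tau : C) : C :=
  (qpow tau ((- 3 * INR N + (\tr M)%:~R) / 2)%coqR
     / Cpow (RtoC 2 * RtoC PI * Ci) N
   * PV_torus (fun w : 'I_N -> C =>
       Rfun e w * Theta M tau w * \big[Cmult/RtoC 1]_(j < N) Cinv (w j)))%C.

Definition delta (N : nat) (e : rel 'I_N) : 'cV[int]_N :=
  \col_j Posz (odd (deg e j)).

Definition Theta0 (N : nat) (e : rel 'I_N) (M : 'M[int]_N) (tau : C)
    (w : 'I_N -> C) : C :=
  sum_over
    (fun l : 'cV[int]_N => exists k : 'cV[int]_N, l = (M *m k) *+ 2 + delta e)
    (fun l => (qpow tau (invform M l / 4)%coqR * monomial w l)%C).

Definition Zhat0 (N : nat) (e : rel 'I_N) (M : 'M[int]_N) (tau : C) : C :=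
  (qpow tau ((- 3 * INR N + (\tr M)%:~R) / 4)%coqR
     / Cpow (RtoC 2 * RtoC PI * Ci) N
   * PV_torus (fun w : 'I_N -> C =>
       Rfun e w * Theta0 e M tau w * \big[Cmult/RtoC 1]_(j < N) Cinv (w j)))%C.

Definition real_analytic_on (U : R -> Prop) (g : R -> C) : Prop :=
  forall x, U x ->
  exists (r : R) (a : nat -> C), (0 < r)%coqR /\
    forall y : R, (Rabs (y - x) < r)%coqR ->
      is_pseries (K := R_AbsRing) (V := C_R_NormedModule) a (y - x)%coqR (g y).

Definition finite_index_subgroup_SL2Z (Gam : 'M[int]_2 -> Prop) : Prop :=
  [/\ forall g, Gam g -> \det g = 1,
      Gam 1%:M,
      forall g h, Gam g -> Gam h -> Gam (g *m h),
      forall g, Gam g -> Gam (invmx g) &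
      exists s : seq 'M[int]_2, forall g, \det g = 1 ->
        exists h k, [/\ Gam h, k \in s & g = h *m k]].

Local Notation ma g := (g (0 : 'I_2) (0 : 'I_2)).
Local Notation mb g := (g (0 : 'I_2) (1 : 'I_2)).
Local Notation mc g := (g (1 : 'I_2) (0 : 'I_2)).
Local Notation md g := (g (1 : 'I_2) (1 : 'I_2)).

(* c x + d, and (a x + b) / (c x + d) for c x + d <> 0. *)
Definition autj (g : 'M[int]_2) (x : rat) : rat := (mc g)%:~R * x + (md g)%:~R.
Definition moebius (g : 'M[int]_2) (x : rat) : rat :=
  ((ma g)%:~R * x + (mb g)%:~R) / autj g x.

(* (c x + d)^s by the principal branch, for c x + d <> 0.  If c x + d < 0 this
   point lies on the branch cut; the value is then the limit of the principal
   (c z + d)^s as z tends to x from the lower half-plane, i.e. arg (c x + d) is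
   - PI if c > 0 and PI otherwise.  This is the boundary value for which
   quantum modularity can hold on both sides of - d / c: the values on Q of a
   false theta function are those of a nonholomorphic Eichler integral living
   on the lower half-plane.  The constant choice arg = PI fails for c > 0: with
   f = sum_(n >= 1) (-4|n) q^(n^2/8), k = 1/2, g = (1, 0; 8, 1), the phase of
   the cocycle to the left of - 1/8 is the one given by arg = - PI. *)
Definition autpow (g : 'M[int]_2) (x : rat) (s : R) : C :=
  let u : R := ratr (autj g x) in
  let arg : R := if Rlt_dec u 0 then (if 0 < mc g then (- PI)%coqR else PI)
                 else 0%coqR in
  Cexp (RtoC s * (RtoC (ln (Rabs u)) + Ci * RtoC arg))%C.

Definition preserves (Gam : 'M[int]_2 -> Prop) (Q : rat -> Prop) : Prop :=
  forall g x, Gam g -> Q x -> autj g x != 0 -> Q (moebius g x).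

(* Only the values of f on the upper half-plane matter; F is the function of
   vertical limits of f on the quantum set Q. *)
Definition quantum_modular (k : rat) (Q : rat -> Prop) (f : C -> C) : Prop :=
  (exists n : int, k = n%:~R / 2%:R) /\
  (exists x, Q x) /\
  exists (Gam : 'M[int]_2 -> Prop) (chi : 'M[int]_2 -> C) (F : rat -> C),
    [/\ finite_index_subgroup_SL2Z Gam,
        preserves Gam Q,
        forall g, Gam g -> chi g <> RtoC 0,
        forall x, Q x ->
          filterlim (fun t : R => f (RtoC (ratr x) + Ci * RtoC t)%C : C_UniformSpace)
            (at_right 0%coqR) (locally (F x : C_UniformSpace)) &
        forall g, Gam g ->
          exists2 h : R -> C,
            real_analytic_on
              (fun y : R => mc g <> 0 -> y <> - (md g)%:~R / (mc g)%:~R) h &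
            forall x, Q x -> autj g x != 0 ->
              (F x - Cinv (chi g) * autpow g x (ratr (- k))
                       * F (moebius g x))%C = h (ratr x)].

(* Main.v *)
(* The circle integrals of the vertex factors are elementary: a leaf picks out
   w^(-1) and w with signs +1 and -1, a vertex of degree 2 picks out w^0, and the
   principal value at the centre contributes sgn(n)/2 on odd n.  So Z and Zhat_0
   are finite sums, over the exponents at the leaves, of series
   Sum_n sgn(n) psi(n) q^(Q(n)) with psi periodic and Q quadratic; completing the
   square turns each one, up to a power of q and finitely many terms, into a false
   theta function F = Sum_n sgn(n) phi(n) q^(n^2/4p) with phi of period 2p.

   Quantum modularity of F comes from a Poisson summation formula for sgn.  Let
   Psi(t) = Sum_m sgn(m) e^(2 pi i m al) e^(pi i m^2 t) and
   Phi(t) = Sum_n sgn(n + al) e^(pi i (n + al)^2 t).  Summing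
   Int_0^oo sin(2 pi (n + al) x) e^(pi i t x^2) dx over n with Fejer's kernel, and
   turning the half-line by the angle -pi/4 (both integrals solve the same linear
   differential equation in n + al), one gets
   Psi(t) = -2 mu A(t) Phi(-1/t) + 2 mu B(t), where A(t) is Int_0^oo e^(-pi t y^2) dy,
   mu = e^(pi i/4), and B(t) is the integral of e^(-pi t y^2) against a bounded kernel; B stays analytic up to the real axis away from t = 0.  For
   gamma = I mod 4p the classical Gauss sums turn this into a transformation of F
   under gamma whose error is a combination of such B.  Letting tau tend to a
   rational gives the values of F and the cocycle relation there.

   For det M = 1 all sign choices at the leaves that contribute give the same power
   of q, because each leg carries exactly one leaf. *)
Require Import Defs.
From Stdlib Require Import Reals Lra Lia Classical.
From Coquelicot Require Import Coquelicot.
From mathcomp Require Import all_boot all_order all_algebra.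
From mathcomp Require Import Rstruct.
From mathcomp Require Import zify.

Set Implicit Arguments.
Unset Strict Implicit.
Unset Printing Implicit Defensive.

Local Open Scope R_scope.

(** * Complex-valued functions of a real variable *)

(** Three obstacles shape the argument. The half-line sine integrals decay only like 1/s, so their
    sum over n is not absolutely convergent. Cesaro means of the Dirichlet integrals are therefore
    used: the Fejer kernel is nonnegative and O(1/x^2), so a Lipschitz bound on the summand
    suffices. Next, the modular image of a vertical ray is an arc of a circle, so vertical limits at
    rationals do not transform by themselves. The limits are therefore proved with the rate sqrt(Im
    tau) and shown to be stable under a horizontal deviation O((Im tau)^2). Finally, completing a
    square leaves finitely many terms with the wrong sign. Such a term is not modular, but a
    transformation turns it into a multiple of [kap t] times exp(-pi i s^2/t), which is itself a
    Gaussian integral and analytic off t = 0, so it joins the error of the cocycle. Neither the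
    Gauss sum nor the integral of exp(-pi y^2) is ever evaluated: both stay symbolic in the
    multiplier, which only needs them to be nonzero and the integral to be real. *)

Notation CV := C_R_CompleteNormedModule.

Lemma exp_le x y : x <= y -> exp x <= exp y.
Proof. by case=> [/exp_increasing|->]; [exact: Rlt_le | exact: Rle_refl]. Qed.

Lemma exp_opp_le1 x : 0 <= x -> exp (- x) <= 1.
Proof. by move=> h; rewrite -[X in _ <= X]exp_0; apply: exp_le; lra. Qed.

Lemma Cmod_normE (z : C) : norm (z : CV) = Cmod z.
Proof.
rewrite /norm /= /prod_norm /Cmod; congr sqrt.
by rewrite /norm /= /abs /= -!Rmult_assoc !Rmult_1_r -!Rabs_mult !Rabs_pos_eq //; nra.
Qed.

Lemma norm_minusC (x y : C) : norm (minus (x : CV) (y : CV)) = Cmod (x - y).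
Proof. exact: Cmod_normE. Qed.

Lemma ball_Cmod (x y : C) eps : Cmod (y - x) < eps -> ball (x : CV) eps (y : CV).
Proof. by rewrite -norm_minusC; exact: norm_compat1. Qed.

Lemma scalCE (x : R) (z : C) : scal x (z : CV) = (RtoC x * z)%C.
Proof. exact: scal_R_Cmult. Qed.

Lemma Ceq (x y : C) : Re x = Re y -> Im x = Im y -> x = y.
Proof. by case: x => a b; case: y => c d /= -> ->. Qed.

Lemma Re_plus (x y : C) : Re (x + y)%C = Re x + Re y. Proof. by []. Qed.
Lemma Im_plus (x y : C) : Im (x + y)%C = Im x + Im y. Proof. by []. Qed.
Lemma Re_opp (x : C) : Re (- x)%C = - Re x. Proof. by []. Qed.
Lemma Im_opp (x : C) : Im (- x)%C = - Im x. Proof. by []. Qed.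
Lemma Re_mult (x y : C) : Re (x * y)%C = Re x * Re y - Im x * Im y. Proof. by []. Qed.
Lemma Im_mult (x y : C) : Im (x * y)%C = Re x * Im y + Im x * Re y. Proof. by []. Qed.

Lemma Re_minus (x y : C) : Re (x - y)%C = Re x - Re y. Proof. by []. Qed.
Lemma Im_minus (x y : C) : Im (x - y)%C = Im x - Im y. Proof. by []. Qed.

Definition ReImE := (Re_plus, Im_plus, Re_minus, Im_minus, Re_opp, Im_opp, Re_mult, Im_mult, re_RtoC, im_RtoC).

Lemma CexpE (z : C) : Cexp z = (exp (Re z) * cos (Im z), exp (Re z) * sin (Im z)).
Proof. by apply: Ceq => /=; ring. Qed.

Lemma Cexp_add (x y : C) : Cexp (x + y) = (Cexp x * Cexp y)%C.
Proof.
rewrite !CexpE Re_plus Im_plus exp_plus cos_plus sin_plus; apply: Ceq => /=; ring.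
Qed.

Lemma Cexp_0 : Cexp 0 = 1%C.
Proof. by rewrite CexpE /= exp_0 cos_0 sin_0 !Rmult_1_l. Qed.

Lemma Cmod_Cexp (z : C) : Cmod (Cexp z) = exp (Re z).
Proof.
rewrite CexpE /Cmod /=.
have -> : exp (Re z) * cos (Im z) * (exp (Re z) * cos (Im z) * 1)
  + exp (Re z) * sin (Im z) * (exp (Re z) * sin (Im z) * 1) = (exp (Re z))^2.
  have := sin2_cos2 (Im z); rewrite /Rsqr => h.
  transitivity ((exp (Re z))^2 * (sin (Im z) * sin (Im z) + cos (Im z) * cos (Im z))); first ring.
  by rewrite h; ring.
by rewrite sqrt_pow2 //; left; apply: exp_pos.
Qed.

Lemma Cexp_neq0 (z : C) : Cexp z <> 0%C.
Proof. by apply/Cmod_gt_0; rewrite Cmod_Cexp; apply: exp_pos. Qed.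

Lemma Cexp_conj (z : C) : Cexp (Cconj z) = Cconj (Cexp z).
Proof. by case: z => a b; rewrite !CexpE /Cconj /= cos_neg sin_neg; congr pair; ring. Qed.

Lemma Cexp_opp (z : C) : Cexp (- z) = (/ Cexp z)%C.
Proof.
have h : (Cexp z * Cexp (- z))%C = 1%C by rewrite -Cexp_add Cplus_opp_r Cexp_0.
have nz := @Cexp_neq0 z.
transitivity (/ Cexp z * (Cexp z * Cexp (- z)))%C; first by field.
by rewrite h; ring.
Qed.

Lemma Cexp_pow (z : C) n : Cpow (Cexp z) n = Cexp (RtoC (INR n) * z).
Proof.
elim: n => [|n IH]; first by rewrite /= Cmult_0_l Cexp_0.
rewrite S_INR RtoC_plus Cmult_plus_distr_r Cexp_add Cmult_1_l -IH /=; ring.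
Qed.

Lemma Cexp_R (x : R) : Cexp (RtoC x) = RtoC (exp x).
Proof. by rewrite CexpE; apply: Ceq => /=; rewrite ?cos_0 ?sin_0; ring. Qed.

Lemma Cexp_iR (x : R) : Cexp (Ci * RtoC x) = Cis x.
Proof.
rewrite CexpE /Cis; apply: Ceq; rewrite !ReImE /=;
have -> : 0 * x - 1 * 0 = 0 by ring.
all: rewrite exp_0; have -> : 0 * 0 + 1 * x = x by ring.
all: ring.
Qed.


Lemma is_derive_RtoC (f : R -> R) x l :
  is_derive f x l -> is_derive (fun t => RtoC (f t) : CV) x (RtoC l).
Proof.
move=> h.
apply: (is_derive_ext (V := CV) (fun t => scal (f t) (RtoC 1 : CV))).
  by move=> t; rewrite scalCE Cmult_1_r.
have -> : (RtoC l : CV) = scal l (RtoC 1 : CV) by rewrite scalCE Cmult_1_r.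
by apply: (is_derive_scal_l (V := CV)).
Qed.

Lemma is_derive_Cpair (f : R -> C) x (l : C) :
  is_derive (fun t => Re (f t)) x (Re l) -> is_derive (fun t => Im (f t)) x (Im l) ->
  is_derive (f : R -> CV) x l.
Proof.
move=> h1 h2.
apply: (is_derive_ext (V := CV) (fun t => plus (scal (Re (f t)) (RtoC 1 : CV)) (scal (Im (f t)) (Ci : CV)))).
  by move=> t; rewrite !scalCE; apply: Ceq; rewrite !ReImE /=; ring.
have -> : (l : CV) = plus (scal (Re l) (RtoC 1 : CV)) (scal (Im l) (Ci : CV)).
  by rewrite !scalCE; apply: Ceq; rewrite !ReImE /=; ring.
by apply: (is_derive_plus (V := CV)); apply: (is_derive_scal_l (V := CV)).
Qed.

Lemma is_derive_Re (f : R -> C) x (l : C) :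
  is_derive (f : R -> CV) x l -> is_derive (fun t => Re (f t)) x (Re l).
Proof.
move=> h.
rewrite /is_derive.
apply: (filterdiff_ext_lin (U := R_NormedModule) (V := R_NormedModule) (fun t => Re (f t)) (fun y => Re (scal y (l : CV)))).
  apply: (filterdiff_comp (U := R_NormedModule) (V := CV) (W := R_NormedModule) (f : R -> CV) (fst : C -> R) (fun y => scal y (l : CV)) fst h).
  apply: filterdiff_linear; exact: is_linear_fst.
by move=> y; rewrite scalCE !ReImE /scal /= /mult /=; ring.
Qed.

Lemma is_derive_Im (f : R -> C) x (l : C) :
  is_derive (f : R -> CV) x l -> is_derive (fun t => Im (f t)) x (Im l).
Proof.
move=> h.
rewrite /is_derive.
apply: (filterdiff_ext_lin (U := R_NormedModule) (V := R_NormedModule) (fun t => Im (f t)) (fun y => Im (scal y (l : CV)))).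
  apply: (filterdiff_comp (U := R_NormedModule) (V := CV) (W := R_NormedModule) (f : R -> CV) (snd : C -> R) (fun y => scal y (l : CV)) snd h).
  apply: filterdiff_linear; exact: is_linear_snd.
by move=> y; rewrite scalCE !ReImE /scal /= /mult /=; ring.
Qed.

Lemma is_derive_Cmult (f g : R -> C) x (a b : C) :
  is_derive (f : R -> CV) x a -> is_derive (g : R -> CV) x b ->
  is_derive (fun t => (f t * g t)%C : CV) x (a * g x + f x * b)%C.
Proof.
move=> hf hg.
have f1 := is_derive_Re hf; have f2 := is_derive_Im hf.
have g1 := is_derive_Re hg; have g2 := is_derive_Im hg.
apply: is_derive_Cpair.
  have -> : Re (a * g x + f x * b)%C = (Re a * Re (g x) + Re (f x) * Re b) - (Im a * Im (g x) + Im (f x) * Im b).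
    by rewrite !ReImE; ring.
  by apply: (is_derive_minus (V := R_NormedModule)); apply: (is_derive_mult (K := R_AbsRing)) => //; exact: Rmult_comm.
have -> : Im (a * g x + f x * b)%C = (Re a * Im (g x) + Re (f x) * Im b) + (Im a * Re (g x) + Im (f x) * Re b).
  by rewrite !ReImE; ring.
by apply: (is_derive_plus (V := R_NormedModule)); apply: (is_derive_mult (K := R_AbsRing)) => //; exact: Rmult_comm.
Qed.

Lemma is_derive_Cexp (f : R -> C) x (a : C) :
  is_derive (f : R -> CV) x a ->
  is_derive (fun t => Cexp (f t) : CV) x (a * Cexp (f x))%C.
Proof.
move=> hf; have f1 := is_derive_Re hf; have f2 := is_derive_Im hf.
apply: (is_derive_ext (V := CV) (fun t => (exp (Re (f t)) * cos (Im (f t)), exp (Re (f t)) * sin (Im (f t))))).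
  by move=> t; rewrite CexpE.
move: f1 f2; rewrite CexpE; set u := (fun t => Re (f t)); set v := (fun t => Im (f t)) => f1 f2.
have E1 : ex_derive u x by exists (Re a).
have E2 : ex_derive v x by exists (Im a).
have D1 := is_derive_unique _ _ _ f1; have D2 := is_derive_unique _ _ _ f2.
apply: is_derive_Cpair.
  rewrite Re_mult; have -> : Re a * Re (exp (Re (f x)) * cos (Im (f x)), exp (Re (f x)) * sin (Im (f x))) - Im a * Im (exp (Re (f x)) * cos (Im (f x)), exp (Re (f x)) * sin (Im (f x)))
    = Re a * exp (u x) * cos (v x) - Im a * exp (u x) * sin (v x) by rewrite /u /v /=; ring.
  apply: (is_derive_ext (fun t => exp (u t) * cos (v t))) => //.
  by auto_derive => //; rewrite D1 D2; ring.
rewrite Im_mult; have -> : Re a * Im (exp (Re (f x)) * cos (Im (f x)), exp (Re (f x)) * sin (Im (f x))) + Im a * Re (exp (Re (f x)) * cos (Im (f x)), exp (Re (f x)) * sin (Im (f x)))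
    = Re a * exp (u x) * sin (v x) + Im a * exp (u x) * cos (v x) by rewrite /u /v /=; ring.
apply: (is_derive_ext (fun t => exp (u t) * sin (v t))) => //.
by auto_derive => //; rewrite D1 D2; ring.
Qed.

Lemma is_derive_lin (a : C) x : is_derive (fun t : R => (RtoC t * a)%C : CV) x a.
Proof.
have h := @is_derive_Cmult (fun t => RtoC t) (fun=> a) x (RtoC 1) (RtoC 0)
   (is_derive_RtoC (is_derive_id x)) (is_derive_const (V := CV) a x).
have -> : a = (RtoC 1 * a + RtoC x * RtoC 0)%C by ring.
move: h; by have -> : (1 * a + x * 0)%C = (a)%C by ring.
Qed.

Lemma is_derive_quad (a b : C) x :
  is_derive (fun t : R => (RtoC (t ^ 2) * a + RtoC t * b)%C : CV) x (RtoC (2 * x) * a + b)%C.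
Proof.
apply: (is_derive_plus (V := CV)); last exact: is_derive_lin.
have h : is_derive (fun t : R => t ^ 2) x (2 * x) by auto_derive => //; ring.
have := is_derive_Cmult (is_derive_RtoC h) (is_derive_const (V := CV) a x).
rewrite /zero /= => H; have -> : (RtoC (2 * x) * a)%C = (RtoC (2 * x) * a + RtoC (x ^ 2) * 0)%C by ring.
exact: H.
Qed.

Lemma continuous_derive (f : R -> C) x (l : C) : is_derive (f : R -> CV) x l -> continuous (f : R -> CV) x.
Proof. by move=> h; apply: (ex_derive_continuous (V := CV)); exists l. Qed.

Lemma continuous_Re (f : R -> C) x : continuous (f : R -> CV) x -> continuous (fun t => Re (f t)) x.
Proof. move=> h; apply: (continuous_comp (f : R -> CV) (fst : CV -> R)) => //; exact: continuous_fst. Qed.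
Lemma continuous_Im (f : R -> C) x : continuous (f : R -> CV) x -> continuous (fun t => Im (f t)) x.
Proof. move=> h; apply: (continuous_comp (f : R -> CV) (snd : CV -> R)) => //; exact: continuous_snd. Qed.

Lemma continuous_RtoC (f : R -> R) x : continuous f x -> continuous (fun t => RtoC (f t) : CV) x.
Proof.
move=> h; apply: (continuous_ext (fun t => scal (f t) (RtoC 1 : CV))).
  by move=> t; rewrite scalCE Cmult_1_r.
apply: (continuous_scal_l (V := CV)); exact: h.
Qed.

Lemma continuous_Cpair (f : R -> C) x :
  continuous (fun t => Re (f t)) x -> continuous (fun t => Im (f t)) x -> continuous (f : R -> CV) x.
Proof.
move=> h1 h2.
apply: (continuous_ext (fun t => plus (scal (Re (f t)) (RtoC 1 : CV)) (scal (Im (f t)) (Ci : CV)))).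
  by move=> t; rewrite !scalCE; apply: Ceq; rewrite !ReImE /=; ring.
apply: continuous_plus; apply: (continuous_scal_l (V := CV)) => //.
Qed.

Lemma continuous_Cplus (f g : R -> C) x : continuous (f : R -> CV) x -> continuous (g : R -> CV) x ->
  continuous (fun t => (f t + g t)%C : CV) x.
Proof. exact: (continuous_plus (V := CV)). Qed.

Lemma continuous_Cmult (f g : R -> C) x : continuous (f : R -> CV) x -> continuous (g : R -> CV) x ->
  continuous (fun t => (f t * g t)%C : CV) x.
Proof.
move=> hf hg.
have f1 := continuous_Re hf; have f2 := continuous_Im hf.
have g1 := continuous_Re hg; have g2 := continuous_Im hg.
apply: continuous_Cpair => /=.
  apply: (continuous_minus (V := R_NormedModule)); exact: (continuous_mult (K := R_AbsRing)).
apply: (continuous_plus (V := R_NormedModule)); exact: (continuous_mult (K := R_AbsRing)).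
Qed.

Lemma continuous_Cinv (f : R -> C) x : continuous (f : R -> CV) x -> f x <> 0%C ->
  continuous (fun t => (/ f t)%C : CV) x.
Proof.
move=> hf nz.
have f1 := continuous_Re hf; have f2 := continuous_Im hf.
have nz2 : (Re (f x))^2 + (Im (f x))^2 <> 0.
  rewrite -Cmod2_alt => h; apply: nz; apply: Cmod_eq_0.
  have := Cmod_ge_0 (f x) => ?; nra.
have c2 : continuous (fun t => / ((Re (f t))^2 + (Im (f t))^2)) x.
  apply: (continuous_comp (fun t => (Re (f t))^2 + (Im (f t))^2) Rinv); last exact: continuous_Rinv.
  apply: (continuous_ext (fun t => plus (mult (Re (f t)) (Re (f t))) (mult (Im (f t)) (Im (f t))))).
    by move=> t; rewrite /plus /mult /=; ring.
  apply: (continuous_plus (V := R_NormedModule)); exact: (continuous_mult (K := R_AbsRing)).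
apply: continuous_Cpair.
  by apply: (continuous_mult (K := R_AbsRing)) c2.
apply: (continuous_mult (K := R_AbsRing)) c2; exact: (continuous_opp (V := R_NormedModule)).
Qed.

Lemma continuous_Cexp (f : R -> C) x : continuous (f : R -> CV) x -> continuous (fun t => Cexp (f t) : CV) x.
Proof.
move=> hf; have f1 := continuous_Re hf; have f2 := continuous_Im hf.
apply: (continuous_ext (fun t => (exp (Re (f t)) * cos (Im (f t)), exp (Re (f t)) * sin (Im (f t))))).
  by move=> t; rewrite CexpE.
have ce : continuous (fun t => exp (Re (f t))) x.
  apply: (continuous_comp (fun t => Re (f t)) exp) => //; exact: continuous_exp.
apply: continuous_Cpair => /=; apply: (continuous_mult (K := R_AbsRing)) => //.
  apply: (continuous_comp (fun t => Im (f t)) cos) => //; exact: continuous_cos.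
apply: (continuous_comp (fun t => Im (f t)) sin) => //; exact: continuous_sin.
Qed.

Lemma Cmod_le_sum (z : C) : Cmod z <= Rabs (Re z) + Rabs (Im z).
Proof.
have h1 := Rabs_pos (Re z); have h2 := Rabs_pos (Im z).
apply: Rsqr_incr_0_var; last lra.
rewrite /Rsqr; have := Cmod2_alt z; rewrite -(pow2_abs (Re z)) -(pow2_abs (Im z)) /= => h.
nra.
Qed.

(** The mean value theorem has no equality form for complex values, so it is applied to the real and
    the imaginary part separately; this costs the factor 2. *)
Lemma Cbounded_variation (f df : R -> C) D a b : 
  (forall t, Rmin a b <= t <= Rmax a b -> is_derive (f : R -> CV) t (df t) /\ Cmod (df t) <= D) ->
  Cmod (f b - f a) <= 2 * D * Rabs (b - a).
Proof.
move=> h.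
have D0 : 0 <= D.
  have [_ h1] := h a (conj (Rmin_l _ _) (Rmax_l _ _)); have := Cmod_ge_0 (df a); lra.
have aux (g dg : R -> R) : (forall t, Rmin a b <= t <= Rmax a b -> is_derive g t (dg t) /\ Rabs (dg t) <= D) -> Rabs (g b - g a) <= D * Rabs (b - a).
  move=> H.
  have [c [hc ->]] := MVT_gen g a b dg (fun x hx => proj1 (H x (conj (Rlt_le _ _ (proj1 hx)) (Rlt_le _ _ (proj2 hx)))))
    (fun x hx => proj2 (continuity_pt_filterlim g x) (ex_derive_continuous (V := R_NormedModule) g x (ex_intro _ _ (proj1 (H x hx))))).
  rewrite Rabs_mult; apply: Rmult_le_compat_r; first exact: Rabs_pos.
  by case: (H c hc).
have h1 : Rabs (Re (f b) - Re (f a)) <= D * Rabs (b - a).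
  apply: (aux (fun t => Re (f t)) (fun t => Re (df t))) => t /h [d1 d2]; split; first exact: is_derive_Re.
  by apply: Rle_trans d2; apply: re_le_Cmod.
have h2 : Rabs (Im (f b) - Im (f a)) <= D * Rabs (b - a).
  apply: (aux (fun t => Im (f t)) (fun t => Im (df t))) => t /h [d1 d2]; split; first exact: is_derive_Im.
  apply: Rle_trans d2; have := Rmax_Cmod (df t); have := Rmax_r (Rabs (fst (df t))) (Rabs (snd (df t))); rewrite /Im; lra.
apply: Rle_trans (Cmod_le_sum _) _.
rewrite !ReImE; lra.
Qed.

(** * Unconditional sums *)

Lemma filterlimCP (T : Type) (F : (T -> Prop) -> Prop) {FF : Filter F} (f : T -> C) (l : C) :
  filterlim (f : T -> CV) F (locally (l : CV)) <->
  (forall eps : R, 0 < eps -> F (fun x => Cmod (f x - l) < eps)).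
Proof.
rewrite (filterlim_locally_ball_norm (U := CV)); split.
  move=> h eps he; have := h (mkposreal eps he); apply: filter_imp => x.
  by rewrite /ball_norm /= Cmod_normE.
move=> h eps; have := h eps (cond_pos eps); apply: filter_imp => x.
by rewrite /ball_norm /= Cmod_normE.
Qed.

Lemma filterlimC_unique (T : Type) (F : (T -> Prop) -> Prop) {FF : ProperFilter F} (f : T -> C) (l l' : C) :
  filterlim (f : T -> CV) F (locally (l : CV)) ->
  filterlim (f : T -> CV) F (locally (l' : CV)) -> l = l'.
Proof. by move=> h h'; refine (@filterlim_locally_unique T R_AbsRing CV F _ f l l' h h'). Qed.

Lemma Cmod_switch (x y : C) : Cmod (x - y) = Cmod (y - x).
Proof. by rewrite -Cmod_opp; congr Cmod; ring. Qed.

Lemma Cmod_le_dist (x y z : C) : Cmod (x - z) <= Cmod (x - y) + Cmod (y - z).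
Proof. by have -> : (x - z = (x - y) + (y - z))%C by [ring]; exact: Cmod_triangle. Qed.

Lemma Ceq_arch (x y : C) : (forall eps, 0 < eps -> Cmod (x - y) <= eps) -> x = y.
Proof.
move=> h; have h0 : Cmod (x - y) = 0.
  apply: Rle_antisym; last exact: Cmod_ge_0.
  by apply: le_epsilon => eps he; rewrite Rplus_0_l; exact: h.
by have -> : x = ((x - y) + y)%C by [ring]; rewrite (Cmod_eq_0 _ h0); ring.
Qed.

Lemma filterlim_Cscal (T : Type) (F : (T -> Prop) -> Prop) {FF : Filter F} (f : T -> C) l (a : C) :
  filterlim (f : T -> CV) F (locally (l : CV)) -> filterlim (fun x => (a * f x)%C : CV) F (locally ((a * l)%C : CV)).
Proof.
move=> /filterlimCP h; apply/filterlimCP => eps he; have ha := Cmod_ge_0 a; have ha1 : 0 < Cmod a + 1 by lra.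
have h1 := h (eps / (Cmod a + 1)) (Rdiv_lt_0_compat _ _ he ha1).
apply: filter_imp h1 => x hx.
have -> (b : C) : (a * b - a * l = a * (b - l))%C by ring.
rewrite Cmod_mult; set d := Cmod _ in hx *.
have d0 : 0 <= d by apply: Cmod_ge_0.
apply: Rle_lt_trans (_ : (Cmod a + 1) * d < eps); first nra.
have -> : eps = (Cmod a + 1) * (eps / (Cmod a + 1)) by field; lra.
apply: Rmult_lt_compat_l => //; lra.
Qed.

Lemma filterlim_Cplus (T : Type) (F : (T -> Prop) -> Prop) {FF : Filter F} (f g : T -> C) l m :
  filterlim (f : T -> CV) F (locally (l : CV)) -> filterlim (g : T -> CV) F (locally (m : CV)) ->
  filterlim (fun x => (f x + g x)%C : CV) F (locally ((l + m)%C : CV)).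
Proof.
move=> /filterlimCP hf /filterlimCP hg; apply/filterlimCP => eps he.
have he2 : 0 < eps / 2 by lra.
apply: filter_imp (filter_and _ _ (hf _ he2) (hg _ he2)) => x [h1 h2].
have -> (a b : C) : (a + b - (l + m) = (a - l) + (b - m))%C by ring.
apply: Rle_lt_trans (Cmod_triangle _ _) _; lra.
Qed.

Section Bigsum.
Variable T : eqType.
Implicit Types (s : seq T) (f g : T -> C) (P : T -> Prop).

Lemma Cmod_bigsum s f :
  Cmod (\big[Cplus/RtoC 0]_(x <- s) f x) <= \big[Rplus/0]_(x <- s) Cmod (f x).
Proof.
elim: s => [|x s IH]; first by rewrite !big_nil Cmod_0; apply: Rle_refl.
rewrite !big_cons; apply: Rle_trans (Cmod_triangle _ _) _; lra.
Qed.

Lemma bigC_scal s f a :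
  \big[Cplus/RtoC 0]_(x <- s) (a * f x)%C = (a * \big[Cplus/RtoC 0]_(x <- s) f x)%C.
Proof.
elim: s => [|x s IH]; first by rewrite !big_nil; ring.
by rewrite !big_cons IH; ring.
Qed.

Lemma bigC_conj s f :
  \big[Cplus/RtoC 0]_(x <- s) (Cconj (f x))%C = (Cconj (\big[Cplus/RtoC 0]_(x <- s) f x))%C.
Proof.
elim: s => [|x s IH]; first by rewrite !big_nil; apply: Ceq => /=; ring.
by rewrite !big_cons IH Cplus_conj.
Qed.

Lemma bigR_ge0 s (f : T -> R) : (forall x, x \in s -> 0 <= f x) -> 0 <= \big[Rplus/0]_(x <- s) f x.
Proof.
elim: s => [|x s IH] h; first by rewrite big_nil; apply: Rle_refl.
rewrite big_cons; have := h x (mem_head _ _).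
have := IH (fun y hy => h y (mem_behead (s := x :: s) hy)); lra.
Qed.

Lemma bigR_le s (f g : T -> R) : (forall x, x \in s -> f x <= g x) ->
  \big[Rplus/0]_(x <- s) f x <= \big[Rplus/0]_(x <- s) g x.
Proof.
elim: s => [|x s IH] h; first by rewrite !big_nil; apply: Rle_refl.
rewrite !big_cons; have := h x (mem_head _ _).
have := IH (fun y hy => h y (mem_behead (s := x :: s) hy)); lra.
Qed.

Lemma bigR_scal s (f : T -> R) a :
  \big[Rplus/0]_(x <- s) (a * f x) = a * \big[Rplus/0]_(x <- s) f x.
Proof.
elim: s => [|x s IH]; first by rewrite !big_nil; ring.
by rewrite !big_cons IH; ring.
Qed.

Lemma bigR_subset s s' (f : T -> R) : uniq s -> uniq s' -> {subset s <= s'} -> (forall x, 0 <= f x) ->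
  \big[Rplus/0]_(x <- s) f x <= \big[Rplus/0]_(x <- s') f x.
Proof.
move=> us us' sub f0.
have -> : \big[Rplus/0]_(x <- s) f x = \big[Rplus/0]_(x <- s' | x \in s) f x.
  rewrite -[RHS]big_filter; apply: perm_big; apply: uniq_perm => //; first exact: filter_uniq.
  move=> x; rewrite mem_filter; case hx: (x \in s) => //=; symmetry; exact: sub.
rewrite [X in _ <= X](bigID (mem s)) /=.
rewrite -[X in X <= _]Rplus_0_r; apply: Rplus_le_compat_l.
by rewrite -big_filter; apply: bigR_ge0.
Qed.

Lemma bigC_subset s s' f : uniq s -> uniq s' -> {subset s <= s'} ->
  \big[Cplus/RtoC 0]_(x <- s') f x =
  (\big[Cplus/RtoC 0]_(x <- s) f x + \big[Cplus/RtoC 0]_(x <- [seq x <- s' | x \notin s]) f x)%C.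
Proof.
move=> us us' sub; rewrite [LHS](bigID (mem s)) /= big_filter.
congr Cplus; rewrite -big_filter; apply: perm_big; apply: uniq_perm => //; first exact: filter_uniq.
by move=> x; rewrite mem_filter; case hx: (x \in s) => //=; exact: sub.
Qed.


Definition summable P f := exists B : R, forall s, uniq s -> (forall x, x \in s -> P x) ->
  \big[Rplus/0]_(x <- s) Cmod (f x) <= B.

(** Some finite [s0] comes within [eps] of the supremum of the finite absolute sums; appending a
    disjoint set cannot pass the supremum. *)
Lemma summable_tail P f : summable P f -> forall eps : R, 0 < eps ->
  exists s0, [/\ uniq s0, forall x, x \in s0 -> P x &
    forall s, uniq s -> (forall x, x \in s -> P x) -> (forall x, x \in s -> x \notin s0) ->
     \big[Rplus/0]_(x <- s) Cmod (f x) < eps].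
Proof.
move=> [B hB] eps he.
pose E r := exists s, [/\ uniq s, forall x, x \in s -> P x & r = \big[Rplus/0]_(x <- s) Cmod (f x)].
have [||S [S1 S2]] := completeness E.
- by exists B => r [s [us hs ->]]; apply: hB.
- by exists 0, [::]; split=> //; rewrite big_nil.
have [s0 [u0 P0 h0]] : exists s0, [/\ uniq s0, forall x, x \in s0 -> P x & S - eps < \big[Rplus/0]_(x <- s0) Cmod (f x)].
  apply: Classical_Prop.NNPP => H; have : S <= S - eps; last lra.
  apply: S2 => r [s [us hs ->]]; apply: Rnot_lt_le => hl; apply: H; by exists s.
exists s0; split=> // s us Ps dis.
have : \big[Rplus/0]_(x <- s0 ++ s) Cmod (f x) <= S.
  apply: S1; exists (s0 ++ s); split=> //.
    by rewrite cat_uniq u0 us andbT; apply/hasPn => x /dis.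
  by move=> x; rewrite mem_cat => /orP [/P0|/Ps].
rewrite big_cat /= => h; lra.
Qed.

(** The finite subsets of [P] directed by inclusion. Unconditional summation becomes a limit along
    this filter, so that uniqueness and completeness apply. *)
Definition fin_filter P : (seq T -> Prop) -> Prop := fun U =>
  exists s0, [/\ uniq s0, forall x, x \in s0 -> P x &
    forall s, uniq s -> (forall x, x \in s -> P x) -> {subset s0 <= s} -> U s].

Lemma fin_filter_proper P : ProperFilter (fin_filter P).
Proof.
constructor.
  by move=> U [s0 [u0 P0 h]]; exists s0; apply: h.
constructor.
- by exists [::]; split.
- move=> U V [s [u p h]] [s' [u' p' h']]; exists (undup (s ++ s')); split.
  + exact: undup_uniq.
  + by move=> x; rewrite mem_undup mem_cat => /orP [/p|/p'].
  + move=> t ut pt sub; split; [apply: h | apply: h'] => // x hx; apply: sub;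
      by rewrite mem_undup mem_cat hx ?orbT.
- by move=> U V UV [s [u p h]]; exists s; split=> // t *; apply: UV; apply: h.
Qed.

Lemma is_sum_overP P f l : is_sum_over P f l <->
  filterlim (fun s => \big[Cplus/RtoC 0]_(x <- s) f x : CV) (fin_filter P) (locally (l : CV)).
Proof.
have FF : Filter (fin_filter P) by case: (fin_filter_proper P).
by split=> h; [apply/filterlimCP | move/filterlimCP: h].
Qed.

Lemma is_sum_over_unique P f l l' : is_sum_over P f l -> is_sum_over P f l' -> l = l'.
Proof.
move=> /is_sum_overP h /is_sum_overP h'.
exact: (@filterlimC_unique _ _ (fin_filter_proper P) _ _ _ h h').
Qed.

Lemma sum_overE P f l : is_sum_over P f l -> sum_over P f = l.
Proof.
move=> h; apply: (iota_unique (V := CV)) => // y hy; exact: is_sum_over_unique hy h.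
Qed.

Lemma summable_sum P f : summable P f -> exists l, is_sum_over P f l.
Proof.
move=> hs; have FF := fin_filter_proper P.
pose F := filtermap (fun s => \big[Cplus/RtoC 0]_(x <- s) f x) (fin_filter P).
have hc : cauchy (T := CV) F.
  move=> eps; have [s0 [u0 P0 h0]] := summable_tail hs (cond_pos eps).
  exists (\big[Cplus/RtoC 0]_(x <- s0) f x), s0; split=> // s us Ps sub.
  apply: ball_Cmod; rewrite (bigC_subset f u0 us sub).
  have -> (a b : C) : (a + b - a)%C = b by ring.
  apply: Rle_lt_trans (Cmod_bigsum _ _) _; apply: h0.
  - exact: filter_uniq.
  - by move=> x; rewrite mem_filter => /andP [_ /Ps].
  - by move=> x; rewrite mem_filter => /andP [].
exists (lim (T := CV) F); apply/is_sum_overP.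
apply/(filterlim_locally (U := CV)) => eps; exact: (complete_cauchy (T := CV)).
Qed.

Lemma is_sum_over_ext P f g l : (forall x, P x -> f x = g x) -> is_sum_over P f l -> is_sum_over P g l.
Proof.
move=> fg h eps /h [s0 [u0 p0 h0]]; exists s0; split=> // s us ps sub.
have <- : \big[Cplus/RtoC 0]_(x <- s) f x = \big[Cplus/RtoC 0]_(x <- s) g x.
  by apply: eq_big_seq => x /ps /fg.
exact: h0.
Qed.

Lemma is_sum_over_plus P f g l m : is_sum_over P f l -> is_sum_over P g m ->
  is_sum_over P (fun x => f x + g x)%C (l + m)%C.
Proof.
move=> hf hg eps he; have he2 : 0 < eps / 2 by lra.
have [s [u p h]] := hf _ he2; have [s' [u' p' h']] := hg _ he2.
exists (undup (s ++ s')); split; first exact: undup_uniq.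
  by move=> x; rewrite mem_undup mem_cat => /orP [/p|/p'].
move=> t ut pt sub; rewrite big_split /=.
have -> (a b : C) : (a + b - (l + m) = (a - l) + (b - m))%C by ring.
apply: Rle_lt_trans (Cmod_triangle _ _) _.
have := h t ut pt; have := h' t ut pt; move=> A B.
have : {subset s' <= t} by move=> x hx; apply: sub; rewrite mem_undup mem_cat hx orbT.
have : {subset s <= t} by move=> x hx; apply: sub; rewrite mem_undup mem_cat hx.
move=> /B h1 /A h2; lra.
Qed.

Lemma is_sum_over_scal P f l a : is_sum_over P f l -> is_sum_over P (fun x => a * f x)%C (a * l)%C.
Proof.
move=> hf eps he; have ha := Cmod_ge_0 a; have ha1 : 0 < Cmod a + 1 by lra.
have [s [u p h]] := hf (eps / (Cmod a + 1)) (Rdiv_lt_0_compat _ _ he ha1).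
exists s; split=> // t ut pt sub; rewrite bigC_scal.
have -> (b : C) : (a * b - a * l = a * (b - l))%C by ring.
rewrite Cmod_mult; have {}h := h t ut pt sub; set d := Cmod _ in h *.
have d0 : 0 <= d by apply: Cmod_ge_0.
apply: Rle_lt_trans (_ : (Cmod a + 1) * d < eps); first nra.
have -> : eps = (Cmod a + 1) * (eps / (Cmod a + 1)) by field; lra.
apply: Rmult_lt_compat_l => //; lra.
Qed.

Lemma is_sum_over_conj P f l : is_sum_over P f l -> is_sum_over P (fun x => Cconj (f x)) (Cconj l).
Proof.
move=> hf eps /hf [s [u p h]]; exists s; split=> // t ut pt sub.
by rewrite bigC_conj -Cminus_conj Cmod_conj; apply: h.
Qed.

Lemma is_sum_over_0 P : is_sum_over P (fun _ : T => RtoC 0) (RtoC 0).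
Proof.
move=> eps he; exists [::]; split=> // s _ _ _; rewrite big1 //.
by have -> : (0 - 0 = 0)%C by [ring]; rewrite Cmod_0.
Qed.

Lemma is_sum_over_big (I : eqType) (r : seq I) P (F : I -> T -> C) (l : I -> C) :
  (forall i, i \in r -> is_sum_over P (F i) (l i)) ->
  is_sum_over P (fun x => \big[Cplus/RtoC 0]_(i <- r) F i x) (\big[Cplus/RtoC 0]_(i <- r) l i).
Proof.
elim: r => [|i r IH] h.
  rewrite big_nil; apply: is_sum_over_ext (is_sum_over_0 P) => x _; by rewrite big_nil.
rewrite big_cons.
have h1 := is_sum_over_plus (h i (mem_head _ _)) (IH (fun j hj => h j (mem_behead (s := i :: r) hj))).
by apply: is_sum_over_ext h1 => x _; rewrite big_cons.
Qed.

Lemma is_sum_over_le P f l B : is_sum_over P f l ->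
  (forall s, uniq s -> (forall x, x \in s -> P x) -> \big[Rplus/0]_(x <- s) Cmod (f x) <= B) -> Cmod l <= B.
Proof.
move=> hf hB; apply: le_epsilon => eps /hf [s [u p h]].
have {}h := h s u p (fun x hx => hx); have := hB s u p; have := Cmod_bigsum s f.
set S := \big[Cplus/_]_(_ <- _) _ in h *.
have := Cmod_triangle (l - S) S; have -> : (l - S + S = l)%C by ring.
rewrite (Cmod_switch l S); lra.
Qed.

Lemma summable_le P f (g : T -> R) : (forall x, P x -> Cmod (f x) <= g x) ->
  (exists B, forall s, uniq s -> (forall x, x \in s -> P x) -> \big[Rplus/0]_(x <- s) g x <= B) -> summable P f.
Proof.
move=> fg [B hB]; exists B => s us ps; apply: Rle_trans (hB s us ps).
by apply: bigR_le => x /ps /fg.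
Qed.

Lemma is_sum_over_seq P f l (s : nat -> seq T) : is_sum_over P f l ->
  (forall n, uniq (s n)) -> (forall n x, x \in s n -> P x) ->
  (forall x, P x -> exists n0, forall n, (n0 <= n)%N -> x \in s n) ->
  filterlim (fun n => \big[Cplus/RtoC 0]_(x <- s n) f x : CV) eventually (locally (l : CV)).
Proof.
move=> hf us ps ex; apply/filterlimCP => eps /hf [s0 [u0 p0 h]].
have [n0 hn0] : exists n0, forall n, (n0 <= n)%N -> {subset s0 <= s n}.
  elim: s0 {u0 h} p0 => [|x s0 IH] p0; first by exists 0%N => n _ x.
  have [n1 h1] := ex x (p0 x (mem_head _ _)).
  have [n2 h2] := IH (fun y hy => p0 y (mem_behead (s := x :: s0) hy)).
  exists (maxn n1 n2) => n; rewrite geq_max => /andP [l1 l2] y; rewrite inE => /orP [/eqP ->|].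
    exact: h1.
  exact: h2.
exists n0 => n /leP hn; apply: h => // [x /ps //|]; exact: hn0.
Qed.

(** Dominated convergence for unconditional sums: beyond a finite set everything lies below the tail
    of [g], and on that set the limit is taken term by term. It lets the cut of the principal value
    shrink under the theta series. *)
Lemma tannery (U : Type) (F : (U -> Prop) -> Prop) {FF : Filter F} P (f : U -> T -> C) f0 (g : T -> R) (l : U -> C) l0 :
  (exists B, forall s, uniq s -> (forall x, x \in s -> P x) -> \big[Rplus/0]_(x <- s) g x <= B) ->
  F (fun u => forall x, P x -> Cmod (f u x) <= g x) ->
  (forall x, P x -> Cmod (f0 x) <= g x) ->
  (forall x, P x -> filterlim (fun u => f u x : CV) F (locally (f0 x : CV))) ->
  F (fun u => is_sum_over P (f u) (l u)) -> is_sum_over P f0 l0 ->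
  filterlim (l : U -> CV) F (locally (l0 : CV)).
Proof.
move=> hB fg f0g cv hl hl0.
have sg : summable P (fun x => RtoC (g x)).
  apply: (summable_le (g := g)) hB => x px; rewrite Cmod_R Rabs_pos_eq; first exact: Rle_refl.
  apply: Rle_trans (f0g x px); exact: Cmod_ge_0.
apply/filterlimCP => eps he.
(* Two fifths for each of [f u] and [f0] (tail of [g], distance of a large finite sum to the total)
   and one fifth for the difference on the finite set. *)
have he5 : 0 < eps / 5 by lra.
have [s0 [u0 p0 h0]] := summable_tail sg he5.
have fin : F (fun u => Cmod (\big[Cplus/RtoC 0]_(x <- s0) f u x - \big[Cplus/RtoC 0]_(x <- s0) f0 x) < eps / 5).
  move: (eps / 5) he5 {h0 u0} => e.
  elim: s0 p0 e => [|x s0 IH] p0 e he5.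
    apply: filter_forall => u; rewrite !big_nil; have -> : (0 - 0 = 0)%C by [ring]; by rewrite Cmod_0.
  have he2 : 0 < e / 2 by lra.
  have H1 := IH (fun y hy => p0 y (mem_behead (s := x :: s0) hy)) _ he2.
  have H2 := proj1 (@filterlimCP U F FF _ _) (cv x (p0 x (mem_head _ _))) _ he2.
  apply: filter_imp (filter_and _ _ H1 H2) => u [a b]; rewrite !big_cons.
  have -> (p q r t : C) : (p + q - (r + t) = (q - t) + (p - r))%C by ring.
  apply: Rle_lt_trans (Cmod_triangle _ _) _; lra.
have aux (h : T -> C) L : (forall x, P x -> Cmod (h x) <= g x) -> is_sum_over P h L ->
   Cmod (\big[Cplus/RtoC 0]_(x <- s0) h x - L) <= eps / 5 + eps / 5.
  move=> hg /(_ _ he5) [s1 [u1 p1 h1]].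
  have ut := undup_uniq (s0 ++ s1).
  have pt x : x \in undup (s0 ++ s1) -> P x by rewrite mem_undup mem_cat => /orP [/p0|/p1].
  have {}h1 := h1 _ ut pt (fun x hx => etrans (mem_undup _ _) (etrans (mem_cat _ _ _) (introT orP (or_intror hx)))).
  apply: Rle_trans (Cmod_le_dist _ (\big[Cplus/RtoC 0]_(x <- undup (s0 ++ s1)) h x) _) _.
  apply: Rplus_le_compat; last exact: Rlt_le.
  rewrite Cmod_switch (bigC_subset h u0 ut) => [|x hx]; last by rewrite mem_undup mem_cat hx.
  have -> (a b : C) : (a + b - a)%C = b by ring.
  apply: Rle_trans (Cmod_bigsum _ _) _.
  apply: Rle_trans (_ : _ <= \big[Rplus/0]_(x <- [seq x <- undup (s0 ++ s1) | x \notin s0]) Cmod (RtoC (g x))) _.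
    apply: bigR_le => x; rewrite mem_filter => /andP [_ /pt px]; rewrite Cmod_R.
    apply: Rle_trans (hg x px) _; exact: Rle_abs.
  apply: Rlt_le; apply: h0.
  - exact: filter_uniq.
  - by move=> x; rewrite mem_filter => /andP [_ /pt].
  - by move=> x; rewrite mem_filter => /andP [].
apply: filter_imp (filter_and _ _ fin (filter_and _ _ fg hl)) => u [h1 [h2 h3]].
have A := aux _ _ h2 h3; have B := aux _ _ f0g hl0.
rewrite Cmod_switch in A.
apply: Rle_lt_trans (Cmod_le_dist _ (\big[Cplus/RtoC 0]_(x <- s0) f u x) _) _.
have := Cmod_le_dist (\big[Cplus/RtoC 0]_(x <- s0) f u x) (\big[Cplus/RtoC 0]_(x <- s0) f0 x) l0; lra.
Qed.

End Bigsum.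

Lemma is_sum_over_reindex (T T' : eqType) (P : T -> Prop) (P' : T' -> Prop) (h : T' -> T) (f : T -> C) l :
  (forall y, P' y -> P (h y)) ->
  (forall y y', P' y -> P' y' -> h y = h y' -> y = y') ->
  (forall x, P x -> f x <> RtoC 0 -> exists2 y, P' y & h y = x) ->
  is_sum_over P' (fun y => f (h y)) l -> is_sum_over P f l.
Proof.
move=> hP inj surj hs eps /hs [s0 [u0 p0 H]].
exists (map h s0); split.
- by rewrite map_inj_in_uniq // => x y hx hy; apply: inj; apply: p0.
- by move=> x /mapP [y /p0 /hP py ->].
move=> s us ps sub.
(* The preimage of [s] under [h]; whether an element of [s] has one is decided classically. *)
have [s' [us' ps' hs' sub']] : exists s', [/\ uniq s', forall y, y \in s' -> P' y,
   forall y, y \in s' -> h y \in s & forall y, P' y -> h y \in s -> y \in s'].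
  elim: s us ps {sub} => [|x s IH] /=; first by move=> _ _; exists [::]; split.
  move=> /andP [xs us] ps.
  have [s' [us' ps' hs' sub']] := IH us (fun y hy => ps y (mem_behead (s := x :: s) hy)).
  have [[y py yx]|N] := Classical_Prop.classic (exists2 y, P' y & h y = x).
    exists (y :: s'); split => /=.
    + by rewrite us' andbT; apply: contra xs => /hs'; rewrite yx.
    + by move=> z; rewrite inE => /orP [/eqP ->|/ps'].
    + by move=> z; rewrite !inE => /orP [/eqP ->|/hs' ->]; rewrite ?yx ?eqxx ?orbT.
    + move=> z pz; rewrite !inE => /orP [/eqP zx|/(sub' _ pz) ->]; last by rewrite orbT.
      by rewrite (inj z y) ?eqxx // zx.
  exists s'; split=> //.
  + by move=> z /hs' hz; rewrite inE hz orbT.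
  + move=> z pz; rewrite inE => /orP [/eqP zx|]; last exact: sub'.
    by case: N; exists z.
have -> : \big[Cplus/RtoC 0]_(x <- s) f x = \big[Cplus/RtoC 0]_(y <- s') f (h y).
  have hu : uniq (map h s') by rewrite map_inj_in_uniq // => x y hx hy; apply: inj; apply: ps'.
  have hsub : {subset map h s' <= s} by move=> x /mapP [y /hs' hy ->].
  rewrite (bigC_subset f hu us hsub) big_map -[RHS]Cplus_0_r; congr Cplus.
  rewrite big_seq; apply: big1 => x; rewrite mem_filter => /andP [nx xs]; apply: Classical_Prop.NNPP => nz.
  have [y py yx] := surj x (ps x xs) nz; move/negP: nx; apply; apply/mapP; exists y => //.
  by apply: sub'; rewrite ?yx.
apply: H => // y ys0; apply: sub'; first exact: p0.
by apply: sub; apply: map_f.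
Qed.

(** * Improper integrals on the half-line *)

(** The exhaustion avoids the endpoint 0, where the kernel [kern] is a quotient 0/0. A discrete
    exhaustion suffices because all integrands are dominated. *)
Definition is_II (f : R -> C) (l : C) :=
  filterlim (fun n => RInt (V := CV) f (/ (INR n + 1)) (INR n + 1)) eventually (locally (l : CV)).

Definition II (f : R -> C) : C := Hierarchy.iota (T := CV) (is_II f).

(** A single exponential controls both ends: the mass of [f] on (0, a) is at most B (1 - exp(-a)),
    that beyond b at most B exp(-b). *)
Definition IIdom (f : R -> C) (B : R) :=
  forall y, 0 < y -> continuous (f : R -> CV) y /\ Cmod (f y) <= B * exp (- y).

Lemma inv_Sn_pos n : 0 < / (INR n + 1).
Proof. apply: Rinv_0_lt_compat; have := pos_INR n; lra. Qed.

Lemma inv_Sn_le n : / (INR n + 1) <= INR n + 1.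
Proof.
have h := pos_INR n; apply: Rle_trans (_ : 1 <= _); last lra.
by rewrite -Rinv_1; apply: Rinv_le_contravar; lra.
Qed.

Lemma IIdom_ex f B a b : IIdom f B -> 0 < a -> 0 < b -> ex_RInt (f : R -> CV) a b.
Proof.
move=> h ha hb; apply: (ex_RInt_continuous (V := CV)) => z [hz _].
by apply: (proj1 (h z _)); apply: Rlt_le_trans hz; apply: Rmin_glb_lt.
Qed.

Lemma IIdom_bound f B a b : IIdom f B -> 0 < a -> a <= b ->
  Cmod (RInt (V := CV) f a b) <= B * (exp (- a) - exp (- b)).
Proof.
move=> h ha hab; rewrite -Cmod_normE.
apply: (norm_RInt_le (V := CV) f (fun y => B * exp (- y)) a b) => //.
- by move=> x hx; rewrite Cmod_normE; apply: (proj2 (h x _)); lra.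
- apply: (RInt_correct (V := CV)); apply: IIdom_ex h _ _ => //; lra.
- have -> : B * (exp (- a) - exp (- b)) = minus (- B * exp (- b)) (- B * exp (- a)).
    by rewrite /minus /plus /Hierarchy.opp /=; ring.
  apply: (is_RInt_derive (V := R_CompleteNormedModule) (fun y => - B * exp (- y))) => x _.
    by auto_derive => //; ring.
  apply: (ex_derive_continuous (V := R_NormedModule)); by auto_derive.
Qed.

Lemma IIdom_ge0 f B : IIdom f B -> 0 <= B.
Proof.
move=> h; have [_ h1] := h 1 Rlt_0_1; have := exp_pos (Ropp 1); have := Cmod_ge_0 (f 1); nra.
Qed.

Lemma IIdom_diff f B n m : IIdom f B -> (n <= m)%coq_nat ->
  Cmod (RInt (V := CV) f (/ (INR m + 1)) (INR m + 1) - RInt (V := CV) f (/ (INR n + 1)) (INR n + 1))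
  <= B * (1 - exp (- / (INR n + 1)) + exp (- (INR n + 1))).
Proof.
move=> h hnm; have B0 := IIdom_ge0 h.
have p1 := inv_Sn_pos m; have p2 := inv_Sn_pos n; have q1 := pos_INR m; have q2 := pos_INR n.
have l1 : INR n <= INR m by apply: le_INR.
have l2 : / (INR m + 1) <= / (INR n + 1) by apply: Rinv_le_contravar; lra.
have l3 := inv_Sn_le n; have r1 : 0 < INR m + 1 by lra.
have r2 : 0 < INR n + 1 by lra.
have C1 := @RInt_Chasles CV f (/ (INR m + 1)) (/ (INR n + 1)) (INR m + 1)
   (IIdom_ex h p1 p2) (IIdom_ex h p2 r1).
have C2 := @RInt_Chasles CV f (/ (INR n + 1)) (INR n + 1) (INR m + 1)
   (IIdom_ex h p2 r2) (IIdom_ex h r2 r1).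
rewrite -C1 -C2 /plus /=.
have b1 := IIdom_bound h p1 l2.
have l4 : INR n + 1 <= INR m + 1 by lra.
have b2 := IIdom_bound h r2 l4.
set X := RInt _ _ _ in b1 *; set Y := RInt _ (INR n + 1) _ in b2 *; set Z := RInt _ _ _.
have -> : (prod_plus X (prod_plus Z Y) - Z = X + Y :> C)%C.
  by apply: Ceq; rewrite !ReImE /Re /Im /prod_plus /plus /=; ring.
apply: Rle_trans (Cmod_triangle _ _) _.
have e1 : exp (- / (INR m + 1)) <= 1 by apply: exp_opp_le1; lra.
have := exp_pos (- (INR m + 1)) => e2.
apply: Rle_trans (Rplus_le_compat _ _ _ _ b1 b2) _.
rewrite -Rmult_plus_distr_l; apply: Rmult_le_compat_l => //; lra.
Qed.

Lemma lim_inv_Sn : is_lim_seq (fun n => / (INR n + 1)) 0.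
Proof.
apply: (is_lim_seq_ext (fun n => / INR (n.+1))) => [n|]; first by rewrite S_INR.
apply/(is_lim_seq_incr_1 (fun n => / INR n)).
have -> : Rbar.Finite 0 = Rbar_inv p_infty by [].
by apply: is_lim_seq_inv => //; exact: is_lim_seq_INR.
Qed.

Lemma lim_exp_Sn : is_lim_seq (fun n => exp (- (INR n + 1))) 0.
Proof.
apply: (is_lim_seq_le_le (fun=> 0) _ (fun n => / (INR n + 1))); last exact: lim_inv_Sn.
  move=> n; have := pos_INR n => h; split; first by left; apply: exp_pos.
  rewrite exp_Ropp; apply: Rinv_le_contravar; first lra.
  have := exp_ineq1_le (INR n + 1); lra.
exact: is_lim_seq_const.
Qed.

Lemma II_ex f B : IIdom f B -> exists l, is_II f l.
Proof.
move=> h; have B0 := IIdom_ge0 h.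
pose r n := B * (1 - exp (- / (INR n + 1)) + exp (- (INR n + 1))).
have hr : is_lim_seq r 0.
  have -> : Rbar.Finite 0 = Rbar.Finite (B * (1 - exp (- 0) + 0)) by rewrite Ropp_0 exp_0; congr Rbar.Finite; ring.
  apply: (is_lim_seq_scal_l _ B (Rbar.Finite (1 - exp (- 0) + 0))).
  apply: is_lim_seq_plus'; last exact: lim_exp_Sn.
  apply: is_lim_seq_minus'; first exact: is_lim_seq_const.
  apply: (is_lim_seq_continuous (fun x => exp (- x))); last exact: lim_inv_Sn.
  apply: (proj2 (continuity_pt_filterlim _ _)); refine (@ex_derive_continuous R_AbsRing R_NormedModule (fun x => exp (- x)) 0 _); by auto_derive.
apply/(filterlim_locally_cauchy (U := CV)) => eps.
have he2 : 0 < eps / 2 by have := cond_pos eps; lra.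
move/is_lim_seq_spec: hr => /(_ (mkposreal _ he2)) [N hN].
exists (fun n => (N <= n)%coq_nat); split; first by exists N.
move=> u v hu hv; apply: ball_Cmod.
have D k : (N <= k)%coq_nat -> Cmod (RInt (V := CV) f (/ (INR k + 1)) (INR k + 1) - RInt (V := CV) f (/ (INR N + 1)) (INR N + 1)) < eps / 2.
  move=> hk; apply: Rle_lt_trans (IIdom_diff h hk) _.
  have := hN N (Nat.le_refl N); rewrite Rminus_0_r /=; exact: Rle_lt_trans (Rle_abs _).
apply: Rle_lt_trans (_ : _ <= Cmod (RInt (V := CV) f (/ (INR v + 1)) (INR v + 1) - RInt (V := CV) f (/ (INR N + 1)) (INR N + 1)) + Cmod (RInt (V := CV) f (/ (INR N + 1)) (INR N + 1) - RInt (V := CV) f (/ (INR u + 1)) (INR u + 1))) _.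
  exact: Cmod_le_dist.
rewrite [X in _ + X]Cmod_switch; have := D u hu; have := D v hv; lra.
Qed.

Lemma is_II_unique f l l' : is_II f l -> is_II f l' -> l = l'.
Proof. exact: filterlimC_unique. Qed.

Lemma is_IIE f l : is_II f l -> II f = l.
Proof. move=> h; apply: (iota_unique (V := CV)) => // y hy; exact: is_II_unique hy h. Qed.

Lemma II_correct f B : IIdom f B -> is_II f (II f).
Proof. by move/II_ex => [l hl]; rewrite (is_IIE hl). Qed.

Lemma II_norm f B : IIdom f B -> Cmod (II f) <= B.
Proof.
move=> h; have B0 := IIdom_ge0 h; have hl := II_correct h.
apply: le_epsilon => eps he; have [N hN] := proj1 (@filterlimCP _ eventually _ _ _) hl eps he.
have {}hN := hN N (Nat.le_refl N).
have b := IIdom_bound h (inv_Sn_pos N) (inv_Sn_le N).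
set X := RInt _ _ _ in hN b.
have t := Cmod_triangle (II f - X) X; have E : (II f - X + X = II f)%C by ring.
rewrite E Cmod_switch in t.
have e1 : exp (- / (INR N + 1)) <= 1 by apply: exp_opp_le1; have := inv_Sn_pos N; lra.
have := exp_pos (- (INR N + 1)); nra.
Qed.

Lemma is_II_plus f g B B' l m : IIdom f B -> IIdom g B' -> is_II f l -> is_II g m ->
  is_II (fun y => f y + g y)%C (l + m)%C.
Proof.
move=> hf hg fl gm.
apply: (filterlim_ext (fun n => plus (RInt (V := CV) f (/ (INR n + 1)) (INR n + 1)) (RInt (V := CV) g (/ (INR n + 1)) (INR n + 1)))).
  move=> n; have p1 := inv_Sn_pos n; have p2 := pos_INR n.
  symmetry; apply: (RInt_plus (V := CV)); [apply: IIdom_ex hf _ _ | apply: IIdom_ex hg _ _]; lra.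
exact: filterlim_Cplus fl gm.
Qed.

Lemma RInt_Cscal (f : R -> C) a b (k : C) : ex_RInt (f : R -> CV) a b ->
  RInt (V := CV) (fun y => (k * f y)%C) a b = (k * RInt (V := CV) f a b)%C.
Proof.
move=> h; have {}h := RInt_correct (V := CV) _ _ _ h.
apply: (is_RInt_unique (V := CV)).
have h1 := is_RInt_fct_extend_fst (U := R_NormedModule) (V := R_NormedModule) f a b _ h.
have h2 := is_RInt_fct_extend_snd (U := R_NormedModule) (V := R_NormedModule) f a b _ h.
set l := RInt _ _ _ in h h1 h2 *.
apply: (is_RInt_fct_extend_pair (U := R_NormedModule) (V := R_NormedModule)) => /=.
  apply: (is_RInt_minus (V := R_NormedModule)); exact: (is_RInt_scal (V := R_NormedModule)).
apply: (is_RInt_plus (V := R_NormedModule)); exact: (is_RInt_scal (V := R_NormedModule)).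
Qed.

Lemma is_II_scal f B l (k : C) : IIdom f B -> is_II f l -> is_II (fun y => k * f y)%C (k * l)%C.
Proof.
move=> hf fl.
apply: (filterlim_ext (fun n => (k * RInt (V := CV) f (/ (INR n + 1)) (INR n + 1))%C : CV)).
  move=> n; have p1 := inv_Sn_pos n; have p2 := pos_INR n.
  symmetry; apply: RInt_Cscal; apply: IIdom_ex hf _ _; lra.
exact: filterlim_Cscal.
Qed.

Lemma is_II_ext f g l : (forall y, 0 < y -> f y = g y) -> is_II f l -> is_II g l.
Proof.
move=> fg; apply: filterlim_ext => n; apply: (RInt_ext (V := CV)) => x [hx _]; apply: fg.
apply: Rlt_trans hx; apply: Rmin_glb_lt; have := inv_Sn_pos n; have := pos_INR n; lra.
Qed.

Lemma IIdom_plus f g B B' : IIdom f B -> IIdom g B' -> IIdom (fun y => f y + g y)%C (B + B').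
Proof.
move=> hf hg y hy; have [c1 b1] := hf y hy; have [c2 b2] := hg y hy; split.
  exact: continuous_Cplus.
apply: Rle_trans (Cmod_triangle _ _) _; rewrite Rmult_plus_distr_r; lra.
Qed.

Lemma IIdom_scal f B (k : C) : IIdom f B -> IIdom (fun y => k * f y)%C (Cmod k * B).
Proof.
move=> hf y hy; have [c1 b1] := hf y hy; split.
  apply: continuous_Cmult => //; exact: continuous_const.
rewrite Cmod_mult Rmult_assoc; apply: Rmult_le_compat_l => //; exact: Cmod_ge_0.
Qed.

Lemma II_plus f g B B' : IIdom f B -> IIdom g B' -> II (fun y => f y + g y)%C = (II f + II g)%C.
Proof. by move=> hf hg; apply: is_IIE; apply: is_II_plus (II_correct hf) (II_correct hg); eassumption. Qed.

Lemma II_scal f B (k : C) : IIdom f B -> II (fun y => k * f y)%C = (k * II f)%C.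
Proof. by move=> hf; apply: is_IIE; apply: is_II_scal (II_correct hf); eassumption. Qed.

Lemma II_ext f g B : IIdom f B -> (forall y, 0 < y -> f y = g y) -> II f = II g.
Proof. by move=> hf fg; symmetry; apply: is_IIE; apply: is_II_ext fg (II_correct hf). Qed.

Lemma IIdom_ext f g B : (forall y, f y = g y) -> IIdom f B -> IIdom g B.
Proof.
move=> fg h y hy; have [c b] := h y hy; split; last by rewrite -fg.
by apply: (continuous_ext (f : R -> CV)) c.
Qed.

Lemma II_diff_le f g B B' D : IIdom f B -> IIdom g B' ->
  (forall y, 0 < y -> Cmod (f y - g y) <= D * exp (- y)) -> Cmod (II f - II g) <= D.
Proof.
move=> hf hg h.
have hg' := IIdom_scal (-1)%C hg.
have -> : (II f - II g = II (fun y => f y + (-1) * g y))%C.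
  by rewrite (II_plus hf hg') (II_scal _ hg); ring.
apply: II_norm => y hy; split; first exact: (proj1 (IIdom_plus hf hg' hy)).
by have -> : (f y + -1 * g y = f y - g y)%C by [ring]; exact: h.
Qed.

Lemma is_II_deriv (G f : R -> C) (G0 L : C) :
  (forall y, 0 < y -> is_derive (G : R -> CV) y (f y)) -> (forall y, 0 < y -> continuous (f : R -> CV) y) ->
  filterlim (fun n => G (/ (INR n + 1)) : CV) eventually (locally (G0 : CV)) ->
  filterlim (fun n => G (INR n + 1) : CV) eventually (locally (L : CV)) ->
  is_II f (L - G0)%C.
Proof.
move=> hd hc h0 hL.
apply: (filterlim_ext (fun n => minus (G (INR n + 1) : CV) (G (/ (INR n + 1)) : CV))).
  move=> n; symmetry; apply: (is_RInt_unique (V := CV)).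
  apply: (is_RInt_derive (V := CV)) => x [hx _]; [apply: hd | apply: hc];
    apply: Rlt_le_trans hx; apply: Rmin_glb_lt; have := inv_Sn_pos n; have := pos_INR n; lra.
have -> : (L - G0 = L + (-1) * G0)%C by ring.
have H := filterlim_Cplus hL (filterlim_Cscal (a := RtoC (-1)) h0).
refine (filterlim_ext _ _ _ (H _ _)) => n.
have E (a b : C) : (a + -1 * b)%C = minus (a : CV) (b : CV) by transitivity (a - b)%C; first ring.
exact: E.
Qed.

(** * Gaussian integrals *)

Definition gexp (a l : C) (y : R) : C := Cexp (RtoC (y ^ 2) * (- a) + RtoC y * l).

Lemma gauss_le c d y : 0 < c -> - c * y ^ 2 + d * y <= d ^ 2 / (4 * c).
Proof.
move=> hc.
have -> : - c * y ^ 2 + d * y = d ^ 2 / (4 * c) - c * (y - d / (2 * c)) ^ 2 by field; lra.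
have := pow2_ge_0 (y - d / (2 * c)); nra.
Qed.

Lemma le_exp_self y : y <= exp y.
Proof. by have := exp_ineq1_le y; lra. Qed.

Lemma sq_le_exp y : 0 <= y -> y ^ 2 <= 4 * exp y.
Proof.
move=> hy; have -> : exp y = exp (y / 2) * exp (y / 2) by rewrite -exp_plus; congr exp; field.
have := le_exp_self (y / 2); nra.
Qed.

Lemma Cmod_gexp a l y : Cmod (gexp a l y) = exp (- Re a * y ^ 2 + Re l * y).
Proof. by rewrite /gexp Cmod_Cexp !ReImE; congr exp; ring. Qed.

Lemma gexp_derive a l y : is_derive (gexp a l : R -> CV) y ((RtoC (2 * y) * - a + l) * gexp a l y)%C.
Proof. by apply: is_derive_Cexp; exact: is_derive_quad. Qed.

Lemma gexp_continuous a l y : continuous (gexp a l : R -> CV) y.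
Proof. exact: continuous_derive (gexp_derive _ _ _). Qed.

(** The 1 added to [d + Re l] pays for the factor exp(-y); what remains is the maximum of a
    quadratic polynomial. *)
Lemma IIdom_gauss (f : R -> C) A d a l : 0 < Re a -> 0 <= A ->
  (forall y, 0 < y -> continuous (f : R -> CV) y) ->
  (forall y, 0 < y -> Cmod (f y) <= A * exp (d * y)) ->
  IIdom (fun y => f y * gexp a l y)%C (A * exp ((d + Re l + 1) ^ 2 / (4 * Re a))).
Proof.
move=> ha hA hc hb y hy; split; first by apply: continuous_Cmult; [apply: hc | apply: gexp_continuous].
rewrite Cmod_mult Cmod_gexp.
apply: Rle_trans (_ : A * exp (d * y) * exp (- Re a * y ^ 2 + Re l * y) <= _).
  apply: Rmult_le_compat_r; [left; exact: exp_pos | exact: hb].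
have H := gauss_le (d + Re l + 1) y ha; set q := _ / _ in H *.
rewrite (Rmult_assoc A (exp (d * y))) (Rmult_assoc A (exp q)) -!exp_plus.
by apply: Rmult_le_compat_l => //; apply: exp_le; lra.
Qed.

Lemma IIdom_gexp a l : 0 < Re a -> IIdom (gexp a l) (exp ((Re l + 1) ^ 2 / (4 * Re a))).
Proof.
move=> ha; have h := @IIdom_gauss (fun=> RtoC 1) 1 0 a l ha Rle_0_1.
move: h; rewrite Rmult_1_l Rplus_0_l => h.
apply: IIdom_ext (h _ _) => [y|y _|y _]; first by rewrite Cmult_1_l.
  exact: continuous_const.
by rewrite Rmult_0_l exp_0 Cmod_1; lra.
Qed.

Lemma Cexp_taylor1 (u : C) : Cmod (Cexp u - 1) <= 2 * Cmod u * exp (Cmod u).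
Proof.
have h := @Cbounded_variation (fun t => Cexp (RtoC t * u)) (fun t => u * Cexp (RtoC t * u))%C (Cmod u * exp (Cmod u)) 0 1.
have H : Cmod (Cexp (RtoC 1 * u) - Cexp (RtoC 0 * u)) <= 2 * (Cmod u * exp (Cmod u)) * Rabs (1 - 0).
  apply: h => t; rewrite Rmin_left ?Rmax_right; try lra; move=> ht; split.
    apply: is_derive_Cexp; exact: is_derive_lin.
  rewrite Cmod_mult Cmod_Cexp; apply: Rmult_le_compat_l; first exact: Cmod_ge_0.
  apply: exp_le; rewrite re_scal_l; have := re_le_Cmod u; have := Rle_abs (Re u); have := Cmod_ge_0 u; nra.
move: H; rewrite Cmult_1_l Cmult_0_l Cexp_0 Rminus_0_r Rabs_R1; lra.
Qed.

Lemma Cexp_taylor2 (u : C) : Cmod (Cexp u - 1 - u) <= 4 * Cmod u ^ 2 * exp (Cmod u).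
Proof.
have hu := Cmod_ge_0 u; have he := exp_pos (Cmod u).
have h := @Cbounded_variation (fun t => Cexp (RtoC t * u) + - (RtoC t * u))%C (fun t => u * Cexp (RtoC t * u) + - u)%C (2 * Cmod u ^ 2 * exp (Cmod u)) 0 1.
have H : Cmod (Cexp (RtoC 1 * u) + - (RtoC 1 * u) - (Cexp (RtoC 0 * u) + - (RtoC 0 * u))) <= 2 * (2 * Cmod u ^ 2 * exp (Cmod u)) * Rabs (1 - 0).
  apply: h => t; rewrite Rmin_left ?Rmax_right; try lra; move=> ht; split.
    apply: (is_derive_plus (V := CV)); first by apply: is_derive_Cexp; exact: is_derive_lin.
    apply: (is_derive_opp (V := CV)); exact: is_derive_lin.
  have -> : (u * Cexp (RtoC t * u) + - u = u * (Cexp (RtoC t * u) - 1))%C by ring.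
  rewrite Cmod_mult.
  have T := Cexp_taylor1 (RtoC t * u)%C.
  have e : Cmod (RtoC t * u) <= Cmod u by rewrite Cmod_mult Cmod_R Rabs_pos_eq; nra.
  have e2 := exp_le e; have := Cmod_ge_0 (RtoC t * u) => e3.
  have := exp_pos (Cmod (RtoC t * u)) => e4.
  have T2 : Cmod (Cexp (RtoC t * u) - 1) <= 2 * Cmod u * exp (Cmod u).
    apply: Rle_trans T _; apply: Rmult_le_compat => //; lra.
  nra.
move: H; rewrite Cmult_1_l Cmult_0_l Cexp_0 Rminus_0_r Rabs_R1.
have -> : (Cexp u + - u - (1 + - 0) = Cexp u - 1 - u)%C by ring.
lra.
Qed.

Lemma gexp_lim0 a l : filterlim (fun n => gexp a l (/ (INR n + 1)) : CV) eventually (locally (RtoC 1 : CV)).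
Proof.
have -> : RtoC 1 = gexp a l 0.
  rewrite /gexp; have -> : 0 ^ 2 = 0 by ring.
  by have -> : (RtoC 0 * - a + RtoC 0 * l = RtoC 0)%C by [ring]; rewrite Cexp_0.
apply: (filterlim_comp _ _ _ (fun n => / (INR n + 1)) (gexp a l : R -> CV) _ (locally 0)); first exact: lim_inv_Sn.
exact: gexp_continuous.
Qed.

Lemma gexp_lim_infty a l : 0 < Re a -> filterlim (fun n => gexp a l (INR n + 1) : CV) eventually (locally (RtoC 0 : CV)).
Proof.
move=> ha; apply/filterlimCP => eps he.
have hB := exp_pos ((Re l + 1) ^ 2 / (4 * Re a)); set B := exp _ in hB.
have h1 : is_lim_seq (fun n => B * exp (- (INR n + 1))) (B * 0).
  by apply: (is_lim_seq_scal_l _ B (Rbar.Finite 0)); exact: lim_exp_Sn.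
rewrite Rmult_0_r in h1; move/is_lim_seq_spec: h1 => /(_ (mkposreal _ he)) [N hN].
exists N => n hn; have {}hN := hN n hn.
have -> (z : C) : (z - 0 = z)%C by ring.
have [_ b] := IIdom_gexp l ha (ltac:(have := pos_INR n; lra) : 0 < INR n + 1).
apply: Rle_lt_trans b _; move: hN; rewrite Rminus_0_r /=; exact: Rle_lt_trans (Rle_abs _).
Qed.

(** Integrate the derivative of [gexp a l], which falls from 1 at the origin to 0 at infinity. *)
Lemma II_gexp_mom a l : 0 < Re a ->
  II (fun y => RtoC y * gexp a l y)%C = ((1 + l * II (gexp a l)) / (2 * a))%C.
Proof.
move=> ha.
have anz : a <> 0%C by move=> h; move: ha; rewrite h /=; lra.
have dom1 : IIdom (fun y => RtoC y * gexp a l y)%C (1 * exp ((1 + Re l + 1) ^ 2 / (4 * Re a))).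
  apply: IIdom_gauss => // [|y _|y hy]; first lra.
    by apply: continuous_RtoC; exact: continuous_id.
  rewrite Cmod_R Rabs_pos_eq; last lra; rewrite !Rmult_1_l; exact: le_exp_self.
have dom2 := IIdom_gexp l ha.
have dom3 := IIdom_plus (IIdom_scal (-2 * a)%C dom1) (IIdom_scal l dom2).
have E (y : R) : ((RtoC 2 * RtoC y * - a + l) * gexp a l y = -2 * a * (y * gexp a l y) + l * gexp a l y)%C by ring.
have h : is_II (fun y => (-2 * a * (y * gexp a l y) + l * gexp a l y)%C) (0 - 1)%C.
  apply: (is_II_deriv (G := gexp a l)) (gexp_lim0 a l) (gexp_lim_infty l ha) => y hy.
    by rewrite -E -RtoC_mult; exact: gexp_derive.
  exact: (proj1 (dom3 y hy)).
have {}h : (2 * a * II (fun y => RtoC y * gexp a l y) = 1 + l * II (gexp a l))%C.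
  have {h} := is_IIE h; rewrite (II_plus (IIdom_scal (-2 * a)%C dom1) (IIdom_scal l dom2)).
  rewrite (II_scal _ dom1) (II_scal _ dom2) => h.
  set X := II _ in h *; set Y := II _ in h *.
  have -> : (2 * a * X = - (-2 * a * X + l * Y) + l * Y)%C by ring.
  by rewrite h; ring.
by rewrite -h; field.
Qed.

Definition gM (a l : C) (s : R) : C := II (gexp a (RtoC s * l)).

(** Differentiation under the integral, done directly with the second-order Taylor bound of the
    exponential. The first moment then expresses the derivative through [gM] itself, so a linear
    differential equation results. *)
Lemma gM_derive a l s : 0 < Re a ->
  is_derive (gM a l : R -> CV) s (l / (2 * a) + l * l / (2 * a) * (RtoC s * gM a l s))%C.
Proof.
move=> ha.
have anz : a <> 0%C by move=> h; move: ha; rewrite h /=; lra.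
have hl := Cmod_ge_0 l.
set D := (_ + _)%C.
have D1 : IIdom (fun y => RtoC y * gexp a (RtoC s * l) y)%C (1 * exp ((1 + Re (RtoC s * l) + 1) ^ 2 / (4 * Re a))).
  apply: IIdom_gauss => // [|y _|y hy]; first lra.
    by apply: continuous_RtoC; exact: continuous_id.
  rewrite Cmod_R Rabs_pos_eq; last lra; rewrite !Rmult_1_l; exact: le_exp_self.
have ED : D = II (fun y => l * (RtoC y * gexp a (RtoC s * l) y))%C.
  by rewrite (II_scal _ D1) (II_gexp_mom _ ha) /D /gM; field.
(* 16 is the 4 of [Cexp_taylor2] times the 4 of y^2 <= 4 exp y; the exponent collects that exp y,
   the Taylor factor exp(|l| y) and the exp(-y) demanded by the domination. *)
pose K := 16 * Cmod l ^ 2 * exp ((1 + Cmod l + Re (RtoC s * l) + 1) ^ 2 / (4 * Re a)).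
have K0 : 0 <= K by apply: Rmult_le_pos; [nra | left; exact: exp_pos].
have main t : Rabs (t - s) <= 1 -> Cmod (gM a l t - gM a l s - RtoC (t - s) * D) <= K * (t - s) ^ 2.
  move=> hts.
  have d1 := IIdom_gexp (RtoC t * l)%C ha; have d2 := IIdom_gexp (RtoC s * l)%C ha.
  have d3 := IIdom_scal (RtoC (t - s)) (IIdom_scal l D1).
  have -> : (gM a l t - gM a l s - RtoC (t - s) * D = gM a l t - II (fun y => gexp a (RtoC s * l) y + RtoC (t - s) * (l * (RtoC y * gexp a (RtoC s * l) y))))%C.
    rewrite (II_plus d2 d3) (II_scal _ (IIdom_scal l D1)) -ED /gM.
    ring.
  have d4 := IIdom_plus d2 d3.
  apply: (II_diff_le d1 d4) => y hy.
  have -> : (gexp a (RtoC t * l) y - (gexp a (RtoC s * l) y + RtoC (t - s) * (l * (RtoC y * gexp a (RtoC s * l) y)))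
     = gexp a (RtoC s * l) y * (Cexp (RtoC ((t - s) * y) * l) - 1 - RtoC ((t - s) * y) * l))%C.
    have -> : gexp a (RtoC t * l)%C y = (gexp a (RtoC s * l) y * Cexp (RtoC ((t - s) * y) * l))%C.
      by rewrite /gexp -Cexp_add; congr Cexp; rewrite RtoC_mult RtoC_minus; ring.
    by rewrite RtoC_mult; ring.
  rewrite Cmod_mult Cmod_gexp.
  have T := Cexp_taylor2 (RtoC ((t - s) * y) * l)%C.
  have eu : Cmod (RtoC ((t - s) * y) * l) = Rabs (t - s) * y * Cmod l.
    by rewrite Cmod_mult Cmod_R Rabs_mult (Rabs_pos_eq y); lra.
  have sq : (Rabs (t - s) * y * Cmod l) ^ 2 = (t - s) ^ 2 * y ^ 2 * Cmod l ^ 2.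
    by rewrite -(pow2_abs (t - s)); ring.
  rewrite eu sq in T.
  apply: Rle_trans (Rmult_le_compat_l _ _ _ (Rlt_le _ _ (exp_pos _)) T) _.
  have e1 : exp (Rabs (t - s) * y * Cmod l) <= exp (Cmod l * y).
    apply: exp_le; rewrite (Rmult_comm (Cmod l)); apply: Rmult_le_compat_r => //.
    by rewrite -[X in _ <= X]Rmult_1_l; apply: Rmult_le_compat_r => //; lra.
  have e2 := sq_le_exp (Rlt_le _ _ hy).
  have e3 := pow2_ge_0 (t - s); have e4 := pow2_ge_0 (Cmod l).
  set g := exp (_ + _).
  have g0 : 0 < g by exact: exp_pos.
  apply: Rle_trans (_ : g * (4 * ((t - s) ^ 2 * (4 * exp y) * Cmod l ^ 2) * exp (Cmod l * y)) <= _).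
    apply: Rmult_le_compat_l; first lra.
    apply: Rmult_le_compat => //; last 1 first.
    - apply: Rmult_le_compat_l; first lra; apply: Rmult_le_compat_r => //; exact: Rmult_le_compat_l.
    - have := pow2_ge_0 y; move=> ?; apply: Rmult_le_pos; first lra; apply: Rmult_le_pos => //; exact: Rmult_le_pos.
    - by left; exact: exp_pos.
  have -> : g * (4 * ((t - s) ^ 2 * (4 * exp y) * Cmod l ^ 2) * exp (Cmod l * y)) = 16 * Cmod l ^ 2 * (t - s) ^ 2 * (g * exp y * exp (Cmod l * y)) by ring.
  rewrite /K; set q := _ / _.
  have -> : 16 * Cmod l ^ 2 * exp q * (t - s) ^ 2 * exp (- y) = 16 * Cmod l ^ 2 * (t - s) ^ 2 * (exp q * exp (- y)) by ring.
  apply: Rmult_le_compat_l; first by apply: Rmult_le_pos => //; lra.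
  rewrite /g -!exp_plus; apply: exp_le.
  have := gauss_le (1 + Cmod l + Re (RtoC s * l) + 1) y ha; rewrite -/q; lra.
split; first exact: is_linear_scal_l.
move=> x hx; have {x hx} -> : x = s by symmetry; apply: is_filter_lim_locally_unique.
move=> eps; have he := cond_pos eps.
have hd : 0 < Rmin 1 (eps / (K + 1)) by apply: Rmin_glb_lt; [lra | apply: Rdiv_lt_0_compat; lra].
exists (mkposreal _ hd) => t /= ht.
have {}ht : Rabs (t - s) < Rmin 1 (eps / (K + 1)) by exact: ht.
have h1 := Rlt_le_trans _ _ _ ht (Rmin_l _ _); have h2 := Rlt_le_trans _ _ _ ht (Rmin_r _ _).
rewrite norm_minusC scalCE.
apply: Rle_trans (main t (Rlt_le _ _ h1)) _.
have -> : norm (minus t s) = Rabs (t - s) by [].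
rewrite -(pow2_abs (t - s)); have h3 := Rabs_pos (t - s).
have : K * Rabs (t - s) <= eps; last nra.
apply: Rle_trans (_ : (K + 1) * (eps / (K + 1)) <= _); last by right; field; lra.
apply: Rmult_le_compat => //; lra.
Qed.

Lemma ode_gauss (X : R -> C) (b : C) :
  (forall s, is_derive (X : R -> CV) s (b * (RtoC s * X s))%C) ->
  forall s, 0 <= s -> X s = (X 0 * Cexp (b / 2 * RtoC (s ^ 2)))%C.
Proof.
move=> h s hs; have [->|s0] := Req_dec s 0.
  have -> : 0 ^ 2 = 0 by ring.
  by rewrite Cmult_0_r Cexp_0 Cmult_1_r.
(* The integrating factor: [Y] has derivative zero. *)
pose Y t := (X t * Cexp (RtoC (t ^ 2) * (- b / 2) + RtoC t * 0))%C.
have hY : Y 0 = Y s.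
  apply: (eq_is_derive (V := CV)); last lra.
  move=> t _; have := is_derive_Cmult (h t) (is_derive_Cexp (is_derive_quad (- b / 2)%C 0%C t)).
  have -> : (b * (t * X t) * Cexp ((t ^ 2)%coqR * (- b / 2) + t * 0) + X t * (((2 * t)%coqR * (- b / 2) + 0) * Cexp ((t ^ 2)%coqR * (- b / 2) + t * 0)) = 0)%C.
    by rewrite RtoC_mult; field.
  by [].
have E t : X t = (Y t * Cexp (b / 2 * RtoC (t ^ 2)))%C.
  rewrite /Y -Cmult_assoc -Cexp_add.
  have -> : (RtoC (t ^ 2) * (- b / 2) + RtoC t * 0 + b / 2 * RtoC (t ^ 2) = 0)%C by field.
  by rewrite Cexp_0 Cmult_1_r.
rewrite [LHS]E -hY; congr Cmult.
rewrite /Y; have -> : 0 ^ 2 = 0 by ring.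
have -> : (RtoC 0 * (- b / 2) + RtoC 0 * 0 = 0)%C by field.
by rewrite Cexp_0 Cmult_1_r.
Qed.

Lemma gM_derive_opp a l s : 0 < Re a ->
  is_derive (fun t => gM a l (- t) : CV) s (- (l / (2 * a)) + l * l / (2 * a) * (RtoC s * gM a l (- s)))%C.
Proof.
move=> ha.
have h1 : is_derive (fun t : R => - t) s (-1) by auto_derive => //; ring.
have h := @is_derive_comp R_AbsRing CV (gM a l) (fun t : R => - t) s _ _ (gM_derive l (- s) ha) h1.
move: h; rewrite scalCE.
have anz : a <> 0%C by move=> h; move: ha; rewrite h /=; lra.
by have -> : (-1 * (l / (2 * a) + l * l / (2 * a) * (RtoC (- s) * gM a l (- s))) = - (l / (2 * a)) + l * l / (2 * a) * (s * gM a l (- s)))%C by rewrite RtoC_opp; field.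
Qed.

(** The two equations are those of the substitution x = mu y, but no contour is moved. They make the
    difference [X] of the odd parts a solution of the homogeneous equation with X(0) = 0, hence
    zero. The even part [Y] solves the same equation and is an explicit Gaussian; it is what
    separates the odd part from twice [gM a' l' s]. *)
Lemma gM_odd (a l a' l' mu : C) s : 0 < Re a -> 0 < Re a' ->
  (l / (2 * a) = mu * (l' / (2 * a')))%C -> (l * l / (2 * a) = l' * l' / (2 * a'))%C -> 0 <= s ->
  (gM a l s - gM a l (- s) = 2 * mu * gM a' l' s - 2 * mu * gM a' l' 0 * Cexp (l' * l' / (2 * a') / 2 * RtoC (s ^ 2)))%C.
Proof.
move=> ha ha' E1 E2 hs.
pose b := (l * l / (2 * a))%C.
pose X t := (gM a l t - gM a l (- t) - mu * gM a' l' t + mu * gM a' l' (- t))%C.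
pose Y t := (gM a' l' t + gM a' l' (- t))%C.
have dX t : is_derive (X : R -> CV) t (b * (RtoC t * X t))%C.
  have H := is_derive_plus (V := CV) _ _ _ _ _ (is_derive_minus (V := CV) _ _ _ _ _ (is_derive_minus (V := CV) _ _ _ _ _ (gM_derive l t ha) (gM_derive_opp l t ha))
    (is_derive_Cmult (is_derive_const (V := CV) mu t) (gM_derive l' t ha')))
    (is_derive_Cmult (is_derive_const (V := CV) mu t) (gM_derive_opp l' t ha')).
  have E : (b * (RtoC t * X t))%C = ((l / (2 * a) + l * l / (2 * a) * (t * gM a l t)) -
     (- (l / (2 * a)) + l * l / (2 * a) * (t * gM a l (- t)%coqR)) -
     (0 * gM a' l' t + mu * (l' / (2 * a') + l' * l' / (2 * a') * (t * gM a' l' t))) +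
     (0 * gM a' l' (- t)%coqR + mu * (- (l' / (2 * a')) + l' * l' / (2 * a') * (t * gM a' l' (- t)%coqR))))%C.
    rewrite -E2 E1 /X /b; ring.
  by rewrite E; exact: H.
have dY t : is_derive (Y : R -> CV) t (b * (RtoC t * Y t))%C.
  have H := is_derive_plus (V := CV) _ _ _ _ _ (gM_derive l' t ha') (gM_derive_opp l' t ha').
  have E : (b * (RtoC t * Y t))%C = ((l' / (2 * a') + l' * l' / (2 * a') * (t * gM a' l' t)) +
     (- (l' / (2 * a')) + l' * l' / (2 * a') * (t * gM a' l' (- t)%coqR)))%C.
    rewrite -E2 /Y /b; ring.
  by rewrite E; exact: H.
have X0 : X s = 0%C.
  rewrite (ode_gauss dX hs) /X Ropp_0; ring.
have Y0 := ode_gauss dY hs.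
have -> : (gM a l s - gM a l (- s)%coqR = X s + mu * (2 * gM a' l' s - Y s))%C by rewrite /X /Y; ring.
rewrite X0 Y0 /Y Ropp_0 /b E2; ring.
Qed.

(** * The Fejer kernel *)

Fixpoint Dir (N : nat) (x : R) : R :=
  match N with 0%N => 1 | S n => Dir n x + 2 * cos (2 * PI * INR (S n) * x) end.

(** The Fejer kernel of period 1 without its factor 1/(M + 1): its mean over a period is M + 1. *)
Fixpoint FejS (M : nat) (x : R) : R :=
  match M with 0%N => 1 | S m => FejS m x + Dir (S m) x end.

Lemma sin_Dir N x : sin (PI * x) * Dir N x = sin ((2 * INR N + 1) * (PI * x)).
Proof.
elim: N => [|N IH]; first by rewrite /= Rmult_1_r; congr sin; ring.
rewrite [Dir _ _]/= -/(INR N.+1) Rmult_plus_distr_l IH.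
set t := PI * x.
have -> : 2 * PI * INR N.+1 * x = 2 * INR N.+1 * t by rewrite /t; ring.
rewrite S_INR.
have -> : (2 * INR N + 1) * t = 2 * (INR N + 1) * t - t by ring.
have -> : (2 * (INR N + 1) + 1) * t = 2 * (INR N + 1) * t + t by ring.
rewrite sin_plus sin_minus; ring.
Qed.

(** The closed form from which both the positivity of the kernel and its bound 1/x^2 follow. *)
Lemma sin_FejS M x : sin (PI * x) ^ 2 * FejS M x = sin ((INR M + 1) * (PI * x)) ^ 2.
Proof.
elim: M => [|M IH]; first by rewrite /= Rplus_0_l Rmult_1_l; ring.
rewrite [FejS _ _]/= -/(Dir M.+1 x) Rmult_plus_distr_l IH.
have -> : sin (PI * x) ^ 2 * Dir M.+1 x = sin (PI * x) * (sin (PI * x) * Dir M.+1 x) by ring.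
rewrite sin_Dir S_INR; set t := PI * x.
have -> : (2 * (INR M + 1) + 1) * t = 2 * ((INR M + 1) * t) + t by ring.
have -> : (INR M + 1 + 1) * t = (INR M + 1) * t + t by ring.
set u := (INR M + 1) * t.
rewrite !sin_plus sin_2a cos_2a.
have h := sin2_cos2 t; have h' := sin2_cos2 u; rewrite /Rsqr in h h'.
transitivity ((sin u * cos t + cos u * sin t) ^ 2 + sin u ^ 2 * (1 - (sin t * sin t + cos t * cos t))); last by rewrite h; ring.
ring_simplify. nra.
Qed.

Lemma Dir_0 N : Dir N 0 = 2 * INR N + 1.
Proof.
elim: N => [|N IH]; first by rewrite /=; ring.
by rewrite [Dir _ _]/= -/(INR N.+1) IH Rmult_0_r cos_0 S_INR; ring.
Qed.

Lemma FejS_0_pos M : 0 <= FejS M 0.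
Proof.
elim: M => [|M IH]; first by rewrite /=; lra.
rewrite [FejS _ _]/= -/(Dir M.+1 0) Dir_0; have := pos_INR M.+1; lra.
Qed.

(** Up to 1/3 the mean value theorem applies with a cosine of at least 1/2; beyond, the sine itself
    is at least 1/2. *)
Lemma sin_half x : 0 <= x <= / 2 -> x <= sin (PI * x).
Proof.
move=> hx; have p := PI_RGT_0; have p3 : 3 < PI by have := PI2_3_2; lra.
have [h|h] := Rle_dec x (/ 3).
  have [->|x0] := Req_dec x 0; first by rewrite Rmult_0_r sin_0; lra.
  have hpx : 0 < PI * x by apply: Rmult_lt_0_compat; lra.
  have [c [E hc]] := MVT_cor2 sin cos 0 (PI * x) hpx (fun c _ => derivable_pt_lim_sin c).
  have hc2 : / 2 <= cos c.
    have -> : / 2 = cos (PI / 3) by rewrite cos_PI3; lra.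
    have l1 : PI * x <= PI / 3 by nra.
    by apply: cos_decr_1; lra.
  rewrite sin_0 !Rminus_0_r in E; rewrite E; nra.
rewrite -cos_shift.
have : cos (PI / 3) <= cos (PI / 2 - PI * x); last by rewrite cos_PI3; lra.
apply: cos_decr_1; nra.
Qed.

Lemma sin_pos_half x : 0 < x <= / 2 -> 0 < sin (PI * x).
Proof. move=> hx; have := @sin_half x; lra. Qed.

Lemma FejS_ge0 M x : 0 <= x <= / 2 -> 0 <= FejS M x.
Proof.
move=> hx; have [->|x0] := Req_dec x 0; first exact: FejS_0_pos.
have hs : 0 < sin (PI * x) by apply: sin_pos_half; lra.
have E := sin_FejS M x; have h := pow2_ge_0 (sin ((INR M + 1) * (PI * x))).
apply: Rnot_lt_le => n; have := pow_lt _ 2 hs; rewrite -E in h; nra.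
Qed.

Lemma FejS_bound M x : 0 <= x <= / 2 -> x ^ 2 * FejS M x <= 1.
Proof.
move=> hx; have h1 := sin_half hx; have h2 := FejS_ge0 M hx; have E := sin_FejS M x.
have h3 := SIN_bound ((INR M + 1) * (PI * x)).
apply: Rle_trans (_ : sin (PI * x) ^ 2 * FejS M x <= _).
  by apply: Rmult_le_compat_r => //; nra.
rewrite E; nra.
Qed.

Lemma Dir_derive N x : ex_derive (Dir N) x.
Proof.
elim: N => [|N IH]; first by apply: ex_derive_const.
by apply: (ex_derive_plus (V := R_NormedModule)) => //; auto_derive.
Qed.

Lemma FejS_derive N x : ex_derive (FejS N) x.
Proof.
elim: N => [|N IH]; first by apply: ex_derive_const.
by apply: (ex_derive_plus (V := R_NormedModule)) => //; exact: Dir_derive.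
Qed.

Lemma FejS_continuous N x : continuous (FejS N) x.
Proof. exact: (ex_derive_continuous (V := R_NormedModule) _ _ (FejS_derive N x)). Qed.

Lemma Dir_shift N k x : Dir N (INR k + x) = Dir N x.
Proof.
elim: N => [|N IH] //; rewrite [LHS]/= [RHS]/= IH -/(INR N.+1); congr (_ + 2 * _).
have -> : 2 * PI * INR N.+1 * (INR k + x) = 2 * PI * INR N.+1 * x + 2 * INR (N.+1 * k) * PI.
  by rewrite mult_INR; ring.
exact: cos_period.
Qed.

Lemma Dir_opp N x : Dir N (- x) = Dir N x.
Proof.
elim: N => [|N IH] //; rewrite [LHS]/= [RHS]/= IH -/(INR N.+1); congr (_ + 2 * _).
by rewrite -cos_neg; congr cos; ring.
Qed.

Lemma FejS_shift N k x : FejS N (INR k + x) = FejS N x.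
Proof. by elim: N => [|N IH] //; rewrite [LHS]/= [RHS]/= IH -!/(Dir N.+1 _) Dir_shift. Qed.

Lemma FejS_opp N x : FejS N (- x) = FejS N x.
Proof. by elim: N => [|N IH] //; rewrite [LHS]/= [RHS]/= IH -!/(Dir N.+1 _) Dir_opp. Qed.

Lemma Dir_int N : is_RInt (Dir N) 0 (/ 2) (/ 2).
Proof.
elim: N => [|N IH].
  have := is_RInt_const (V := R_NormedModule) 0 (/ 2) 1.
  by rewrite /scal /= /mult /= Rmult_1_r Rminus_0_r.
have p : 2 * PI * INR N.+1 <> 0.
  by have := PI_neq0; have := not_0_INR N.+1 (ltac:(by [])); move=> h1 h2; apply: Rmult_integral_contrapositive_currified => //; lra.
have -> : / 2 = plus (/ 2) 0 by rewrite /plus /= Rplus_0_r.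
rewrite {1}/plus /= Rplus_0_r -/(INR N.+1).
apply: (is_RInt_plus (V := R_NormedModule)) => //.
pose G x := 2 * (sin (2 * PI * INR N.+1 * x) / (2 * PI * INR N.+1)).
have E : minus (G (/ 2)) (G 0) = 0.
  rewrite /G /minus /plus /Hierarchy.opp /= -/(INR N.+1) Rmult_0_r sin_0.
  have -> : 2 * PI * INR N.+1 * / 2 = PI * INR N.+1 by field.
  have -> : sin (PI * INR N.+1) = 0.
    apply: sin_eq_0_1; exists (Z.of_nat N.+1); rewrite -INR_IZR_INZ; ring.
  by rewrite /Rdiv !Rmult_0_l !Rmult_0_r; ring.
have H : is_RInt (fun y => 2 * cos (2 * PI * INR N.+1 * y)) 0 (/ 2) (minus (G (/ 2)) (G 0)).
  apply: (is_RInt_derive (V := R_CompleteNormedModule)) => x _.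
    by rewrite /G; move: (2 * PI * INR N.+1) p => c p; auto_derive => //; field.
  by apply: (ex_derive_continuous (V := R_NormedModule)); auto_derive.
by rewrite E in H.
Qed.

Lemma FejS_int M : is_RInt (FejS M) 0 (/ 2) ((INR M + 1) * / 2).
Proof.
elim: M => [|M IH]; first by rewrite /= Rplus_0_l Rmult_1_l; exact: (Dir_int 0).
have -> : (INR M.+1 + 1) * / 2 = plus ((INR M + 1) * / 2) (/ 2) by rewrite S_INR /plus /=; field.
apply: (is_RInt_plus (V := R_NormedModule)) => //; exact: (Dir_int M.+1).
Qed.

(** From x^2 [FejS] <= 1 and the arithmetic-geometric mean, x [FejS] is at most half of eta [FejS] +
    1/eta. The free parameter [eta] replaces a splitting of the interval and a logarithmic estimate:
    after division by M + 1 the error is L eta plus a term that vanishes as M grows. *)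
Lemma fejer_half M (u : R -> C) u0 L eta : 0 < eta -> 0 <= L ->
  (forall x, 0 <= x <= / 2 -> continuous (u : R -> CV) x) ->
  (forall x, 0 <= x <= / 2 -> Cmod (u x - u0) <= L * x) ->
  Cmod (RInt (V := CV) (fun x => RtoC (FejS M x) * u x)%C 0 (/ 2) - RtoC ((INR M + 1) / 2) * u0)
   <= L * ((INR M + 1) * eta + / eta).
Proof.
move=> he hL hc hu.
have l2 : 0 <= / 2 by lra.
have exu : ex_RInt (fun x => RtoC (FejS M x) * u x : CV)%C 0 (/ 2).
  apply: (ex_RInt_continuous (V := CV)) => z; rewrite Rmin_left // Rmax_right // => hz.
  apply: continuous_Cmult; last exact: hc.
  by apply: continuous_RtoC; exact: FejS_continuous.
have h1 : is_RInt (fun x => RtoC (FejS M x) * u0 : CV)%C 0 (/ 2) (RtoC ((INR M + 1) / 2) * u0)%C.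
  have E : RInt (V := CV) (fun x => u0 * RtoC (FejS M x))%C 0 (/ 2) = (RtoC ((INR M + 1) / 2) * u0)%C.
    rewrite RInt_Cscal; last first.
      apply: (ex_RInt_continuous (V := CV)) => z _; apply: continuous_RtoC; exact: FejS_continuous.
    rewrite Cmult_comm; congr Cmult; apply: (is_RInt_unique (V := CV)).
    apply: (is_RInt_fct_extend_pair (U := R_NormedModule) (V := R_NormedModule)) => /=.
      exact: FejS_int.
    have := is_RInt_const (V := R_NormedModule) 0 (/ 2) 0.
    by rewrite /scal /= /mult /= Rmult_0_r.
  rewrite -E; apply: (is_RInt_ext (V := CV) (fun x => u0 * RtoC (FejS M x))%C).
    by move=> x _; rewrite Cmult_comm.
  apply: (RInt_correct (V := CV)); apply: (ex_RInt_continuous (V := CV)) => z _.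
  apply: continuous_Cmult; first exact: continuous_const.
  apply: continuous_RtoC; exact: FejS_continuous.
have h2 := is_RInt_minus (V := CV) _ _ _ _ _ _ (RInt_correct (V := CV) _ _ _ exu) h1.
rewrite -norm_minusC.
have h3 : is_RInt (fun x => L / 2 * (eta * FejS M x + / eta)) 0 (/ 2) (L / 2 * (eta * ((INR M + 1) * / 2) + / eta * / 2)).
  apply: (is_RInt_scal (V := R_NormedModule)); apply: (is_RInt_plus (V := R_NormedModule)).
    by apply: (is_RInt_scal (V := R_NormedModule)); exact: FejS_int.
  have := is_RInt_const (V := R_NormedModule) 0 (/ 2) (/ eta).
  by rewrite /scal /= /mult /= Rminus_0_r Rmult_comm.
apply: Rle_trans (_ : L / 2 * (eta * ((INR M + 1) * / 2) + / eta * / 2) <= _); last first.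
  have := Rinv_0_lt_compat _ he; have := pos_INR M => q1 q2.
  have q3 : 0 <= (INR M + 1) * eta by nra.
  set a := (INR M + 1) * eta in q3 *.
  have -> : eta * ((INR M + 1) * / 2) = a / 2 by rewrite /a; field.
  nra.
apply: (norm_RInt_le (V := CV) _ _ 0 (/ 2) _ _ l2 _ h2 h3) => x hx.
rewrite norm_minusC.
have -> : (FejS M x * u x - FejS M x * u0 = FejS M x * (u x - u0))%C by ring.
rewrite Cmod_mult Cmod_R Rabs_pos_eq; last exact: FejS_ge0.
have F0 := FejS_ge0 M hx; have F1 := FejS_bound M hx.
apply: Rle_trans (Rmult_le_compat_l _ _ _ F0 (hu x hx)) _.
have ie := Rinv_0_lt_compat _ he.
have amgm : x <= / 2 * (eta + x ^ 2 * / eta).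
  have : 0 <= (x - eta) ^ 2 * / eta by apply: Rmult_le_pos; [exact: pow2_ge_0 | lra].
  have -> : (x - eta) ^ 2 * / eta = x ^ 2 * / eta - 2 * x + eta by field; lra.
  lra.
have : FejS M x * x <= / 2 * (eta * FejS M x + / eta).
  apply: Rle_trans (Rmult_le_compat_l _ _ _ F0 amgm) _.
  have : x ^ 2 * FejS M x * / eta <= 1 * / eta by apply: Rmult_le_compat_r => //; lra.
  set q := x ^ 2; nra.
move=> h; have -> : FejS M x * (L * x) = L * (FejS M x * x) by ring.
have -> : L / 2 * (eta * FejS M x + / eta) = L * (/ 2 * (eta * FejS M x + / eta)) by field; lra.
exact: Rmult_le_compat_l.
Qed.

(** The kernel concentrates at the integers, so each unit interval is cut in the middle and each
    half attached to its own end. *)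
Lemma RInt_half (f : R -> C) n : (forall y, continuous (f : R -> CV) y) ->
  RInt (V := CV) f (INR n) (INR n + 1) =
  Cplus (RInt (V := CV) (fun y => f (INR n + y)) 0 (/ 2)) (RInt (V := CV) (fun y => f (INR n + 1 - y)) 0 (/ 2)).
Proof.
move=> hc.
have ex a b : ex_RInt (f : R -> CV) a b by apply: (ex_RInt_continuous (V := CV)).
rewrite -(RInt_Chasles (V := CV) f (INR n) (INR n + / 2) (INR n + 1)) //.
congr Cplus.
  have := RInt_comp_lin (V := CV) f 1 (INR n) 0 (/ 2) (ex _ _).
  have -> : 1 * 0 + INR n = INR n by ring.
  have -> : 1 * / 2 + INR n = INR n + / 2 by ring.
  move=> <-; apply: (RInt_ext (V := CV)) => y _; rewrite scal_one; congr f; ring.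
have h := RInt_comp_lin (V := CV) f (-1) (INR n + 1) 0 (/ 2) (ex _ _).
have E1 : -1 * 0 + (INR n + 1) = INR n + 1 by ring.
have E2 : -1 * / 2 + (INR n + 1) = INR n + / 2 by field.
rewrite E1 E2 in h.
rewrite -(opp_RInt_swap (V := CV)); last exact: ex.
rewrite -h -(RInt_opp (V := CV)).
  apply: (RInt_ext (V := CV)) => y _; rewrite !scalCE.
  have -> : -1 * y + (INR n + 1) = INR n + 1 - y by ring.
  have E (z : C) : (- (-1 * z))%C = z by ring.
  exact: E.
apply: (ex_RInt_continuous (V := CV)) => z _.
apply: (continuous_scal_r (V := CV)).
apply: (continuous_comp (fun y => -1 * y + (INR n + 1)) (f : R -> CV)); last exact: hc.
apply: (ex_derive_continuous (V := R_NormedModule)); by auto_derive.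
Qed.

Lemma exp_m1_half : exp (Ropp 1) <= / 2.
Proof.
rewrite exp_Ropp; apply: Rinv_le_contravar; first lra.
have := exp_ineq1_le 1; lra.
Qed.

(** The local Lipschitz constants decay like exp(-k), so the errors of the unit intervals add up;
    the factor 1 - exp(-n) is the shape that an induction can carry. *)
Lemma fejer_line M (v : R -> C) L eta n : 0 < eta -> 0 <= L ->
  (forall y, continuous (v : R -> CV) y) ->
  (forall (k : nat) x, 0 <= x <= / 2 -> Cmod (v (INR k + x) - v (INR k)) <= L * exp (- INR k) * x) ->
  (forall (k : nat) x, 0 <= x <= / 2 -> Cmod (v (INR k + 1 - x) - v (INR k + 1)) <= L * exp (- INR k) * x) ->
  Cmod (RInt (V := CV) (fun x => RtoC (FejS M x) * v x)%C 0 (INR n) -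
      RtoC ((INR M + 1) / 2)%coqR * \big[Cplus/RtoC 0]_(k <- iota 0 n) (v (INR k) + v (INR k + 1)%coqR)%C)
   <= 4 * L * ((INR M + 1) * eta + / eta) * (1 - exp (- INR n)).
Proof.
move=> he hL hc h1 h2; set Q := (INR M + 1) * eta + / eta.
have Q0 : 0 <= Q.
  have := Rinv_0_lt_compat _ he; have := pos_INR M; rewrite /Q => q1 q2.
  have : 0 <= (INR M + 1) * eta by nra.
  lra.
pose f x := (RtoC (FejS M x) * v x)%C.
have hf y : continuous (f : R -> CV) y.
  apply: continuous_Cmult; last exact: hc.
  apply: continuous_RtoC; exact: FejS_continuous.
have ex a b : ex_RInt (f : R -> CV) a b by apply: (ex_RInt_continuous (V := CV)).
rewrite -/f; elim: n => [|n IH].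
  rewrite big_nil (RInt_point (V := CV)) Cmult_0_r Ropp_0 exp_0 Rminus_diag Rmult_0_r.
  have -> : ((zero : CV) - 0 = 0)%C by transitivity (0 - 0)%C; [|ring].
  by rewrite Cmod_0; apply: Rle_refl.
rewrite S_INR -addn1 iotaD big_cat /= add0n big_cons big_nil Cplus_0_r.
rewrite -(RInt_Chasles (V := CV) f 0 (INR n) (INR n + 1)) // (RInt_half n hf).
set S := \big[_/_]_(_ <- _) _ in IH *; set A := RInt (V := CV) f 0 _ in IH *.
have E1 : RInt (V := CV) (fun y => f (INR n + y)) 0 (/ 2) = RInt (V := CV) (fun x => RtoC (FejS M x) * v (INR n + x)%coqR)%C 0 (/ 2).
  by apply: (RInt_ext (V := CV)) => y _; rewrite /f FejS_shift.
have E2 : RInt (V := CV) (fun y => f (INR n + 1 - y)) 0 (/ 2) = RInt (V := CV) (fun x => RtoC (FejS M x) * v (INR n + 1 - x)%coqR)%C 0 (/ 2).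
  apply: (RInt_ext (V := CV)) => y _; rewrite /f -S_INR; congr (RtoC _ * _)%C.
  by have -> : INR n.+1 - y = INR n.+1 + - y by [ring]; rewrite FejS_shift FejS_opp.
have e0 := exp_pos (- INR n).
have L0 : 0 <= L * exp (- INR n) by nra.
have B1 := @fejer_half M (fun x => v (INR n + x)) (v (INR n)) _ eta he L0 _ (h1 n).
have B2 := @fejer_half M (fun x => v (INR n + 1 - x)) (v (INR n + 1)) _ eta he L0 _ (h2 n).
have c1 x : 0 <= x <= / 2 -> continuous (fun x => v (INR n + x) : CV) x.
  move=> _; apply: (continuous_comp (fun x => INR n + x) (v : R -> CV)) => //.
  apply: (ex_derive_continuous (V := R_NormedModule)); by auto_derive.
have c2 x : 0 <= x <= / 2 -> continuous (fun x => v (INR n + 1 - x) : CV) x.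
  move=> _; apply: (continuous_comp (fun x => INR n + 1 - x) (v : R -> CV)) => //.
  apply: (ex_derive_continuous (V := R_NormedModule)); by auto_derive.
have {}B1 := B1 c1; have {}B2 := B2 c2; rewrite -E1 in B1; rewrite -E2 in B2.
set X := RInt (V := CV) _ _ _ in B1 *; set Y := RInt (V := CV) _ _ _ in B2 *.
set c := RtoC _ in IH B1 B2 *.
have -> : ((plus A (X + Y)%C : CV) - c * (S + (v (INR n) + v (INR n + 1)%coqR)) = (A - c * S) + ((X - c * v (INR n)) + (Y - c * v (INR n + 1)%coqR)))%C.
  transitivity (A + (X + Y) - c * (S + (v (INR n) + v (INR n + 1)%coqR)))%C => //; ring.
apply: Rle_trans (Cmod_triangle _ _) _.
apply: Rle_trans (Rplus_le_compat_l _ _ _ (Cmod_triangle _ _)) _.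
rewrite -/Q in B1 B2.
(* Since exp(-1) <= 1/2, the new error 2 L exp(-n) is absorbed by the increment of 4 L (1 -
   exp(-n)). *)
have e1 : exp (- (INR n + 1)) <= / 2 * exp (- INR n).
  rewrite Ropp_plus_distr exp_plus Rmult_comm; apply: Rmult_le_compat_r; first lra.
  exact: exp_m1_half.
have : 2 * (L * exp (- INR n) * Q) <= 4 * L * Q * (exp (- INR n) - exp (- (INR n + 1))).
  have -> : 2 * (L * exp (- INR n) * Q) = 4 * L * Q * (/ 2 * exp (- INR n)) by field.
  apply: Rmult_le_compat_l; last lra.
  by apply: Rmult_le_pos => //; lra.
lra.
Qed.

(** Connects the exhaustion that avoids 0 with the integrals over [0, n], the natural ones for a
    kernel of period 1. *)
Lemma II_of_RInt0 (f : R -> C) B : IIdom f B -> (forall y, continuous (f : R -> CV) y) -> Cmod (f 0) <= B ->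
  filterlim (fun n => RInt (V := CV) f 0 (INR n) : CV) eventually (locally (II f : CV)).
Proof.
move=> hd hc h0; have B0 := IIdom_ge0 hd.
have ex a b : ex_RInt (f : R -> CV) a b by apply: (ex_RInt_continuous (V := CV)).
have H : filterlim (fun n => RInt (V := CV) f 0 (INR n + 1) : CV) eventually (locally (II f : CV)).
  apply/filterlimCP => eps he; have he2 : 0 < eps / 2 by lra.
  have [N1 h1] := proj1 (@filterlimCP _ eventually _ _ _) (II_correct hd) _ he2.
  have l1 : is_lim_seq (fun n => B * / (INR n + 1)) (B * 0).
    by apply: (is_lim_seq_scal_l _ B (Rbar.Finite 0)); exact: lim_inv_Sn.
  rewrite Rmult_0_r in l1; move/is_lim_seq_spec: l1 => /(_ (mkposreal _ he2)) [N2 h2].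
  exists (maxn N1 N2) => n hn.
  have {}h1 := h1 n (ltac:(lia)); have {}h2 := h2 n (ltac:(lia)).
  rewrite Rminus_0_r /= in h2.
  rewrite -(RInt_Chasles (V := CV) f 0 (/ (INR n + 1)) (INR n + 1)) //.
  have p := inv_Sn_pos n.
  have b : Cmod (RInt (V := CV) f 0 (/ (INR n + 1))) <= (/ (INR n + 1) - 0) * B.
    rewrite -Cmod_normE.
    apply: (norm_RInt_le_const (V := CV) f); first lra; last by apply: (RInt_correct (V := CV)).
    move=> x hx; rewrite Cmod_normE; have [->|x0] := Req_dec x 0; first exact: h0.
    have [|_ hb] := hd x; first lra.
    apply: Rle_trans hb _; rewrite -[X in _ <= X]Rmult_1_r; apply: Rmult_le_compat_l => //.
    apply: exp_opp_le1; lra.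
  have h3 := Rle_abs (B * / (INR n + 1)).
  set X := RInt (V := CV) _ _ _ in b *; set Y := RInt (V := CV) _ _ _ in h1 *.
  have -> : ((plus X Y : CV) - II f = X + (Y - II f))%C by transitivity (X + Y - II f)%C; [|ring].
  apply: Rle_lt_trans (Cmod_triangle _ _) _; lra.
apply/filterlimCP => eps he.
have [N hN] := proj1 (@filterlimCP _ eventually _ _ _) H eps he.
exists N.+1 => n hn; case: n hn => [|n] hn; first lia.
by rewrite S_INR; apply: hN; lia.
Qed.

Lemma Dir_bound N x : Rabs (Dir N x) <= 2 * INR N + 1.
Proof.
elim: N => [|N IH]; first by rewrite /= Rabs_R1; lra.
rewrite [Dir _ _]/= -/(INR N.+1) S_INR; apply: Rle_trans (Rabs_triang _ _) _.
have := COS_bound (2 * PI * INR N.+1 * x); rewrite S_INR => h.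
have : Rabs (2 * cos (2 * PI * (INR N + 1) * x)) <= 2 by apply: Rabs_le; lra.
lra.
Qed.

Lemma FejS_bounded M : exists c, 0 <= c /\ forall x, Rabs (FejS M x) <= c.
Proof.
elim: M => [|M [c [c0 IH]]]; first by exists 1; split; [lra|move=> x; rewrite /= Rabs_R1; lra].
exists (c + (2 * INR M.+1 + 1)); split; first by have := pos_INR M.+1; lra.
move=> x; rewrite [FejS _ _]/= -/(Dir M.+1 x); apply: Rle_trans (Rabs_triang _ _) _.
by have := IH x; have := Dir_bound M.+1 x; lra.
Qed.

Lemma fejer_II M (v : R -> C) L B eta S : 0 < eta -> 0 <= L ->
  (forall y, continuous (v : R -> CV) y) -> (forall y, 0 <= y -> Cmod (v y) <= B * exp (- y)) ->
  (forall (k : nat) x, 0 <= x <= / 2 -> Cmod (v (INR k + x) - v (INR k)) <= L * exp (- INR k) * x) ->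
  (forall (k : nat) x, 0 <= x <= / 2 -> Cmod (v (INR k + 1 - x) - v (INR k + 1)) <= L * exp (- INR k) * x) ->
  filterlim (fun n => (/ 2 * \big[Cplus/RtoC 0]_(k <- iota 0 n) (v (INR k) + v (INR k + 1)%coqR))%C : CV) eventually (locally (S : CV)) ->
  Cmod (II (fun x => RtoC (FejS M x) * v x)%C - RtoC (INR M + 1)%coqR * S) <= 4 * L * ((INR M + 1) * eta + / eta).
Proof.
move=> he hL hc hB h1 h2 hS.
have [c [c0 hcc]] := FejS_bounded M.
pose f x := (RtoC (FejS M x) * v x)%C.
have hf y : continuous (f : R -> CV) y.
  apply: continuous_Cmult; last exact: hc.
  apply: continuous_RtoC; exact: FejS_continuous.
have fb y : 0 <= y -> Cmod (f y) <= c * B * exp (- y).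
  move=> hy; rewrite /f Cmod_mult Cmod_R Rmult_assoc; apply: Rmult_le_compat => //.
  - exact: Rabs_pos.
  - exact: Cmod_ge_0.
  - exact: hB.
have dom : IIdom f (c * B) by move=> y hy; split => //; apply: fb; lra.
have lim1 := II_of_RInt0 dom hf (ltac:(have := fb 0 (Rle_refl _); rewrite Ropp_0 exp_0; lra)).
have lim2 := filterlim_Cscal (a := RtoC (INR M + 1)) hS.
apply: le_epsilon => eps heps; have he2 : 0 < eps / 2 by lra.
have [N1 H1] := proj1 (@filterlimCP _ eventually _ _ _) lim1 _ he2.
have [N2 H2] := proj1 (@filterlimCP _ eventually _ _ _) (lim2 _) _ he2.
set n := maxn N1 N2.
have {}H1 := H1 n (ltac:(lia)); have {}H2 := H2 n (ltac:(lia)).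
have H3 := fejer_line M n he hL hc h1 h2.
rewrite -/f in H3 *.
set A := RInt (V := CV) _ _ _ in H1 H3; set T := \big[_/_]_(_ <- _) _ in H2 H3.
have EE : (RtoC ((INR M + 1) / 2)%coqR * T = RtoC (INR M + 1)%coqR * (/ 2 * T))%C.
  by rewrite RtoC_div; [field|lra].
rewrite EE in H3.
have : 4 * L * ((INR M + 1) * eta + / eta) * (1 - exp (- INR n)) <= 4 * L * ((INR M + 1) * eta + / eta).
  rewrite -[X in _ <= X]Rmult_1_r; apply: Rmult_le_compat_l; last by have := exp_pos (- INR n); lra.
  have := Rinv_0_lt_compat _ he; have := pos_INR M => q1 q2.
  have : 0 <= (INR M + 1) * eta by nra.
  move=> q3; apply: Rmult_le_pos; lra.
move=> H4.
have T1 := Cmod_le_dist (II f) A (RtoC (INR M + 1)%coqR * S)%C.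
have T2 := Cmod_le_dist A (RtoC (INR M + 1)%coqR * (/ 2 * T))%C (RtoC (INR M + 1)%coqR * S)%C.
rewrite (Cmod_switch A) in H1.
lra.
Qed.

(** * Poisson summation with signs *)

(** Decay at rate [r] instead of 1 divides the bound by [r]. This gives the decay 1/(s + 1) of the
    transforms, which is enough because only single remainders have to vanish. *)
Lemma II_norm_rate f B D r : IIdom f B -> 0 < r -> 0 <= D ->
  (forall y, 0 < y -> Cmod (f y) <= D * exp (- (r * y))) -> Cmod (II f) <= D / r.
Proof.
move=> h hr hD hb; have hl := II_correct h.
apply: le_epsilon => eps he; have [N hN] := proj1 (@filterlimCP _ eventually _ _ _) hl eps he.
have {}hN := hN N (Nat.le_refl N).
have p := inv_Sn_pos N; have p2 := inv_Sn_le N.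
have b : Cmod (RInt (V := CV) f (/ (INR N + 1)) (INR N + 1)) <= D / r * (exp (- (r * / (INR N + 1))) - exp (- (r * (INR N + 1)))).
  rewrite -Cmod_normE.
  apply: (norm_RInt_le (V := CV) f (fun y => D * exp (- (r * y))) (/ (INR N + 1)) (INR N + 1)) => //.
  - by move=> x hx; rewrite Cmod_normE; apply: hb; lra.
  - apply: (RInt_correct (V := CV)); apply: IIdom_ex h _ _ => //; lra.
  - set a := / _; set b := _ + 1.
    have -> : D / r * (exp (- (r * a)) - exp (- (r * b))) = minus (- D / r * exp (- (r * b))) (- D / r * exp (- (r * a))).
      by rewrite /minus /plus /Hierarchy.opp /=; field; lra.
    apply: (is_RInt_derive (V := R_CompleteNormedModule) (fun y => - D / r * exp (- (r * y)))) => x _.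
      by auto_derive => //; field; lra.
    apply: (ex_derive_continuous (V := R_NormedModule)); by auto_derive.
set X := RInt (V := CV) _ _ _ in hN b.
have t := Cmod_triangle (II f - X) X; have E : (II f - X + X = II f)%C by ring.
rewrite E Cmod_switch in t.
have e1 : exp (- (r * / (INR N + 1))) <= 1 by apply: exp_opp_le1; nra.
have e2 := exp_pos (- (r * (INR N + 1))).
have : D / r * (exp (- (r * / (INR N + 1))) - exp (- (r * (INR N + 1)))) <= D / r.
  rewrite -[X in _ <= X]Rmult_1_r; apply: Rmult_le_compat_l; last lra.
  by apply: Rmult_le_pos => //; left; exact: Rinv_0_lt_compat.
lra.
Qed.

Lemma Cexp_lip u v : Re u <= 0 -> Re v <= 0 -> Cmod (Cexp u - Cexp v) <= 2 * Cmod (u - v).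
Proof.
move=> hu hv.
have h := @Cbounded_variation (fun t => Cexp (RtoC t * (u - v) + v)) (fun t => (u - v) * Cexp (RtoC t * (u - v) + v))%C (Cmod (u - v)) 0 1.
have H : Cmod (Cexp (RtoC 1 * (u - v) + v) - Cexp (RtoC 0 * (u - v) + v)) <= 2 * Cmod (u - v) * Rabs (1 - 0).
  apply: h => t; rewrite Rmin_left ?Rmax_right; try lra; move=> ht; split.
    apply: is_derive_Cexp.
    have E := is_derive_plus (V := CV) _ _ _ _ _ (is_derive_lin (u - v)%C t) (is_derive_const (V := CV) v t).
    by rewrite plus_zero_r in E.
  rewrite Cmod_mult Cmod_Cexp -[X in _ <= X]Rmult_1_r; apply: Rmult_le_compat_l; first exact: Cmod_ge_0.
  rewrite -[X in _ <= X]exp_0; apply: exp_le; rewrite !ReImE; nra.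
move: H; rewrite Rminus_0_r Rabs_R1 Rmult_1_r.
have -> : (RtoC 1 * (u - v) + v = u)%C by ring.
by have -> : (RtoC 0 * (u - v) + v = v)%C by ring.
Qed.

Definition mu8 : C := Cis (PI / 4).
(** The frequency 2 pi i after the substitution x = [mu8] y, under which exp(pi i t x^2) becomes
    exp(-pi t y^2). Its real part is negative, so the sum over the frequencies turns into a
    convergent geometric series. *)
Definition lam : C := (- (2 * RtoC PI * Cconj mu8))%C.

Lemma mu8_re : Re mu8 = cos (PI / 4).
Proof. by rewrite /mu8 /Cis !ReImE /=; ring. Qed.
Lemma mu8_im : Im mu8 = cos (PI / 4).
Proof. by rewrite /mu8 /Cis !ReImE /= sin_PI4 cos_PI4; ring. Qed.

Lemma cos_PI4_half : / 2 <= cos (PI / 4).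
Proof.
have -> : / 2 = cos (PI / 3) by rewrite cos_PI3; lra.
have := PI_RGT_0 => p; apply: cos_decr_1; lra.
Qed.

Lemma cos_PI4_sq : cos (PI / 4) * cos (PI / 4) = / 2.
Proof.
have := sin2_cos2 (PI / 4); rewrite /Rsqr sin_PI4 -cos_PI4; lra.
Qed.

Lemma mu8_sq : (mu8 * mu8 = Ci)%C.
Proof. by apply: Ceq; rewrite ?Re_mult ?Im_mult mu8_re mu8_im /=; have := cos_PI4_sq; lra. Qed.

Lemma mu8_conj : (mu8 * Cconj mu8 = 1)%C.
Proof.
apply: Ceq; rewrite ?Re_mult ?Im_mult re_conj im_conj mu8_re mu8_im /=; have := cos_PI4_sq; lra.
Qed.

Lemma mu8c_sq : (Cconj mu8 * Cconj mu8 = - Ci)%C.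
Proof.
by rewrite -Cmult_conj mu8_sq; apply: Ceq; rewrite ?re_conj ?im_conj /=; lra.
Qed.

Lemma Ci_sq : (Ci * Ci = - 1)%C.
Proof. by apply: Ceq; rewrite !ReImE /=; ring. Qed.

Lemma lam_re : Re lam = - (2 * PI * cos (PI / 4)).
Proof. by rewrite /lam Re_opp !Re_mult re_conj !Im_mult mu8_re /=; ring. Qed.

Lemma lam_re_le : Re lam <= -3.
Proof. rewrite lam_re; have := cos_PI4_half; have := PI2_3_2; move=> a b; nra. Qed.

Lemma lam_mod : Cmod lam <= 2 * (- Re lam).
Proof.
rewrite lam_re /lam Cmod_opp !Cmod_mult Cmod_conj !Cmod_R Rabs_pos_eq; last lra.
have -> : Cmod mu8 = 1.
  have h : Cmod (mu8 * Cconj mu8) = 1 by rewrite mu8_conj Cmod_1.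
  rewrite Cmod_mult Cmod_conj in h; have := Cmod_ge_0 mu8; nra.
have := PI_RGT_0 => p; rewrite Rabs_pos_eq; last lra.
have := cos_PI4_half; nra.
Qed.

(** The sum over k >= 0 of exp((k + al) y lam) - exp((k + 1 - al) y lam). The numerator vanishes at
    y = 0 together with the denominator, which keeps the kernel bounded. *)
Definition kern (al y : R) : C :=
  ((Cexp (RtoC (al * y) * lam) - Cexp (RtoC ((1 - al) * y) * lam)) / (1 - Cexp (RtoC y * lam)))%C.

Lemma kern_den y : 0 < y -> let x := - Re lam * y in x / (1 + x) <= Cmod (1 - Cexp (RtoC y * lam)).
Proof.
move=> hy x; have hx : 0 < x by rewrite /x; have := lam_re_le; nra.
have h1 : Cmod (Cexp (RtoC y * lam)) = exp (- x) by rewrite Cmod_Cexp re_scal_l /x; congr exp; ring.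
have h2 := Cmod_triangle (1 - Cexp (RtoC y * lam)) (Cexp (RtoC y * lam)).
have E : (1 - Cexp (RtoC y * lam) + Cexp (RtoC y * lam) = 1)%C by ring.
rewrite E Cmod_1 h1 in h2.
have h3 : exp (- x) <= / (1 + x).
  by rewrite exp_Ropp; apply: Rinv_le_contravar; [lra|exact: exp_ineq1_le].
have : x / (1 + x) = 1 - / (1 + x) by field; lra.
lra.
Qed.

Lemma kern_den_neq0 y : 0 < y -> (1 - Cexp (RtoC y * lam))%C <> 0%C.
Proof.
move=> hy; have h := kern_den hy; have hx : 0 < - Re lam * y by have := lam_re_le; nra.
apply/Cmod_gt_0; apply: Rlt_le_trans h; apply: Rdiv_lt_0_compat => //; lra.
Qed.

(** With x = - Re lam y the numerator is at most 4x and at most 2, and the denominator at least x/(1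
    + x). The constant 8 comes from x <= 1; for x > 1 the second bound gives 4. *)
Lemma kern_bound al y : 0 < al < 1 -> 0 < y -> Cmod (kern al y) <= 8.
Proof.
move=> ha hy; have h := kern_den hy; have hx : 0 < - Re lam * y by have := lam_re_le; nra.
move: h => /=; set x := - Re lam * y in hx * => h.
have hd : 0 < x / (1 + x) by apply: Rdiv_lt_0_compat; lra.
have rl (t : R) : 0 <= t -> Re (RtoC (t * y) * lam) <= 0.
  by move=> ht; rewrite re_scal_l; have := lam_re_le; move=> ?; have : 0 <= t * y by [nra]; nra.
rewrite /kern Cmod_div; last exact: kern_den_neq0.
set nu := (_ - _)%C; set D := Cmod (1 - _) in h *.
have n1 : Cmod nu <= 4 * x.
  apply: Rle_trans (Cexp_lip _ _) _; try (apply: rl; lra).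
  have -> : ((al * y)%coqR * lam - ((1 - al) * y)%coqR * lam = RtoC ((2 * al - 1) * y)%coqR * lam)%C.
    by rewrite !RtoC_mult !RtoC_minus !RtoC_mult; ring.
  rewrite Cmod_mult Cmod_R Rabs_mult (Rabs_pos_eq y); last lra.
  have a1 : Rabs (2 * al - 1) <= 1 by apply: Rabs_le; lra.
  have a2 := Rabs_pos (2 * al - 1); have a3 := lam_mod; have a4 := Cmod_ge_0 lam.
  have : Rabs (2 * al - 1) * y * Cmod lam <= y * (2 * - Re lam).
    apply: Rmult_le_compat => //; first nra; nra.
  rewrite /x; lra.
have n2 : Cmod nu <= 2.
  apply: Rle_trans (Cmod_triangle _ _) _; rewrite Cmod_opp !Cmod_Cexp.
  have e (t : R) : 0 <= t -> exp (Re (RtoC (t * y) * lam)) <= 1.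
    by move=> ht; rewrite -[X in _ <= X]exp_0; apply: exp_le; apply: rl.
  have := e al (ltac:(lra)); have := e (1 - al) (ltac:(lra)); lra.
have n0 := Cmod_ge_0 nu.
apply: Rle_trans (_ : Cmod nu * / (x / (1 + x)) <= _).
  by apply: Rmult_le_compat_l => //; apply: Rinv_le_contravar.
have -> : / (x / (1 + x)) = (1 + x) / x by field; split; lra.
apply: (Rmult_le_reg_r x) => //; rewrite /Rdiv Rmult_assoc Rmult_assoc Rinv_l ?Rmult_1_r; last lra.
have [l|l] := Rle_dec x 1; nra.
Qed.

Lemma kern_continuous al y : 0 < y -> continuous (kern al : R -> CV) y.
Proof.
have c (t : R) z : continuous (fun y => Cexp (RtoC (t * y) * lam) : CV) z.
  apply: continuous_Cexp; apply: continuous_Cmult; last exact: continuous_const.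
  apply: continuous_RtoC; apply: (ex_derive_continuous (V := R_NormedModule)); by auto_derive.
move=> hy; apply: continuous_Cmult.
  by apply: (continuous_minus (V := CV)).
apply: continuous_Cinv; last exact: kern_den_neq0.
apply: (continuous_minus (V := CV)); first exact: continuous_const.
apply: (continuous_ext (fun y => Cexp (RtoC (1 * y) * lam) : CV)); last exact: c.
by move=> t; rewrite Rmult_1_l.
Qed.

Definition gA (t : C) : C := II (gexp (RtoC PI * t) 0).
Definition gB (al : R) (t : C) : C := II (fun y => kern al y * gexp (RtoC PI * t) 0 y)%C.

Lemma Re_PI_mul t : Re (RtoC PI * t) = PI * Re t.
Proof. exact: re_scal_l. Qed.

Lemma gB_dom al t (k : nat) : 0 < al < 1 -> 0 < Re t ->
  IIdom (fun y => kern al y * Cpow (Cexp (RtoC y * lam)) k * gexp (RtoC PI * t) 0 y)%C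
    (8 * exp ((0 + Re 0 + 1) ^ 2 / (4 * Re (RtoC PI * t)))).
Proof.
move=> ha ht; have hp := PI_RGT_0.
apply: IIdom_gauss => //; first by rewrite Re_PI_mul; nra.
- lra.
- move=> y hy; apply: continuous_Cmult; first exact: kern_continuous.
  apply: (continuous_ext (fun y => Cexp (RtoC (INR k) * (RtoC y * lam)) : CV)).
    by move=> s; rewrite Cexp_pow.
  apply: continuous_Cexp; apply: continuous_Cmult; first exact: continuous_const.
  apply: continuous_Cmult; last exact: continuous_const.
  apply: continuous_RtoC; exact: continuous_id.
move=> y hy; rewrite Rmult_0_l exp_0 Cmod_mult Cexp_pow Cmod_Cexp.
apply: Rmult_le_compat; [exact: Cmod_ge_0|left; exact: exp_pos|exact: kern_bound|].
rewrite -exp_0; apply: exp_le; rewrite !re_scal_l.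
have := pos_INR k; have := lam_re_le; move=> a b; have : y * Re lam <= 0 by nra.
nra.
Qed.

Lemma gexp_rate t y : 0 < Re t -> 0 < y ->
  exp (- Re (RtoC PI * t) * y ^ 2) <= exp (1 / (4 * Re (RtoC PI * t))) * exp (- y).
Proof.
move=> ht hy; have hp := PI_RGT_0.
have h : 0 < Re (RtoC PI * t) by rewrite Re_PI_mul; nra.
have := gauss_le 1 y h; rewrite -exp_plus pow1 => H; apply: exp_le; lra.
Qed.

(** By the closed form of [kern], each difference of exponentials is the difference of two
    consecutive tails of the geometric series; the partial sums therefore carry an explicit
    remainder. *)
Lemma gK_telescope al t N : 0 < al < 1 -> 0 < Re t ->
  \big[Cplus/RtoC 0]_(k <- iota 0 N)
     (gM (RtoC PI * t) lam (INR k + al) - gM (RtoC PI * t) lam (INR k + 1 - al))%C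
  = (gB al t - II (fun y => kern al y * Cpow (Cexp (RtoC y * lam)) N * gexp (RtoC PI * t) 0 y))%C.
Proof.
move=> ha ht; have hp := PI_RGT_0.
have rp : 0 < Re (RtoC PI * t) by rewrite Re_PI_mul; nra.
elim: N => [|N IH].
  rewrite big_nil /gB.
  have -> : II (fun y => kern al y * Cexp (y * lam) ^ 0 * gexp (PI * t) 0 y)%C = II (fun y => kern al y * gexp (PI * t) 0 y)%C.
    by apply: (II_ext (gB_dom 0 ha ht)) => y _ /=; ring.
  ring.
rewrite -addn1 iotaD big_cat /= add0n big_cons big_nil Cplus_0_r IH.
have d1 := gB_dom N ha ht; have d2 := gB_dom N.+1 ha ht.
have d3 := IIdom_gexp (RtoC (INR N + 1 - al) * lam)%C rp.
have d4 := IIdom_gexp (RtoC (INR N + al) * lam)%C rp.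
have E : II (gexp (RtoC PI * t) (RtoC (INR N + al) * lam)) =
   (II (fun y => kern al y * Cpow (Cexp (RtoC y * lam)) N * gexp (RtoC PI * t) 0 y) +
    (-1) * II (fun y => kern al y * Cpow (Cexp (RtoC y * lam)) N.+1 * gexp (RtoC PI * t) 0 y) +
    II (gexp (RtoC PI * t) (RtoC (INR N + 1 - al) * lam)))%C.
  rewrite -(II_scal _ d2) -(II_plus d1 (IIdom_scal _ d2)) -(II_plus (IIdom_plus d1 (IIdom_scal _ d2)) d3).
  apply: (II_ext d4) => y hy.
  have ge s : gexp (RtoC PI * t) (RtoC s * lam) y = (Cexp (RtoC (s * y) * lam) * gexp (RtoC PI * t) 0 y)%C.
    by rewrite /gexp -Cexp_add; congr Cexp; rewrite RtoC_mult; ring.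
  rewrite !ge !Cexp_pow.
  have -> : Cexp (RtoC (INR N.+1) * (RtoC y * lam)) = (Cexp (RtoC (INR N) * (RtoC y * lam)) * Cexp (RtoC y * lam))%C.
    by rewrite -Cexp_add S_INR RtoC_plus; congr Cexp; ring.
  have nz := kern_den_neq0 hy.
  have -> : Cexp (RtoC ((INR N + al) * y) * lam) = (Cexp (RtoC (INR N) * (RtoC y * lam)) * Cexp (RtoC (al * y) * lam))%C.
    by rewrite -Cexp_add !RtoC_mult RtoC_plus; congr Cexp; ring.
  have -> : Cexp (RtoC ((INR N + 1 - al) * y) * lam) = (Cexp (RtoC (INR N) * (RtoC y * lam)) * Cexp (RtoC ((1 - al) * y) * lam))%C.
    by rewrite -Cexp_add !RtoC_mult !RtoC_minus RtoC_plus; congr Cexp; ring.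
  by rewrite /kern; field.
rewrite /gM E addn1.
move: (II _) (II _) (II _) => x1 x2 x3; rewrite /gB; ring.
Qed.

Lemma gM_lam_rate t s : 0 < Re t -> 0 <= s ->
  Cmod (gM (RtoC PI * t) lam s) <= exp (1 / (4 * Re (RtoC PI * t))) / (s + 1).
Proof.
move=> ht hs; have hp := PI_RGT_0.
have rp : 0 < Re (RtoC PI * t) by rewrite Re_PI_mul; nra.
apply: (II_norm_rate (IIdom_gexp (RtoC s * lam)%C rp)); [lra | left; exact: exp_pos |].
move=> y hy; rewrite Cmod_gexp exp_plus.
have h1 := gexp_rate ht hy.
have h2 : exp (Re (RtoC s * lam) * y) <= exp (- (s * y)).
  apply: exp_le; rewrite re_scal_l; have := lam_re_le; have : 0 <= s * y by [nra]; move=> a b; nra.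
have -> : - ((s + 1) * y) = - y + - (s * y) by ring.
rewrite exp_plus -Rmult_assoc; apply: Rmult_le_compat => //; left; exact: exp_pos.
Qed.

Lemma gB_tail al t N : 0 < al < 1 -> 0 < Re t ->
  Cmod (II (fun y => kern al y * Cpow (Cexp (RtoC y * lam)) N * gexp (RtoC PI * t) 0 y)%C)
    <= 8 * exp (1 / (4 * Re (RtoC PI * t))) / (INR N + 1).
Proof.
move=> ha ht; have hN := pos_INR N.
apply: (II_norm_rate (gB_dom N ha ht)); [lra | have := exp_pos (1 / (4 * Re (RtoC PI * t))); lra |].
move=> y hy; rewrite Cmod_mult Cmod_gexp (Cmod_mult (kern al y)) Cexp_pow Cmod_Cexp !re_scal_l.
have -> : - (PI * Re t) * y ^ 2 + Re 0 * y = - (PI * Re t) * y ^ 2 by rewrite /=; ring.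
have h1 := gexp_rate ht hy; rewrite re_scal_l in h1.
have h2 : exp (INR N * (y * Re lam)) <= exp (- (INR N * y)).
  apply: exp_le; have := lam_re_le; have : 0 <= INR N * y by [nra]; move=> a b; nra.
have h3 := kern_bound ha hy.
have -> : - ((INR N + 1) * y) = - (INR N * y) + - y by ring.
rewrite exp_plus.
have e1 := exp_pos (INR N * (y * Re lam)); have e2 := exp_pos (- (PI * Re t) * y ^ 2).
have e0 := Cmod_ge_0 (kern al y).
set q := exp (1 / _) in h1 *.
have -> : 8 * q * (exp (- (INR N * y)) * exp (- y)) = (8 * exp (- (INR N * y))) * (q * exp (- y)) by ring.
apply: Rmult_le_compat => //; [nra | lra | apply: Rmult_le_compat => //; lra].
Qed.

Definition qE (t : C) (s : R) : C := Cexp (RtoC PI * Ci * t * RtoC (s ^ 2)).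

Lemma cesaro (u : nat -> C) (l : C) : filterlim (u : nat -> CV) eventually (locally (l : CV)) ->
  forall eps, 0 < eps -> exists N, forall n, (N <= n)%coq_nat ->
    Cmod (\big[Cplus/RtoC 0]_(k <- iota 0 n.+1) u k - RtoC (INR n.+1) * l) <= eps * INR n.+1.
Proof.
move=> hl eps he; have he2 : 0 < eps / 2 by lra.
have [N hN] := proj1 (@filterlimCP _ eventually _ _ _) hl _ he2.
pose D n := Cmod (\big[Cplus/RtoC 0]_(k <- iota 0 n) u k - RtoC (INR n) * l).
have st n : D n.+1 <= D n + Cmod (u n - l).
  rewrite /D -addn1 iotaD big_cat /= add0n big_cons big_nil Cplus_0_r addn1 S_INR RtoC_plus.
  set X := \big[_/_]_(_ <- _) _.
  have -> : (X + u n - (INR n + 1) * l = (X - INR n * l) + (u n - l))%C by ring.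
  exact: Cmod_triangle.
have bd k : D (N + k)%N <= D N + eps / 2 * INR k.
  elim: k => [|k IH]; first by rewrite addn0 /=; lra.
  rewrite addnS S_INR; have := st (N + k)%N; have := hN (N + k)%coq_nat (Nat.le_add_r _ _).
  move=> h1 h2; have : Cmod (u (N + k)%N - l) < eps / 2 by exact: h1.
  lra.
have [N2 hN2] : exists n2 : nat, D N <= eps / 2 * INR n2.
  have D0 : 0 <= D N by exact: Cmod_ge_0.
  have [n2 h2] := INR_unbounded (D N / (eps / 2)).
  exists n2; have := Rmult_le_compat_l _ _ _ (Rlt_le _ _ he2) (Rlt_le _ _ h2).
  by have -> : eps / 2 * (D N / (eps / 2)) = D N by field; lra.
exists (N + N2)%N => n hn.
have E : n.+1 = (N + (n.+1 - N))%N by lia.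
rewrite -/(D n.+1) E; apply: Rle_trans (bd _) _; rewrite -E.
have h1 : INR N2 <= INR n.+1 by apply: le_INR; lia.
have h2 : INR (n.+1 - N) <= INR n.+1 by apply: le_INR; lia.
have : eps / 2 * INR N2 <= eps / 2 * INR n.+1 by apply: Rmult_le_compat_l; lra.
have : eps / 2 * INR (n.+1 - N) <= eps / 2 * INR n.+1 by apply: Rmult_le_compat_l; lra.
lra.
Qed.

Lemma filterlim0_rate (u : nat -> C) c : (forall n, Cmod (u n) <= c / (INR n + 1)) ->
  filterlim (u : nat -> CV) eventually (locally (RtoC 0 : CV)).
Proof.
move=> h; apply/filterlimCP => eps he.
have l1 : is_lim_seq (fun n => c * / (INR n + 1)) (c * 0).
  by apply: (is_lim_seq_scal_l _ c (Rbar.Finite 0)); exact: lim_inv_Sn.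
rewrite Rmult_0_r in l1; move/is_lim_seq_spec: l1 => /(_ (mkposreal _ he)) [N hN].
exists N => n hn; have := hN n hn; rewrite Rminus_0_r /=.
have -> (z : C) : (z - 0 = z)%C by ring.
by have := h n; have := Rle_abs (c * / (INR n + 1)); rewrite /Rdiv; lra.
Qed.

Lemma Im_Cinv_opp (t : C) : 0 < Im t -> 0 < Im (- / t).
Proof.
move=> h; rewrite /Cinv /=; have p1 := pow2_ge_0 (fst t); have p2 : 0 < snd t * snd t by rewrite /Im in h; nra.
rewrite /Im in h.
have -> : - (- snd t / (fst t * (fst t * 1) + snd t * (snd t * 1))) = snd t / (fst t ^ 2 + snd t * snd t).
  by field; nra.
apply: Rdiv_lt_0_compat => //; lra.
Qed.

Lemma Cmod_qE t s : Cmod (qE t s) = exp (- (PI * Im t * s ^ 2)).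
Proof. by rewrite /qE Cmod_Cexp re_scal_r; congr exp; case: t => x y /=; ring. Qed.

Lemma qE_rate t al : 0 < Im t -> 0 < al -> exists c, forall n, Cmod (qE t (INR n + al)) <= c / (INR n + 1).
Proof.
move=> hi ha; have hp := PI_RGT_0.
have hg : 0 < PI * Im t by nra.
exists (exp (1 / (4 * (PI * Im t)))) => n; have hn := pos_INR n.
rewrite Cmod_qE.
have := gauss_le 1 (INR n + al) hg; rewrite pow1 => H.
apply: Rle_trans (_ : exp (1 / (4 * (PI * Im t))) * exp (- (INR n + al)) <= _).
  rewrite -exp_plus; apply: exp_le; lra.
apply: Rmult_le_compat_l; first by left; exact: exp_pos.
rewrite exp_Ropp; apply: Rinv_le_contravar; first lra.
have := exp_ineq1_le (INR n + al); lra.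
Qed.

(** * The summation formula for t in the open first quadrant *)

Section Core.
Variables (t : C) (al : R).
Hypothesis (ht : 0 < Re t) (hi : 0 < Im t) (ha : 0 < al < 1).

Let a : C := (- (RtoC PI * Ci * t))%C.
Let lm : C := (2 * RtoC PI * Ci)%C.
(** 2 i sin(2 pi al x) exp(pi i t x^2), whose values at the positive integers make up the series
    Psi. It vanishes at 0, so the half-line sum has no boundary term. *)
Let v (x : R) : C := (gexp a (RtoC al * lm) x - gexp a (RtoC (- al) * lm) x)%C.
Let Del (s : R) : C := (gM a lm s - gM a lm (- s))%C.

Let Rea : Re a = PI * Im t.
Proof. rewrite /a; case: (t) => x y /=; ring. Qed.

Let Rea0 : 0 < Re a.
Proof. rewrite Rea; have := PI_RGT_0; nra. Qed.

Let Relm (x : R) : Re (RtoC x * lm) = 0.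
Proof. rewrite /lm /=; ring. Qed.

Let gexp_osc (x y : R) : gexp a (RtoC x * lm) y = (qE t y * Cexp (RtoC (x * y) * lm))%C.
Proof. by rewrite /gexp /qE -Cexp_add; congr Cexp; rewrite /a RtoC_mult; ring. Qed.

Let domv : IIdom v (exp ((0 + 1) ^ 2 / (4 * Re a)) + Cmod (-1)%C * exp ((0 + 1) ^ 2 / (4 * Re a))).
Proof.
have d1 := IIdom_gexp (RtoC al * lm)%C Rea0; have d2 := IIdom_gexp (RtoC (- al) * lm)%C Rea0.
rewrite Relm in d1; rewrite Relm in d2.
apply: IIdom_ext (IIdom_plus d1 (IIdom_scal (-1)%C d2)) => y; rewrite /v; ring.
Qed.

Let cosexp (x : R) : (RtoC (2 * cos (2 * PI * x)) = Cexp (RtoC x * lm) + Cexp (RtoC (- x) * lm))%C.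
Proof.
have -> : (RtoC x * lm = Ci * RtoC (2 * PI * x))%C by rewrite /lm !RtoC_mult; ring.
have -> : (RtoC (- x) * lm = Ci * RtoC (- (2 * PI * x)))%C by rewrite /lm !RtoC_opp !RtoC_mult; ring.
rewrite !Cexp_iR /Cis cos_neg sin_neg; apply: Ceq; rewrite !ReImE /=; ring.
Qed.

Let II_cos (n : nat) : let f y := (RtoC (2 * cos (2 * PI * INR n * y)) * v y)%C in
  (exists B, IIdom f B) /\ II f = (Del (INR n + al) - Del (INR n - al))%C.
Proof.
move=> f.
have d x := IIdom_gexp (RtoC x * lm)%C Rea0.
pose g y := (gexp a (RtoC (INR n + al) * lm) y + (-1) * gexp a (RtoC (- (INR n + al)) * lm) y
   + ((-1) * gexp a (RtoC (INR n - al) * lm) y + gexp a (RtoC (- (INR n - al)) * lm) y))%C.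
have dg := IIdom_plus (IIdom_plus (d (INR n + al)) (IIdom_scal (-1)%C (d (- (INR n + al)))))
   (IIdom_plus (IIdom_scal (-1)%C (d (INR n - al))) (d (- (INR n - al)))).
have E y : g y = f y.
  rewrite /g /f /v !gexp_osc Rmult_assoc cosexp.
  have e (z : R) : (Cexp (RtoC (INR n * y) * lm) * Cexp (RtoC (z * y) * lm) = Cexp (RtoC ((INR n + z) * y) * lm))%C.
    by rewrite -Cexp_add !RtoC_mult RtoC_plus; congr Cexp; ring.
  have e' (z : R) : (Cexp (RtoC (- (INR n * y)) * lm) * Cexp (RtoC (z * y) * lm) = Cexp (RtoC ((- INR n + z) * y) * lm))%C.
    by rewrite -Cexp_add !RtoC_opp !RtoC_mult RtoC_plus !RtoC_opp; congr Cexp; ring.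
  have -> : INR n - al = INR n + - al by ring.
  have -> : - (INR n + al) = - INR n + - al by ring.
  have -> : - (INR n + - al) = - INR n + al by ring.
  by rewrite -!e -!e'; ring.
have df := IIdom_ext E dg.
split; first by eexists; exact: df.
rewrite -(II_ext dg (fun y _ => E y)).
rewrite (II_plus (IIdom_plus (d (INR n + al)) (IIdom_scal (-1)%C (d (- (INR n + al)))))
   (IIdom_plus (IIdom_scal (-1)%C (d (INR n - al))) (d (- (INR n - al))))).
rewrite (II_plus (d (INR n + al)) (IIdom_scal (-1)%C (d (- (INR n + al))))).
rewrite (II_plus (IIdom_scal (-1)%C (d (INR n - al))) (d (- (INR n - al)))).
rewrite !(II_scal _ (d _)) /Del /gM.
move: (II _) (II _) (II _) (II _) => x1 x2 x3 x4; ring.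
Qed.

(** Each cosine of the Dirichlet kernel shifts the frequency al by n in both directions. Regrouping
    into pairs k + al, k + 1 - al, the shape of a sum over all integers weighted by sgn(j + al),
    leaves the last transform unpaired. *)
Let II_Dir (N : nat) : (exists B, IIdom (fun y => RtoC (Dir N y) * v y)%C B) /\
  II (fun y => RtoC (Dir N y) * v y)%C =
   (\big[Cplus/RtoC 0]_(k <- iota 0 N) (Del (INR k + al) - Del (INR k + 1 - al)%coqR) + Del (INR N + al))%C.
Proof.
elim: N => [|N [[B dB] IH]].
  have E y : v y = (RtoC (Dir 0 y) * v y)%C by rewrite /= Cmult_1_l.
  split; first by eexists; apply: IIdom_ext E domv.
  rewrite big_nil Cplus_0_l /= Rplus_0_l -(II_ext domv (fun y _ => E y)) /v.
  have d1 := IIdom_gexp (RtoC al * lm)%C Rea0; have d2 := IIdom_gexp (RtoC (- al) * lm)%C Rea0.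
  transitivity (II (fun y => gexp a (RtoC al * lm) y + (-1) * gexp a (RtoC (- al) * lm) y)%C).
    by apply: (II_ext domv) => y _; rewrite /v; ring.
  by rewrite (II_plus d1 (IIdom_scal _ d2)) (II_scal _ d2) /Del /gM; ring.
have [[B' dB'] IH'] := II_cos N.+1.
have E y : (RtoC (Dir N y) * v y + RtoC (2 * cos (2 * PI * INR N.+1 * y)) * v y)%C = (RtoC (Dir N.+1 y) * v y)%C.
  by rewrite [Dir N.+1 _]/= -/(INR N.+1) RtoC_plus; ring.
have dd := IIdom_plus dB dB'.
split; first by eexists; apply: IIdom_ext E dd.
rewrite -(II_ext dd (fun y _ => E y)) (II_plus dB dB') IH IH'.
rewrite -addn1 iotaD big_cat /= add0n big_cons big_nil addn1 S_INR.
ring.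
Qed.

Let II_Fej (M : nat) : (exists B, IIdom (fun y => RtoC (FejS M y) * v y)%C B) /\
  II (fun y => RtoC (FejS M y) * v y)%C =
   \big[Cplus/RtoC 0]_(N <- iota 0 M.+1) II (fun y => RtoC (Dir N y) * v y)%C.
Proof.
elim: M => [|M [[B dB] IH]].
  by split; [have [] := II_Dir 0 | rewrite big_cons big_nil Cplus_0_r].
have [[B' dB'] _] := II_Dir M.+1.
have E y : (RtoC (FejS M y) * v y + RtoC (Dir M.+1 y) * v y)%C = (RtoC (FejS M.+1 y) * v y)%C.
  by rewrite [FejS M.+1 _]/= -/(Dir M.+1 y) RtoC_plus; ring.
have dd := IIdom_plus dB dB'.
split; first by eexists; apply: IIdom_ext E dd.
rewrite -(II_ext dd (fun y _ => E y)) (II_plus dB dB') IH.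
by rewrite -(addn1 M.+1) iotaD big_cat /= add0n [X in _ = (_ + X)%C]big_cons big_nil Cplus_0_r.
Qed.

Let tnz : t <> 0%C.
Proof. move=> h; move: ht; rewrite h /=; lra. Qed.

Let PInz : RtoC PI <> 0%C.
Proof. by move=> h; have := PI_neq0; apply; case: h. Qed.

(** [gM_odd] with the frequency [lam]: the slowly decaying odd transform splits into a part to be
    summed geometrically and the Gaussian in -1/t that builds Phi. *)
Let Delta_eq s : 0 <= s -> Del s = (2 * mu8 * gM (RtoC PI * t) lam s - 2 * mu8 * gA t * qE (- / t) s)%C.
Proof.
move=> hs; have hp := PI_RGT_0.
have rp : 0 < Re (RtoC PI * t) by rewrite Re_PI_mul; nra.
have mc := mu8_conj; have mcs := mu8c_sq; have ci := Ci_sq.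
have inz := Ci_nz.
have E1 : (lm / (2 * a) = mu8 * (lam / (2 * (RtoC PI * t))))%C.
  transitivity (- / t)%C; first by rewrite /lm /a; field.
  transitivity (- ((mu8 * Cconj mu8) / t))%C; first by rewrite mc; field.
  by rewrite /lam; field.
have E2 : (lam * lam / (2 * (RtoC PI * t)) = - (2 * RtoC PI * Ci / t))%C.
  transitivity (2 * RtoC PI * (Cconj mu8 * Cconj mu8) / t)%C; first by rewrite /lam; field.
  by rewrite mcs; field.
have E3 : (lm * lm / (2 * a) = - (2 * RtoC PI * Ci / t))%C.
  by rewrite /lm /a; field.
rewrite /Del (gM_odd Rea0 rp E1 (etrans E3 (esym E2)) hs).
apply: (f_equal2 Cminus); [by [] | apply: (f_equal2 Cmult)].
  rewrite /gM /gA; apply: (f_equal2 Cmult); first by [].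
  by congr (II (gexp _ _)); ring.
rewrite E2 /qE; congr Cexp; field => //.
Qed.

(** The Dirichlet integrals are computed exactly and converge to the right-hand side, hence so do
    their Cesaro means. Those means are Fejer integrals, which converge to [S]. *)
Lemma core_identity (S P : C) :
  filterlim (fun n => \big[Cplus/RtoC 0]_(k <- iota 0 n)
     (qE t (INR k + 1) * (Cexp (2 * RtoC PI * Ci * RtoC ((INR k + 1) * al)) - Cexp (- (2 * RtoC PI * Ci * RtoC ((INR k + 1) * al)))))%C : CV)
     eventually (locally (S : CV)) ->
  filterlim (fun n => \big[Cplus/RtoC 0]_(k <- iota 0 n)
     (qE (- / t) (INR k + al) - qE (- / t) (INR k + 1 - al))%C : CV)
     eventually (locally (P : CV)) ->
  S = (2 * mu8 * gB al t - 2 * mu8 * gA t * P)%C.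
Proof.
move=> hS hP; have hp := PI_RGT_0.
have rp : 0 < Re (RtoC PI * t) by rewrite Re_PI_mul; nra.
pose R0 := (2 * mu8 * gB al t - 2 * mu8 * gA t * P)%C.
pose I N := II (fun y => RtoC (Dir N y) * v y)%C.
(* Three remainders go to 0: the tail of the geometric series, the unpaired transform at frequency N
   + al, and its Gaussian. *)
have limI : filterlim (I : nat -> CV) eventually (locally (R0 : CV)).
  have h1 := filterlim0_rate (fun n => gB_tail n ha ht).
  have h2 : filterlim (fun n => gM (RtoC PI * t) lam (INR n + al) : CV) eventually (locally (RtoC 0 : CV)).
    apply: (@filterlim0_rate _ (exp (1 / (4 * Re (RtoC PI * t))))) => n.
    have hn := pos_INR n; have n1 : 0 <= INR n + al by lra.
    apply: Rle_trans (gM_lam_rate ht n1) _.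
    apply: Rmult_le_compat_l; first by left; exact: exp_pos.
    apply: Rinv_le_contravar; lra.
  have h3 : filterlim (fun n => qE (- / t) (INR n + al) : CV) eventually (locally (RtoC 0 : CV)).
    have [c hc] := qE_rate (Im_Cinv_opp hi) (proj1 ha).
    exact: filterlim0_rate hc.
  have EQ n : ((2 * mu8 * gB al t +
     (-2 * mu8) * II (fun y => kern al y * Cpow (Cexp (RtoC y * lam)) n * gexp (RtoC PI * t) 0 y)) +
     ((-2 * mu8 * gA t) * \big[Cplus/RtoC 0]_(k <- iota 0 n) (qE (- / t) (INR k + al)%coqR - qE (- / t) (INR k + 1 - al)%coqR) +
     (2 * mu8 * gM (RtoC PI * t) lam (INR n + al)%coqR + (-2 * mu8 * gA t) * qE (- / t) (INR n + al)%coqR)))%C = I n.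
    rewrite /I (proj2 (II_Dir n)) Delta_eq; last by have := pos_INR n; lra.
    have -> : \big[Cplus/RtoC 0]_(k <- iota 0 n) (Del (INR k + al) - Del (INR k + 1 - al)%coqR)%C =
       (2 * mu8 * (gB al t - II (fun y => kern al y * Cpow (Cexp (RtoC y * lam)) n * gexp (RtoC PI * t) 0 y)) +
       (-2 * mu8 * gA t) * \big[Cplus/RtoC 0]_(k <- iota 0 n) (qE (- / t) (INR k + al)%coqR - qE (- / t) (INR k + 1 - al)%coqR))%C.
      rewrite -(gK_telescope n ha ht) -!bigC_scal -big_split /=.
      apply: eq_bigr => k _; have hk := pos_INR k.
      rewrite !Delta_eq; [ring | lra | lra].
    move: (II _) (\big[_/_]_(_ <- _) _) => x1 x2; ring.
  have -> : R0 = ((2 * mu8 * gB al t + (-2 * mu8) * 0) + ((-2 * mu8 * gA t) * P + (2 * mu8 * 0 + (-2 * mu8 * gA t) * 0)))%C.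
    rewrite /R0; ring.
  refine (filterlim_ext _ _ EQ _).
  refine (filterlim_Cplus _ _); refine (filterlim_Cplus _ _).
  - exact: filterlim_const.
  - exact: filterlim_Cscal h1.
  - exact: filterlim_Cscal hP.
  - refine (filterlim_Cplus _ _); exact: filterlim_Cscal.
have contv y : continuous (v : R -> CV) y.
  by apply: (continuous_minus (V := CV)); exact: gexp_continuous.
have modv y : 0 <= y -> Cmod (v y) <= 2 * exp (1 / (4 * Re a)) * exp (- y).
  move=> hy; apply: Rle_trans (Cmod_triangle _ _) _; rewrite Cmod_opp !Cmod_gexp !Relm.
  have := gauss_le 1 y Rea0; rewrite pow1 => H.
  have : exp (- Re a * y ^ 2 + 0 * y) <= exp (1 / (4 * Re a)) * exp (- y).
    rewrite -exp_plus; apply: exp_le; lra.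
  lra.
pose D := 2 * (2 * Cmod a + Cmod lm) * exp (2 ^ 2 / (4 * Re a)).
have D0 : 0 <= D.
  have := Cmod_ge_0 a; have := Cmod_ge_0 lm; have := exp_pos (2 ^ 2 / (4 * Re a)) => e h1 h2.
  by apply: Rmult_le_pos; lra.
pose dv y := ((RtoC (2 * y) * - a + RtoC al * lm) * gexp a (RtoC al * lm) y - (RtoC (2 * y) * - a + RtoC (- al) * lm) * gexp a (RtoC (- al) * lm) y)%C.
have dvd y : is_derive (v : R -> CV) y (dv y).
  by apply: (is_derive_minus (V := CV)); exact: gexp_derive.
have dvb y : 0 <= y -> Cmod (dv y) <= D * exp (- y).
  move=> hy.
  have aux (x : R) : Rabs x <= 1 -> Cmod ((RtoC (2 * y) * - a + RtoC x * lm) * gexp a (RtoC x * lm) y)%C <= (2 * Cmod a + Cmod lm) * exp (2 ^ 2 / (4 * Re a)) * exp (- y).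
    move=> hx; rewrite Cmod_mult Cmod_gexp Relm.
    have H := gauss_le 2 y Rea0.
    have h1 : Cmod (RtoC (2 * y) * - a + RtoC x * lm) <= (2 * Cmod a + Cmod lm) * exp y.
      apply: Rle_trans (Cmod_triangle _ _) _; rewrite (Cmod_mult (RtoC (2 * y))) (Cmod_mult (RtoC x)) Cmod_opp !Cmod_R (Rabs_pos_eq (2 * y)); last lra.
      have := le_exp_self y; have := exp_ineq1_le y; have := Cmod_ge_0 a; have := Cmod_ge_0 lm; have := Rabs_pos x => *.
      rewrite Rmult_plus_distr_r; apply: Rplus_le_compat; nra.
    have e1 := exp_pos (- Re a * y ^ 2 + 0 * y).
    apply: Rle_trans (Rmult_le_compat_r _ _ _ (Rlt_le _ _ e1) h1) _.
    rewrite !(Rmult_assoc (2 * Cmod a + Cmod lm)) -!exp_plus; apply: Rmult_le_compat_l.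
      by have := Cmod_ge_0 a; have := Cmod_ge_0 lm; lra.
    apply: exp_le; lra.
  apply: Rle_trans (Cmod_triangle _ _) _; rewrite Cmod_opp.
  have := aux al (ltac:(apply: Rabs_le; lra)); have := aux (- al) (ltac:(apply: Rabs_le; lra)).
  rewrite /D; lra.
have lip (k : nat) x y : INR k <= x -> INR k <= y -> Cmod (v y - v x) <= 2 * D * exp (- INR k) * Rabs (y - x).
  move=> hx hy; rewrite (Rmult_assoc 2).
  apply: (@Cbounded_variation v dv) => s hs; split=> //.
  have hk := pos_INR k.
  have hs2 : INR k <= s by apply: Rle_trans (proj1 hs); apply: Rmin_glb.
  apply: Rle_trans (dvb s _) _; first lra.
  by apply: Rmult_le_compat_l => //; apply: exp_le; lra.
have v0 : v 0 = 0%C.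
  rewrite /v /gexp; have -> : 0 ^ 2 = 0 by ring.
  by rewrite !Cmult_0_l; ring.
have vS k : v (INR k + 1) = (qE t (INR k + 1)%coqR * (Cexp (2 * RtoC PI * Ci * RtoC ((INR k + 1) * al)%coqR) - Cexp (- (2 * RtoC PI * Ci * RtoC ((INR k + 1) * al)%coqR))))%C.
  rewrite /v !gexp_osc /lm.
  have -> : (RtoC (al * (INR k + 1)) * (2 * RtoC PI * Ci) = 2 * RtoC PI * Ci * RtoC ((INR k + 1) * al)%coqR)%C.
    by rewrite !RtoC_mult; ring.
  have -> : (RtoC (- al * (INR k + 1)) * (2 * RtoC PI * Ci) = - (2 * RtoC PI * Ci * RtoC ((INR k + 1) * al)%coqR))%C.
    by rewrite !RtoC_mult RtoC_opp; ring.
  ring.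
have limv : filterlim (fun n => (/ 2 * \big[Cplus/RtoC 0]_(k <- iota 0 n) (v (INR k) + v (INR k + 1)%coqR))%C : CV) eventually (locally (S : CV)).
  have h0 : filterlim (fun n => v (INR n) : CV) eventually (locally (RtoC 0 : CV)).
    apply: (@filterlim0_rate _ (2 * exp (1 / (4 * Re a)))) => n.
    apply: Rle_trans (modv _ (pos_INR n)) _; apply: Rmult_le_compat_l.
      by have := exp_pos (1 / (4 * Re a)); lra.
    rewrite exp_Ropp; apply: Rinv_le_contravar; first by have := pos_INR n; lra.
    have := exp_ineq1_le (INR n); lra.
  (* The Fejer estimate yields trapezoidal sums; since [v] vanishes at 0 they differ from the sum of
     [v] over 1, ..., n by half of [v n] only. *)
  have EQ n : (\big[Cplus/RtoC 0]_(k <- iota 0 n) v (INR k + 1)%coqR + (- / 2) * v (INR n))%C =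
     (/ 2 * \big[Cplus/RtoC 0]_(k <- iota 0 n) (v (INR k) + v (INR k + 1)%coqR))%C.
    elim: n => [|n IH]; first by rewrite !big_nil v0; ring.
    rewrite -addn1 iotaD !big_cat /= add0n !big_cons !big_nil !Cplus_0_r Cmult_plus_distr_l -IH addn1 S_INR.
    set X := \big[_/_]_(_ <- _) _; field.
  have -> : S = (S + (- / 2) * 0)%C by ring.
  refine (filterlim_ext _ _ EQ _); refine (filterlim_Cplus _ _); last exact: filterlim_Cscal.
  refine (filterlim_ext _ _ _ hS) => n; by apply: eq_bigr => k _; rewrite vS.
symmetry; apply: Ceq_arch => eps heps.
have he4 : 0 < eps / 4 by lra.
have [N1 H1] := cesaro limI he4.
pose L := 2 * D; have L0 : 0 <= L by rewrite /L; lra.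
(* Chosen so that 4 L eta <= eps/4. With [eta] fixed, [M] is then taken so large that 4 L/eta <=
   (eps/4)(M + 1). *)
pose eta := eps / (16 * (L + 1)).
have eta0 : 0 < eta by apply: Rdiv_lt_0_compat; lra.
have [N2 hN2] := INR_unbounded (4 * L / (eta * (eps / 4))).
pose M := (N1 + N2)%N.
have H2 := H1 M (ltac:(rewrite /M; lia)).
have lip1 (k : nat) x : 0 <= x <= / 2 -> Cmod (v (INR k + x) - v (INR k)) <= L * exp (- INR k) * x.
  move=> hx; have := lip k (INR k) (INR k + x) (ltac:(lra)) (ltac:(lra)).
  by have -> : INR k + x - INR k = x by [ring]; rewrite Rabs_pos_eq //; lra.
have lip2 (k : nat) x : 0 <= x <= / 2 -> Cmod (v (INR k + 1 - x) - v (INR k + 1)) <= L * exp (- INR k) * x.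
  move=> hx; have := lip k (INR k + 1) (INR k + 1 - x) (ltac:(lra)) (ltac:(lra)).
  by have -> : INR k + 1 - x - (INR k + 1) = - x by [ring]; rewrite Rabs_Ropp Rabs_pos_eq //; lra.
have H3 := fejer_II M eta0 L0 contv modv lip1 lip2 limv.
rewrite (proj2 (II_Fej M)) -S_INR in H3.
rewrite -/(I) in H2 *.
have m0 : 0 < INR M.+1 by apply: lt_0_INR; lia.
have H4 : Cmod (RtoC (INR M.+1) * R0 - RtoC (INR M.+1) * S) <= eps * INR M.+1.
  set X := \big[_/_]_(_ <- _) _ in H2 H3.
  apply: Rle_trans (Cmod_le_dist _ X _) _; rewrite (Cmod_switch _ X).
  apply: Rle_trans (Rplus_le_compat _ _ _ _ H2 H3) _.
  have q1 : 4 * L * / eta <= eps / 4 * INR M.+1.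
    have hM : INR N2 <= INR M.+1 by apply: le_INR; rewrite /M; lia.
    have : 4 * L / (eta * (eps / 4)) * (eps / 4) <= INR M.+1 * (eps / 4).
      by apply: Rmult_le_compat_r; lra.
    have -> : 4 * L / (eta * (eps / 4)) * (eps / 4) = 4 * L * / eta by field; lra.
    lra.
  have q2 : 4 * L * eta <= eps / 4.
    rewrite /eta; have -> : 4 * L * (eps / (16 * (L + 1))) = eps / 4 * (L / (L + 1)) by field; lra.
    rewrite -[X in _ <= X]Rmult_1_r; apply: Rmult_le_compat_l; first lra.
    apply: (Rmult_le_reg_r (L + 1)); first lra.
    by rewrite /Rdiv Rmult_assoc Rinv_l; lra.
  rewrite S_INR in q1 m0 *; set m := INR M + 1 in q1 m0 *.
  have -> : 4 * L * (m * eta + / eta) = 4 * L * eta * m + 4 * L * / eta by ring.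
  have : 4 * L * eta * m <= eps / 4 * m by apply: Rmult_le_compat_r; lra.
  have : 0 < eps * m by apply: Rmult_lt_0_compat.
  lra.
have E : (RtoC (INR M.+1) * R0 - RtoC (INR M.+1) * S = RtoC (INR M.+1) * (R0 - S))%C by ring.
rewrite E Cmod_mult Cmod_R Rabs_pos_eq in H4; last lra.
apply: (Rmult_le_reg_l (INR M.+1)) => //; rewrite -/R0; lra.
Qed.
End Core.

(** * Gaussian integrals against a kernel, as functions of t *)

Definition GK (k : R -> C) (t : C) : C := II (fun y => k y * gexp (RtoC PI * t) 0 y)%C.

Definition kbounded (A b : R) (k : R -> C) :=
  [/\ 0 <= A, forall y, 0 < y -> continuous (k : R -> CV) y & forall y, 0 < y -> Cmod (k y) <= A * exp (b * y)].

Lemma kbounded_kern al : 0 < al < 1 -> kbounded 8 0 (kern al).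
Proof.
move=> ha; split=> [|y hy|y hy]; [lra | exact: kern_continuous |].
by rewrite Rmult_0_l exp_0 Rmult_1_r; exact: kern_bound.
Qed.

Lemma kbounded_1 : kbounded 1 0 (fun=> RtoC 1).
Proof.
split=> [|y _|y _]; [lra | exact: continuous_const |].
by rewrite Rmult_0_l exp_0 Cmod_1; lra.
Qed.

Lemma GK_dom A b k t : kbounded A b k -> 0 < Re t ->
  IIdom (fun y => k y * gexp (RtoC PI * t) 0 y)%C (A * exp ((b + Re 0 + 1) ^ 2 / (4 * Re (RtoC PI * t)))).
Proof.
move=> [A0 kc kb] ht; have hp := PI_RGT_0.
by apply: IIdom_gauss => //; rewrite Re_PI_mul; nra.
Qed.

Lemma gA_GK t : 0 < Re t -> gA t = GK (fun=> RtoC 1) t.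
Proof.
move=> ht; symmetry; apply: (II_ext (GK_dom kbounded_1 ht)) => y _; by rewrite Cmult_1_l.
Qed.

Lemma gexp_R (T y : R) : gexp (RtoC PI * RtoC T) 0 y = RtoC (exp (- (PI * T) * y ^ 2)).
Proof.
rewrite /gexp -Cexp_R; congr Cexp.
move: (y ^ 2) => z.
by rewrite (RtoC_mult (- (PI * T))) RtoC_opp (RtoC_mult PI); ring.
Qed.

Lemma GK_lip A b k (T : R) : kbounded A b k -> 0 < T -> exists c, forall t : C,
  Cmod (t - RtoC T) <= T / 2 -> Cmod (GK k t - GK k (RtoC T)) <= c * Cmod (t - RtoC T).
Proof.
move=> hk hT; have hp := PI_RGT_0; have [A0 kc kb] := hk.
have hpT : 0 < PI * T / 2 by apply: Rdiv_lt_0_compat; nra.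
exists (8 * A * PI * exp ((b + 2) ^ 2 / (4 * (PI * T / 2)))) => t htT.
have rt : 0 < Re t.
  have h := re_le_Cmod (t - RtoC T)%C; rewrite Re_minus re_RtoC in h.
  have := Rle_abs (- (Re t - T)); rewrite Rabs_Ropp; lra.
have rT : 0 < Re (RtoC T) by [].
have d1 := GK_dom hk rt; have d2 := GK_dom hk rT.
apply: (II_diff_le d1 d2) => y hy.
have -> : (k y * gexp (RtoC PI * t) 0 y - k y * gexp (RtoC PI * RtoC T) 0 y =
  k y * (gexp (RtoC PI * RtoC T) 0 y * (Cexp (RtoC (y ^ 2) * - (RtoC PI * (t - RtoC T))) - 1)))%C.
  have -> : gexp (RtoC PI * t) 0 y = (gexp (RtoC PI * RtoC T) 0 y * Cexp (RtoC (y ^ 2) * - (RtoC PI * (t - RtoC T))))%C.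
    by rewrite /gexp -Cexp_add; congr Cexp; ring.
  ring.
rewrite Cmod_mult (Cmod_mult (gexp _ _ _)) Cmod_gexp.
set u := (RtoC (y ^ 2) * _)%C.
have T1 := Cexp_taylor1 u.
have eu : Cmod u = y ^ 2 * (PI * Cmod (t - RtoC T)).
  by rewrite /u (Cmod_mult (RtoC _)) Cmod_opp (Cmod_mult (RtoC PI)) !Cmod_R !Rabs_pos_eq //; [lra | exact: pow2_ge_0].
set d := Cmod (t - RtoC T) in htT eu *.
have d0 : 0 <= d by exact: Cmod_ge_0.
have y2 := pow2_ge_0 y.
have e1 : Cmod u <= PI * T / 2 * y ^ 2.
  rewrite eu Rmult_comm; apply: Rmult_le_compat_r => //.
  by have -> : PI * T / 2 = PI * (T / 2) by [field]; apply: Rmult_le_compat_l => //; lra.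
have -> : - Re (RtoC PI * RtoC T) * y ^ 2 + Re 0 * y = - (PI * T) * y ^ 2 by rewrite Re_PI_mul /=; ring.
have kb' := kb y hy; have kb0 := Cmod_ge_0 (k y).
have m0 : Cmod (Cexp u - 1) <= 2 * (4 * exp y * (PI * d)) * exp (PI * T / 2 * y ^ 2).
  apply: Rle_trans T1 _; apply: Rmult_le_compat; [have := Cmod_ge_0 u; lra | left; exact: exp_pos | | exact: exp_le].
  apply: Rmult_le_compat_l; first lra.
  by rewrite eu; apply: Rmult_le_compat_r; [nra | apply: sq_le_exp; lra].
have g0 := exp_pos (- (PI * T) * y ^ 2).
apply: Rle_trans (_ : A * exp (b * y) * (exp (- (PI * T) * y ^ 2) * (2 * (4 * exp y * (PI * d)) * exp (PI * T / 2 * y ^ 2))) <= _).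
  apply: Rmult_le_compat => //; last by apply: Rmult_le_compat_l => //; lra.
  apply: Rmult_le_pos; [lra | exact: Cmod_ge_0].
have -> : A * exp (b * y) * (exp (- (PI * T) * y ^ 2) * (2 * (4 * exp y * (PI * d)) * exp (PI * T / 2 * y ^ 2))) =
  8 * A * PI * d * (exp (- (PI * T) * y ^ 2) * exp (b * y) * exp y * exp (PI * T / 2 * y ^ 2)) by ring.
set q := _ / (4 * _).
have -> : 8 * A * PI * exp q * d * exp (- y) = 8 * A * PI * d * (exp q * exp (- y)) by ring.
apply: Rmult_le_compat_l; first by apply: Rmult_le_pos => //; apply: Rmult_le_pos; lra.
rewrite -!exp_plus; apply: exp_le; have := gauss_le (b + 2) y hpT; rewrite -/q; lra.
Qed.

Lemma sum_SnR (a : nat -> R) n : sum_n a n.+1 = sum_n a n + a n.+1.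
Proof. exact: sum_Sn. Qed.

Lemma exp_psum_le v n : 0 <= v -> sum_n (fun j => v ^ j / INR (Factorial.fact j)) n <= exp v.
Proof.
move=> hv; have h := is_exp_Reals v.
have {}h : is_lim_seq (sum_n (fun j => v ^ j / INR (Factorial.fact j))) (exp v).
  move: h; rewrite /is_pseries => h; apply: (filterlim_ext _ _ _ h) => m.
  by apply: sum_n_ext => j; rewrite pow_n_pow /scal /= /mult /=.
apply: (is_lim_seq_incr_compare _ _ h) => m; rewrite sum_SnR.
have : 0 <= v ^ m.+1 / INR (Factorial.fact m.+1).
  by apply: Rmult_le_pos; [exact: pow_le | left; apply: Rinv_0_lt_compat; exact: INR_fact_lt_0].
lra.
Qed.

(** Term by term, |u|^j is at most 2^-j v^j, so the tail after n is at most 2^-n times that of the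
    series of exp v. *)
Lemma exp_remainder u v n : Rabs u <= v / 2 ->
  Rabs (exp u - sum_n (fun j => u ^ j / INR (Factorial.fact j)) n) <= (/ 2) ^ n * exp v.
Proof.
move=> huv; have hv : 0 <= v by have := Rabs_pos u; lra.
pose S x := sum_n (fun j => x ^ j / INR (Factorial.fact j)).
have h : is_lim_seq (S u) (exp u).
  have := is_exp_Reals u; rewrite /is_pseries => h; apply: (filterlim_ext _ _ _ h) => m.
  by apply: sum_n_ext => j; rewrite pow_n_pow /scal /= /mult /=.
have D m : Rabs (S u (n + m)%N - S u n) <= (/ 2) ^ n * (S v (n + m)%N - S v n).
  elim: m => [|m IH]; first by rewrite addn0 !Rminus_diag Rabs_R0 Rmult_0_r; lra.
  rewrite addnS /S !sum_SnR -/(S u) -/(S v).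
  set a := u ^ _ / _; set b := v ^ _ / _.
  have hab : Rabs a <= (/ 2) ^ n * b.
    rewrite /a /b /Rdiv Rabs_mult -RPow_abs -Rmult_assoc Rabs_inv (Rabs_pos_eq (INR _)); last exact: pos_INR.
    apply: Rmult_le_compat_r; first by left; apply: Rinv_0_lt_compat; exact: INR_fact_lt_0.
    apply: Rle_trans (_ : (v / 2) ^ (n + m).+1 <= _); first by apply: pow_incr; split=> //; exact: Rabs_pos.
    have -> : v / 2 = / 2 * v by field.
    rewrite Rpow_mult_distr; apply: Rmult_le_compat_r; first exact: pow_le.
    have -> : (n + m).+1 = (n + m.+1)%coq_nat by lia.
    rewrite pow_add -[X in _ <= X]Rmult_1_r; apply: Rmult_le_compat_l; first by apply: pow_le; lra.
    by rewrite -(pow1 m.+1); apply: pow_incr; lra.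
  have -> : S u (n + m)%N + a - S u n = (S u (n + m)%N - S u n) + a by ring.
  apply: Rle_trans (Rabs_triang _ _) _; lra.
have D2 m : Rabs (S u (n + m)%N - S u n) <= (/ 2) ^ n * exp v.
  apply: Rle_trans (D m) _; apply: Rmult_le_compat_l; first by apply: pow_le; lra.
  have := exp_psum_le (n + m)%N hv; rewrite -/(S v _).
  have : 0 <= S v n.
    rewrite /S; elim: (n) => [|k IH]; first by rewrite sum_O /=; lra.
    rewrite sum_SnR.
    have : 0 <= v ^ k.+1 / INR (Factorial.fact k.+1).
      by apply: Rmult_le_pos; [exact: pow_le | left; apply: Rinv_0_lt_compat; exact: INR_fact_lt_0].
    lra.
  lra.
apply: le_epsilon => eps he.
move/is_lim_seq_spec: h => /(_ (mkposreal _ he)) [N hN].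
have := hN (n + N)%N (ltac:(lia)); have := D2 N; rewrite /= -/(S u) => h1 h2.
have -> : exp u - S u n = (S u (n + N)%N - S u n) - (S u (n + N)%N - exp u) by ring.
apply: Rle_trans (Rabs_triang _ _) _; rewrite Rabs_Ropp; lra.
Qed.

(** Expand exp(-pi (T - T0) y^2) in powers of T - T0 under the integral. Within a quarter of [T0]
    the remainder after n terms is at most 2^-n exp(pi T0 y^2/2), which costs half of the Gaussian
    at [T0]. *)
Lemma GK_analytic A b k (T0 : R) : kbounded A b k -> 0 < T0 -> exists a : nat -> C, forall T : R,
  Rabs (T - T0) < T0 / 4 ->
  is_pseries (K := R_AbsRing) (V := C_R_NormedModule) a (T - T0) (GK k (RtoC T)).
Proof.
move=> hk hT; have hp := PI_RGT_0; have [A0 kc kb] := hk.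
have pT : 0 < PI * T0 by nra.
pose f j y := (k y * RtoC ((- PI * y ^ 2) ^ j / INR (Factorial.fact j)) * gexp (RtoC PI * RtoC T0) 0 y)%C.
have pjc j y : continuous (fun y => RtoC ((- PI * y ^ 2) ^ j / INR (Factorial.fact j)) : CV) y.
  apply: continuous_RtoC; apply: (ex_derive_continuous (V := R_NormedModule)); by auto_derive.
have c8 : 0 < PI * T0 / 8 by apply: Rdiv_lt_0_compat; lra.
have c4 : 0 < PI * T0 / 4 by apply: Rdiv_lt_0_compat; lra.
(* An eighth of the Gaussian at [T0] pays for each Taylor monomial, so every coefficient is a
   convergent integral. *)
have mon j y : 0 <= y -> Rabs ((- PI * y ^ 2) ^ j / INR (Factorial.fact j)) <= (8 / T0) ^ j * exp (PI * T0 / 8 * y ^ 2).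
  move=> hy; have y2 := pow2_ge_0 y.
  have -> : - PI * y ^ 2 = - (8 / T0 * (PI * T0 / 8 * y ^ 2)) by field; lra.
  set w := PI * T0 / 8 * y ^ 2; have w0 : 0 <= w by rewrite /w; nra.
  have q0 : 0 < 8 / T0 by apply: Rdiv_lt_0_compat; lra.
  rewrite /Rdiv Rabs_mult -RPow_abs Rabs_Ropp (Rabs_pos_eq (8 * / T0 * w)); last by apply: Rmult_le_pos; lra.
  rewrite Rabs_inv (Rabs_pos_eq (INR _)); last exact: pos_INR.
  rewrite Rpow_mult_distr Rmult_assoc; apply: Rmult_le_compat_l; first by apply: pow_le; lra.
  apply: Rle_trans (exp_psum_le j w0).
  case: j => [|j]; first by rewrite sum_O; apply: Rle_refl.
  rewrite sum_SnR; set S := sum_n _ _; suff : 0 <= S by rewrite /Rdiv; lra.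
  rewrite /S; elim: (j) => [|i IH]; first by rewrite sum_O /=; lra.
  rewrite sum_SnR.
  have : 0 <= w ^ i.+1 / INR (Factorial.fact i.+1).
    by apply: Rmult_le_pos; [exact: pow_le | left; apply: Rinv_0_lt_compat; exact: INR_fact_lt_0].
  lra.
have fdom j : exists B, IIdom (f j) B.
  have q0 : 0 < 8 / T0 by apply: Rdiv_lt_0_compat; lra.
  exists (A * (8 / T0) ^ j * exp ((b + 1) ^ 2 / (4 * (PI * T0 * 7 / 8)))) => y hy; split.
    by apply: continuous_Cmult; [apply: continuous_Cmult; [exact: kc | exact: pjc] | exact: gexp_continuous].
  rewrite /f gexp_R Cmod_mult (Cmod_mult (k y)) !Cmod_R (Rabs_pos_eq (exp _)); last by left; exact: exp_pos.
  have m := mon j y (Rlt_le _ _ hy); have kb' := kb y hy.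
  have e0 := exp_pos (- (PI * T0) * y ^ 2).
  apply: Rle_trans (_ : A * exp (b * y) * ((8 / T0) ^ j * exp (PI * T0 / 8 * y ^ 2)) * exp (- (PI * T0) * y ^ 2) <= _).
    apply: Rmult_le_compat_r; first lra; apply: Rmult_le_compat => //; [exact: Cmod_ge_0 | exact: Rabs_pos].
  set q := _ / (4 * _); set z := (8 / T0) ^ j.
  have z0 : 0 <= z by apply: pow_le; lra.
  have -> : A * exp (b * y) * (z * exp (PI * T0 / 8 * y ^ 2)) * exp (- (PI * T0) * y ^ 2) = A * z * (exp (b * y) * exp (PI * T0 / 8 * y ^ 2) * exp (- (PI * T0) * y ^ 2)) by ring.
  rewrite (Rmult_assoc (A * z)); apply: Rmult_le_compat_l; first exact: Rmult_le_pos.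
  rewrite -!exp_plus; apply: exp_le.
  have c7 : 0 < PI * T0 * 7 / 8 by apply: Rdiv_lt_0_compat; lra.
  have := gauss_le (b + 1) y c7; rewrite -/q; lra.
exists (fun j => II (f j)) => T hT'.
have rT : 0 < Re (RtoC T) by rewrite re_RtoC; have := Rle_abs (- (T - T0)); rewrite Rabs_Ropp; lra.
have dT := GK_dom hk rT.
pose eS y n := sum_n (fun j => (- PI * (T - T0) * y ^ 2) ^ j / INR (Factorial.fact j)) n.
pose g n y := (k y * RtoC (eS y n) * gexp (RtoC PI * RtoC T0) 0 y)%C.
have gS n y : g n.+1 y = (g n y + RtoC ((T - T0) ^ n.+1) * f n.+1 y)%C.
  rewrite /g /f /eS sum_SnR RtoC_plus.
  have -> : - PI * (T - T0) * y ^ 2 = (T - T0) * (- PI * y ^ 2) by ring.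
  rewrite Rpow_mult_distr /Rdiv Rmult_assoc (RtoC_mult ((T - T0) ^ n.+1)); ring.
have gI n : (exists B, IIdom (g n) B) /\ II (g n) = sum_n (fun j => scal (pow_n (T - T0) j) (II (f j) : C_R_NormedModule)) n.
  elim: n => [|n [[B dB] IH]].
    have [B dB] := fdom 0%N.
    have E y : f 0%N y = g 0%N y by rewrite /g /f /eS sum_O /=.
    split; first by exists B; apply: IIdom_ext E dB.
    by rewrite -(II_ext dB (fun y _ => E y)) sum_O pow_n_pow /= scal_one.
  have [B' dB'] := fdom n.+1.
  have dd := IIdom_plus dB (IIdom_scal (RtoC ((T - T0) ^ n.+1)) dB').
  split; first by eexists; apply: IIdom_ext dd => y; rewrite gS.
  rewrite sum_Sn -IH -(II_ext dd (fun y _ => esym (gS n y))).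
  by rewrite (II_plus dB (IIdom_scal _ dB')) (II_scal _ dB') pow_n_pow [in RHS]scalCE.
rewrite /is_pseries.
have key n : Cmod (II (g n) - GK k (RtoC T)) <= A * exp ((b + 1) ^ 2 / (4 * (PI * T0 / 4))) * (/ 2) ^ n.
  have [[B dB] _] := gI n.
  apply: (II_diff_le dB dT) => y hy; have y2 := pow2_ge_0 y.
  rewrite /g /eS !gexp_R.
  set u := - PI * (T - T0) * y ^ 2.
  have -> : - (PI * T) * y ^ 2 = u + - (PI * T0) * y ^ 2 by rewrite /u; ring.
  rewrite exp_plus RtoC_mult.
  have hu : Rabs u <= PI * T0 / 2 * y ^ 2 / 2.
    rewrite /u (Rabs_mult (- PI * _)) (Rabs_mult (- PI)) Rabs_Ropp (Rabs_pos_eq PI) ?(Rabs_pos_eq (y ^ 2)) //; last lra.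
    have -> : PI * T0 / 2 * y ^ 2 / 2 = PI * (T0 / 4) * y ^ 2 by field.
    by apply: Rmult_le_compat_r => //; apply: Rmult_le_compat_l; lra.
  have := exp_remainder n hu.
  set S := sum_n _ _; set e0 := exp (- (PI * T0) * y ^ 2).
  have -> : (k y * RtoC S * RtoC e0 - k y * (RtoC (exp u) * RtoC e0) = - (k y * RtoC (exp u - S) * RtoC e0))%C.
    by rewrite RtoC_minus; ring.
  have e00 : 0 < e0 by exact: exp_pos.
  rewrite Cmod_opp Cmod_mult (Cmod_mult (k y)) !Cmod_R (Rabs_pos_eq e0); last lra.
  move=> R1; have kb' := kb y hy.
  apply: Rle_trans (_ : A * exp (b * y) * ((/ 2) ^ n * exp (PI * T0 / 2 * y ^ 2)) * e0 <= _).
    apply: Rmult_le_compat_r; first lra; apply: Rmult_le_compat => //; [exact: Cmod_ge_0 | exact: Rabs_pos].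
  rewrite /e0; set q := _ / (4 * _); set z := (/ 2) ^ n.
  have z0 : 0 <= z by apply: pow_le; lra.
  have -> : A * exp (b * y) * (z * exp (PI * T0 / 2 * y ^ 2)) * exp (- (PI * T0) * y ^ 2) = A * z * (exp (b * y) * exp (PI * T0 / 2 * y ^ 2) * exp (- (PI * T0) * y ^ 2)) by ring.
  have -> : A * exp q * z * exp (- y) = A * z * (exp q * exp (- y)) by ring.
  apply: Rmult_le_compat_l; first exact: Rmult_le_pos.
  rewrite -!exp_plus; apply: exp_le; have := gauss_le (b + 1) y c4; rewrite -/q.
  have : 0 <= PI * T0 / 4 * y ^ 2 by apply: Rmult_le_pos; lra.
  lra.
apply: (filterlim_ext (fun n => II (g n) : CV)); first by move=> n; rewrite (proj2 (gI n)).
apply/filterlimCP => eps he.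
pose K := A * exp ((b + 1) ^ 2 / (4 * (PI * T0 / 4))) + 1.
have K0 : 0 < K by have := exp_pos ((b + 1) ^ 2 / (4 * (PI * T0 / 4))); rewrite /K; nra.
have [N hN] := pow_lt_1_zero (/ 2) (ltac:(rewrite Rabs_pos_eq; lra)) (eps / K) (Rdiv_lt_0_compat _ _ he K0).
exists N => n hn; apply: Rle_lt_trans (key n) _.
apply: Rle_lt_trans (_ : K * (/ 2) ^ n < _).
  by apply: Rmult_le_compat_r; [apply: pow_le; lra | rewrite /K; lra].
have := hN n hn; rewrite Rabs_pos_eq; last by apply: pow_le; lra.
move=> h; have -> : eps = K * (eps / K) by field; lra.
exact: Rmult_lt_compat_l.
Qed.

Lemma II_cutoff f B a b : IIdom f B -> 0 < a -> a <= b ->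
  Cmod (II f - RInt (V := CV) f a b) <= B * (1 - exp (- a) + exp (- b)).
Proof.
move=> h ha hab; have B0 := IIdom_ge0 h; have hl := II_correct h.
apply: le_epsilon => eps he; have [N hN] := proj1 (@filterlimCP _ eventually _ _ _) hl eps he.
have [N1 h1] := INR_unbounded (/ a + b).
pose n := (N + N1)%N.
have {}hN := hN n (ltac:(rewrite /n; lia)).
have ia := Rinv_0_lt_compat _ ha.
have n1 : / a + b < INR n + 1.
  have : INR N1 <= INR n by apply: le_INR; rewrite /n; lia.
  lra.
have p := inv_Sn_pos n; set A := / (INR n + 1) in p hN; set B' := INR n + 1 in n1 hN.
have lA : A <= a by rewrite -(Rinv_inv a) /A; apply: Rinv_le_contravar => //; rewrite -/B'; lra.
have lB : b <= B' by lra.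
have pb : 0 < b by lra.
have pB' : 0 < B' by lra.
have E1 := RInt_Chasles (V := CV) f A a B' (IIdom_ex h p ha) (IIdom_ex h ha pB').
have E2 := RInt_Chasles (V := CV) f a b B' (IIdom_ex h ha pb) (IIdom_ex h pb pB').
have b1 := IIdom_bound h p lA; have b2 := IIdom_bound h pb lB.
rewrite -E1 -E2 in hN.
set X := RInt (V := CV) f A a in hN b1; set Y := RInt (V := CV) f a b in hN *; set Z := RInt (V := CV) f b B' in hN b2.
have {}hN : Cmod (X + (Y + Z) - II f) < eps by exact: hN.
have -> : (II f - Y = (X + Z) - (X + (Y + Z) - II f))%C by ring.
apply: Rle_trans (Cmod_triangle _ _) _; rewrite Cmod_opp.
have := Cmod_triangle X Z.
have := exp_opp_le1 (Rlt_le _ _ p); have := exp_pos (- B').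
move: b1 b2 hN; move: (exp (- A)) (exp (- B')) (exp (- a)) (exp (- b)) => x1 x2 x3 x4 *.
nra.
Qed.

Lemma gA_scale (T : R) : 0 < T -> gA (RtoC T) = (RtoC (/ sqrt T) * gA 1)%C.
Proof.
move=> hT; have hp := PI_RGT_0; have st := sqrt_lt_R0 _ hT.
have rT : 0 < Re (RtoC PI * RtoC T) by rewrite Re_PI_mul /=; nra.
have r1 : 0 < Re (RtoC PI * RtoC 1) by rewrite Re_PI_mul /=; nra.
have d1 := IIdom_gexp 0 r1; have dT := IIdom_gexp 0 rT.
(* The substitution y -> sqrt(T) y does not preserve the exhausting intervals, so the limit along
   the rescaled ones is established separately. *)
have lim : filterlim (fun n => (RtoC (/ sqrt T) * RInt (V := CV) (gexp (RtoC PI * RtoC 1) 0) (sqrt T * / (INR n + 1)) (sqrt T * (INR n + 1)))%C : CV) eventually (locally ((RtoC (/ sqrt T) * gA 1)%C : CV)).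
  refine (filterlim_Cscal _).
  apply/filterlimCP => eps he.
  set B := exp _ in d1; have B0 := exp_pos ((Re 0 + 1) ^ 2 / (4 * Re (RtoC PI * RtoC 1))).
  have l : is_lim_seq (fun n => B * (1 - exp (- (sqrt T * / (INR n + 1))) + / sqrt T * / (INR n + 1))) (B * (1 - exp (- (sqrt T * 0)) + / sqrt T * 0)).
    apply: (is_lim_seq_scal_l _ B (Rbar.Finite _)).
    apply: is_lim_seq_plus'; last by apply: (is_lim_seq_scal_l _ _ (Rbar.Finite 0)); exact: lim_inv_Sn.
    apply: is_lim_seq_minus'; first exact: is_lim_seq_const.
    apply: (is_lim_seq_continuous (fun x => exp (- (sqrt T * x)))); last exact: lim_inv_Sn.
    apply: (proj2 (continuity_pt_filterlim _ _)); refine (@ex_derive_continuous R_AbsRing R_NormedModule (fun x => exp (- (sqrt T * x))) 0 _); by auto_derive.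
  rewrite !Rmult_0_r Ropp_0 exp_0 Rminus_diag Rplus_0_r Rmult_0_r in l.
  move/is_lim_seq_spec: l => /(_ (mkposreal _ he)) [N hN].
  exists N => n hn; rewrite Cmod_switch.
  have hn0 := pos_INR n; have pn := inv_Sn_pos n.
  apply: Rle_lt_trans (II_cutoff d1 _ _) _.
  - nra.
  - by apply: Rmult_le_compat_l; [lra | exact: inv_Sn_le].
  have := hN n hn; rewrite Rminus_0_r /= => /(Rle_lt_trans _ _ _ (Rle_abs _)); apply: Rle_lt_trans.
  apply: Rmult_le_compat_l; first by left.
  apply: Rplus_le_compat_l; rewrite exp_Ropp -Rinv_mult; apply: Rinv_le_contravar; first nra.
  have := exp_ineq1_le (sqrt T * (INR n + 1)); lra.
apply: (filterlimC_unique (F := eventually) (f := fun n => RInt (V := CV) (gexp (RtoC PI * RtoC T) 0) (/ (INR n + 1)) (INR n + 1))).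
  exact: (II_correct dT).
refine (filterlim_ext _ _ _ lim) => n.
have hn0 := pos_INR n; have pn := inv_Sn_pos n.
have ex : ex_RInt (gexp (RtoC PI * RtoC 1) 0 : R -> CV) (sqrt T * / (INR n + 1) + 0) (sqrt T * (INR n + 1) + 0).
  apply: (ex_RInt_continuous (V := CV)) => z _; exact: gexp_continuous.
have := RInt_comp_lin (V := CV) _ (sqrt T) 0 _ _ ex; rewrite !Rplus_0_r => <-.
rewrite -RInt_Cscal; last first.
  apply: (ex_RInt_continuous (V := CV)) => z _.
  apply: (continuous_scal_r (V := CV)); apply: (continuous_comp (fun y => sqrt T * y + 0) (gexp (RtoC PI * RtoC 1) 0 : R -> CV)).
    apply: (ex_derive_continuous (V := R_NormedModule)); by auto_derive.
  exact: gexp_continuous.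
apply: (RInt_ext (V := CV)) => y _.
rewrite scalCE Cmult_assoc -RtoC_mult Rinv_l ?Cmult_1_l ?gexp_R; last lra.
congr (RtoC (exp _)); rewrite Rplus_0_r Rpow_mult_distr pow2_sqrt; [ring|lra].
Qed.

(** The integrand is real and positive, and at least exp(-4 pi) on [1, 2]; an integral over a large
    interval is thus bounded away from 0. *)
Lemma gA1_neq0 : gA 1 <> 0%C.
Proof.
move=> h; have hp := PI_RGT_0.
have r1 : 0 < Re (RtoC PI * RtoC 1) by rewrite Re_PI_mul /=; nra.
have d1 := IIdom_gexp 0 r1; have hl := II_correct d1.
have e0 := exp_pos (- (PI * 1) * 2 ^ 2); set e := exp _ in e0.
have [N hN] := proj1 (@filterlimCP _ eventually _ _ _) hl e e0.
have {}hN := hN N.+1 (ltac:(lia)); rewrite -/(gA 1) h in hN.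
set a := / _ in hN; set b := _ + 1 in hN.
have ha : 0 < a by exact: inv_Sn_pos.
have n0 := pos_INR N; have hb : 2 <= b by rewrite /b S_INR; lra.
have ha1 : a <= 1 by rewrite -[X in _ <= X]Rinv_1 /a; apply: Rinv_le_contravar; rewrite -/b; lra.
pose f y := exp (- (PI * 1) * y ^ 2).
have exf x y : ex_RInt f x y.
  apply: (ex_RInt_continuous (V := R_CompleteNormedModule)) => z _.
  apply: (ex_derive_continuous (V := R_NormedModule)); rewrite /f; by auto_derive.
have E : RInt (V := CV) (gexp (RtoC PI * RtoC 1) 0) a b = RtoC (RInt f a b).
  apply: (is_RInt_unique (V := CV)).
  apply: (is_RInt_ext (V := CV) (fun y => RtoC (f y))); first by move=> y _; rewrite gexp_R.
  apply: (is_RInt_fct_extend_pair (U := R_NormedModule) (V := R_NormedModule)) => /=.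
    exact: (RInt_correct (V := R_CompleteNormedModule)).
  have := is_RInt_const (V := R_NormedModule) a b 0; by rewrite /scal /= /mult /= Rmult_0_r.
have ge0 x y : x <= y -> 0 <= RInt f x y.
  by move=> hxy; apply: RInt_ge_0 => // z _; left; exact: exp_pos.
have C1 := RInt_Chasles (V := R_CompleteNormedModule) f a 1 b (exf _ _) (exf _ _).
have C2 := RInt_Chasles (V := R_CompleteNormedModule) f 1 2 b (exf _ _) (exf _ _).
have m : e * (2 - 1) <= RInt f 1 2.
  have -> : e * (2 - 1) = RInt (fun=> e) 1 2 by rewrite RInt_const /scal /= /mult /=; ring.
  apply: RInt_le => //; [lra | exact: ex_RInt_const |] => x hx.
  rewrite /e /f; apply: exp_le.
  have : x ^ 2 <= 2 ^ 2 by apply: pow_incr; lra.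
  nra.
rewrite E -C1 -C2 /plus /= in hN.
have g1 := ge0 a 1 ha1; have g2 := ge0 2 b hb.
move: hN; have -> (z : C) : (z - 0 = z)%C by ring.
rewrite Cmod_R => /(Rle_lt_trans _ _ _ (Rle_abs _)); lra.
Qed.

(** * Sums over the integers and the two sign conventions *)

Import GRing.Theory.

Definition zr (n : int) : R := (n%:~R)%R.

Lemma zrD m n : zr (m + n)%R = zr m + zr n.
Proof. by rewrite /zr intrD. Qed.
Lemma zrM m n : zr (m * n)%R = zr m * zr n.
Proof. by rewrite /zr intrM. Qed.
Lemma zrN n : zr (- n)%R = - zr n.
Proof. by rewrite /zr mulrNz. Qed.
Lemma zr_Posz k : zr (Posz k) = INR k.
Proof. by rewrite INRE. Qed.
Lemma zr_Negz k : zr (Negz k) = - (INR k + 1).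
Proof. by rewrite NegzE zrN zr_Posz S_INR. Qed.
Lemma zr_inj m n : zr m = zr n -> m = n.
Proof. by move=> h; apply: (@intr_inj R). Qed.

Definition sg (n : int) : R := match n with Posz 0%N => 0 | Posz _ => 1 | Negz _ => -1 end.
(** The sign of n + al for 0 < al < 1; hence the value 1 at n = 0, unlike [sg]. *)
Definition sgj (n : int) : R := match n with Posz _ => 1 | Negz _ => -1 end.

Lemma sg_opp n : sg (- n)%R = - sg n.
Proof. by case: n => [[|n]|n]; rewrite /sg ?oppr0 ?NegzE ?opprK //=; lra. Qed.

Lemma sg_bound n : Rabs (sg n) <= 1.
Proof. by case: n => [[|n]|n] /=; apply: Rabs_le; lra. Qed.

Lemma sgj_bound n : Rabs (sgj n) <= 1.
Proof. by case: n => n /=; apply: Rabs_le; lra. Qed.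

Definition TT {T : Type} : T -> Prop := fun=> True.

Definition int_box (M : nat) : seq int := map Posz (iota 0 M) ++ map Negz (iota 0 M).

Lemma int_box_mem M n : (match n with Posz k => k < M | Negz k => k < M end)%N -> n \in int_box M.
Proof.
case: n => k h; rewrite mem_cat; apply/orP; [left|right]; apply/mapP; exists k => //;
  by rewrite mem_iota.
Qed.

Lemma int_box_uniq M : uniq (int_box M).
Proof.
rewrite cat_uniq; apply/and3P; split.
- by rewrite map_inj_uniq ?iota_uniq // => x y [].
- by apply/hasPn => x /mapP [k _ ->]; apply/negP => /mapP [j _].
- by rewrite map_inj_uniq ?iota_uniq // => x y [].
Qed.

Lemma geom_exp_bound M : \big[Rplus/0]_(k <- iota 0 M) exp (- INR k) <= 2 * (1 - exp (- INR M)).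
Proof.
elim: M => [|M IH]; first by rewrite big_nil Ropp_0 exp_0; lra.
rewrite -addn1 iotaD big_cat /= add0n big_cons big_nil addn1 S_INR.
have : exp (- (INR M + 1)) <= / 2 * exp (- INR M).
  rewrite Ropp_plus_distr exp_plus Rmult_comm; apply: Rmult_le_compat_r; last exact: exp_m1_half.
  by left; exact: exp_pos.
lra.
Qed.

Lemma int_exp_bound s : uniq s -> \big[Rplus/0]_(n <- s) exp (- Rabs (zr n)) <= 4.
Proof.
move=> us.
have [M hM] : exists M, {subset s <= int_box M}.
  elim: s {us} => [|x s [M IH]]; first by exists 0%N.
  exists (maxn M (match x with Posz k => k.+1 | Negz k => k.+1 end)) => y.
  rewrite inE => /orP [/eqP ->|/IH]; first by apply: int_box_mem; case: x => k; lia.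
  rewrite mem_cat => /orP [] /mapP [k]; rewrite mem_iota add0n => /andP [_ h] ->; apply: int_box_mem; lia.
apply: Rle_trans (bigR_subset us (int_box_uniq M) hM (fun x => Rlt_le _ _ (exp_pos _))) _.
rewrite big_cat !big_map /=.
have h := geom_exp_bound M; have e0 := exp_pos (- INR M).
have h1 : \big[Rplus/0]_(k <- iota 0 M) exp (- Rabs (zr (Posz k))) <= \big[Rplus/0]_(k <- iota 0 M) exp (- INR k).
  by apply: bigR_le => k _; rewrite zr_Posz Rabs_pos_eq; [lra | exact: pos_INR].
have h2 : \big[Rplus/0]_(k <- iota 0 M) exp (- Rabs (zr (Negz k))) <= \big[Rplus/0]_(k <- iota 0 M) exp (- INR k).
  apply: bigR_le => k _; rewrite zr_Negz Rabs_Ropp Rabs_pos_eq; last by have := pos_INR k; lra.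
  apply: exp_le; lra.
lra.
Qed.

Lemma int_summable (f : int -> C) B : 0 <= B -> (forall n, Cmod (f n) <= B * exp (- Rabs (zr n))) -> summable TT f.
Proof.
move=> hB hf; exists (B * 4) => s us _.
apply: Rle_trans (_ : \big[Rplus/0]_(n <- s) (B * exp (- Rabs (zr n))) <= _); first by apply: bigR_le => n _.
by rewrite bigR_scal; apply: Rmult_le_compat_l => //; exact: int_exp_bound.
Qed.

Lemma is_sum_int_seq (f : int -> C) l : is_sum_over TT f l ->
  filterlim (fun n => \big[Cplus/RtoC 0]_(k <- iota 0 n) (f (Posz k) + f (Negz k))%C : CV) eventually (locally (l : CV)).
Proof.
move=> h.
have H := @is_sum_over_seq _ TT f l int_box h int_box_uniq (fun _ _ _ => Logic.I).
refine (filterlim_ext _ _ _ (H _)) => [n|x _].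
  by rewrite big_cat !big_map /= big_split.
exists (match x with Posz k => k.+1 | Negz k => k.+1 end) => n hn; apply: int_box_mem.
by case: x hn => k; lia.
Qed.

(** Here k + 1 is paired with -(k + 1), which suits the weight sgn(m); [is_sum_int_seq] pairs k with
    -(k + 1), which suits sgn(j + al). *)
Lemma is_sum_int_seq1 (f : int -> C) l : is_sum_over TT f l -> f (Posz 0) = 0%C ->
  filterlim (fun n => \big[Cplus/RtoC 0]_(k <- iota 0 n) (f (Posz k.+1) + f (Negz k))%C : CV) eventually (locally (l : CV)).
Proof.
move=> h f0.
pose bx n := map Posz (iota 0 n.+1) ++ map Negz (iota 0 n).
have ub n : uniq (bx n).
  rewrite cat_uniq; apply/and3P; split.
  - by rewrite map_inj_uniq ?iota_uniq // => x y [].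
  - by apply/hasPn => x /mapP [k _ ->]; apply/negP => /mapP [j _].
  - by rewrite map_inj_uniq ?iota_uniq // => x y [].
have H := @is_sum_over_seq _ TT f l bx h ub (fun _ _ _ => Logic.I).
refine (filterlim_ext _ _ _ (H _)) => [n|x _].
  have E : iota 0 n.+1 = 0%N :: map S (iota 0 n) by rewrite [LHS]/= (iotaDl 1 0).
  rewrite /bx E big_cat /= big_cons !big_map f0 Cplus_0_l.
  by rewrite -big_split.
exists (match x with Posz k => k.+1 | Negz k => k.+1 end) => n hn.
rewrite mem_cat; case: x hn => k hk; apply/orP; [left|right]; apply/mapP; exists k => //;
  rewrite mem_iota; lia.
Qed.

Definition cis2 (x : R) : C := Cexp (2 * RtoC PI * Ci * RtoC x).

Definition psiT (al : R) (t : C) (m : int) : C := (RtoC (sg m) * cis2 (zr m * al) * qE t (zr m))%C.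
Definition phiT (al : R) (t : C) (j : int) : C := (RtoC (sgj j) * qE t (zr j + al))%C.

Lemma cis2_opp x : cis2 (- x) = Cexp (- (2 * RtoC PI * Ci * RtoC x)).
Proof. by rewrite /cis2 RtoC_opp; congr Cexp; ring. Qed.

Lemma qE_opp t s : qE t (- s) = qE t s.
Proof. by rewrite /qE; have -> : (- s) ^ 2 = s ^ 2 by ring. Qed.

Lemma qE_conj t s : Cconj (qE t s) = qE (- Cconj t) s.
Proof.
rewrite /qE -Cexp_conj; congr Cexp; move: (s ^ 2) => z; case: t => x y; apply: Ceq => /=; ring.
Qed.

Lemma cis2_conj x : Cconj (cis2 x) = cis2 (- x).
Proof. by rewrite /cis2 -Cexp_conj; congr Cexp; apply: Ceq => /=; ring. Qed.

Lemma core_pos (t : C) (al : R) (S P : C) : 0 < Re t -> 0 < Im t -> 0 < al < 1 ->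
  is_sum_over TT (psiT al t) S -> is_sum_over TT (phiT al (- / t)) P ->
  S = (2 * mu8 * gB al t - 2 * mu8 * gA t * P)%C.
Proof.
move=> ht hi ha hS hP; apply: core_identity => //.
  have p0 : psiT al t (Posz 0) = 0%C by rewrite /psiT /=; ring.
  refine (filterlim_ext _ _ _ (is_sum_int_seq1 hS p0)) => n; apply: eq_bigr => k _.
  rewrite /psiT /= zr_Posz zr_Negz qE_opp S_INR.
  have -> : - (INR k + 1) * al = - ((INR k + 1) * al) by ring.
  rewrite cis2_opp /cis2; ring.
refine (filterlim_ext _ _ _ (is_sum_int_seq hP)) => n; apply: eq_bigr => k _.
rewrite /phiT /= zr_Posz zr_Negz.
have -> : - (INR k + 1) + al = - (INR k + 1 - al) by ring.
rewrite qE_opp; ring.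
Qed.

(** [kap] and [HB] are the factor of Phi and the error term; their values for Re t < 0 are dictated
    by the reflection t -> - conj t. *)
Definition kap (t : C) : C :=
  if Rlt_dec 0 (Re t) then (- (2 * mu8 * gA t))%C else (2 * Cconj (mu8 * gA (- Cconj t)))%C.
Definition HB (al : R) (t : C) : C :=
  if Rlt_dec 0 (Re t) then (2 * mu8 * gB al t)%C else (- (2 * Cconj (mu8 * gB al (- Cconj t))))%C.

(** Conjugation moves the nome from t to - conj t. Followed by m -> -m it changes the series Psi by
    a sign only, because [sg] is odd, and it merely conjugates Phi; so the case Re t < 0 is the
    conjugate of the other one. *)
Lemma core_both (t : C) (al : R) (S P : C) : Re t <> 0 -> 0 < Im t -> 0 < al < 1 ->
  is_sum_over TT (psiT al t) S -> is_sum_over TT (phiT al (- / t)) P ->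
  S = (kap t * P + HB al t)%C.
Proof.
move=> ht hi ha hS hP; rewrite /kap /HB; case: Rlt_dec => [h|h] /=.
  rewrite (core_pos h hi ha hS hP); ring.
pose t' := (- Cconj t)%C.
have rt : 0 < Re t' by rewrite /t' Re_opp re_conj; lra.
have it : 0 < Im t' by rewrite /t' Im_opp im_conj; lra.
have tnz : t <> 0%C by move=> e; move: hi; rewrite e /=; lra.
have cnz : Cconj t <> 0%C by move=> e; apply: tnz; rewrite -(Cconj_conj t) e; apply: Ceq => /=; lra.
have hS' : is_sum_over TT (psiT al t') (- Cconj S)%C.
  have h1 := is_sum_over_conj hS.
  have h2 : is_sum_over TT (fun m => Cconj (psiT al t m)) (Cconj S) by [].
  have h3 : is_sum_over TT (fun m : int => (- 1) * Cconj (psiT al t (- m)%R))%C ((-1) * Cconj S)%C.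
    apply: is_sum_over_scal.
    apply: (is_sum_over_reindex (h := fun m : int => (- m)%R) (P' := TT)) => //.
    - by move=> y y' _ _ /oppr_inj.
    - by move=> x _ _; exists (- x)%R => //; rewrite opprK.
    by apply: is_sum_over_ext h2 => m _; rewrite opprK.
  have -> : (- Cconj S = (-1) * Cconj S)%C by ring.
  apply: is_sum_over_ext h3 => m _.
  rewrite /psiT sg_opp zrN Cmult_conj (Cmult_conj (RtoC _)) cis2_conj qE_conj qE_opp.
  have -> : - (- zr m * al) = zr m * al by ring.
  have -> : Cconj (RtoC (- sg m)) = (- RtoC (sg m))%C by apply: Ceq => /=; ring.
  rewrite -/t'; ring.
have hP' : is_sum_over TT (phiT al (- / t')) (Cconj P).
  apply: is_sum_over_ext (is_sum_over_conj hP) => m _.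
  rewrite /phiT Cmult_conj qE_conj; congr Cmult; first by apply: Ceq => /=; ring.
  congr qE; rewrite /t' Copp_conj Cinv_conj //; field => //.
have E := core_pos rt it ha hS' hP'.
have {}E : Cconj S = (2 * mu8 * gA t' * Cconj P - 2 * mu8 * gB al t')%C.
  have -> : (Cconj S = - - Cconj S)%C by ring.
  by rewrite E; ring.
transitivity (Cconj (2 * mu8 * gA t' * Cconj P - 2 * mu8 * gB al t'))%C; first by rewrite -E Cconj_conj.
have X (a b m p : C) : (Cconj (2 * m * a * Cconj p - 2 * m * b) = 2 * Cconj (m * a) * p + - (2 * Cconj (m * b)))%C.
  by apply: Ceq => /=; ring.
exact: X.
Qed.

(** * Boundary limits *)

(** The factor (1 + h)/h dominates 1/(1 - exp(-h)); its growth like 1/h counts the terms that matter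
    at scale h. *)
Lemma geomh_bound h M : 0 < h -> \big[Rplus/0]_(k <- iota 0 M) exp (- (h * INR k)) <= (1 + h) / h * (1 - exp (- (h * INR M))).
Proof.
move=> hh; elim: M => [|M IH]; first by rewrite big_nil Rmult_0_r Ropp_0 exp_0 Rminus_diag Rmult_0_r; lra.
rewrite -addn1 iotaD big_cat /= add0n big_cons big_nil addn1 S_INR.
have e1 : exp (- (h * (INR M + 1))) <= exp (- (h * INR M)) * / (1 + h).
  have -> : - (h * (INR M + 1)) = - (h * INR M) + - h by ring.
  rewrite exp_plus; apply: Rmult_le_compat_l; first by left; exact: exp_pos.
  rewrite exp_Ropp; apply: Rinv_le_contravar; [lra | exact: exp_ineq1_le].
have q0 : 0 < (1 + h) / h by apply: Rdiv_lt_0_compat; lra.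
have : exp (- (h * INR M)) <= (1 + h) / h * (exp (- (h * INR M)) - exp (- (h * (INR M + 1)))).
  set x := exp (- (h * INR M)) in e1 *.
  have -> : x = (1 + h) / h * (x - x * / (1 + h)) by field; lra.
  apply: Rmult_le_compat_l; first lra.
  have -> : (1 + h) / h * (x - x * / (1 + h)) = x by field; lra.
  lra.
lra.
Qed.

Lemma int_exp_bound_h h s : 0 < h -> uniq s -> \big[Rplus/0]_(n <- s) exp (- (h * Rabs (zr n))) <= 2 * ((1 + h) / h) + 2 * ((1 + h) / h).
Proof.
move=> hh us.
have [M hM] : exists M, {subset s <= int_box M}.
  elim: s {us} => [|x s [M IH]]; first by exists 0%N.
  exists (maxn M (match x with Posz k => k.+1 | Negz k => k.+1 end)) => y.
  rewrite inE => /orP [/eqP ->|/IH]; first by apply: int_box_mem; case: x => k; lia.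
  rewrite mem_cat => /orP [] /mapP [k]; rewrite mem_iota add0n => /andP [_ hk] ->; apply: int_box_mem; lia.
apply: Rle_trans (bigR_subset us (int_box_uniq M) hM (fun x => Rlt_le _ _ (exp_pos _))) _.
rewrite big_cat !big_map /=.
have q0 : 0 < (1 + h) / h by apply: Rdiv_lt_0_compat; lra.
have g : \big[Rplus/0]_(k <- iota 0 M) exp (- (h * INR k)) <= (1 + h) / h.
  apply: Rle_trans (geomh_bound M hh) _; have := exp_pos (- (h * INR M)); nra.
have h1 : \big[Rplus/0]_(k <- iota 0 M) exp (- (h * Rabs (zr (Posz k)))) <= \big[Rplus/0]_(k <- iota 0 M) exp (- (h * INR k)).
  by apply: bigR_le => k _; rewrite zr_Posz Rabs_pos_eq; [lra | exact: pos_INR].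
have h2 : \big[Rplus/0]_(k <- iota 0 M) exp (- (h * Rabs (zr (Negz k)))) <= \big[Rplus/0]_(k <- iota 0 M) exp (- (h * INR k)).
  apply: bigR_le => k _; rewrite zr_Negz Rabs_Ropp Rabs_pos_eq; last by have := pos_INR k; lra.
  apply: exp_le; nra.
lra.
Qed.

Lemma qE_exp_bound (t : C) : 0 < Im t -> exists c, 0 < c /\ forall s, Cmod (qE t s) <= c * exp (- Rabs s).
Proof.
move=> hi; have hp := PI_RGT_0.
have hg : 0 < PI * Im t by nra.
exists (exp (1 / (4 * (PI * Im t)))); split; first exact: exp_pos.
move=> s; rewrite Cmod_qE -exp_plus; apply: exp_le.
have := gauss_le 1 (Rabs s) hg; rewrite pow1 pow2_abs; lra.
Qed.

Lemma qE_int_summable (a : int -> C) (t : C) (D al : R) : 0 < Im t ->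
  (forall n, Cmod (a n) <= D) -> summable TT (fun n => a n * qE t (zr n + al))%C.
Proof.
move=> hi ha; have [c [c0 hc]] := qE_exp_bound hi.
have D0 : 0 <= D by have := ha (Posz 0); have := Cmod_ge_0 (a (Posz 0)); lra.
apply: (@int_summable _ (D * (c * exp (Rabs al)))).
  by apply: Rmult_le_pos => //; apply: Rmult_le_pos; [lra | left; exact: exp_pos].
move=> n; rewrite Cmod_mult !Rmult_assoc; apply: Rmult_le_compat => //; try exact: Cmod_ge_0.
apply: Rle_trans (hc _) _; apply: Rmult_le_compat_l; first lra.
rewrite -exp_plus; apply: exp_le.
have := Rabs_triang (zr n + al) (- al); rewrite Rabs_Ropp.
have -> : zr n + al + - al = zr n by ring.
lra.
Qed.

Definition fT (D : R) (c : int -> C) (t : C) (n : int) : C := (c n * qE (t / RtoC D) (zr n))%C.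
Definition FT (D : R) (c : int -> C) (t : C) : C := sum_over TT (fT D c t).

Lemma Im_divR (t : C) D : 0 < D -> Im (t / RtoC D) = Im t / D.
Proof.
move=> hD; have -> : (t / RtoC D = RtoC (/ D) * t)%C by rewrite RtoC_inv; [rewrite /Cdiv Cmult_comm | lra].
by rewrite im_scal_l; field; lra.
Qed.

Lemma FT_summable D c t B : 0 < D -> 0 < Im t -> (forall n, Cmod (c n) <= B) -> summable TT (fT D c t).
Proof.
move=> hD hi hc.
have h : 0 < Im (t / RtoC D) by rewrite Im_divR //; apply: Rdiv_lt_0_compat.
have [b hb] := @qE_int_summable c _ B 0 h hc; exists b => s us ps.
apply: Rle_trans (hb s us ps); apply: bigR_le => n _; rewrite /fT Rplus_0_r; lra.
Qed.

Lemma FT_sum D c t B : 0 < D -> 0 < Im t -> (forall n, Cmod (c n) <= B) -> is_sum_over TT (fT D c t) (FT D c t).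
Proof.
by move=> hD hi hc; have [l hl] := summable_sum (FT_summable hD hi hc); rewrite /FT (sum_overE hl).
Qed.

Lemma qE_real (x : R) (s : R) : Cmod (qE (RtoC x) s) = 1.
Proof. by rewrite Cmod_qE /= Rmult_0_r Rmult_0_l Ropp_0 exp_0. Qed.

Lemma qE_add t u s : qE (t + u) s = (qE t s * qE u s)%C.
Proof. by rewrite /qE -Cexp_add; congr Cexp; ring. Qed.

Lemma qE_im d s : qE (Ci * RtoC d) s = RtoC (exp (- (PI * d * s ^ 2))).
Proof.
rewrite /qE -Cexp_R; congr Cexp; move: (s ^ 2) => z.
by rewrite RtoC_opp (RtoC_mult _ z) (RtoC_mult PI); transitivity (Ci * Ci * (RtoC PI * RtoC d * RtoC z))%C; [ring | rewrite Ci_sq; ring].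
Qed.

(** Put d = Im y and h = sqrt d. The Gaussian restricts attention to |n| of order 1/h. There the
    horizontal deviation A d^2 changes the phase by O(d^2 n^2) = O(d), and about 1/h such terms give
    O(h). *)
Lemma FT_sideways D c B A : 0 < D -> 0 <= A -> (forall n, Cmod (c n) <= B) -> exists K, 0 <= K /\ forall (y : C) (x0 : R),
  0 < Im y <= 1 -> Rabs (Re y - x0) <= A * Im y ^ 2 ->
  Cmod (FT D c y - FT D c (RtoC x0 + Ci * RtoC (Im y))) <= K * sqrt (Im y).
Proof.
move=> hD hA hc; have hp := PI_RGT_0.
have B0 : 0 <= B by have := hc (Posz 0); have := Cmod_ge_0 (c (Posz 0)); lra.
pose c0 := PI / D; have c00 : 0 < c0 by apply: Rdiv_lt_0_compat.
pose K0 := B * (2 * (c0 * A)) * 4 * exp (2 ^ 2 / (4 * c0)).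
have K00 : 0 <= K0.
  have := exp_pos (2 ^ 2 / (4 * c0)) => e; rewrite /K0.
  apply: Rmult_le_pos; last lra; apply: Rmult_le_pos; last lra; apply: Rmult_le_pos => //; nra.
exists (K0 * 8); split; first lra.
move=> y x0 [hi hi1] hre; set d := Im y in hi hi1 hre *.
have h2 : 0 < Im (RtoC x0 + Ci * RtoC d) by rewrite /=; lra.
have S1 := FT_sum hD hi hc; have S2 := FT_sum hD h2 hc.
have S3 := is_sum_over_plus S1 (is_sum_over_scal (- RtoC 1)%C S2).
have -> : (FT D c y - FT D c (RtoC x0 + Ci * RtoC d) = FT D c y + - RtoC 1 * FT D c (RtoC x0 + Ci * RtoC d))%C by ring.
pose h := sqrt d; have hh : 0 < h by apply: sqrt_lt_R0.
have hd : h * h = d by apply: sqrt_sqrt; lra.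
have hle1 : h <= 1 by rewrite -sqrt_1; apply: sqrt_le_1; lra.
have term n : Cmod (fT D c y n + - RtoC 1 * fT D c (RtoC x0 + Ci * RtoC d) n) <= K0 * d * exp (- (h * Rabs (zr n))).
  rewrite /fT; set z := zr n.
  have -> : (c n * qE (y / RtoC D) z + - RtoC 1 * (c n * qE ((RtoC x0 + Ci * RtoC d) / RtoC D) z) =
     c n * (qE (y / RtoC D) z - qE ((RtoC x0 + Ci * RtoC d) / RtoC D) z))%C by ring.
  have Dnz : RtoC D <> 0%C by move=> [] e; lra.
  have -> : (y / RtoC D = RtoC ((Re y - x0) / D) + (RtoC x0 + Ci * RtoC d) / RtoC D)%C.
    have E : y = (RtoC (Re y) + Ci * RtoC d)%C by rewrite /d; apply: Ceq; rewrite !ReImE /=; ring.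
    rewrite {1}E RtoC_div ?RtoC_minus; [field => // | lra].
  rewrite qE_add.
  set w := qE ((RtoC x0 + Ci * RtoC d) / RtoC D) z.
  have -> : (qE (RtoC ((Re y - x0) / D)) z * w - w = (qE (RtoC ((Re y - x0) / D)) z - 1) * w)%C by ring.
  have mw : Cmod w = exp (- (c0 * (h * z) ^ 2)).
    rewrite /w Cmod_qE Im_divR // Im_plus im_RtoC /= Rplus_0_l.
    by rewrite -hd /c0; congr exp; field; lra.
  have mq : Cmod (qE (RtoC ((Re y - x0) / D)) z - 1) <= 2 * (c0 * A * d * (h * z) ^ 2).
    have -> : RtoC 1 = Cexp 0 by rewrite Cexp_0.
    apply: Rle_trans (Cexp_lip _ _) _; [rewrite re_scal_r /=; lra | rewrite /=; lra |].
    apply: Rmult_le_compat_l; first lra.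
    have -> : (RtoC PI * Ci * RtoC ((Re y - x0) / D) * RtoC (z ^ 2) - 0 = RtoC (PI * ((Re y - x0) / D) * z ^ 2) * Ci)%C.
      by move: (z ^ 2) => q; rewrite (RtoC_mult _ q) (RtoC_mult PI); ring.
    rewrite Cmod_mult Cmod_Ci Rmult_1_r Cmod_R.
    have -> : PI * ((Re y - x0) / D) * z ^ 2 = c0 * z ^ 2 * (Re y - x0) by rewrite /c0; field; lra.
    rewrite Rabs_mult Rabs_pos_eq; last by have := pow2_ge_0 z; nra.
    have -> : c0 * A * d * (h * z) ^ 2 = c0 * z ^ 2 * (A * d ^ 2).
      by rewrite Rpow_mult_distr; have -> : h ^ 2 = d by [rewrite -hd; ring]; ring.
    by apply: Rmult_le_compat_l => //; have := pow2_ge_0 z; nra.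
  rewrite Cmod_mult (Cmod_mult _ w) mw.
  have az : Rabs (h * z) = h * Rabs z by rewrite Rabs_mult (Rabs_pos_eq h); lra.
  set u := Rabs (h * z); have u0 : 0 <= u by exact: Rabs_pos.
  have u2 : (h * z) ^ 2 = u ^ 2 by rewrite pow2_abs.
  rewrite u2 in mq *.
  have su := sq_le_exp u0.
  have g := gauss_le 2 u c00.
  have e0 := exp_pos (- (c0 * u ^ 2)).
  apply: Rle_trans (_ : B * (2 * (c0 * A * d * (4 * exp u)) * exp (- (c0 * u ^ 2))) <= _).
    apply: Rmult_le_compat => //; [exact: Cmod_ge_0 | apply: Rmult_le_pos; [exact: Cmod_ge_0 | lra] |].
    apply: Rmult_le_compat_r; first lra.
    apply: Rle_trans mq _; apply: Rmult_le_compat_l; first lra.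
    apply: Rmult_le_compat_l => //; apply: Rmult_le_pos; [nra|lra].
  rewrite -az -/u /K0; set q := _ / (4 * _) in g *.
  have -> : B * (2 * (c0 * A * d * (4 * exp u)) * exp (- (c0 * u ^ 2))) = B * (2 * (c0 * A)) * 4 * d * (exp u * exp (- (c0 * u ^ 2))) by ring.
  have -> : B * (2 * (c0 * A)) * 4 * exp q * d * exp (- u) = B * (2 * (c0 * A)) * 4 * d * (exp q * exp (- u)) by ring.
  apply: Rmult_le_compat_l.
    by apply: Rmult_le_pos; [apply: Rmult_le_pos; [apply: Rmult_le_pos => //; nra | lra] | lra].
  rewrite -!exp_plus; apply: exp_le; lra.
apply: (is_sum_over_le S3) => s us _.
apply: Rle_trans (_ : \big[Rplus/0]_(n <- s) (K0 * d * exp (- (h * Rabs (zr n)))) <= _); first by apply: bigR_le => n _.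
rewrite bigR_scal.
apply: Rle_trans (Rmult_le_compat_l _ _ _ _ (int_exp_bound_h hh us)) _; first by nra.
rewrite -/h -hd.
have -> : K0 * (h * h) * (2 * ((1 + h) / h) + 2 * ((1 + h) / h)) = K0 * h * (4 * (1 + h)) by field; lra.
have : 0 <= K0 * h by nra.
nra.
Qed.

Lemma gauss_deriv2_bound x : 0 <= x -> Rabs ((4 * x ^ 2 - 2) * exp (- x ^ 2)) <= 18 * exp 1 * exp (- x).
Proof.
move=> hx; have h1 := sq_le_exp hx; have h2 := pow2_ge_0 x; have h3 := exp_ineq1_le x.
rewrite Rabs_mult (Rabs_pos_eq (exp _)); last by left; exact: exp_pos.
have e0 := exp_pos (- x ^ 2).
apply: Rle_trans (_ : 18 * exp x * exp (- x ^ 2) <= _).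
  apply: Rmult_le_compat_r; first lra; apply: Rabs_le; lra.
rewrite !(Rmult_assoc 18) -!exp_plus; apply: Rmult_le_compat_l; first lra.
apply: exp_le; have := pow2_ge_0 (x - 1); lra.
Qed.

(** The error of linear interpolation of exp(-x^2) on a step of length h, from two applications of
    the mean value theorem. It is of order h^2 with a decaying factor, so the errors over all steps
    sum to O(h). *)
Lemma gauss_interp h k b : 0 < h -> 0 <= k -> 0 <= b <= 1 ->
  Rabs (exp (- (h * (k + b)) ^ 2) - exp (- (h * (k + 1)) ^ 2) - (1 - b) * (exp (- (h * k) ^ 2) - exp (- (h * (k + 1)) ^ 2)))
   <= 36 * exp 1 * h ^ 2 * exp (- (h * k)).
Proof.
move=> hh hk hb.
pose u x := h * (k + x).
pose L x := exp (- (u x * u x)).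
pose L1 x := - 2 * h * u x * exp (- (u x * u x)).
pose L2 x := h ^ 2 * ((4 * u x ^ 2 - 2) * exp (- u x ^ 2)).
have dL x : is_derive L x (L1 x) by rewrite /L /L1 /u; auto_derive => //; ring.
have dL1 x : is_derive L1 x (L2 x).
  rewrite /L2; have -> : u x ^ 2 = u x * u x by ring.
  by rewrite /L1 /u; auto_derive => //; ring.
have EL x : exp (- (h * (k + x)) ^ 2) = L x by rewrite /L /u; congr exp; ring.
have K0 : 0 <= 36 * exp 1 * h ^ 2 * exp (- (h * k)).
  have := exp_pos 1; have := exp_pos (- (h * k)); have := pow2_ge_0 h => a1 a2 a3.
  by apply: Rmult_le_pos; [apply: Rmult_le_pos; lra | lra].
rewrite !EL; have -> : exp (- (h * k) ^ 2) = L 0 by rewrite -EL Rplus_0_r.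
have [->|b1] := Req_dec b 1; first by rewrite !Rminus_diag Rmult_0_l Rminus_0_r Rabs_R0.
have [x1 [E1 hx1]] := MVT_cor2 L L1 b 1 (ltac:(lra)) (fun c _ => proj1 (is_derive_Reals _ _ _) (dL c)).
have [x2 [E2 hx2]] := MVT_cor2 L L1 0 1 (ltac:(lra)) (fun c _ => proj1 (is_derive_Reals _ _ _) (dL c)).
have -> : L b - L 1 - (1 - b) * (L 0 - L 1) = (1 - b) * (L1 x2 - L1 x1).
  have -> : L b - L 1 = - (L1 x1 * (1 - b)) by rewrite -E1; ring.
  have -> : L 0 - L 1 = - (L1 x2 * (1 - 0)) by rewrite -E2; ring.
  ring.
have bd : Rabs (L1 x2 - L1 x1) <= 36 * exp 1 * h ^ 2 * exp (- (h * k)).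
  have H := @Cbounded_variation (fun x => RtoC (L1 x)) (fun x => RtoC (L2 x)) (18 * exp 1 * h ^ 2 * exp (- (h * k))) x1 x2.
  rewrite -RtoC_minus Cmod_R in H; apply: Rle_trans (H _) _.
    move=> t ht; split; first exact: is_derive_RtoC.
    have t0 : 0 <= t by apply: Rle_trans (proj1 ht); apply: Rmin_glb; lra.
    rewrite Cmod_R /L2 Rabs_mult (Rabs_pos_eq (h ^ 2)); last exact: pow2_ge_0.
    have p : 0 <= u t by apply: Rmult_le_pos; lra.
    apply: Rle_trans (Rmult_le_compat_l _ _ _ (pow2_ge_0 h) (gauss_deriv2_bound p)) _.
    have -> : h ^ 2 * (18 * exp 1 * exp (- u t)) = 18 * exp 1 * h ^ 2 * exp (- u t) by ring.
    apply: Rmult_le_compat_l; last by apply: exp_le; rewrite /u; nra.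
    by have := exp_pos 1; have := pow2_ge_0 h => a1 a2; apply: Rmult_le_pos; lra.
  have : Rabs (x2 - x1) <= 1 by apply: Rabs_le; lra.
  have := Rabs_pos (x2 - x1) => q1 q2.
  set Z := 18 * _ * _ * _; have -> : 36 * exp 1 * h ^ 2 * exp (- (h * k)) = 2 * Z * 1 by rewrite /Z; ring.
  apply: Rmult_le_compat_l => //; rewrite /Z; lra.
rewrite Rabs_mult Rabs_pos_eq; last lra.
have := Rabs_pos (L1 x2 - L1 x1); nra.
Qed.

Lemma bigC_iotaS (F : nat -> C) N :
  \big[Cplus/RtoC 0]_(k <- iota 0 N.+1) F k = (\big[Cplus/RtoC 0]_(k <- iota 0 N) F k + F N)%C.
Proof. by rewrite -addn1 iotaD big_cat add0n /= big_cons big_nil Cplus_0_r. Qed.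

Lemma bigR_iotaS (F : nat -> R) N :
  \big[Rplus/0]_(k <- iota 0 N.+1) F k = \big[Rplus/0]_(k <- iota 0 N) F k + F N.
Proof.
rewrite -addn1 iotaD big_cat add0n [iota N 1]/= big_cons big_nil.
by rewrite -[LHS]/(_ + (_ + 0)) Rplus_0_r.
Qed.

Lemma big_iota_group (F : nat -> C) Q N :
  \big[Cplus/RtoC 0]_(k <- iota 0 (N * Q)) F k =
  \big[Cplus/RtoC 0]_(K <- iota 0 N) \big[Cplus/RtoC 0]_(j <- iota 0 Q) F (K * Q + j)%N.
Proof.
elim: N => [|N IH]; first by rewrite mul0n !big_nil.
rewrite -[in RHS]addn1 iotaD big_cat /= add0n big_cons big_nil Cplus_0_r -IH.
rewrite mulSn addnC iotaD big_cat /= add0n; congr Cplus.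
by rewrite -[X in iota X Q]addn0 iotaDl big_map.
Qed.

Lemma periodic_mul (f : int -> C) (Q : nat) (k : nat) n : (forall m, f (m + Posz Q)%R = f m) -> f (n + Posz (k * Q))%R = f n.
Proof.
move=> h; elim: k => [|k IH]; first by rewrite mul0n addr0.
by rewrite mulSn addnC PoszD addrA h.
Qed.

Lemma periodic_reflect (f : int -> C) (Q : nat) : (forall m, f (m + Posz Q)%R = f m) ->
  \big[Cplus/RtoC 0]_(j <- iota 0 Q) f (Posz j.+1) = \big[Cplus/RtoC 0]_(j <- iota 0 Q) f (Negz j).
Proof.
move=> h.
have E1 : \big[Cplus/RtoC 0]_(j <- iota 0 Q) f (Posz j.+1) = \big[Cplus/RtoC 0]_(j <- iota 0 Q) f (Posz j).
  have T n : (\big[Cplus/RtoC 0]_(j <- iota 0 n) f (Posz j.+1) + f (Posz 0) = \big[Cplus/RtoC 0]_(j <- iota 0 n) f (Posz j) + f (Posz n))%C.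
    elim: n => [|n IH]; first by rewrite !big_nil.
    rewrite -addn1 iotaD !big_cat /= add0n !big_cons !big_nil !Cplus_0_r addn1.
    have -> (x y z : C) : (x + y + z = (x + z) + y)%C by ring.
    by rewrite IH; ring.
  have := T Q; have -> : f (Posz Q) = f (Posz 0) by rewrite -(h (Posz 0)) add0r.
  set X := \big[_/_]_(_ <- _) _; set Y := \big[_/_]_(_ <- _) _; move: (f _) => z E.
  transitivity (X + z - z)%C; first ring.
  by rewrite E; ring.
rewrite E1.
have -> : iota 0 Q = index_iota 0 Q by rewrite /index_iota subn0.
rewrite big_nat_rev /= add0n; apply: eq_big_nat => j /andP [_ hj].
rewrite -(h (Negz j)); congr f; rewrite NegzE; lia.
Qed.

(** At x0 the coefficients become periodic, and the sign makes their sum over a period vanish, so no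
    main term of order 1/sqrt(d) appears. Summation in blocks of length Q against an interpolated
    Gaussian leaves a telescoping sum whose value is the limit. *)
Lemma FT_vertical D (phi : int -> C) B x0 (Q : nat) : 0 < D -> (0 < Q)%N -> (forall n, Cmod (phi n) <= B) ->
  (forall n, (phi (n + Posz Q)%R * qE (RtoC (x0 / D)) (zr (n + Posz Q)%R))%C = (phi n * qE (RtoC (x0 / D)) (zr n))%C) ->
  exists (L : C) (K : R), 0 <= K /\ forall d, 0 < d <= 1 ->
   Cmod (FT D (fun n => RtoC (sg n) * phi n)%C (RtoC x0 + Ci * RtoC d) - L) <= K * sqrt d.
Proof.
move=> hD hQ hB hper; have hp := PI_RGT_0.
have B0 : 0 <= B by have := hB (Posz 0); have := Cmod_ge_0 (phi (Posz 0)); lra.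
have q0 : 0 < INR Q by apply: lt_0_INR; lia.
pose psi n := (phi n * qE (RtoC (x0 / D)) (zr n))%C.
have psiper n : psi (n + Posz Q)%R = psi n := hper n.
have psib n : Cmod (psi n) <= B by rewrite /psi Cmod_mult qE_real Rmult_1_r.
(* The coefficient of the joint Gaussian of the indices k + 1 and -(k + 1). *)
pose o (k : nat) := (psi (Posz k.+1) - psi (Negz k))%C.
have ob k : Cmod (o k) <= 2 * B.
  apply: Rle_trans (Cmod_triangle _ _) _; rewrite Cmod_opp; have := psib (Posz k.+1); have := psib (Negz k); lra.
have oper K j : o (K * Q + j)%N = o j.
  rewrite /o; congr Cminus.
    rewrite -(periodic_mul K (Posz j.+1) psiper); congr psi; rewrite -PoszD; congr Posz; lia.
  rewrite -(periodic_mul K (Negz (K * Q + j)%N) psiper); congr psi; rewrite !NegzE; lia.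
have osum : \big[Cplus/RtoC 0]_(j <- iota 0 Q) o j = 0%C.
  have := periodic_reflect psiper => E.
  have -> : \big[Cplus/RtoC 0]_(j <- iota 0 Q) o j = (\big[Cplus/RtoC 0]_(j <- iota 0 Q) psi (Posz j.+1) + (-1) * \big[Cplus/RtoC 0]_(j <- iota 0 Q) psi (Negz j))%C.
    rewrite -bigC_scal -big_split; apply: eq_bigr => j _; rewrite /o /=; ring.
  rewrite E; ring.
(* The Abel value of the series of the [o j]: the weight 1 - (j + 1)/Q is that of linear
   interpolation between the ends of a block. *)
pose L := \big[Cplus/RtoC 0]_(j <- iota 0 Q) (o j * RtoC (1 - (INR j + 1) / INR Q))%C.
pose c0 := sqrt (PI / D) * INR Q.
have c00 : 0 < c0 by apply: Rmult_lt_0_compat => //; apply: sqrt_lt_R0; apply: Rdiv_lt_0_compat.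
pose W := 2 * B * INR Q * (36 * exp 1).
have W0 : 0 <= W.
  have := exp_pos 1 => e; rewrite /W; apply: Rmult_le_pos; last lra; apply: Rmult_le_pos; lra.
exists L, (W * c0 * (1 + c0)); split; first by apply: Rmult_le_pos; [apply: Rmult_le_pos; lra | lra].
move=> d [hd hd1].
pose h := c0 * sqrt d.
have sd : 0 < sqrt d by apply: sqrt_lt_R0.
have sd1 : sqrt d <= 1 by rewrite -sqrt_1; apply: sqrt_le_1; lra.
have hh : 0 < h by apply: Rmult_lt_0_compat.
have Epow m : exp (- (PI * (d / D) * m ^ 2)) = exp (- (h * (m / INR Q)) ^ 2).
  congr exp; rewrite /h /c0.
  have -> : sqrt (PI / D) * INR Q * sqrt d * (m / INR Q) = (sqrt (PI / D) * sqrt d) * m by field; lra.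
  rewrite !Rpow_mult_distr !pow2_sqrt; [field; lra | lra |].
  left; exact: Rdiv_lt_0_compat.
pose c n := (RtoC (sg n) * phi n)%C.
have cb n : Cmod (c n) <= B.
  rewrite /c Cmod_mult Cmod_R; have := sg_bound n; have := hB n; have := Cmod_ge_0 (phi n); have := Rabs_pos (sg n); nra.
have hi : 0 < Im (RtoC x0 + Ci * RtoC d) by rewrite /=; lra.
have S := FT_sum hD hi cb.
have fE n : fT D c (RtoC x0 + Ci * RtoC d) n = (RtoC (sg n) * psi n * RtoC (exp (- (h * (zr n / INR Q)) ^ 2)))%C.
  rewrite /fT /c /psi -Epow -qE_im.
  have -> : ((RtoC x0 + Ci * RtoC d) / RtoC D = RtoC (x0 / D) + Ci * RtoC (d / D))%C.
    by rewrite !RtoC_div; [field; move=> [] e; lra | lra | lra].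
  rewrite qE_add; ring.
have f0 : fT D c (RtoC x0 + Ci * RtoC d) (Posz 0) = 0%C by rewrite /fT /c /=; ring.
have lim := is_sum_int_seq1 S f0.
pose E m := exp (- (h * (m / INR Q)) ^ 2).
have part n : (fT D c (RtoC x0 + Ci * RtoC d) (Posz n.+1) + fT D c (RtoC x0 + Ci * RtoC d) (Negz n))%C = (o n * RtoC (E (INR n + 1)%coqR))%C.
  rewrite !fE zr_Posz zr_Negz S_INR [sg (Posz _)]/= [sg (Negz _)]/= /o /E.
  have -> : - (h * (- (INR n + 1) / INR Q)) ^ 2 = - (h * ((INR n + 1) / INR Q)) ^ 2 by field; lra.
  ring.
pose Sg N := \big[Cplus/RtoC 0]_(k <- iota 0 (N * Q)) (o k * RtoC (E (INR k + 1)%coqR))%C.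
(* [h] is the scale of a whole block, so block N runs over the Gaussian from h N to h (N + 1); after
   N blocks the main terms have telescoped to L (1 - exp(-(h N)^2)). *)
have est N : Cmod (Sg N - L * RtoC (1 - exp (- (h * INR N) ^ 2))%coqR) <= W * h ^ 2 * ((1 + h) / h * (1 - exp (- (h * INR N)))).
  apply: Rle_trans (_ : W * h ^ 2 * \big[Rplus/0]_(k <- iota 0 N) exp (- (h * INR k)) <= _); last first.
    apply: Rmult_le_compat_l; last exact: geomh_bound.
    by apply: Rmult_le_pos => //; exact: pow2_ge_0.
  rewrite /Sg big_iota_group.
  elim: N => [|N IH].
    rewrite !big_nil !Rmult_0_r; have -> : - 0 ^ 2 = 0 by ring.
    rewrite exp_0 Rminus_diag Cmult_0_r; have -> : (0 - 0 = 0)%C by ring.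
    rewrite Cmod_0; lra.
  rewrite bigC_iotaS bigR_iotaS S_INR.
  set X := \big[_/_]_(_ <- _) _ in IH *.
  pose g0 := exp (- (h * INR N) ^ 2); pose g1 := exp (- (h * (INR N + 1)) ^ 2).
  pose ej j := exp (- (h * (INR N + (INR j + 1) / INR Q)) ^ 2).
  pose wj j := 1 - (INR j + 1) / INR Q.
  (* Because the [o j] sum to 0, the value [g1] at the end of the block can be subtracted freely;
     the rest is L times the drop of the Gaussian plus interpolation errors. *)
  have blk : \big[Cplus/RtoC 0]_(j <- iota 0 Q) (o (N * Q + j)%N * RtoC (E (INR (N * Q + j) + 1)%coqR))%C
     = (L * RtoC (g0 - g1) + \big[Cplus/RtoC 0]_(j <- iota 0 Q) (o j * RtoC (ej j - g1 - wj j * (g0 - g1))%coqR))%C.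
    have -> : \big[Cplus/RtoC 0]_(j <- iota 0 Q) (o (N * Q + j)%N * RtoC (E (INR (N * Q + j) + 1)%coqR))%C =
       (\big[Cplus/RtoC 0]_(j <- iota 0 Q) (o j * RtoC (ej j - g1)%coqR) + RtoC g1 * \big[Cplus/RtoC 0]_(j <- iota 0 Q) o j)%C.
      rewrite -bigC_scal -big_split; apply: eq_bigr => j _ /=.
      have -> : E (INR (N * Q + j) + 1) = ej j.
        rewrite /E /ej plus_INR mult_INR; congr exp; field; lra.
      rewrite oper RtoC_minus; ring.
    rewrite osum Cmult_0_r Cplus_0_r (Cmult_comm L) /L -bigC_scal -big_split; apply: eq_bigr => j _ /=.
    rewrite -/(wj j) RtoC_minus (RtoC_minus _ (wj j * _)) (RtoC_minus (ej j)) RtoC_mult RtoC_minus; ring.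
  rewrite blk.
  set Y := \big[_/_]_(_ <- _) (_ * _)%C.
  have -> : (X + (L * RtoC (g0 - g1) + Y) - L * RtoC (1 - exp (- (h * (INR N + 1)) ^ 2))%coqR = (X - L * RtoC (1 - exp (- (h * INR N) ^ 2))%coqR) + Y)%C.
    rewrite -/g0 -/g1 !RtoC_minus; ring.
  apply: Rle_trans (Cmod_triangle _ _) _.
  rewrite Rmult_plus_distr_l; apply: Rplus_le_compat => //.
  apply: Rle_trans (Cmod_bigsum _ _) _.
  apply: Rle_trans (_ : \big[Rplus/0]_(j <- iota 0 Q) (2 * B * (36 * exp 1 * h ^ 2 * exp (- (h * INR N)))) <= _).
    apply: bigR_le => j; rewrite mem_iota add0n => /andP [_ hj].
    rewrite Cmod_mult Cmod_R; apply: Rmult_le_compat => //; [exact: Cmod_ge_0 | exact: Rabs_pos |].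
    apply: gauss_interp => //; first exact: pos_INR.
    have j1 : INR j + 1 <= INR Q by rewrite -S_INR; apply: le_INR; lia.
    have j0 := pos_INR j; split.
      by apply: Rmult_le_pos; [lra | left; exact: Rinv_0_lt_compat].
    by apply: (Rmult_le_reg_r (INR Q)) => //; rewrite /Rdiv Rmult_assoc Rinv_l; lra.
  have cst (a : R) n : \big[Rplus/0]_(j <- iota 0 n) a = INR n * a.
    elim: n => [|n IHn]; first by rewrite big_nil /=; ring.
    by rewrite bigR_iotaS IHn S_INR; ring.
  rewrite cst /W; right; ring.
have hq : W * h ^ 2 * ((1 + h) / h) <= W * c0 * (1 + c0) * sqrt d.
  have -> : W * h ^ 2 * ((1 + h) / h) = W * h * (1 + h) by field; lra.
  have hc : h <= c0 by rewrite /h; nra.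
  have -> : W * c0 * (1 + c0) * sqrt d = W * h * (1 + c0) by rewrite /h; ring.
  apply: Rmult_le_compat_l; [apply: Rmult_le_pos; lra | lra].
apply: le_epsilon => eps he.
have he2 : 0 < eps / 2 by lra.
have [N1 H1] := proj1 (@filterlimCP _ eventually _ _ _) lim _ he2.
have [N2 H2] : exists N2, forall n, (N2 <= n)%N -> Cmod L * exp (- (h * INR n) ^ 2) < eps / 2.
  have L0 := Cmod_ge_0 L.
  have [N2 hN2] := INR_unbounded ((Cmod L / (eps / 2) + 1) / h).
  exists N2 => n hn.
  have hn2 : (Cmod L / (eps / 2) + 1) / h < INR n by have : INR N2 <= INR n by [apply: le_INR; lia]; lra.
  have h3 : Cmod L / (eps / 2) + 1 < h * INR n.
    have := Rmult_lt_compat_l _ _ _ hh hn2.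
    by have -> : h * ((Cmod L / (eps / 2) + 1) / h) = Cmod L / (eps / 2) + 1 by field; lra.
  have l0 : 0 <= Cmod L / (eps / 2) by apply: Rmult_le_pos => //; left; apply: Rinv_0_lt_compat.
  set u := h * INR n in h3 *.
  have h4 : exp (- u ^ 2) <= / (Cmod L / (eps / 2) + 1).
    rewrite exp_Ropp; apply: Rinv_le_contravar; first lra.
    have := exp_ineq1_le (u ^ 2); nra.
  apply: Rle_lt_trans (Rmult_le_compat_l _ _ _ L0 h4) _.
  apply: (Rmult_lt_reg_r (Cmod L / (eps / 2) + 1)); first lra.
  rewrite Rmult_assoc Rinv_l; last lra.
  have : eps / 2 * (Cmod L / (eps / 2) + 1) = Cmod L + eps / 2 by field; lra.
  lra.
pose N := (N1 + N2)%N.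
have {}H2 := H2 N (ltac:(rewrite /N; lia)).
have {}H1 := H1 (N * Q)%N (ltac:(rewrite /N; nia)).
have {}H1 : Cmod (Sg N - FT D c (RtoC x0 + Ci * RtoC d)) < eps / 2.
  by move: H1; rewrite /Sg (eq_bigr (fun k => (o k * RtoC (E (INR k + 1)%coqR))%C) (fun k _ => part k)).
have H3 := est N.
have H4 : W * h ^ 2 * ((1 + h) / h * (1 - exp (- (h * INR N)))) <= W * h ^ 2 * ((1 + h) / h).
  apply: Rmult_le_compat_l; first by apply: Rmult_le_pos => //; exact: pow2_ge_0.
  rewrite -[X in _ <= X]Rmult_1_r; apply: Rmult_le_compat_l.
    by left; apply: Rdiv_lt_0_compat; lra.
  have := exp_pos (- (h * INR N)); lra.
set F := FT D c _ in H1 *.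
rewrite Cmod_switch in H1.
have T1 := Cmod_le_dist F (Sg N) L.
have T2 := Cmod_le_dist (Sg N) (L * RtoC (1 - exp (- (h * INR N) ^ 2))%coqR)%C L.
have T3 : Cmod (L * RtoC (1 - exp (- (h * INR N) ^ 2))%coqR - L) = Cmod L * exp (- (h * INR N) ^ 2).
  have -> : (L * RtoC (1 - exp (- (h * INR N) ^ 2))%coqR - L = - (L * RtoC (exp (- (h * INR N) ^ 2))%coqR))%C.
    rewrite RtoC_minus; ring.
  by rewrite Cmod_opp Cmod_mult Cmod_R Rabs_pos_eq //; left; exact: exp_pos.
rewrite -/c in T1 *.
lra.
Qed.

(** * Analyticity of the error terms *)

Definition ana (g : R -> C) (x : R) := exists (r : R) (a : nat -> C), 0 < r /\
  forall y : R, Rabs (y - x) < r -> is_pseries (K := R_AbsRing) (V := C_R_NormedModule) a (y - x) (g y).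

Lemma pseriesP (a : nat -> C) (d : R) (l : C) :
  is_pseries (K := R_AbsRing) (V := C_R_NormedModule) a d l <->
  filterlim (fun n => sum_n (fun k => (RtoC (d ^ k) * a k)%C : CV) n) eventually (locally (l : CV)).
Proof.
have E k : scal (pow_n (K := R_AbsRing) d k) (a k : CV) = (RtoC (d ^ k) * a k)%C by rewrite scalCE pow_n_pow.
by split => h; refine (filterlim_ext _ _ _ h) => n; apply: sum_n_ext => k; rewrite E.
Qed.

Lemma sum_n_Clin (L : C -> C) (a b : nat -> C) n : (forall x y, L (x + y)%C = (L x + L y)%C) ->
  (forall k, L (a k) = b k) -> sum_n (b : nat -> CV) n = L (sum_n (a : nat -> CV) n).
Proof.
move=> hL hab; elim: n => [|n IH]; first by rewrite !sum_O hab.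
by rewrite !sum_Sn IH -hab; symmetry; exact: hL.
Qed.

Lemma ana_ext g f x r : 0 < r -> (forall y, Rabs (y - x) < r -> f y = g y) -> ana f x -> ana g x.
Proof.
move=> hr E [r' [a [hr' h]]]; exists (Rmin r r'), a; split; first exact: Rmin_glb_lt.
move=> y hy; rewrite -E; last by apply: Rlt_le_trans hy (Rmin_l _ _).
by apply: h; apply: Rlt_le_trans hy (Rmin_r _ _).
Qed.

Lemma ana_plus f g x : ana f x -> ana g x -> ana (fun y => f y + g y)%C x.
Proof.
move=> [r [a [hr h]]] [r' [a' [hr' h']]]; exists (Rmin r r'), (fun k => a k + a' k)%C; split; first exact: Rmin_glb_lt.
move=> y hy; apply: (is_pseries_plus (K := R_AbsRing) (V := C_R_NormedModule)).
  by apply: h; apply: Rlt_le_trans hy (Rmin_l _ _).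
by apply: h'; apply: Rlt_le_trans hy (Rmin_r _ _).
Qed.

Lemma ana_scal c f x : ana f x -> ana (fun y => c * f y)%C x.
Proof.
move=> [r [a [hr h]]]; exists r, (fun k => c * a k)%C; split=> // y /h /pseriesP hy; apply/pseriesP.
refine (filterlim_ext _ _ _ (filterlim_Cscal (a := c) hy)) => n.
symmetry; apply: sum_n_Clin => [u v|k]; ring.
Qed.

Lemma ana_const c x : ana (fun=> c) x.
Proof.
exists 1, (fun k => if k is 0%N then c else RtoC 0); split; first lra.
move=> y _; apply/pseriesP.
refine (filterlim_ext _ _ _ (filterlim_const c)) => n.
elim: n => [|n IH]; first by rewrite sum_O /= Cmult_1_l.
by rewrite sum_Sn -IH Cmult_0_r; symmetry; exact: Cplus_0_r.
Qed.

Lemma ana_conj f x : ana f x -> ana (fun y => Cconj (f y)) x.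
Proof.
move=> [r [a [hr h]]]; exists r, (fun k => Cconj (a k)); split=> // y /h /pseriesP hy; apply/pseriesP.
have E n : sum_n (fun k => (RtoC ((y - x) ^ k) * Cconj (a k))%C : CV) n = Cconj (sum_n (fun k => (RtoC ((y - x) ^ k) * a k)%C : CV) n).
  apply: sum_n_Clin => [u v|k]; first exact: Cplus_conj.
  by rewrite Cmult_conj; congr Cmult; apply: Ceq => /=; ring.
apply/filterlimCP => eps he; have [N hN] := proj1 (@filterlimCP _ eventually _ _ _) hy eps he.
by exists N => n hn; rewrite E -Cminus_conj Cmod_conj; exact: hN.
Qed.

Lemma ana_affine f u v x : u <> 0 -> ana f (u * x + v) -> ana (fun y => f (u * y + v)) x.
Proof.
move=> hu [r [a [hr h]]]; have au := Rabs_pos_lt u hu.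
exists (r / Rabs u), (fun k => RtoC (u ^ k) * a k)%C; split; first exact: Rdiv_lt_0_compat.
move=> y hy; have E : u * y + v - (u * x + v) = u * (y - x) by ring.
have h1 : Rabs (u * y + v - (u * x + v)) < r.
  rewrite E Rabs_mult; have -> : r = Rabs u * (r / Rabs u) by field; lra.
  exact: Rmult_lt_compat_l.
have /pseriesP h2 := h _ h1; apply/pseriesP.
refine (filterlim_ext _ _ _ h2) => n; apply: sum_n_ext => k.
rewrite E Rpow_mult_distr Cmult_assoc -RtoC_mult; congr (RtoC _ * _)%C; ring.
Qed.

Lemma ana_big (I : eqType) (s : seq I) (f : I -> R -> C) x : (forall i, i \in s -> ana (f i) x) ->
  ana (fun y => \big[Cplus/RtoC 0]_(i <- s) f i y) x.
Proof.
elim: s => [|i s IH] h.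
  by apply: (@ana_ext _ (fun=> RtoC 0) x 1 _ _ (ana_const _ _)) => [|y _]; [lra | rewrite big_nil].
have h1 := ana_plus (h i (mem_head _ _)) (IH (fun j hj => h j (mem_behead (s := i :: s) hj))).
by apply: (@ana_ext _ _ x 1 _ _ h1) => [|y _]; [lra | rewrite big_cons].
Qed.

(** Induction on the order: the remainder of order n + 1 along the segment from 0 to z has
    derivative z times that of order n. Each step costs 2 |z|, the 2 coming from
    [Cbounded_variation]. *)
Lemma Cexp_remainder (z : C) n : forall t, 0 <= t <= 1 ->
  Cmod (Cexp (RtoC t * z) - sum_n (fun k => (RtoC (t ^ k) * (Cpow z k * RtoC (/ INR (Factorial.fact k))))%C : CV) n) <= (2 * Cmod z) ^ n.+1 * exp (Cmod z).
Proof.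
have z0 := Cmod_ge_0 z; have ez := exp_pos (Cmod z).
pose S n t := sum_n (fun k => (RtoC (t ^ k) * (Cpow z k * RtoC (/ INR (Factorial.fact k))))%C : CV) n.
have S0E t : S 0%N t = RtoC 1 by rewrite /S sum_O /= Rinv_1 !Cmult_1_l.
have dS m t : is_derive (S m.+1 : R -> CV) t (z * S m t)%C.
  elim: m => [|m IH].
    apply: (is_derive_ext (V := CV) (fun u => plus (RtoC 1 : CV) ((RtoC u * z)%C : CV))).
      move=> u; rewrite /S sum_Sn sum_O /= Rinv_1 Rmult_1_r; congr plus; rewrite ?Cmult_1_r //; ring.
    rewrite S0E Cmult_1_r -[z in is_derive _ _ z](plus_zero_l (G := CV)).
    exact: (is_derive_plus (V := CV) _ _ _ _ _ (is_derive_const (V := CV) (RtoC 1) t) (is_derive_lin z t)).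
  apply: (is_derive_ext (V := CV) (fun s => plus (S m.+1 s : CV) ((RtoC (s ^ m.+2) * (Cpow z m.+2 * RtoC (/ INR (Factorial.fact m.+2))))%C : CV))).
    by move=> s; rewrite /S [in RHS]sum_Sn.
  have -> : (z * S m.+1 t)%C = plus ((z * S m t)%C : CV) ((RtoC (INR m.+2 * t ^ m.+1) * (Cpow z m.+2 * RtoC (/ INR (Factorial.fact m.+2))))%C : CV).
    rewrite /S sum_Sn -/(S m t).
    have -> : / INR (Factorial.fact m.+2) = / INR (Factorial.fact m.+1) / INR m.+2.
      rewrite fact_simpl mult_INR; field; split; [exact: INR_fact_neq_0 | exact: not_0_INR].
    rewrite RtoC_mult RtoC_div; last exact: not_0_INR.
    have nz : RtoC (INR m.+2) <> RtoC 0 by move/RtoC_inj; exact: not_0_INR.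
    move: (RtoC (INR m.+2)) nz (RtoC (t ^ m.+1)) (RtoC (/ _)) => A nz B D.
    have plusE (p q : C) : plus (p : CV) (q : CV) = (p + q)%C by [].
    rewrite -[Cpow z m.+2]/(z * Cpow z m.+1)%C !plusE; move: (Cpow z _) (S m t) => P Q; field => //.
  apply: (is_derive_plus (V := CV)) IH _.
  have h : is_derive (fun s : R => s ^ m.+2) t (INR m.+2 * t ^ m.+1).
    have := is_derive_pow (fun s => s) m.+2 t 1 (is_derive_id t); by rewrite Rmult_1_r.
  have := is_derive_Cmult (is_derive_RtoC h) (is_derive_const (V := CV) (Cpow z m.+2 * RtoC (/ INR (Factorial.fact m.+2)))%C t).
  by rewrite /zero /= Cmult_0_r Cplus_0_r.
have eb t : 0 <= t <= 1 -> Cmod (Cexp (RtoC t * z)) <= exp (Cmod z).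
  move=> ht; rewrite Cmod_Cexp; apply: exp_le; rewrite re_scal_l.
  have := re_le_Cmod z; have := Rle_abs (Re z); have := Rabs_pos (Re z); nra.
have base (f df : R -> C) (K : R) t : 0 <= t <= 1 -> (forall s, 0 <= s <= 1 -> is_derive (f : R -> CV) s (z * df s)%C /\ Cmod (df s) <= K) -> f 0 = RtoC 0 ->
   Cmod (f t) <= 2 * Cmod z * K.
  move=> ht H f0.
  have K0 : 0 <= K by have := proj2 (H 0 (ltac:(lra))); have := Cmod_ge_0 (df 0); lra.
  have := @Cbounded_variation f (fun s => z * df s)%C (Cmod z * K) 0 t.
  rewrite f0 Rminus_0_r; have -> : (f t - 0 = f t)%C by ring.
  rewrite Rabs_pos_eq; last lra.
  move=> h; apply: Rle_trans (h _) _; last by have : 0 <= Cmod z * K by [nra]; nra.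
  move=> s; rewrite Rmin_left ?Rmax_right; try lra; move=> hs.
  have [h1 h2] := H s (ltac:(lra)); split=> //; rewrite Cmod_mult; exact: Rmult_le_compat_l.
have dE t : is_derive (fun s : R => Cexp (RtoC s * z) : CV) t (z * Cexp (RtoC t * z))%C.
  exact: is_derive_Cexp (is_derive_lin z t).
have S0 m : S m 0 = RtoC 1.
  elim: m => [|m IH]; first exact: S0E.
  rewrite /S sum_Sn -/(S m 0) IH /= Rmult_0_l /plus /=; apply: Ceq; rewrite !ReImE /=; ring.
elim: n => [|n IH] t ht.
  rewrite pow_1; apply: (base (fun t => Cexp (RtoC t * z) - S 0%N t)%C (fun t => Cexp (RtoC t * z)) _ t ht).
    move=> s hs; split; last exact: eb.
    have -> : (z * Cexp (RtoC s * z))%C = minus ((z * Cexp (RtoC s * z))%C : CV) (zero : CV).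
      by rewrite (minus_zero_r (G := CV)).
    apply: (is_derive_minus (V := CV)) (dE s) _.
    apply: (is_derive_ext (V := CV) (fun=> RtoC 1)); last exact: is_derive_const.
    by move=> u; rewrite S0E.
  by rewrite S0 Cmult_0_l Cexp_0; apply: Cplus_opp_r.
have -> : (2 * Cmod z) ^ n.+2 * exp (Cmod z) = 2 * Cmod z * ((2 * Cmod z) ^ n.+1 * exp (Cmod z)) by rewrite -Rmult_assoc.
apply: (base (fun t => Cexp (RtoC t * z) - S n.+1 t)%C (fun t => Cexp (RtoC t * z) - S n t)%C _ t ht).
  move=> s hs; split; last exact: IH.
  have -> : (z * (Cexp (RtoC s * z) - S n s))%C = minus ((z * Cexp (RtoC s * z))%C : CV) ((z * S n s)%C : CV).
    have minusE (p q : C) : minus (p : CV) (q : CV) = (p - q)%C by [].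
    by rewrite minusE; ring.
  exact: (is_derive_minus (V := CV)) (dE s) (dS n s).
by rewrite S0 Cmult_0_l Cexp_0; apply: Cplus_opp_r.
Qed.

Lemma ana_Cexp (b : C) x : ana (fun y => Cexp (RtoC y * b)) x.
Proof.
have b0 := Cmod_ge_0 b.
apply: (@ana_ext _ (fun y => Cexp (RtoC x * b) * Cexp (RtoC (y - x) * b))%C x 1); first lra.
  by move=> y _; rewrite -Cexp_add; congr Cexp; rewrite RtoC_minus; ring.
apply: ana_scal.
(* The radius that makes 2 |z| <= 1/2 in [Cexp_remainder]. *)
exists (/ (4 * (Cmod b + 1))), (fun k => Cpow b k * RtoC (/ INR (Factorial.fact k)))%C.
have r0 : 0 < 4 * (Cmod b + 1) by lra.
split; first exact: Rinv_0_lt_compat.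
move=> y hy; apply/pseriesP; set d := y - x in hy *.
pose z := (RtoC d * b)%C.
have hz : Cmod z <= / 4.
  rewrite /z Cmod_mult Cmod_R; apply: Rle_trans (_ : / (4 * (Cmod b + 1)) * (Cmod b + 1) <= _).
    by apply: Rmult_le_compat => //; [exact: Rabs_pos | lra | lra].
  right; field; lra.
have E n : sum_n (fun k => (RtoC (d ^ k) * (Cpow b k * RtoC (/ INR (Factorial.fact k))))%C : CV) n =
   sum_n (fun k => (RtoC (1 ^ k) * (Cpow z k * RtoC (/ INR (Factorial.fact k))))%C : CV) n.
  by apply: sum_n_ext => k; rewrite pow1 /z Cpow_mult_l -RtoC_pow Cmult_1_l Cmult_assoc.
have z0 := Cmod_ge_0 z.
apply/filterlimCP => eps he.
have [N hN] := pow_lt_1_zero (/ 2) (ltac:(rewrite Rabs_pos_eq; lra)) (eps / exp (Cmod z)) (Rdiv_lt_0_compat _ _ he (exp_pos _)).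
exists N => n hn; rewrite E Cmod_switch.
have := @Cexp_remainder z n 1 (ltac:(lra)); rewrite Cmult_1_l => h.
apply: Rle_lt_trans h _.
have h1 : (2 * Cmod z) ^ n.+1 <= (/ 2) ^ n.+1 by apply: pow_incr; lra.
have := hN n.+1 (ltac:(lia)); rewrite Rabs_pos_eq; last by apply: pow_le; lra.
move=> h2; have e0 := exp_pos (Cmod z).
have -> : eps = eps / exp (Cmod z) * exp (Cmod z) by field; lra.
apply: Rmult_lt_compat_r => //; lra.
Qed.

Lemma ana_GK A b k T : kbounded A b k -> 0 < T -> ana (fun t => GK k (RtoC t)) T.
Proof.
move=> hk hT; have [a ha] := GK_analytic hk hT; exists (T / 4), a; split=> //; lra.
Qed.

Lemma ana_affineE f g u v x : u <> 0 -> (forall y, g y = f (u * y + v)) -> ana f (u * x + v) -> ana g x.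
Proof.
move=> hu E h; apply: (@ana_ext _ _ x 1 _ _ (ana_affine hu h)); first lra.
by move=> y _; rewrite E.
Qed.

Lemma ana_HB al T : 0 < al < 1 -> T <> 0 -> ana (fun t => HB al (RtoC t)) T.
Proof.
move=> ha hT; have [hp|hn] := Rlt_or_le 0 T.
  apply: (@ana_ext _ (fun t => 2 * mu8 * GK (kern al) (RtoC t))%C T T) => // [y hy|].
    have y0 : 0 < y by have := Rabs_def2 _ _ hy; lra.
    by rewrite /HB /=; case: Rlt_dec.
  exact: ana_scal (ana_GK (kbounded_kern ha) hp).
have {}hn : 0 < - T by lra.
apply: (@ana_ext _ (fun t => -1 * (2 * Cconj (mu8 * GK (kern al) (RtoC (- t)))))%C T (- T)) => // [y hy|].
  have y0 : y < 0 by have := Rabs_def2 _ _ hy; lra.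
  rewrite /HB /=; case: Rlt_dec => h; first lra.
  have -> : (- Cconj (RtoC y) = RtoC (- y))%C by apply: Ceq => /=; ring.
  rewrite -[RHS]/(- (2 * Cconj (mu8 * GK (kern al) (RtoC (- y)))))%C; ring.
apply: ana_scal; apply: ana_scal; apply: ana_conj; apply: ana_scal.
apply: (@ana_affineE (fun t => GK (kern al) (RtoC t)) _ (-1) 0); [lra | move=> y; congr (GK _ (RtoC _)); ring |].
have -> : -1 * T + 0 = - T by ring.
exact: ana_GK (kbounded_kern ha) hn.
Qed.

(** The even part of [gM] solves the homogeneous equation, so the function T^(-1/2) exp(-pi i s^2/T)
    is itself a Gaussian integral in T. Its analyticity then follows from that of [GK] and needs no
    composition with 1/T. *)
Lemma gauss_kernel s T : 0 < T ->
  (RtoC (/ sqrt T) * qE (- / RtoC T) s = / (2 * gA 1) * GK (fun y => Cexp (RtoC y * (RtoC s * lam)) + Cexp (RtoC y * (RtoC (- s) * lam))) (RtoC T))%C.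
Proof.
move=> hT; have hp := PI_RGT_0.
wlog hs : s / 0 <= s => [W|].
  have [h|h] := Rle_or_lt 0 s; first exact: W.
  rewrite -qE_opp W; last lra.
  by congr Cmult; rewrite Ropp_involutive; congr (II _); apply: FunctionalExtensionality.functional_extensionality => y; rewrite Cplus_comm.
have rT : 0 < Re (RtoC PI * RtoC T) by rewrite Re_PI_mul /=; nra.
set a := (RtoC PI * RtoC T)%C in rT.
have dY t : is_derive (fun t => gM a lam t + gM a lam (- t) : CV)%C t (lam * lam / (2 * a) * (RtoC t * (gM a lam t + gM a lam (- t))))%C.
  have H := is_derive_plus (V := CV) _ _ _ _ _ (gM_derive lam t rT) (gM_derive_opp lam t rT).
  have -> : (lam * lam / (2 * a) * (RtoC t * (gM a lam t + gM a lam (- t))) = ((lam / (2 * a) + lam * lam / (2 * a) * (t * gM a lam t)) +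
     (- (lam / (2 * a)) + lam * lam / (2 * a) * (t * gM a lam (- t)%coqR))))%C by ring.
  exact: H.
have Y0 := ode_gauss dY hs.
have -> : GK (fun y => Cexp (RtoC y * (RtoC s * lam)) + Cexp (RtoC y * (RtoC (- s) * lam)))%C (RtoC T) = (gM a lam s + gM a lam (- s))%C.
  have d1 := IIdom_gexp (RtoC s * lam)%C rT; have d2 := IIdom_gexp (RtoC (- s) * lam)%C rT.
  rewrite /gM -(II_plus d1 d2); symmetry; apply: (II_ext (IIdom_plus d1 d2)) => y _.
  by rewrite Cmult_plus_distr_r /gexp -!Cexp_add; congr (Cexp _ + Cexp _)%C; rewrite -/a; ring.
rewrite Y0 Ropp_0.
have g0 : gM a lam 0 = gA (RtoC T) by rewrite /gM /gA Cmult_0_l.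
rewrite g0 (gA_scale hT) /qE.
have Tnz : RtoC T <> 0%C by move=> [] e; lra.
have Pnz : RtoC PI <> 0%C by move=> [] e; lra.
have -> : (lam * lam / (2 * a) / 2 * RtoC (s ^ 2) = RtoC PI * Ci * - / RtoC T * RtoC (s ^ 2))%C.
  have -> : (lam * lam = 4 * RtoC PI * RtoC PI * (Cconj mu8 * Cconj mu8))%C by rewrite /lam; ring.
  rewrite mu8c_sq /a; field; split=> //.
have := gA1_neq0; move: (gA 1) (Cexp _) => G E hG; field => //.
Qed.

Lemma ana_gauss s T : 0 < T -> ana (fun t => RtoC (/ sqrt t) * qE (- / RtoC t) s)%C T.
Proof.
move=> hT; apply: (@ana_ext _ _ T T _ _ (ana_scal (/ (2 * gA 1)) (ana_GK _ hT))) => // [y hy|].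
  by rewrite gauss_kernel //; have := Rabs_def2 _ _ hy; lra.
have l0 := Cmod_ge_0 lam; have s0 := Rabs_pos s.
split; first (instantiate (1 := 2); lra).
  move=> y _; apply: continuous_Cplus; apply: continuous_Cexp; exact: continuous_derive (is_derive_lin _ y).
instantiate (1 := Rabs s * Cmod lam).
have h u y : 0 < y -> Rabs u = Rabs s -> Cmod (Cexp (RtoC y * (RtoC u * lam))) <= exp (Rabs s * Cmod lam * y).
  move=> hy hu; rewrite Cmod_Cexp; apply: exp_le; apply: Rle_trans (Rle_abs _) _; apply: Rle_trans (re_le_Cmod _) _.
  rewrite Cmod_mult (Cmod_mult (RtoC u)) !Cmod_R hu (Rabs_pos_eq y); lra.
move=> y hy; apply: Rle_trans (Cmod_triangle _ _) _.
have := h s y hy erefl; have := h (- s) y hy (Rabs_Ropp s); lra.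
Qed.

(** * Gauss sums and the modular transformation *)

Lemma cis2_add x y : cis2 (x + y) = (cis2 x * cis2 y)%C.
Proof. by rewrite /cis2 -Cexp_add; congr Cexp; rewrite RtoC_plus; ring. Qed.

Lemma cis2_0 : cis2 0 = RtoC 1.
Proof. by rewrite /cis2 Cmult_0_r Cexp_0. Qed.

Lemma cis2_Cis x : cis2 x = Cis (2 * PI * x).
Proof. by rewrite /cis2 -Cexp_iR; congr Cexp; rewrite (RtoC_mult _ x) (RtoC_mult 2); ring. Qed.

Lemma cis2_neq0 x : cis2 x <> RtoC 0.
Proof. exact: Cexp_neq0. Qed.

Lemma cis2_zr k : cis2 (zr k) = RtoC 1.
Proof.
have h n : cis2 (INR n) = RtoC 1.
  rewrite cis2_Cis /Cis -[2 * PI * INR n]Rplus_0_l (_ : 2 * PI * INR n = 2 * INR n * PI); last by ring.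
  by rewrite cos_period sin_period cos_0 sin_0; ring.
case: k => n; first by rewrite zr_Posz.
rewrite zr_Negz -S_INR.
have : (cis2 (- INR n.+1) * cis2 (INR n.+1) = 1)%C by rewrite -cis2_add Rplus_opp_l cis2_0.
by rewrite h Cmult_1_r.
Qed.

Lemma cis2_addz x y k : y = x + zr k -> cis2 y = cis2 x.
Proof. by move=> ->; rewrite cis2_add cis2_zr Cmult_1_r. Qed.

Lemma cis2_neq1 x : 0 < x < 1 -> cis2 x <> RtoC 1.
Proof.
move=> hx; have hp := PI_RGT_0.
have s0 : 0 < sin (PI * x) by apply: sin_gt_0; nra.
have E : Re (cis2 x) = 1 - 2 * sin (PI * x) * sin (PI * x).
  by rewrite cis2_Cis /Cis !ReImE -cos_2a_sin (_ : 2 * (PI * x) = 2 * PI * x) /=; ring.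
by move=> h; move: E; rewrite h /=; nra.
Qed.

Lemma big_shift (f : int -> C) (K : nat) h : (forall m, f (m + Posz K)%R = f m) ->
  \big[Cplus/RtoC 0]_(s <- iota 0 K) f (Posz s + h)%R = \big[Cplus/RtoC 0]_(s <- iota 0 K) f (Posz s).
Proof.
have S1 (g : int -> C) : (forall m, g (m + Posz K)%R = g m) ->
   \big[Cplus/RtoC 0]_(s <- iota 0 K) g (Posz s + 1)%R = \big[Cplus/RtoC 0]_(s <- iota 0 K) g (Posz s).
  move=> hg; have T n : (\big[Cplus/RtoC 0]_(j <- iota 0 n) g (Posz j + 1)%R + g (Posz 0) = \big[Cplus/RtoC 0]_(j <- iota 0 n) g (Posz j) + g (Posz n))%C.
    elim: n => [|n IH]; first by rewrite !big_nil.
    rewrite !bigC_iotaS -PoszD addn1.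
    have -> (x y z : C) : (x + y + z = (x + z) + y)%C by ring.
    by rewrite IH; ring.
  have := T K; have -> : g (Posz K) = g (Posz 0) by rewrite -(hg (Posz 0)) add0r.
  set X := \big[_/_]_(_ <- _) _; set Y := \big[_/_]_(_ <- _) _; move: (g _) => z E.
  transitivity (X + z - z)%C; first ring.
  by rewrite E; ring.
have Sn (n : nat) (g : int -> C) : (forall m, g (m + Posz K)%R = g m) ->
   \big[Cplus/RtoC 0]_(s <- iota 0 K) g (Posz s + Posz n)%R = \big[Cplus/RtoC 0]_(s <- iota 0 K) g (Posz s).
  move=> hg; elim: n => [|n IH]; first by apply: eq_bigr => s _; rewrite addr0.
  rewrite -IH -[RHS](S1 (fun m => g (m + Posz n)%R)); last by move=> m; rewrite addrAC hg.
  by apply: eq_bigr => s _; congr g; lia.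
move=> hf; case: h => n; first exact: Sn.
rewrite -(Sn n.+1 (fun m => f (m + Negz n)%R)); last by move=> m; rewrite addrAC hf.
by apply: eq_bigr => s _; congr f; lia.
Qed.

Lemma periodic_int (f : int -> C) (Q : nat) : (forall m, f (m + Posz Q)%R = f m) ->
  forall (k n : int), f (n + k * Posz Q)%R = f n.
Proof.
move=> h [k|k] n; first by rewrite -PoszM (periodic_mul k n h).
rewrite -(periodic_mul k.+1 _ h); congr f; rewrite NegzE; lia.
Qed.

Lemma bigC_const (I : Type) (s : seq I) (z : C) : \big[Cplus/RtoC 0]_(i <- s) z = (RtoC (INR (size s)) * z)%C.
Proof.
elim: s => [|i s IH]; first by rewrite big_nil Cmult_0_l.
rewrite big_cons IH -[size (i :: s)]/(size s).+1 S_INR RtoC_plus; ring.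
Qed.

Lemma root_sum (n : nat) (s : int) : (0 < n)%N ->
  \big[Cplus/RtoC 0]_(k <- iota 0 n) cis2 (zr (Posz k) * (zr s / INR n)) = if (Posz n %| s)%Z then RtoC (INR n) else RtoC 0.
Proof.
move=> hn; have n0 : 0 < INR n by apply: lt_0_INR; lia.
case: ifP => [/dvdzP [q ->]|ndiv].
  transitivity (\big[Cplus/RtoC 0]_(k <- iota 0 n) RtoC 1).
    apply: eq_bigr => k _; rewrite (@cis2_addz 0 _ (Posz k * q)%R) ?cis2_0 //.
    by rewrite !zrM zr_Posz (zr_Posz n); field; lra.
  by rewrite bigC_const size_iota Cmult_1_r.
pose f (m : int) := cis2 (zr m * (zr s / INR n)).
have fper m : f (m + Posz n)%R = f m.
  by apply: (@cis2_addz _ _ s); rewrite zrD (zr_Posz n); field; lra.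
have E := big_shift 1%R fper.
have fS m : f (m + 1)%R = (cis2 (zr s / INR n) * f m)%C.
  by rewrite /f -cis2_add zrD (zr_Posz 1); congr cis2; rewrite [INR 1]/=; ring.
have {}E : (cis2 (zr s / INR n) * \big[Cplus/RtoC 0]_(k <- iota 0 n) f (Posz k) = \big[Cplus/RtoC 0]_(k <- iota 0 n) f (Posz k))%C.
  rewrite -{2}E -bigC_scal; apply: eq_bigr => k _; by rewrite fS.
have nz : (cis2 (zr s / INR n) - 1)%C <> 0%C.
  pose r := (s %% Posz n)%Z.
  have nn0 : Posz n != 0%R by lia.
  have r1 : (0 <= r)%R by exact: modz_ge0.
  have r2 : (r < Posz n)%R by apply: ltz_pmod.
  have r3 : r != 0%R by rewrite /r; apply: contraFneq ndiv => h; apply/dvdz_mod0P.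
  have -> : cis2 (zr s / INR n) = cis2 (zr r / INR n).
    apply: (@cis2_addz _ _ (s %/ Posz n)%Z); rewrite {1}(divz_eq s (Posz n)) zrD zrM (zr_Posz n) -/r; field; lra.
  have [m em] : exists m : nat, r = Posz m by case: (r) r1 => // m; exists m.
  rewrite em zr_Posz => h.
  have m0 : 0 < INR m by apply: lt_0_INR; lia.
  have m1 : INR m < INR n by apply: lt_INR; lia.
  apply: (@cis2_neq1 (INR m / INR n)).
    split; first exact: Rdiv_lt_0_compat.
    by apply: (Rmult_lt_reg_r (INR n)) => //; rewrite /Rdiv Rmult_assoc Rinv_l; lra.
  have -> : (cis2 (INR m / INR n) = (cis2 (INR m / INR n) - 1) + 1)%C by ring.
  by rewrite h; ring.
rewrite -[LHS]/(\big[Cplus/RtoC 0]_(k <- iota 0 n) f (Posz k)).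
set X := \big[_/_]_(_ <- _) _ in E *.
have : ((cis2 (zr s / INR n) - 1) * X = 0)%C by rewrite -[RHS](Cplus_opp_r X) -{2}E; ring.
by move=> h; case: (Classical_Prop.classic (X = RtoC 0)) => // hx; case: (Cmult_neq_0 _ _ nz hx).
Qed.

Lemma is_sum_residues (f : int -> C) (K : nat) (l : nat -> C) : (0 < K)%N ->
  (forall s, (s < K)%N -> is_sum_over TT (fun j : int => f (Posz s + j * Posz K)%R) (l s)) ->
  is_sum_over TT f (\big[Cplus/RtoC 0]_(s <- iota 0 K) l s).
Proof.
move=> hK h.
pose fs (s : nat) (n : int) := if (n %% Posz K)%Z == Posz s then f n else RtoC 0.
have H : is_sum_over TT (fun n => \big[Cplus/RtoC 0]_(s <- iota 0 K) fs s n) (\big[Cplus/RtoC 0]_(s <- iota 0 K) l s).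
  apply: is_sum_over_big => s; rewrite mem_iota add0n => /andP [_ hs].
  apply: (is_sum_over_reindex (h := fun j : int => (Posz s + j * Posz K)%R) (P' := TT)) => //.
  - move=> j j' _ _; nia.
  - move=> n _; rewrite /fs; case: eqP => // e _; exists (n %/ Posz K)%Z => //.
    by rewrite -e addrC -divz_eq.
  apply: is_sum_over_ext (h s hs) => j _; rewrite /fs addrC modzMDl modz_small ?eqxx //; lia.
apply: is_sum_over_ext H => n _.
have [r er rK] : exists2 r : nat, (n %% Posz K)%Z = Posz r & (r < K)%N.
  have r1 : (0 <= n %% Posz K)%Z%R by apply: modz_ge0; lia.
  have r2 : (n %% Posz K < Posz K)%Z%R by apply: ltz_pmod.
  by case: (n %% Posz K)%Z r1 r2 => // r _ hr; exists r.
have ir : r \in iota 0 K by rewrite mem_iota; lia.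
rewrite (bigD1_seq r ir (iota_uniq _ _)) /=.
rewrite big1 => [|s hs]; last by rewrite /fs er eqz_nat eq_sym (negbTE hs).
by rewrite /fs er eqxx Cplus_0_r.
Qed.

Lemma is_sum_odd (f : int -> C) : summable TT f -> (forall n, f (- n)%R = - f n)%C -> is_sum_over TT f (RtoC 0).
Proof.
move=> /summable_sum [l hl] hodd.
have h2 : is_sum_over TT f ((-1) * l)%C.
  apply: (is_sum_over_reindex (h := fun n : int => (- n)%R) (P' := TT)) => //.
  - by move=> y y' _ _ /oppr_inj.
  - by move=> x _ _; exists (- x)%R => //; rewrite opprK.
  by apply: is_sum_over_ext (is_sum_over_scal (-1)%C hl) => n _; rewrite hodd; ring.
have E := is_sum_over_unique hl h2.
have l0 : l = RtoC 0.
  have : (2 * l = l - (-1) * l)%C by ring.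
  rewrite -E => e; have : (/2 * (2 * l) = 0)%C by rewrite e; ring.
  by rewrite Cmult_assoc Cinv_l ?Cmult_1_l // => [] [] ?; lra.
by rewrite -l0.
Qed.

Lemma Cmod_cis2 x : Cmod (cis2 x) = 1.
Proof. by rewrite /cis2 Cmod_Cexp !ReImE -[RHS]exp_0 /=; congr exp; ring. Qed.

Lemma psiT_summable al t : 0 < Im t -> summable TT (psiT al t).
Proof.
move=> ht.
have hb n : Cmod (RtoC (sg n) * cis2 (zr n * al)) <= 1.
  by rewrite Cmod_mult Cmod_cis2 Cmod_R Rmult_1_r; exact: sg_bound.
have [X hX] := @qE_int_summable _ t 1 0 ht hb.
by exists X => u uu pu; apply: Rle_trans (hX u uu pu); apply: bigR_le => n _; rewrite /psiT Rplus_0_r; exact: Rle_refl.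
Qed.

Section GaussSums.
Variables (p K : nat) (a b c d a' b' c' d' s0 : int).
Hypotheses (hp : (0 < p)%N) (hc : c != 0%R) (det1 : (a * d - b * c)%R = 1%R)
  (ha : a = (1 + Posz (4 * p) * a')%R) (hb : b = (Posz (4 * p) * b')%R)
  (hc' : c = (Posz (4 * p) * c')%R) (hd : d = (1 + Posz (4 * p) * d')%R)
  (hs : s0 = 1%R \/ s0 = (-1)%R) (hK : Posz K = (Posz (2 * p) * (s0 * c))%R).

(** The phase of exp(pi i n^2 tau/2p) at the cusp tau = a/c. Here [s0] is the sign of c and K = 2 p
    |c| is a period of the phase. *)
Definition ea (n : int) : C := cis2 (zr a * zr n ^ 2 / (4 * INR p * zr c)).
Definition g0 : C := \big[Cplus/RtoC 0]_(s <- iota 0 K) ea (Posz s).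

Let P0 : 0 < INR p.
Proof. by apply: lt_0_INR; lia. Qed.
Let c0 : zr c <> 0.
Proof. by move=> h; move: hc; rewrite (zr_inj (h : zr c = zr 0)). Qed.
Let zs : zr s0 * zr s0 = 1.
Proof. by case: hs => ->; rewrite -zrM. Qed.
Let zdet : zr a * zr d - zr b * zr c = 1.
Proof. by rewrite -!zrM /Rminus -zrN -zrD det1. Qed.
Let zK : INR K = 2 * INR p * zr s0 * zr c.
Proof. by rewrite -zr_Posz hK !zrM zr_Posz mult_INR /=; ring. Qed.
Let z4 x : zr (Posz (4 * p) * x)%R = 4 * INR p * zr x.
Proof. by rewrite zrM zr_Posz mult_INR /=; ring. Qed.
Let K0 : INR K <> 0.
Proof.
rewrite zK => /Rmult_integral [/Rmult_integral [|h]|] //; first lra.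
by have := zs; rewrite h; lra.
Qed.
Let Kpos : (0 < K)%N.
Proof. by case: K K0 => // h; case: h. Qed.
Let s00 : zr s0 <> 0.
Proof. by move=> h; have := zs; rewrite h; lra. Qed.

Lemma ea_periodic n : ea (n + Posz K)%R = ea n.
Proof.
apply: (@cis2_addz _ _ (a * s0 * n + a * Posz p * c)%R).
rewrite !zrD !zrM !zr_Posz zK.
have -> : zr a * (zr n + 2 * INR p * zr s0 * zr c) ^ 2 / (4 * INR p * zr c) =
  zr a * zr n ^ 2 / (4 * INR p * zr c) + (zr a * zr s0 * zr n + zr a * INR p * zr c * (zr s0 * zr s0)) by field; split=> //; lra.
by rewrite zs Rmult_1_r.
Qed.

Lemma ea_shift n : ea (n + c)%R = (ea n * cis2 (zr n / (2 * INR p)))%C.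
Proof.
rewrite /ea -cis2_add; apply: (@cis2_addz _ _ (2 * a' * n + a * c')%R).
have Ea : zr a = 1 + 4 * INR p * zr a' by rewrite ha zrD z4.
have Ec : zr c = 4 * INR p * zr c' by rewrite {1}hc' z4.
rewrite !zrD !zrM.
have -> : zr a * (zr n + zr c) ^ 2 / (4 * INR p * zr c) = zr a * zr n ^ 2 / (4 * INR p * zr c) + zr n * zr a / (2 * INR p) + zr a * zr c / (4 * INR p).
  by field; split=> //; lra.
have -> : zr a * zr c / (4 * INR p) = zr a * zr c' by rewrite Ec; field; lra.
have -> : zr n * zr a / (2 * INR p) = zr n / (2 * INR p) + 2 * zr a' * zr n by rewrite Ea; field; lra.
by rewrite (_ : zr 2 = 2) //; ring.
Qed.

(* Shifting s by c multiplies e_a(s) by the root of unity exp(pi i s / p), so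
   only the residue class 0 modulo 2p contributes. *)
Lemma gauss_sum (psi : int -> C) : (forall n, psi (n + Posz (2 * p))%R = psi n) ->
  \big[Cplus/RtoC 0]_(s <- iota 0 K) (psi (Posz s) * ea (Posz s))%C = (psi 0%R * g0)%C.
Proof.
have main (f : int -> C) : (forall n, f (n + Posz (2 * p))%R = f n) ->
    (RtoC (INR (2 * p)) * \big[Cplus/RtoC 0]_(s <- iota 0 K) (f (Posz s) * ea (Posz s)) =
    \big[Cplus/RtoC 0]_(s <- iota 0 K) (f (Posz s) * ea (Posz s) * if (Posz (2 * p) %| Posz s)%Z then RtoC (INR (2 * p)) else RtoC 0))%C.
  move=> hf.
  have fK n : f (n + Posz K)%R = f n.
    by rewrite hK [(Posz (2 * p) * _)%R]mulrC; exact: periodic_int.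
  have St k : \big[Cplus/RtoC 0]_(s <- iota 0 K) (f (Posz s) * ea (Posz s) * cis2 (zr (Posz k) * (zr (Posz s) / INR (2 * p))))%C =
      \big[Cplus/RtoC 0]_(s <- iota 0 K) (f (Posz s) * ea (Posz s))%C.
    elim: k => [|k IH].
      by apply: eq_bigr => s _; rewrite Rmult_0_l cis2_0 Cmult_1_r.
    pose h (n : int) := (f n * ea n * cis2 (zr (Posz k) * (zr n / INR (2 * p))))%C.
    have hper n : h (n + Posz K)%R = h n.
      rewrite /h fK ea_periodic; congr (_ * _)%C; apply: (@cis2_addz _ _ (Posz k * s0 * c)%R).
      by rewrite zrD !zrM (zr_Posz K) zK mult_INR /=; field; lra.
    rewrite -IH -[RHS](big_shift c hper); apply: eq_bigr => s _.
    rewrite /h ea_shift (_ : f (Posz s + c)%R = f (Posz s)); last first.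
      rewrite {1}hc' (_ : (Posz (4 * p) * c')%R = (2 * c' * Posz (2 * p))%R); last by lia.
      exact: periodic_int.
    have -> : cis2 (zr (Posz k) * (zr (Posz s + c)%R / INR (2 * p))) = cis2 (zr (Posz k) * (zr (Posz s) / INR (2 * p))).
      apply: (@cis2_addz _ _ (2 * Posz k * c')%R).
      by rewrite zrD {1}hc' z4 !zrM mult_INR (_ : zr 2 = 2) //=; field; lra.
    have -> : cis2 (zr (Posz k.+1) * (zr (Posz s) / INR (2 * p))) = (cis2 (zr (Posz s) / (2 * INR p)) * cis2 (zr (Posz k) * (zr (Posz s) / INR (2 * p))))%C.
      rewrite -cis2_add; congr cis2; rewrite (zr_Posz k.+1) S_INR zr_Posz (zr_Posz k) mult_INR [INR 2]/=; field; lra.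
    ring.
  transitivity (\big[Cplus/RtoC 0]_(k <- iota 0 (2 * p)) \big[Cplus/RtoC 0]_(s <- iota 0 K) (f (Posz s) * ea (Posz s) * cis2 (zr (Posz k) * (zr (Posz s) / INR (2 * p))))%C).
    by rewrite (eq_bigr _ (fun k _ => St k)) bigC_const size_iota.
  rewrite exchange_big; apply: eq_bigr => s _ /=.
  by rewrite bigC_scal root_sum //; lia.
move=> hpsi.
have nz : RtoC (INR (2 * p)) <> RtoC 0 by move/RtoC_inj; apply: not_0_INR; lia.
have canc (x y : C) : (RtoC (INR (2 * p)) * x = RtoC (INR (2 * p)) * y -> x = y)%C.
  move=> h; transitivity (/ RtoC (INR (2 * p)) * (RtoC (INR (2 * p)) * x))%C; first by field.
  by rewrite h; field.
apply: canc; rewrite (main psi hpsi).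
have -> : (RtoC (INR (2 * p)) * (psi 0%R * g0) = psi 0%R * (RtoC (INR (2 * p)) * g0))%C by ring.
have E1 : g0 = \big[Cplus/RtoC 0]_(s <- iota 0 K) (RtoC 1 * ea (Posz s))%C by apply: eq_bigr => s _; rewrite Cmult_1_l.
rewrite E1 (main (fun=> RtoC 1)) // -bigC_scal; apply: eq_bigr => s _.
case: ifP => [/dvdzP [q hq]|_]; last by ring.
have -> : psi (Posz s) = psi 0%R by rewrite hq -[(q * _)%R]add0r periodic_int.
ring.
Qed.

(** Since ad = 1 + bc, shifting s by u = s0 d m completes the square and absorbs the linear phase.
    [gauss_sum] then keeps only the class 0, where the shifted [phi] has argument - s0 d m,
    congruent to - s0 m modulo 2p. *)
Lemma gauss_bracket (phi : int -> C) (m : int) : (forall n, phi (n + Posz (2 * p))%R = phi n) ->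
  (cis2 (zr d * zr m ^ 2 / (4 * INR p * zr c)) *
   \big[Cplus/RtoC 0]_(s <- iota 0 K) (phi (Posz s) * ea (Posz s) * cis2 (zr m * (zr (Posz s) / INR K))))%C = (phi (- (s0 * m))%R * g0)%C.
Proof.
move=> hphi.
pose u := (s0 * d * m)%R.
have phiK k n : phi (n + k * Posz (2 * p))%R = phi n by exact: periodic_int.
pose f n := (phi (n - u)%R * ea n)%C.
have fper n : f (n + Posz K)%R = f n.
  rewrite /f ea_periodic hK; congr Cmult.
  by rewrite -[RHS](phiK (s0 * c)%R); congr phi; lia.
have E := big_shift u fper.
have -> : (phi (- (s0 * m))%R * g0)%C = \big[Cplus/RtoC 0]_(s <- iota 0 K) f (Posz s).
  rewrite (@gauss_sum (fun n => phi (n - u)%R)) => [|n]; last by rewrite -[in RHS](hphi (n - u)%R); congr phi; lia.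
  congr Cmult; rewrite -[LHS](phiK (- (2 * d' * s0 * m))%R); congr phi.
  rewrite /u hd; lia.
rewrite -E -bigC_scal; apply: eq_bigr => s _.
rewrite /f addrK.
suff -> : ea (Posz s + u)%R = (cis2 (zr d * zr m ^ 2 / (4 * INR p * zr c)) * (ea (Posz s) * cis2 (zr m * (zr (Posz s) / INR K))))%C by ring.
rewrite /ea -!cis2_add.
apply: (@cis2_addz _ _ (2 * b' * s0 * Posz s * m + b' * d * m * m)%R).
have Eb : zr b = 4 * INR p * zr b' by rewrite hb z4.
rewrite zK !zrD !zrM (_ : zr 2 = 2) // (zr_Posz s).
have -> : zr a * (INR s + zr s0 * zr d * zr m) ^ 2 / (4 * INR p * zr c) =
   zr a * INR s ^ 2 / (4 * INR p * zr c) + (zr a * zr d) * (2 * zr s0 * INR s * zr m + zr d * zr m ^ 2 * (zr s0 * zr s0)) / (4 * INR p * zr c).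
  by field; split=> //; lra.
have -> : zr m * (INR s / (2 * INR p * zr s0 * zr c)) = zr s0 * zr m * INR s / (2 * INR p * zr c).
  transitivity ((zr s0 * zr s0) * (zr m * (INR s / (2 * INR p * zr s0 * zr c)))); first by rewrite zs; ring.
  by field; repeat split => //; lra.
rewrite zs (_ : zr a * zr d = 1 + zr b * zr c); last by lra.
rewrite Eb; field; repeat split=> //; lra.
Qed.

(** If the Gauss sum vanished, [gauss_bracket] would annihilate every finite Fourier coefficient of
    [ea], and Fourier inversion at 0 would give K = 0. *)
Lemma g0_neq0 : g0 <> RtoC 0.
Proof.
move=> h.
have E m : \big[Cplus/RtoC 0]_(s <- iota 0 K) (ea (Posz s) * cis2 (zr m * (zr (Posz s) / INR K)))%C = RtoC 0.
  have := @gauss_bracket (fun=> RtoC 1) m (fun=> erefl); rewrite h Cmult_0_r => H.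
  have nz := @cis2_neq0 (zr d * zr m ^ 2 / (4 * INR p * zr c)).
  have {}H : (cis2 (zr d * zr m ^ 2 / (4 * INR p * zr c)) * \big[Cplus/RtoC 0]_(s <- iota 0 K) (ea (Posz s) * cis2 (zr m * (zr (Posz s) / INR K))))%C = RtoC 0.
    by rewrite -[RHS]H; congr Cmult; apply: eq_bigr => s _; rewrite Cmult_1_l.
  set X := \big[_/_]_(_ <- _) _ in H *.
  by case: (Classical_Prop.classic (X = RtoC 0)) => // hx; case: (Cmult_neq_0 _ _ nz hx).
have : \big[Cplus/RtoC 0]_(m <- iota 0 K) \big[Cplus/RtoC 0]_(s <- iota 0 K) (ea (Posz s) * cis2 (zr (Posz m) * (zr (Posz s) / INR K)))%C = RtoC (INR K).
  rewrite exchange_big /=.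
  have Es s : \big[Cplus/RtoC 0]_(m <- iota 0 K) (ea (Posz s) * cis2 (zr (Posz m) * (zr (Posz s) / INR K)))%C =
     (ea (Posz s) * if (Posz K %| Posz s)%Z then RtoC (INR K) else RtoC 0)%C by rewrite bigC_scal root_sum.
  rewrite (eq_bigr _ (fun s _ => Es s)).
  have i0 : 0%N \in iota 0 K by rewrite mem_iota; lia.
  rewrite (bigD1_seq 0%N i0 (iota_uniq _ _)) big1_seq => [|s].
    rewrite dvdz0 /ea (_ : zr a * zr (Posz 0) ^ 2 / (4 * INR p * zr c) = 0) ?cis2_0.
      by rewrite Cmult_1_l; exact: Cplus_0_r.
    by rewrite (zr_Posz 0) [INR 0]/=; field; split => //; lra.
  move=> /andP [s1]; rewrite mem_iota => s2.
  case: ifP => [|_]; last by ring.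
  rewrite dvdzE !absz_nat => hdv; have sp : (0 < s)%N by rewrite lt0n.
  by have := dvdn_leq sp hdv; lia.
rewrite big1 => [|m _]; last exact: E.
by move/RtoC_inj => h0; apply: K0.
Qed.

(** The partial fraction a/c - 1/(c (c tau + d)), scaled so that -1/t occurs with the square of the
    period K. *)
Lemma moebius_div (tau t : C) : (RtoC (zr c) * tau + RtoC (zr d))%C <> RtoC 0 ->
  t = ((RtoC (zr c) * tau + RtoC (zr d)) / RtoC (2 * INR p * zr c)%coqR)%C ->
  ((RtoC (zr a) * tau + RtoC (zr b)) / (RtoC (zr c) * tau + RtoC (zr d)) / RtoC (2 * INR p)%coqR =
   RtoC (zr a / (2 * INR p * zr c))%coqR + - / t / (RtoC (INR K) * RtoC (INR K)))%C.
Proof.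
set j := (RtoC (zr c) * tau + RtoC (zr d))%C => jnz et.
have [D DE] : exists D, D = 2 * INR p by exists (2 * INR p).
have cnz : RtoC (zr c) <> RtoC 0 by move/RtoC_inj.
have Dnz : RtoC D <> RtoC 0 by move/RtoC_inj; lra.
have K2 : (RtoC (INR K) * RtoC (INR K) = RtoC D * RtoC D * RtoC (zr c) * RtoC (zr c))%C.
  rewrite -!RtoC_mult; congr RtoC; rewrite zK DE.
  by transitivity (2 * INR p * (2 * INR p) * zr c * zr c * (zr s0 * zr s0)); [ring | rewrite zs; ring].
have cdet : (RtoC (zr a) * RtoC (zr d) - RtoC (zr b) * RtoC (zr c) = 1)%C by rewrite -!RtoC_mult -RtoC_minus zdet.
rewrite -DE in et *.
rewrite K2 et RtoC_div; last by apply: Rmult_integral_contrapositive_currified => //; lra.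
rewrite (RtoC_mult D).
transitivity ((RtoC (zr a) * j - 1) / (RtoC D * RtoC (zr c) * j))%C; last by field.
by rewrite -cdet /j; field.
Qed.

Lemma qE_moebius (tau t : C) n : (RtoC (zr c) * tau + RtoC (zr d))%C <> RtoC 0 ->
  t = ((RtoC (zr c) * tau + RtoC (zr d)) / RtoC (2 * INR p * zr c)%coqR)%C ->
  qE ((RtoC (zr a) * tau + RtoC (zr b)) / (RtoC (zr c) * tau + RtoC (zr d)) / RtoC (2 * INR p)%coqR) (zr n) =
  (ea n * qE (- / t) (zr n / INR K))%C.
Proof.
move=> jnz et; rewrite (moebius_div jnz et) qE_add; congr Cmult.
  rewrite /qE /ea /cis2; congr Cexp.
  rewrite (_ : zr a * zr n ^ 2 / (4 * INR p * zr c) = / 2 * (zr a / (2 * INR p * zr c)) * zr n ^ 2); last by field; split=> //; lra.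
  rewrite (RtoC_mult _ (zr n ^ 2)) (RtoC_mult (/ 2)) RtoC_inv; last lra.
  by field => [] [] ?; lra.
have Knz : RtoC (INR K) <> RtoC 0 by move/RtoC_inj.
have tnz : t <> RtoC 0.
  rewrite et => h; apply: jnz.
  have nz : RtoC (2 * INR p * zr c) <> RtoC 0 by move/RtoC_inj; apply: Rmult_integral_contrapositive_currified => //; lra.
  move: h nz; move: (RtoC (_ * zr c)) (_ + _)%C => X Y h nz.
  transitivity (Y / X * X)%C; first by field.
  by rewrite h; ring.
have Kp : 0 < INR K by apply: lt_0_INR; lia.
rewrite /qE; congr Cexp.
rewrite (_ : (zr n / INR K) ^ 2 = zr n ^ 2 / (INR K * INR K)) ?RtoC_div; [|nra|by field].
by rewrite (RtoC_mult (INR K) (INR K)); field.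
Qed.

(** Writing n = s + K j at the image of tau yields series Phi with al = s/K at -1/t. The summation
    formula relates each to a series Psi at t, and [gauss_bracket] resums these to the false theta
    function at tau. The class s = 0 drops out on both sides by oddness, so al stays strictly
    between 0 and 1. *)
Lemma modular_FT (phi : int -> C) B (tau t : C) : (forall n, phi (n + Posz (2 * p))%R = phi n) ->
  (forall n, Cmod (phi n) <= B) -> 0 < Im tau ->
  t = ((RtoC (zr c) * tau + RtoC (zr d)) / RtoC (2 * INR p * zr c)%coqR)%C -> Re t <> 0 ->
  (- RtoC (zr s0) * g0 * FT (2 * INR p) (fun n => RtoC (sg n) * phi n) tau =
   kap t * FT (2 * INR p) (fun n => RtoC (sg n) * phi n)
       ((RtoC (zr a) * tau + RtoC (zr b)) / (RtoC (zr c) * tau + RtoC (zr d))) +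
   \big[Cplus/RtoC 0]_(s <- iota 1 K.-1) (phi (Posz s) * ea (Posz s) * HB (INR s / INR K) t))%C.
Proof.
move=> hphi hB hi et rt.
have D0 : 0 < 2 * INR p by lra.
have B0 : 0 <= B by have := hB (Posz 0); have := Cmod_ge_0 (phi (Posz 0)); lra.
have [D DE] : exists D, D = 2 * INR p by exists (2 * INR p).
rewrite -DE in D0 et *.
pose cf n := (RtoC (sg n) * phi n)%C.
have cb n : Cmod (cf n) <= B.
  rewrite /cf Cmod_mult Cmod_R; have := sg_bound n; have := hB n; have := Cmod_ge_0 (phi n); have := Rabs_pos (sg n); nra.
have Kp : 0 < INR K by apply: lt_0_INR; lia.
set j := (RtoC (zr c) * tau + RtoC (zr d))%C in et *.
have cnz : RtoC (zr c) <> RtoC 0 by move/RtoC_inj.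
have Dnz : RtoC D <> RtoC 0 by move/RtoC_inj; lra.
have Knz : RtoC (INR K) <> RtoC 0 by move/RtoC_inj.
have jnz : j <> RtoC 0.
  move=> e; have : Im j = 0 by rewrite e.
  rewrite /j Im_plus im_scal_l im_RtoC Rplus_0_r => /Rmult_integral [|]; [exact: c0 | lra].
have et2 : t = (tau / RtoC D + RtoC (zr d / (D * zr c)))%C.
  rewrite et /j RtoC_div; last by apply: Rmult_integral_contrapositive_currified => //; lra.
  by rewrite (RtoC_mult D); field; split.
have it : 0 < Im t by rewrite et2 Im_plus im_RtoC Rplus_0_r Im_divR //; apply: Rdiv_lt_0_compat.
have tnz : t <> RtoC 0 by move=> e; move: it; rewrite e /=; lra.
set G := ((RtoC (zr a) * tau + RtoC (zr b)) / j)%C.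
have EG : (G / RtoC D = RtoC (zr a / (D * zr c)) + - / t / (RtoC (INR K) * RtoC (INR K)))%C by rewrite DE; apply: moebius_div => //; rewrite -DE.
have iG : 0 < Im G.
  have e1 : Im (G / RtoC D) = Im (- / t) / (INR K * INR K).
    by rewrite EG Im_plus im_RtoC Rplus_0_l -RtoC_mult Im_divR //; nra.
  have e2 : 0 < Im (- / t) / (INR K * INR K) by apply: Rdiv_lt_0_compat; [exact: Im_Cinv_opp | nra].
  rewrite Im_divR // in e1.
  have -> : Im G = Im G / D * D by field; lra.
  by rewrite e1; apply: Rmult_lt_0_compat.
have qG n : qE (G / RtoC D) (zr n) = (ea n * qE (- / t) (zr n / INR K))%C by rewrite DE; apply: qE_moebius => //; rewrite -DE.
have im' := Im_Cinv_opp it.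
pose P s := sum_over TT (phiT (INR s / INR K) (- / t)).
pose S s := sum_over TT (psiT (INR s / INR K) t).
have hP s : is_sum_over TT (phiT (INR s / INR K) (- / t)) (P s).
  have sm : summable TT (phiT (INR s / INR K) (- / t)).
    by apply: (@qE_int_summable (fun j => RtoC (sgj j)) (- / t)%C 1) => // n; rewrite Cmod_R; exact: sgj_bound.
  by have [l hl] := summable_sum sm; rewrite /P (sum_overE hl).
have hS s : is_sum_over TT (psiT (INR s / INR K) t) (S s).
  by have [l hl] := summable_sum (psiT_summable (INR s / INR K) it); rewrite /S (sum_overE hl).
have Glhs : FT D cf G = \big[Cplus/RtoC 0]_(s <- iota 0 K) (if s is 0%N then RtoC 0 else phi (Posz s) * ea (Posz s) * P s)%C.
  apply: (is_sum_over_unique (FT_sum D0 iG cb)).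
  apply: is_sum_residues => // -[|s] hs0.
    apply: is_sum_odd.
      have hcf n : Cmod (cf (n * Posz K)%R * ea (n * Posz K)%R) <= B by rewrite Cmod_mult Cmod_cis2 Rmult_1_r.
      have [X hX] := @qE_int_summable _ (- / t)%C B 0 im' hcf.
      exists X => u uu pu; apply: Rle_trans (hX u uu pu); apply: bigR_le => n _.
      rewrite /fT add0r qG Cmult_assoc zrM zr_Posz (_ : zr n * INR K / INR K = zr n + 0); last by field.
      exact: Rle_refl.
    move=> n; rewrite /fT !add0r /cf mulNr sg_opp zrN qE_opp.
    have E0 k : phi (k * Posz K)%R = phi 0%R.
      by rewrite hK mulrCA mulrC -[X in phi X]add0r; exact: periodic_int.
    have -> : phi (- (n * Posz K))%R = phi (n * Posz K)%R by rewrite -mulNr !E0.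
    rewrite RtoC_opp; move: (phi _) (qE _ _) (sg _) => x y z; ring.
  apply: is_sum_over_ext (is_sum_over_scal (phi (Posz s.+1) * ea (Posz s.+1))%C (hP s.+1)) => n _.
  rewrite /fT qG /phiT /cf.
  have -> : phi (Posz s.+1 + n * Posz K)%R = phi (Posz s.+1).
    by rewrite hK mulrCA mulrC; exact: periodic_int.
  have -> : ea (Posz s.+1 + n * Posz K)%R = ea (Posz s.+1) by exact: (periodic_int ea_periodic).
  (* For 0 < s < K the sign of s + n K is that of n + s/K, which is why [sgj] counts 0 as
     positive. *)
  have -> : sg (Posz s.+1 + n * Posz K)%R = sgj n.
    case: n => n; first by rewrite -PoszM -PoszD addSn.
    have : (Posz s.+1 + Negz n * Posz K < 0)%R by nia.
    by case: (Posz s.+1 + Negz n * Posz K)%R => k.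
  have -> : zr (Posz s.+1 + n * Posz K)%R / INR K = zr n + INR s.+1 / INR K.
    by rewrite zrD zrM !zr_Posz; field.
  ring.
have Tlhs : (- RtoC (zr s0) * g0 * FT D cf tau)%C = \big[Cplus/RtoC 0]_(s <- iota 0 K) (phi (Posz s) * ea (Posz s) * S s)%C.
  have H : is_sum_over TT (fun m => \big[Cplus/RtoC 0]_(s <- iota 0 K) (phi (Posz s) * ea (Posz s) * psiT (INR s / INR K) t m)%C) (\big[Cplus/RtoC 0]_(s <- iota 0 K) (phi (Posz s) * ea (Posz s) * S s)%C).
    by apply: is_sum_over_big => s _; apply: is_sum_over_scal; exact: hS.
  apply: is_sum_over_unique H.
  (* The substitution n = - s0 m matches the argument at which [gauss_bracket] returns [phi]; it
     also produces the factor - s0 through the oddness of [sg]. *)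
  have H2 : is_sum_over TT (fun m => fT D cf tau (- (s0 * m))%R) (FT D cf tau).
    have ss : (s0 * s0 = 1)%R by case: hs => ->.
    apply: (is_sum_over_reindex (h := fun n : int => (- (s0 * n))%R) (P' := TT)) => //.
    - by move=> y y' _ _ /oppr_inj e; rewrite -[y]mul1r -[y']mul1r -ss -!mulrA e.
    - by move=> x _ _; exists (- (s0 * x))%R => //; rewrite mulrN opprK mulrA ss mul1r.
    apply: is_sum_over_ext (FT_sum D0 hi cb) => m _; by rewrite mulrN opprK mulrA ss mul1r.
  apply: is_sum_over_ext (is_sum_over_scal (- RtoC (zr s0) * g0)%C H2) => m _.
  have -> : \big[Cplus/RtoC 0]_(s <- iota 0 K) (phi (Posz s) * ea (Posz s) * psiT (INR s / INR K) t m)%C =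
     (RtoC (sg m) * qE t (zr m) * \big[Cplus/RtoC 0]_(s <- iota 0 K) (phi (Posz s) * ea (Posz s) * cis2 (zr m * (zr (Posz s) / INR K))))%C.
    by rewrite -bigC_scal; apply: eq_bigr => s _; rewrite /psiT (zr_Posz s); ring.
  have -> : qE t (zr m) = (qE (tau / RtoC D) (zr m) * cis2 (zr d * zr m ^ 2 / (4 * INR p * zr c)))%C.
    rewrite et2 qE_add; congr Cmult; rewrite /qE /cis2; congr Cexp.
    rewrite (_ : zr d * zr m ^ 2 / (4 * INR p * zr c) = / 2 * (zr d / (D * zr c)) * zr m ^ 2); last by rewrite DE; field; split=> //; lra.
    rewrite (RtoC_mult _ (zr m ^ 2)) (RtoC_mult (/ 2)) RtoC_inv; last lra.
    by field => [] [] ?; lra.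
  have := gauss_bracket m hphi; set X := \big[_/_]_(_ <- _) _ => E.
  transitivity (RtoC (sg m) * qE (tau / RtoC D) (zr m) * (phi (- (s0 * m))%R * g0))%C; last by rewrite -E; ring.
  rewrite /fT /cf zrN qE_opp.
  have -> : qE (tau / RtoC D) (zr (s0 * m)%R) = qE (tau / RtoC D) (zr m).
    by case: hs => ->; rewrite ?mul1r // mulN1r zrN qE_opp.
  have -> : (RtoC (sg (- (s0 * m))%R) = - RtoC (zr s0) * RtoC (sg m))%C.
    case: hs => ->; first by rewrite mul1r sg_opp RtoC_opp (_ : zr 1 = 1) //; ring.
    rewrite mulN1r opprK (_ : zr (-1)%R = Ropp 1); last by rewrite zrN.
    by rewrite (RtoC_opp 1); ring.
  have zz : (RtoC (zr s0) * RtoC (zr s0) = 1)%C by rewrite -RtoC_mult zs.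
  transitivity ((RtoC (zr s0) * RtoC (zr s0)) * RtoC (sg m) * qE (tau / RtoC D) (zr m) * (phi (- (s0 * m))%R * g0))%C; first ring.
  by rewrite zz; ring.
rewrite -/(cf) Tlhs Glhs.
have K1 : iota 0 K = 0%N :: iota 1 K.-1 by rewrite -[in LHS](prednK Kpos).
rewrite K1 !big_cons.
have S0 : S 0%N = RtoC 0.
  apply: (is_sum_over_unique (hS 0%N)); apply: is_sum_odd.
    exact: psiT_summable.
  move=> n; rewrite /psiT sg_opp zrN qE_opp (_ : INR 0 / INR K = 0); last by rewrite /=; field.
  by rewrite !Rmult_0_r RtoC_opp; ring.
rewrite S0 Cmult_0_r !Cplus_0_l -bigC_scal.
rewrite -big_split; apply: eq_big_seq => s; rewrite mem_iota => /andP [s1 s2].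
have al : 0 < INR s / INR K < 1.
  have a1 : 0 < INR s by apply: lt_0_INR; lia.
  have a2 : INR s < INR K by apply: lt_INR; lia.
  split; first exact: Rdiv_lt_0_compat.
  by apply: (Rmult_lt_reg_r (INR K)) => //; rewrite /Rdiv Rmult_assoc Rinv_l; lra.
rewrite (core_both rt it al (hS s) (hP s)).
by case: s s1 {s2 al} => // s _ /=; ring.
Qed.

End GaussSums.

(** * Boundary values of the transformation factors on the real axis *)

Lemma at_right0 (P : R -> Prop) r : 0 < r -> (forall u, 0 < u < r -> P u) -> at_right 0 P.
Proof.
move=> r0 h; exists (mkposreal r r0) => u hu u0; apply: h; split=> //.
have : Rabs (u - 0) < r := hu.
by rewrite Rminus_0_r => /Rabs_def2 [].
Qed.

Lemma GK_vertical A b k T : kbounded A b k -> 0 < T ->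
  filterlim (fun u : R => GK k (RtoC T + Ci * RtoC u)%C : CV) (at_right 0) (locally (GK k (RtoC T) : CV)).
Proof.
move=> hk hT; have [m hm] := GK_lip hk hT.
apply/filterlimCP => eps he.
pose r := Rmin (T / 2) (eps / (Rabs m + 1)).
have m0 := Rabs_pos m.
have r0 : 0 < r by apply: Rmin_glb_lt; [lra | apply: Rdiv_lt_0_compat; lra].
apply: (at_right0 r0) => u [u0 hu].
have r1 := Rmin_l (T / 2) (eps / (Rabs m + 1)); have r2 := Rmin_r (T / 2) (eps / (Rabs m + 1)).
rewrite -/r in r1 r2.
have E : Cmod (RtoC T + Ci * RtoC u - RtoC T) = u.
  have -> : (RtoC T + Ci * RtoC u - RtoC T = Ci * RtoC u)%C by ring.
  by rewrite Cmod_mult Cmod_Ci Cmod_R Rmult_1_l Rabs_pos_eq; lra.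
have := hm (RtoC T + Ci * RtoC u)%C; rewrite E => h; apply: Rle_lt_trans (h (ltac:(lra))) _.
have h1 := Rle_abs m.
apply: Rle_lt_trans (_ : (Rabs m + 1) * u < eps); first nra.
have -> : eps = (Rabs m + 1) * (eps / (Rabs m + 1)) by field; lra.
apply: Rmult_lt_compat_l; lra.
Qed.

Lemma filterlim_Cconj (U : Type) (F : (U -> Prop) -> Prop) {FF : Filter F} (f : U -> C) l :
  filterlim (f : U -> CV) F (locally (l : CV)) -> filterlim (fun x => Cconj (f x) : CV) F (locally (Cconj l : CV)).
Proof.
move=> /filterlimCP h; apply/filterlimCP => eps /h; apply: filter_imp => x.
by rewrite -Cminus_conj Cmod_conj.
Qed.

Lemma neg_conj_vert T u : (- Cconj (RtoC T + Ci * RtoC u) = RtoC (- T) + Ci * RtoC u)%C.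
Proof. by apply: Ceq; rewrite /= ; ring. Qed.

Lemma Re_vert T u : Re (RtoC T + Ci * RtoC u)%C = T.
Proof. by rewrite !ReImE /=; ring. Qed.
Lemma Im_vert T u : Im (RtoC T + Ci * RtoC u)%C = u.
Proof. by rewrite !ReImE /=; ring. Qed.

Lemma kapE_pos t : 0 < Re t -> kap t = (- (2 * mu8 * GK (fun=> RtoC 1) t))%C.
Proof.
move=> h; rewrite /kap; case: Rlt_dec => h'; last by case: h'.
exact: (congr1 (fun z => - (2 * mu8 * z))%C (gA_GK h)).
Qed.
Lemma kapE_neg t : Re t < 0 -> kap t = (2 * Cconj (mu8 * GK (fun=> RtoC 1) (- Cconj t)))%C.
Proof.
move=> h; have h' : 0 < Re (- Cconj t)%C by rewrite Re_opp re_conj; lra.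
by rewrite -gA_GK // /kap; case: Rlt_dec => // ?; lra.
Qed.
Lemma HBE_pos al t : 0 < Re t -> HB al t = (2 * mu8 * GK (kern al) t)%C.
Proof. by move=> h; rewrite /HB; case: Rlt_dec. Qed.
Lemma HBE_neg al t : Re t < 0 -> HB al t = (- (2 * Cconj (mu8 * GK (kern al) (- Cconj t))))%C.
Proof. by move=> h; rewrite /HB; case: Rlt_dec => // ?; lra. Qed.

Lemma RtoC_vert0 T : (- Cconj (RtoC T) = RtoC (- T))%C.
Proof. by apply: Ceq => /=; ring. Qed.

Lemma kap_vertical T : T <> 0 ->
  filterlim (fun u : R => kap (RtoC T + Ci * RtoC u)%C : CV) (at_right 0) (locally (kap (RtoC T) : CV)).
Proof.
move=> hT; have [h|h] : 0 < T \/ 0 < - T by lra.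
  rewrite kapE_pos //.
  have -> : (- (2 * mu8 * GK (fun=> RtoC 1) (RtoC T)) = - (2 * mu8) * GK (fun=> RtoC 1) (RtoC T))%C by ring.
  have E u : (- (2 * mu8) * GK (fun=> RtoC 1) (RtoC T + Ci * RtoC u) = kap (RtoC T + Ci * RtoC u))%C.
    by rewrite kapE_pos ?Re_vert //; ring.
  exact: filterlim_ext E (filterlim_Cscal (a := (- (2 * mu8))%C) (GK_vertical kbounded_1 h)).
have hn : Re (RtoC T) < 0 by rewrite /=; lra.
rewrite (kapE_neg hn) RtoC_vert0.
refine (filterlim_ext _ _ _ (filterlim_Cscal (a := RtoC 2) (filterlim_Cconj (filterlim_Cscal (a := mu8) (GK_vertical kbounded_1 h))))) => u.
by rewrite kapE_neg ?Re_vert ?neg_conj_vert //; lra.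
Qed.

Lemma HB_vertical al T : 0 < al < 1 -> T <> 0 ->
  filterlim (fun u : R => HB al (RtoC T + Ci * RtoC u)%C : CV) (at_right 0) (locally (HB al (RtoC T) : CV)).
Proof.
move=> ha hT; have [h|h] : 0 < T \/ 0 < - T by lra.
  rewrite HBE_pos //.
  refine (filterlim_ext _ _ _ (filterlim_Cscal (a := (2 * mu8)%C) (GK_vertical (kbounded_kern ha) h))) => u.
  by rewrite HBE_pos ?Re_vert.
have hn : Re (RtoC T) < 0 by rewrite /=; lra.
rewrite (HBE_neg _ hn) RtoC_vert0.
have ng (z : C) : (- (2 * Cconj z) = -2 * Cconj z)%C by ring.
rewrite ng.
refine (filterlim_ext _ _ _ (filterlim_Cscal (a := (-2)%C) (filterlim_Cconj (filterlim_Cscal (a := mu8) (GK_vertical (kbounded_kern ha) h))))) => u.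
by rewrite HBE_neg ?Re_vert ?neg_conj_vert ?ng //; lra.
Qed.

Lemma Cconj_R (x : R) : Cconj (RtoC x) = RtoC x.
Proof. by apply: Ceq => /=; ring. Qed.

(** Reality lets [kap] be expressed by the one constant [kap1] on both sides of 0. *)
Lemma gA1_real : Cconj (gA 1) = gA 1.
Proof.
have r1 : 0 < Re (RtoC PI * RtoC 1) by have hp := PI_RGT_0; rewrite Re_PI_mul /=; nra.
have hl := II_correct (IIdom_gexp 0 r1).
apply: (filterlimC_unique (F := eventually) _ hl).
refine (filterlim_ext _ _ _ (filterlim_Cconj hl)) => n.
have exf x y : ex_RInt (fun y => exp (- (PI * 1) * y ^ 2)) x y.
  apply: (ex_RInt_continuous (V := R_CompleteNormedModule)) => z _.
  apply: (ex_derive_continuous (V := R_NormedModule)); by auto_derive.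
have E x y : RInt (V := CV) (gexp (RtoC PI * RtoC 1) 0) x y = RtoC (RInt (fun y => exp (- (PI * 1) * y ^ 2)) x y).
  apply: (is_RInt_unique (V := CV)).
  apply: (is_RInt_ext (V := CV) (fun y => RtoC (exp (- (PI * 1) * y ^ 2)))); first by move=> z _; rewrite gexp_R.
  apply: (is_RInt_fct_extend_pair (U := R_NormedModule) (V := R_NormedModule)) => /=.
    exact: (RInt_correct (V := R_CompleteNormedModule)).
  have := is_RInt_const (V := R_NormedModule) x y 0; by rewrite /scal /= /mult /= Rmult_0_r.
by rewrite E; exact: Cconj_R.
Qed.

Definition kap1 : C := (- (2 * mu8 * gA 1))%C.

Lemma kap1_neq0 : kap1 <> RtoC 0.
Proof.
have m0 : mu8 <> RtoC 0 by move=> h; have := mu8_conj; rewrite h Cmult_0_l => /RtoC_inj; lra.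
have g0 := gA1_neq0.
move=> h; have h2 : (2 * mu8 * gA 1 = 0)%C by have -> : (2 * mu8 * gA 1 = - kap1)%C by [rewrite /kap1; ring]; rewrite h; ring.
have n2 : RtoC 2 <> RtoC 0 by move/RtoC_inj; lra.
exact: (Cmult_neq_0 _ _ (Cmult_neq_0 _ _ n2 m0) g0 h2).
Qed.

Lemma kap_pos T : 0 < T -> kap (RtoC T) = (RtoC (/ sqrt T) * kap1)%C.
Proof. by move=> h; rewrite kapE_pos // -gA_GK // (gA_scale h) /kap1; ring. Qed.

(** Compared with T > 0 the phase changes by i, because conj [mu8] = - i [mu8]. This is the jump
    that the branch of (c x + d)^(-1/2) has to reproduce. *)
Lemma kap_neg T : T < 0 -> kap (RtoC T) = (RtoC (/ sqrt (- T)) * (Ci * kap1))%C.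
Proof.
move=> h; have hn : Re (RtoC T) < 0 by [].
have h2 : 0 < - T by lra.
rewrite kapE_neg // RtoC_vert0 -gA_GK // (gA_scale h2) Cmult_conj Cmult_conj gA1_real /kap1.
rewrite Cconj_R.
have -> : (Cconj mu8 = - (Ci * mu8))%C.
  have -> : (Ci * mu8 = (mu8 * mu8) * mu8)%C by rewrite mu8_sq.
  transitivity (- ((mu8 * mu8) * (mu8 * mu8)) * Cconj mu8)%C; first by rewrite mu8_sq Ci_sq; ring.
  by transitivity (- (mu8 * mu8 * mu8 * (mu8 * Cconj mu8)))%C; [ring | rewrite mu8_conj; ring].
ring.
Qed.

(** The shape of a finite correction term after a transformation. For T < 0 the function is a
    constant times the conjugate of its values at positive arguments. *)
Lemma ana_kapq s T : T <> 0 -> ana (fun t => kap (RtoC t) * qE (- / RtoC t) s)%C T.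
Proof.
move=> hT; have [h|h] : 0 < T \/ 0 < - T by lra.
  apply: (@ana_ext _ _ T T _ _ (ana_scal kap1 (ana_gauss s h))) => // y hy.
  by rewrite kap_pos; [ring | have := Rabs_def2 _ _ hy; lra].
pose G t := (kap1 * (RtoC (/ sqrt t) * qE (- / RtoC t) s))%C.
apply: (@ana_ext _ (fun t => (Ci * kap1 / Cconj kap1) * Cconj (G (-1 * t + 0)%coqR))%C T (- T)) => // [y hy|]; last first.
  apply: ana_scal; apply: ana_conj; apply: (@ana_affine G); first lra.
  by have -> : -1 * T + 0 = - T by [ring]; apply: ana_scal; exact: ana_gauss.
have y0 : y < 0 by have := Rabs_def2 _ _ hy; lra.
have -> : -1 * y + 0 = - y by ring.
rewrite kap_neg // /G (Cmult_conj kap1) (Cmult_conj (RtoC _)) qE_conj.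
rewrite Cconj_R.
have ynz : RtoC y <> RtoC 0 by move/RtoC_inj; lra.
have ynz' : RtoC (- y) <> RtoC 0 by move/RtoC_inj; lra.
have -> : (- Cconj (- / RtoC (- y)) = - / RtoC y)%C.
  rewrite Copp_conj Cinv_conj // (_ : Cconj (RtoC (- y)) = - RtoC y)%C; first by field.
  by apply: Ceq => /=; ring.
have k0 := kap1_neq0; have k1 : Cconj kap1 <> RtoC 0.
  by move=> e; apply: k0; rewrite -(Cconj_conj kap1) e; apply: Ceq => /=; ring.
by field.
Qed.

Lemma ana_qE D n x : 0 < D -> ana (fun y => qE (RtoC y / RtoC D) n) x.
Proof.
move=> hD; have Dnz : RtoC D <> RtoC 0 by move/RtoC_inj; lra.
apply: (@ana_ext _ _ x 1 _ _ (ana_Cexp (RtoC PI * Ci / RtoC D * RtoC (n ^ 2)) x)); first lra.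
by move=> y _; rewrite /qE; congr Cexp; field.
Qed.

(** * Quantum modularity of false theta functions *)

Lemma det_mx2 (g : 'M[int]_2) : (\det g = g 0 0 * g 1 1 - g 0 1 * g 1 0)%R.
Proof.
rewrite (expand_det_row _ ord0) !big_ord_recl big_ord0 /cofactor !det_mx11 !mxE addr0.
have e0 : lift (ord0 : 'I_2) (ord0 : 'I_1) = 1%R by apply: val_inj.
have e1 : lift (1%R : 'I_2) (ord0 : 'I_1) = 0%R by apply: val_inj.
have e2 : ord0 = (0%R : 'I_2) by apply: val_inj.
have e3 : ord0 = (0%R : 'I_1) by apply: val_inj.
by rewrite -!e3 !e0 e1 !e2 /= expr0 expr1 mul1r mulN1r mulrN.
Qed.

(** The principal congruence subgroup of level n. *)
Definition level_group (n : nat) (g : 'M[int]_2) : Prop :=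
  (\det g = 1)%R /\ exists h : 'M[int]_2, (g = 1%:M + Posz n *: h)%R.

Lemma finite_fibres (T : eqType) (X : finType) (P : T -> Prop) (r : T -> X) :
  exists s : seq T, forall g, P g -> exists k, [/\ k \in s, P k & r k = r g].
Proof.
suff [s hs] : exists s : seq T, forall g, P g -> r g \in enum X -> exists k, [/\ k \in s, P k & r k = r g].
  by exists s => g pg; apply: hs => //; rewrite mem_enum.
elim: (enum X) => [|x l [s hs]]; first by exists [::].
have [[k [pk rk]]|N] := Classical_Prop.classic (exists k, P k /\ r k = x).
  exists (k :: s) => g pg; rewrite inE => /orP [/eqP e|h].
    by exists k; split=> //; [exact: mem_head | rewrite rk].
  by have [k' [h1 h2 h3]] := hs g pg h; exists k'; split=> //; rewrite inE h1 orbT.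
exists s => g pg; rewrite inE => /orP [/eqP e|h]; last exact: hs.
by case: N; exists g.
Qed.

(** Reduction modulo n takes finitely many values, and two unimodular matrices with the same
    reduction differ by a left factor from the group. *)
Lemma level_group_finite_index n : (0 < n)%N -> finite_index_subgroup_SL2Z (level_group n).
Proof.
move=> hn.
have uni (g : 'M[int]_2) : (\det g = 1)%R -> g \in unitmx by rewrite unitmxE => ->; rewrite unitr1.
split.
- by move=> g [].
- by split; [rewrite det1 | exists 0%R; rewrite scaler0 addr0].
- move=> g h [dg [x ex]] [dh [y ey]]; split; first by rewrite det_mulmx dg dh mulr1.
  exists (x + y + Posz n *: (x *m y))%R.
  by rewrite ex ey mulmxDl mul1mx mulmxDr mulmx1 -scalemxAl -scalemxAr !scalerDr -!addrA; congr (_ + _)%R; rewrite addrCA.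
- move=> g [dg [x e]]; have ug := uni g dg; split; first by rewrite det_inv dg invr1.
  exists (- (invmx g *m x))%R.
  by have := mulVmx ug; rewrite {2}e mulmxDr mulmx1 -scalemxAr => E; rewrite -{1}E scalerN addrK.
have n1 : n.-1.+1 = n by rewrite prednK.
pose r (g : 'M[int]_2) : 'M['I_n.-1.+1]_2 := map_mx (fun z : int => inord (absz (z %% Posz n)%Z)) g.
have [s hs] := finite_fibres (fun g : 'M[int]_2 => (\det g = 1)%R) r.
exists s => g dg; have [k [ks dk e]] := hs g dg.
have uk := uni k dk.
exists (g *m invmx k)%R, k; split.
- split; first by rewrite det_mulmx det_inv dg dk invr1 mulr1.
  have [x hx] : exists x : 'M[int]_2, (g = k + Posz n *: x)%R.
    exists (\matrix_(i, j) ((g i j - k i j) %/ Posz n)%Z)%R; apply/matrixP => i j; rewrite !mxE.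
    have dv : (Posz n %| (g i j - k i j)%R)%Z.
      have n0 : Posz n != 0%R by lia.
      rewrite -eqz_mod_dvd; apply/eqP.
      have := congr1 (fun A : 'M_2 => val (A i j)) e; rewrite !mxE /= !inordK ?n1.
      + by have := modz_ge0 (g i j) n0; have := modz_ge0 (k i j) n0; lia.
      + by have := modz_ge0 (g i j) n0; have := ltz_pmod (g i j) (ltac:(lia) : (0 < Posz n)%R); lia.
      + by have := modz_ge0 (k i j) n0; have := ltz_pmod (k i j) (ltac:(lia) : (0 < Posz n)%R); lia.
    by rewrite mulrC divzK // addrC subrK.
  exists (x *m invmx k)%R; by rewrite {1}hx mulmxDl mulmxV // -scalemxAl.
- exact: ks.
- by rewrite mulmxKV.
Qed.

Definition rlim (f : R -> C) : C := Hierarchy.iota (T := CV) (fun l : C => filterlim (fun u => f u : C_UniformSpace) (at_right 0) (locally (l : C_UniformSpace))).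

Lemma rlimE (f : R -> C) (l : C) : filterlim (f : R -> CV) (at_right 0) (locally (l : CV)) -> rlim f = l.
Proof.
move=> h; apply: (iota_unique (V := CV)) => // y hy.
exact: (filterlimC_unique (F := at_right 0) hy h).
Qed.

Lemma sqrt_rate (f : R -> C) l K r : 0 < r -> 0 <= K -> (forall d, 0 < d < r -> Cmod (f d - l) <= K * sqrt d) ->
  filterlim (f : R -> CV) (at_right 0) (locally (l : CV)).
Proof.
move=> r0 K0 h; apply/filterlimCP => eps he.
have e1 : 0 < eps / (K + 1) by apply: Rdiv_lt_0_compat; lra.
have e2 : 0 < (eps / (K + 1)) ^ 2 by apply: pow_lt.
apply: (@at_right0 _ (Rmin r ((eps / (K + 1)) ^ 2))); first exact: Rmin_glb_lt.
move=> u [u0 hu].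
have u1 : u < r := Rlt_le_trans _ _ _ hu (Rmin_l _ _).
have u2 : u < (eps / (K + 1)) ^ 2 := Rlt_le_trans _ _ _ hu (Rmin_r _ _).
have su : sqrt u < eps / (K + 1).
  by rewrite -(sqrt_pow2 (eps / (K + 1))); [apply: sqrt_lt_1; lra | lra].
apply: Rle_lt_trans (h u (conj u0 u1)) _.
have s0 := sqrt_pos u.
apply: Rle_lt_trans (_ : (K + 1) * sqrt u < eps); first nra.
have -> : eps = (K + 1) * (eps / (K + 1)) by field; lra.
apply: Rmult_lt_compat_l; lra.
Qed.

Lemma filterlim_Cmult (U : Type) (F : (U -> Prop) -> Prop) {FF : Filter F} (f g : U -> C) l m :
  filterlim (f : U -> CV) F (locally (l : CV)) -> filterlim (g : U -> CV) F (locally (m : CV)) ->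
  filterlim (fun x => (f x * g x)%C : CV) F (locally ((l * m)%C : CV)).
Proof.
move=> hf hg.
have E x : ((f x - l) * (g x - m) + (l * g x + (m * f x + - (l * m))))%C = (f x * g x)%C by ring.
refine (filterlim_ext _ _ E _).
suff H : filterlim (fun x => ((f x - l) * (g x - m) + (l * g x + (m * f x + - (l * m))))%C : CV) F (locally ((0 + (l * m + (m * l + - (l * m))))%C : CV)).
  by have e : (0 + (l * m + (m * l + - (l * m))))%C = (l * m)%C by [ring]; rewrite e in H.
apply: filterlim_Cplus; last first.
  apply: filterlim_Cplus; first exact: filterlim_Cscal.
  apply: filterlim_Cplus; first exact: filterlim_Cscal.
  exact: filterlim_const.
apply/filterlimCP => eps he.
have h1 := proj1 (@filterlimCP _ F FF _ _) hf 1 Rlt_0_1.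
have h2 := proj1 (@filterlimCP _ F FF _ _) hg eps he.
apply: filter_imp (filter_and _ _ h1 h2) => x [a b].
have -> (z : C) : (z - 0 = z)%C by ring.
rewrite Cmod_mult; have := Cmod_ge_0 (f x - l)%C; have := Cmod_ge_0 (g x - m)%C; nra.
Qed.

Lemma filterlim_Cbig (U : Type) (F : (U -> Prop) -> Prop) {FF : Filter F} (I : eqType) (s : seq I) (f : I -> U -> C) (l : I -> C) :
  (forall i, i \in s -> filterlim (f i : U -> CV) F (locally (l i : CV))) ->
  filterlim (fun x => \big[Cplus/RtoC 0]_(i <- s) f i x : CV) F (locally (\big[Cplus/RtoC 0]_(i <- s) l i : CV)).
Proof.
elim: s => [|i s IH] h.
  rewrite big_nil; refine (filterlim_ext _ _ _ (filterlim_const (RtoC 0 : CV))) => x; by rewrite big_nil.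
rewrite big_cons.
refine (filterlim_ext _ _ _ (filterlim_Cplus (h i (mem_head _ _)) (IH (fun j hj => h j (mem_behead (s := i :: s) hj))))) => x.
by rewrite big_cons.
Qed.

Lemma at_right_scale D : 0 < D -> filterlim (fun u : R => u / D) (at_right 0) (at_right 0).
Proof.
move=> hD P [[r r0] hr].
apply: (@at_right0 _ (r * D)); first exact: Rmult_lt_0_compat.
move=> u [u0 hu]; apply: hr; last exact: Rdiv_lt_0_compat.
rewrite -[ball _ _ _]/(Rabs (u / D - 0) < r) Rminus_0_r Rabs_pos_eq.
  by apply: (Rmult_lt_reg_r D) => //; rewrite /Rdiv Rmult_assoc Rinv_l; lra.
by left; exact: Rdiv_lt_0_compat.
Qed.

Lemma qE_cis2 y s : qE (RtoC y) s = cis2 (y * s ^ 2 / 2).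
Proof.
rewrite /qE /cis2; congr Cexp; move: (s ^ 2) => z.
by rewrite RtoC_div; [rewrite (RtoC_mult y z); field => [] [] ?; lra | lra].
Qed.

Definition vlim (f : C -> C) (x : rat) : C := rlim (fun u => f (RtoC (ratr x) + Ci * RtoC u)%C).

Section Limits.
Variables (p : nat) (phi : int -> C) (B : R).
Hypotheses (hp : (0 < p)%N) (hphi : forall n, phi (n + Posz (2 * p))%R = phi n) (hB : forall n, Cmod (phi n) <= B).

Definition cf n := (RtoC (sg n) * phi n)%C.
Let D := 2 * INR p.
Let P0 : 0 < INR p.
Proof. by apply: lt_0_INR; lia. Qed.
Let D0 : 0 < D.
Proof. by rewrite /D; lra. Qed.

Lemma cf_bound n : Cmod (cf n) <= B.
Proof.
rewrite /cf Cmod_mult Cmod_R; have := sg_bound n; have := hB n; have := Cmod_ge_0 (phi n); have := Rabs_pos (sg n); nra.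
Qed.

Lemma FT_limit (x : rat) : exists K, 0 <= K /\ forall d, 0 < d <= 1 ->
  Cmod (FT D cf (RtoC (ratr x) + Ci * RtoC d) - vlim (FT D cf) x) <= K * sqrt d.
Proof.
have q0 : (0 < denq x)%R by exact: denq_gt0.
pose q := absz (denq x).
have eq : Posz q = denq x by rewrite /q gez0_abs // ltW.
have nx : ratr x * zr (Posz q) = zr (numq x).
  have z0 : zr (denq x) <> 0 by move=> h; move: q0; rewrite (zr_inj (h : zr _ = zr 0)).
  rewrite eq /ratr -!/(zr _).
  by rewrite -[(zr (numq x) / zr (denq x))%R]/(zr (numq x) * / zr (denq x)); field.
(* For x of denominator q, passing from n to n + Q changes x n^2/4p by the integer [numq x] (2 n +
   Q). *)
pose Q := (4 * p * q)%N.
have Q0 : (0 < Q)%N by rewrite /Q; nia.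
have per n : (phi (n + Posz Q)%R * qE (RtoC (ratr x / D)) (zr (n + Posz Q)%R))%C = (phi n * qE (RtoC (ratr x / D)) (zr n))%C.
  congr Cmult.
    by rewrite (_ : Q = (2 * q * (2 * p))%N); [exact: periodic_mul | rewrite /Q; nia].
  rewrite !qE_cis2; apply: (@cis2_addz _ _ (numq x * (2 * n + Posz Q))%R).
  rewrite zrM !zrD zrM -nx (_ : zr 2 = 2) // /Q (zr_Posz (4 * p * q)) (zr_Posz q) !mult_INR /D [INR 4]/=.
  field; lra.
have [L [K [K0 h]]] := FT_vertical D0 Q0 hB per.
exists K; split=> //.
suff -> : vlim (FT D cf) x = L by exact: h.
apply: rlimE; apply: (@sqrt_rate _ _ K 1) => // [|d hd]; first lra.
apply: h; lra.
Qed.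

Lemma FT_vlim (x : rat) : filterlim (fun u : R => FT D cf (RtoC (ratr x) + Ci * RtoC u)%C : CV) (at_right 0) (locally (vlim (FT D cf) x : CV)).
Proof.
have [K [K0 h]] := FT_limit x; apply: (@sqrt_rate _ _ K 1) => // [|d hd]; first lra.
apply: h; lra.
Qed.

(** The real part of the image deviates from its limit only by O(u^2), its height being of order u.
    This is the deviation that [FT_sideways] tolerates. *)
Lemma moebius_vertical (a b c d x u : R) : a * d - b * c = 1 -> c * x + d <> 0 -> 0 < u ->
  let j := c * x + d in let q := j ^ 2 + c ^ 2 * u ^ 2 in
  ((RtoC a * (RtoC x + Ci * RtoC u) + RtoC b) / (RtoC c * (RtoC x + Ci * RtoC u) + RtoC d))%C =
  (RtoC ((a * x + b) / j + c * u ^ 2 / (j * q))%coqR + Ci * RtoC (u / q)%coqR)%C.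
Proof.
move=> det hj hu j q.
have jE : j = c * x + d by [].
have {}hj : j <> 0 by [].
have j2 : 0 < j ^ 2 by rewrite -Rsqr_pow2; apply: Rsqr_pos_lt.
have q0 : 0 < q by have := pow2_ge_0 (c * u); rewrite Rpow_mult_distr /q; lra.
have qE : q = j ^ 2 + c ^ 2 * u ^ 2 by [].
clearbody q; clearbody j.
set w := (RtoC c * (RtoC x + Ci * RtoC u) + RtoC d)%C.
have rw : Re w = j by rewrite /w !ReImE jE /=; ring.
have iw : Im w = c * u by rewrite /w !ReImE /=; ring.
have wnz : w <> RtoC 0 by move=> e; apply: hj; rewrite -rw e.
set A := (_ / j + _); set V := u / q.
have -> : (RtoC a * (RtoC x + Ci * RtoC u) + RtoC b = (RtoC A + Ci * RtoC V) * w)%C.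
  apply: Ceq.
    rewrite (Re_mult _ w) rw iw !ReImE /= /A /V; field; lra.
  rewrite (Im_mult _ w) rw iw !ReImE /= /A /V.
  transitivity (u * (((a * x + b) * c + (a * d - b * c)) / j)); first by rewrite jE; field; rewrite -jE.
  rewrite det; transitivity (u * (((a * x + b) * c + q / q) / j)); first by field; lra.
  rewrite {1}qE; field; lra.
by field.
Qed.

(** Two errors of order sqrt(u): moving the image point sideways onto the vertical line above y, and
    descending that line from height u/q. *)
Lemma FT_moebius_limit (a b c d : int) (x y : rat) : (a * d - b * c)%R = 1%R -> zr c * ratr x + zr d <> 0 ->
  ratr y = (zr a * ratr x + zr b) / (zr c * ratr x + zr d) ->
  filterlim (fun u : R => FT D cf ((RtoC (zr a) * (RtoC (ratr x) + Ci * RtoC u) + RtoC (zr b)) / (RtoC (zr c) * (RtoC (ratr x) + Ci * RtoC u) + RtoC (zr d)))%C : CV) (at_right 0) (locally (vlim (FT D cf) y : CV)).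
Proof.
move=> det hj hy.
have det' : zr a * zr d - zr b * zr c = 1 by rewrite -!zrM /Rminus -zrN -zrD det.
set j := zr c * ratr x + zr d in hj hy.
have j2 : 0 < j ^ 2 by rewrite -Rsqr_pow2; apply: Rsqr_pos_lt.
have aj : 0 < Rabs j by apply: Rabs_pos_lt.
(* Bounds |c| q/|j| for u <= 1, where q = j^2 + c^2 u^2. *)
pose A := Rabs (zr c) * (j ^ 2 + zr c ^ 2) / Rabs j.
have c2 := pow2_ge_0 (zr c); have ac := Rabs_pos (zr c).
have A0 : 0 <= A by apply: Rmult_le_pos; [nra | left; exact: Rinv_0_lt_compat].
have [K1 [K10 h1]] := FT_sideways D0 A0 cf_bound.
have [K2 [K20 h2]] := FT_limit y.
apply: (@sqrt_rate _ _ ((K1 + K2) / Rabs j) (Rmin 1 (j ^ 2))).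
- by apply: Rmin_glb_lt => //; lra.
- by apply: Rmult_le_pos; [lra | left; exact: Rinv_0_lt_compat].
move=> u [u0 hu].
have u1 : u < 1 := Rlt_le_trans _ _ _ hu (Rmin_l _ _).
have u2 : u < j ^ 2 := Rlt_le_trans _ _ _ hu (Rmin_r _ _).
rewrite (moebius_vertical det' hj u0) -/j -hy.
set q := j ^ 2 + zr c ^ 2 * u ^ 2.
have uu : 0 < u ^ 2 by apply: pow_lt.
have qj : j ^ 2 <= q by rewrite /q; nra.
have q0 : 0 < q by lra.
have v0 : 0 < u / q by apply: Rdiv_lt_0_compat.
have vle : u / q <= u / j ^ 2 by apply: Rmult_le_compat_l; [lra | apply: Rinv_le_contravar].
have v1 : u / q <= 1.
  by apply: (Rmult_le_reg_r q) => //; rewrite /Rdiv Rmult_assoc Rinv_l; lra.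
set X := ratr y + _.
have hs : Rabs (X - ratr y) <= A * (u / q) ^ 2.
  have -> : X - ratr y = zr c * u ^ 2 / (j * q) by rewrite /X; ring.
  rewrite Rabs_div ?(Rabs_mult (zr c)) ?(Rabs_mult j) ?(Rabs_pos_eq q) ?(Rabs_pos_eq (u ^ 2)); try lra; last by apply: Rmult_integral_contrapositive_currified => //; lra.
  have -> : Rabs (zr c) * u ^ 2 / (Rabs j * q) = Rabs (zr c) * q / Rabs j * (u / q) ^ 2 by field; lra.
  rewrite /A; apply: Rmult_le_compat_r; first exact: pow2_ge_0.
  apply: Rmult_le_compat_r; first by left; exact: Rinv_0_lt_compat.
  apply: Rmult_le_compat_l => //; rewrite /q; have : u ^ 2 <= 1 by nra.
  nra.
have s1 := h1 (RtoC X + Ci * RtoC (u / q))%C (ratr y); rewrite Re_vert Im_vert in s1.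
have {}s1 := s1 (conj v0 v1) hs.
have s2 := h2 _ (conj v0 v1).
apply: Rle_trans (Cmod_le_dist _ (FT D cf (RtoC (ratr y) + Ci * RtoC (u / q))) _) _.
have sq : sqrt (u / q) <= sqrt u / Rabs j.
  have -> : sqrt u / Rabs j = sqrt (u / j ^ 2).
    by rewrite -Rsqr_pow2 sqrt_div ?sqrt_Rsqr_abs // ?Rsqr_pow2 //; lra.
  apply: sqrt_le_1; lra.
have sp := sqrt_pos (u / q).
apply: Rle_trans (_ : (K1 + K2) * sqrt (u / q) <= _); first lra.
have -> : (K1 + K2) / Rabs j * sqrt u = (K1 + K2) * (sqrt u / Rabs j) by field; lra.
by apply: Rmult_le_compat_l; lra.
Qed.
End Limits.

(** The finite sum over [L] repairs the signs near the origin after a square has been completed; it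
    has to be carried through the cocycle relation. *)
Definition thetaf (D : R) (phi : int -> C) (L : seq int) (dd : int -> C) (tau : C) : C :=
  (FT D (cf phi) tau + \big[Cplus/RtoC 0]_(n <- L) (dd n * qE (tau / RtoC D) (zr n)))%C.

Section Cocycle.
Variables (p : nat) (phi : int -> C) (B : R) (L : seq int) (dd : int -> C).
Hypotheses (hp : (0 < p)%N) (hphi : forall n, phi (n + Posz (2 * p))%R = phi n) (hB : forall n, Cmod (phi n) <= B).

Let D := 2 * INR p.
Let P0 : 0 < INR p.
Proof. by apply: lt_0_INR; lia. Qed.
Let D0 : 0 < D.
Proof. by rewrite /D; lra. Qed.
Let L0 := vlim (FT D (cf phi)).

Definition thetalim (x : rat) : C :=
  (L0 x + \big[Cplus/RtoC 0]_(n <- L) (dd n * qE (RtoC (ratr x) / RtoC D) (zr n)))%C.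

Lemma qE_vertical x n : filterlim (fun u : R => qE ((RtoC x + Ci * RtoC u) / RtoC D) (zr n) : CV) (at_right 0)
   (locally (qE (RtoC x / RtoC D) (zr n) : CV)).
Proof.
have Dnz : RtoC D <> RtoC 0 by move/RtoC_inj; lra.
pose g (u : R) := qE ((RtoC x + Ci * RtoC u) / RtoC D) (zr n).
have c : continuous (g : R -> CV) 0.
  apply: continuous_Cexp.
  apply: (continuous_ext (fun u => (RtoC u * (RtoC PI * Ci * Ci / RtoC D * RtoC (zr n ^ 2)) + RtoC PI * Ci * (RtoC x / RtoC D) * RtoC (zr n ^ 2))%C : CV)).
    move=> u /=; have E : (RtoC u * (RtoC PI * Ci * Ci / RtoC D * RtoC (zr n ^ 2)) + RtoC PI * Ci * (RtoC x / RtoC D) * RtoC (zr n ^ 2) = RtoC PI * Ci * ((RtoC x + Ci * RtoC u) / RtoC D) * RtoC (zr n ^ 2))%C.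
      by field.
    exact: E.
  apply: continuous_Cplus; last exact: continuous_const.
  exact: continuous_derive (is_derive_lin _ 0).
have -> : qE (RtoC x / RtoC D) (zr n) = g 0 by rewrite /g Cmult_0_r Cplus_0_r.
refine (filterlim_filter_le_1 _ _ c); exact: filter_le_within.
Qed.

Lemma thetaf_vlim (x : rat) : filterlim (fun u : R => thetaf D phi L dd (RtoC (ratr x) + Ci * RtoC u)%C : CV) (at_right 0) (locally (thetalim x : CV)).
Proof.
apply: filterlim_Cplus; first exact: (@FT_vlim p phi B).
apply: filterlim_Cbig => n _; apply: filterlim_Cscal; exact: qE_vertical.
Qed.

(** Handles the matrices with c = 0: a translation by a multiple of 4p changes every exponent by an
    integer. *)
Lemma thetalim_shift (b' : int) (x y : rat) : ratr y = ratr x + zr (Posz (4 * p) * b')%R -> thetalim y = thetalim x.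
Proof.
move=> hy.
have q u n : qE ((RtoC (ratr y) + u) / RtoC D) (zr n) = qE ((RtoC (ratr x) + u) / RtoC D) (zr n).
  have Dnz : RtoC D <> RtoC 0 by move/RtoC_inj; lra.
  have -> : ((RtoC (ratr y) + u) / RtoC D = RtoC (zr (2 * b')%R) + (RtoC (ratr x) + u) / RtoC D)%C.
    rewrite hy RtoC_plus; have -> : zr (Posz (4 * p) * b')%R = D * zr (2 * b')%R.
      by rewrite !zrM zr_Posz mult_INR /D (_ : zr 2 = 2) // [INR 4]/=; ring.
    by rewrite (RtoC_mult D); field.
  rewrite qE_add qE_cis2.
  have -> : zr (2 * b')%R * zr n ^ 2 / 2 = zr (b' * n * n)%R by rewrite !zrM (_ : zr 2 = 2) //; field.
  by rewrite cis2_zr Cmult_1_l.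
congr Cplus.
  refine (filterlimC_unique (F := at_right 0) (@FT_vlim p phi B hp hphi hB y) _).
  refine (filterlim_ext _ _ _ (@FT_vlim p phi B hp hphi hB x)) => u.
  rewrite /FT; congr (sum_over TT _); apply: FunctionalExtensionality.functional_extensionality => n.
  by rewrite /fT q.
apply: eq_bigr => n _; congr Cmult.
by have := q (RtoC 0) n; rewrite !Cplus_0_r.
Qed.

Section NonzeroC.
Variables (K : nat) (a b c d a' b' c' d' s0 : int).
Hypotheses (hc : c != 0%R) (det1 : (a * d - b * c)%R = 1%R)
  (ha : a = (1 + Posz (4 * p) * a')%R) (hb : b = (Posz (4 * p) * b')%R)
  (hc' : c = (Posz (4 * p) * c')%R) (hd : d = (1 + Posz (4 * p) * d')%R)
  (hs : s0 = 1%R \/ s0 = (-1)%R) (hK : Posz K = (Posz (2 * p) * (s0 * c))%R).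

Let c0 : zr c <> 0.
Proof. by move=> h; move: hc; rewrite (zr_inj (h : zr c = zr 0)). Qed.
Let Dc0 : D * zr c <> 0.
Proof. by apply: Rmult_integral_contrapositive_currified => //; lra. Qed.
Let E := ea p a c.
Let G := g0 p K a c.

(** The boundary value at x of t = (c tau + d)/(2 p c). *)
Definition modT (x : R) : R := (zr c * x + zr d) / (D * zr c).

(** The limit of [modular_FT] as tau descends vertically to x. Then t descends vertically to
    [modT x] at height u/D, while the image of tau reaches y along an arc. *)
Lemma FT_cocycle (x y : rat) : zr c * ratr x + zr d <> 0 -> ratr y = (zr a * ratr x + zr b) / (zr c * ratr x + zr d) ->
  (- RtoC (zr s0) * G * L0 x = kap (RtoC (modT (ratr x))) * L0 y +
   \big[Cplus/RtoC 0]_(s <- iota 1 K.-1) (phi (Posz s) * E (Posz s) * HB (INR s / INR K) (RtoC (modT (ratr x)))))%C.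
Proof.
move=> hj hy.
pose T := modT (ratr x); rewrite -/T.
have T0 : T <> 0 by apply: Rmult_integral_contrapositive_currified => //; exact: Rinv_neq_0_compat.
pose tau (u : R) := (RtoC (ratr x) + Ci * RtoC u)%C.
have sc := at_right_scale D0.
have FR : Filter (at_right 0) by apply: filter_filter.
have l1 := @filterlim_Cscal _ _ FR _ _ (- RtoC (zr s0) * G)%C (@FT_vlim p phi B hp hphi hB x).
have k1 := filterlim_comp _ _ _ _ _ _ _ _ sc (kap_vertical T0).
have l2 := @filterlim_Cmult _ _ FR _ _ _ _ k1 (FT_moebius_limit hp hphi hB det1 hj hy).
have l3 : filterlim (fun u : R => \big[Cplus/RtoC 0]_(s <- iota 1 K.-1) (phi (Posz s) * E (Posz s) * HB (INR s / INR K) (RtoC T + Ci * RtoC (u / D)))%C : CV) (at_right 0)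
   (locally (\big[Cplus/RtoC 0]_(s <- iota 1 K.-1) (phi (Posz s) * E (Posz s) * HB (INR s / INR K) (RtoC T))%C : CV)).
  apply: filterlim_Cbig => s; rewrite mem_iota => hs1; apply: filterlim_Cscal.
  have al : 0 < INR s / INR K < 1.
    have a1 : 0 < INR s by apply: lt_0_INR; lia.
    have a2 : INR s < INR K by apply: lt_INR; lia.
    split; first by apply: Rdiv_lt_0_compat; lra.
    by apply: (Rmult_lt_reg_r (INR K)); [lra | rewrite /Rdiv Rmult_assoc Rinv_l; lra].
  exact: filterlim_comp sc (HB_vertical al T0).
have l4 := @filterlim_Cplus _ _ FR _ _ _ _ l2 l3.
apply: (filterlimC_unique (F := at_right 0) l1).
apply: (filterlim_ext_loc _ _ _ l4).
apply: (@at_right0 _ 1) => [|u [u0 _]]; first lra.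
have et : (RtoC T + Ci * RtoC (u / D) = (RtoC (zr c) * tau u + RtoC (zr d)) / RtoC (2 * INR p * zr c)%coqR)%C.
  rewrite -/D /T /modT RtoC_div // RtoC_div; last lra.
  have cnz : RtoC (zr c) <> RtoC 0 by move/RtoC_inj.
  have Dnz : RtoC D <> RtoC 0 by move/RtoC_inj; lra.
  by rewrite (RtoC_mult D) RtoC_plus (RtoC_mult (zr c)) /tau; field; split.
have iu : 0 < Im (tau u) by rewrite /tau Im_vert.
have := modular_FT hp hc det1 ha hb hc' hd hs hK hphi hB iu et; rewrite Re_vert => H.
by symmetry; exact: H.
Qed.

(** All that is analytic in the cocycle relation: the integrals [HB], the correction terms at x, and
    those at the image of x, rewritten by [qE_moebius] as functions of x. *)
Definition modh (y : R) : C :=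
  (- (RtoC (zr s0) / G) * \big[Cplus/RtoC 0]_(s <- iota 1 K.-1) (phi (Posz s) * E (Posz s) * HB (INR s / INR K) (RtoC (modT y)))
   + \big[Cplus/RtoC 0]_(n <- L) (dd n * (qE (RtoC y / RtoC D) (zr n) +
       RtoC (zr s0) / G * E n * (kap (RtoC (modT y)) * qE (- / RtoC (modT y)) (zr n / INR K)))))%C.

Lemma ana_modh y : y <> - zr d / zr c -> ana modh y.
Proof.
move=> hy.
have T0 : modT y <> 0.
  apply: Rmult_integral_contrapositive_currified; last exact: Rinv_neq_0_compat.
  by move=> h; apply: hy; have -> : - zr d = zr c * y by [lra]; field.
have aff f : ana f (modT y) -> ana (fun z => f (modT z)) y.
  move=> h; have E1 z : modT z = / D * z + zr d / (D * zr c) by rewrite /modT; field; split=> //; lra.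
  apply: (@ana_affineE f _ (/ D) (zr d / (D * zr c))).
  - by apply: Rinv_neq_0_compat; lra.
  - by move=> z; rewrite E1.
  by rewrite -E1.
apply: ana_plus.
  apply: ana_scal; apply: ana_big => s; rewrite mem_iota => hs1.
  apply: ana_scal; apply: (aff (fun t => HB (INR s / INR K) (RtoC t))); apply: ana_HB => //.
  have a1 : 0 < INR s by apply: lt_0_INR; lia.
  have a2 : INR s < INR K by apply: lt_INR; lia.
  split; first by apply: Rdiv_lt_0_compat; lra.
  by apply: (Rmult_lt_reg_r (INR K)); [lra | rewrite /Rdiv Rmult_assoc Rinv_l; lra].
apply: ana_big => n _; apply: ana_scal; apply: ana_plus; first exact: ana_qE.
apply: ana_scal; apply: (aff (fun t => kap (RtoC t) * qE (- / RtoC t) (zr n / INR K))%C); exact: ana_kapq.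
Qed.

Lemma thetalim_cocycle (x y : rat) : zr c * ratr x + zr d <> 0 -> ratr y = (zr a * ratr x + zr b) / (zr c * ratr x + zr d) ->
  (thetalim x + RtoC (zr s0) / G * kap (RtoC (modT (ratr x))) * thetalim y)%C = modh (ratr x).
Proof.
move=> hj hy.
have F := FT_cocycle hj hy.
have Gnz : G <> RtoC 0 by exact: (g0_neq0 hp hc det1 ha hb hc' hd hs hK).
have zz : (RtoC (zr s0) * RtoC (zr s0) = 1)%C.
  by rewrite -RtoC_mult -zrM; case: hs => ->.
have fin n : qE (RtoC (ratr y) / RtoC D) (zr n) = (E n * qE (- / RtoC (modT (ratr x))) (zr n / INR K))%C.
  have jR : (RtoC (zr c) * RtoC (ratr x) + RtoC (zr d))%C = RtoC (zr c * ratr x + zr d) by rewrite RtoC_plus (RtoC_mult (zr c)).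
  have jc : (RtoC (zr c) * RtoC (ratr x) + RtoC (zr d))%C <> RtoC 0 by rewrite jR => /RtoC_inj.
  have et : RtoC (modT (ratr x)) = ((RtoC (zr c) * RtoC (ratr x) + RtoC (zr d)) / RtoC (2 * INR p * zr c)%coqR)%C.
    by rewrite jR /modT RtoC_div.
  rewrite -(qE_moebius hp hc det1 ha hb hc' hd hs hK n jc et); congr (qE (_ / _) _).
  by rewrite hy RtoC_div // jR RtoC_plus (RtoC_mult (zr a)).
have EL : L0 x = (- (RtoC (zr s0) / G) * (- RtoC (zr s0) * G * L0 x))%C.
  transitivity ((RtoC (zr s0) * RtoC (zr s0)) * L0 x)%C; first by rewrite zz; ring.
  by field.
rewrite /thetalim {1}EL F /modh.
set X := \big[_/_]_(_ <- iota _ _) _.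
set k := kap _.
have -> : \big[Cplus/RtoC 0]_(n <- L) (dd n * (qE (RtoC (ratr x) / RtoC D) (zr n) +
       RtoC (zr s0) / G * E n * (k * qE (- / RtoC (modT (ratr x))) (zr n / INR K))))%C
   = (\big[Cplus/RtoC 0]_(n <- L) (dd n * qE (RtoC (ratr x) / RtoC D) (zr n)) + RtoC (zr s0) / G * k * \big[Cplus/RtoC 0]_(n <- L) (dd n * qE (RtoC (ratr y) / RtoC D) (zr n)))%C.
  rewrite -bigC_scal -big_split; apply: eq_bigr => n _; rewrite fin /=; ring.
ring.
Qed.

End NonzeroC.
End Cocycle.

Lemma Cinv_nz (z : C) : z <> RtoC 0 -> (/ z)%C <> RtoC 0.
Proof.
move=> h e; have : (z * / z = 1)%C by rewrite Cinv_r.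
by rewrite e Cmult_0_r => /RtoC_inj; lra.
Qed.

Lemma Cis_PI2 : Cis (PI / 2) = Ci.
Proof. by rewrite /Cis cos_PI2 sin_PI2; ring. Qed.
Lemma Cis_mPI2 : Cis (- (PI / 2)) = (- Ci)%C.
Proof. by rewrite /Cis cos_neg sin_neg cos_PI2 sin_PI2 RtoC_opp; ring. Qed.
Lemma Cis_0 : Cis 0 = RtoC 1.
Proof. by rewrite /Cis cos_0 sin_0; ring. Qed.

Lemma Cexp_msqrt v th : 0 < v ->
  Cexp (RtoC (- (1 / 2)) * (RtoC (ln v) + Ci * RtoC th)) = (RtoC (/ sqrt v) * Cis (- (th / 2)))%C.
Proof.
move=> hv; have hs := sqrt_lt_R0 _ hv.
rewrite -Cexp_iR.
have -> : (RtoC (- (1 / 2)) * (RtoC (ln v) + Ci * RtoC th) = RtoC (- (/ 2 * ln v)) + Ci * RtoC (- (th / 2)))%C.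
  by apply: Ceq; rewrite !ReImE /=; field.
rewrite Cexp_add Cexp_R exp_Ropp -/(Rpower v (/ 2)) Rpower_sqrt //.
Qed.

Definition c_sign (c : int) : int := if (0 < c)%R then 1%R else (-1)%R.
(** What is left of -(s0/G) [kap] once |c x + d|^(-1/2) and its phase are removed. The case
    distinction on the sign of c combines - s0 with the jump of [kap], so the result does not depend
    on x. *)
Definition chi_inv (p : nat) (g : 'M[int]_2) : C :=
  ((if (0 < g 1%R 0%R)%R then - RtoC 1 else Ci) * kap1 * RtoC (sqrt (2 * INR p * Rabs (zr (g 1%R 0%R))))
   / g0 p (2 * p * absz (g 1%R 0%R)) (g 0%R 0%R) (g 1%R 0%R))%C.

(** Four cases by the signs of c and j: [kap] contributes i exactly when they differ, and the
    argument [th] gives the phase i for c > 0 > j and - i when both are negative. One constant for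
    each sign of c matches all of them. *)
Lemma kap_autpow (p : nat) (a b c d : int) (G : C) (j : R) : (0 < p)%N -> c != 0%R -> j <> 0 -> G <> RtoC 0 ->
  let th := if Rlt_dec j 0 then (if (0 < c)%R then - PI else PI) else 0 in
  ((if (0 < c)%R then - RtoC 1 else Ci) * kap1 * RtoC (sqrt (2 * INR p * Rabs (zr c))) / G * Cexp (RtoC (- (1 / 2)) * (RtoC (ln (Rabs j)) + Ci * RtoC th)) =
   - (RtoC (zr (c_sign c)) / G * kap (RtoC (j / (2 * INR p * zr c)))))%C.
Proof.
move=> hp hc hj hG th.
have P0 : 0 < INR p by apply: lt_0_INR; lia.
have c0 : zr c <> 0 by move=> h; move: hc; rewrite (zr_inj (h : zr c = zr 0)).
have aj := Rabs_pos_lt _ hj; have ac := Rabs_pos_lt _ c0.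
rewrite (Cexp_msqrt _ aj).
have sj := sqrt_lt_R0 _ aj.
have m0 : 0 < 2 * INR p * Rabs (zr c) by apply: Rmult_lt_0_compat; lra.
have key T : 0 < T -> T = Rabs j / (2 * INR p * Rabs (zr c)) -> / sqrt T = sqrt (2 * INR p * Rabs (zr c)) * / sqrt (Rabs j).
  move=> hT ->; rewrite sqrt_div //; last lra.
  have := sqrt_lt_R0 _ m0; move: (sqrt _) => u hu; field; lra.
have T0 : 0 < Rabs j / (2 * INR p * Rabs (zr c)) by apply: Rdiv_lt_0_compat.
have kp : 0 < j / (2 * INR p * zr c) -> kap (RtoC (j / (2 * INR p * zr c))) = (RtoC (sqrt (2 * INR p * Rabs (zr c))) * RtoC (/ sqrt (Rabs j)) * kap1)%C.
  move=> h; rewrite kap_pos // (key _ h) ?RtoC_mult //.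
  rewrite -(Rabs_pos_eq _ (Rlt_le _ _ h)) Rabs_div ?(Rabs_mult _ (zr c)) ?(Rabs_pos_eq (2 * INR p)) //; first lra.
  by apply: Rmult_integral_contrapositive_currified => //; lra.
have kn : j / (2 * INR p * zr c) < 0 -> kap (RtoC (j / (2 * INR p * zr c))) = (RtoC (sqrt (2 * INR p * Rabs (zr c))) * RtoC (/ sqrt (Rabs j)) * (Ci * kap1))%C.
  move=> h; have h' : 0 < - (j / (2 * INR p * zr c)) by lra.
  rewrite kap_neg // (key _ h') ?RtoC_mult //.
  rewrite -(Rabs_left _ h) Rabs_div ?(Rabs_mult _ (zr c)) ?(Rabs_pos_eq (2 * INR p)) //; first lra.
  by apply: Rmult_integral_contrapositive_currified => //; lra.
have CC := Ci_sq.
move: (RtoC (sqrt _)) (RtoC (/ _)) kp kn => S W kp kn.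
rewrite /th /c_sign; case: (boolP (0 < c)%R) => hc0.
  have zc : 0 < zr c by case: (c) hc0 => // n hn; rewrite zr_Posz; apply: lt_0_INR; lia.
  have z1 : zr 1%R = 1 by [].
  have mc : 0 < 2 * INR p * zr c by nra.
  case: Rlt_dec => h /=.
    rewrite kn; last by have := Rdiv_lt_0_compat _ _ (ltac:(lra) : 0 < - j) mc; rewrite /Rdiv; lra.
    have -> : - (- PI / 2) = PI / 2 by field.
    by rewrite Cis_PI2 z1; field.
  rewrite kp; last by apply: Rdiv_lt_0_compat => //; lra.
  have -> : - (0 / 2) = 0 by field.
  by rewrite Cis_0 z1; field.
have zc : zr c < 0.
  case: (c) hc0 hc => n hn h; first by lia.
  by rewrite zr_Negz; have := pos_INR n; lra.
have z1 : zr (-1)%R = -1 by rewrite zrN.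
have mc : 0 < - (2 * INR p * zr c) by nra.
case: Rlt_dec => h /=.
  rewrite kp; last first.
    have -> : j / (2 * INR p * zr c) = (- j) / (- (2 * INR p * zr c)) by field; lra.
    by apply: Rdiv_lt_0_compat => //; lra.
  rewrite Cis_mPI2 z1 (RtoC_opp 1).
  transitivity (- (Ci * Ci) * kap1 * S / G * W)%C; first by field.
  by rewrite CC; field.
rewrite kn; last first.
  have -> : j / (2 * INR p * zr c) = - (j / (- (2 * INR p * zr c))) by field; lra.
  by have := Rdiv_lt_0_compat _ _ (ltac:(lra) : 0 < j) mc; lra.
have -> : - (0 / 2) = 0 by field.
by rewrite Cis_0 z1 (RtoC_opp 1); field.
Qed.

Lemma ratr_autj (g : 'M[int]_2) x : ratr (autj g x) = zr (g 1%R 0%R) * ratr x + zr (g 1%R 1%R).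
Proof. by rewrite /autj rmorphD rmorphM !rmorph_int. Qed.

Lemma ratr_moebius (g : 'M[int]_2) x :
  ratr (moebius g x) = (zr (g 0%R 0%R) * ratr x + zr (g 0%R 1%R)) / (zr (g 1%R 0%R) * ratr x + zr (g 1%R 1%R)).
Proof. by rewrite -ratr_autj /moebius fmorph_div rmorphD rmorphM !rmorph_int. Qed.

Theorem thetaf_quantum_modular (p : nat) (phi : int -> C) (B : R) (L : seq int) (dd : int -> C) :
  (0 < p)%N -> (forall n, phi (n + Posz (2 * p))%R = phi n) -> (forall n, Cmod (phi n) <= B) ->
  quantum_modular (1 / 2%:R)%R (fun=> True) (thetaf (2 * INR p) phi L dd).
Proof.
move=> hp hphi hB; split; first by exists 1%R.
split; first by exists 0%R.
pose chi (g : 'M[int]_2) := if g 1%R 0%R == 0%R then RtoC 1 else (/ chi_inv p g)%C.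
exists (level_group (4 * p)), chi, (thetalim p phi L dd).
have P0 : 0 < INR p by apply: lt_0_INR; lia.
have ent (g : 'M[int]_2) : level_group (4 * p) g -> exists h : 'M[int]_2,
   [/\ g 0%R 0%R = (1 + Posz (4 * p) * h 0%R 0%R)%R, g 0%R 1%R = (Posz (4 * p) * h 0%R 1%R)%R,
       g 1%R 0%R = (Posz (4 * p) * h 1%R 0%R)%R, g 1%R 1%R = (1 + Posz (4 * p) * h 1%R 1%R)%R &
       (g 0%R 0%R * g 1%R 1%R - g 0%R 1%R * g 1%R 0%R)%R = 1%R].
  move=> [dg [h e]]; exists h; split; rewrite -?det_mx2 //; by rewrite e !mxE /= ?mulr1n ?mulr0n ?add0r.
have sgn_spec (c : int) : c != 0%R -> c_sign c = 1%R \/ c_sign c = (-1)%R by rewrite /c_sign; case: ifP; [left | right].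
have sgn_K (c : int) : c != 0%R -> Posz (2 * p * absz c) = (Posz (2 * p) * (c_sign c * c))%R.
  by rewrite /c_sign; case: ifP; lia.
have gnz (g : 'M[int]_2) : level_group (4 * p) g -> g 1%R 0%R != 0%R -> g0 p (2 * p * absz (g 1%R 0%R)) (g 0%R 0%R) (g 1%R 0%R) <> RtoC 0.
  move=> /ent [h [ha hb hc hd det]] c0.
  exact: (g0_neq0 hp c0 det ha hb hc hd (sgn_spec _ c0) (sgn_K _ c0)).
have cinz (g : 'M[int]_2) : level_group (4 * p) g -> g 1%R 0%R != 0%R -> chi_inv p g <> RtoC 0.
  move=> hg c0; have G0 := gnz g hg c0; rewrite /chi_inv.
  have cz : zr (g 1%R 0%R) <> 0 by move=> h; move: c0; rewrite (zr_inj (h : zr _ = zr 0)).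
  have sp : 0 < sqrt (2 * INR p * Rabs (zr (g 1%R 0%R))).
    by apply: sqrt_lt_R0; have := Rabs_pos_lt _ cz; nra.
  have e0 : (if (0 < g 1%R 0%R)%R then - RtoC 1 else Ci)%C <> RtoC 0.
    case: ifP => _ h; have : Cmod (RtoC 0) = 1 by [rewrite -h ?Cmod_opp ?Cmod_Ci ?Cmod_1].
      by rewrite Cmod_0; lra.
    by rewrite Cmod_0; lra.
  apply: Cmult_neq_0; last by apply: Cinv_nz.
  apply: Cmult_neq_0; last by move/RtoC_inj; lra.
  by apply: Cmult_neq_0 => //; exact: kap1_neq0.
have half : ratr (- (1 / 2%:R))%R = - (1 / 2) :> R.
  by rewrite rmorphN fmorph_div rmorph1 rmorph_nat.
split=> //.
- by apply: level_group_finite_index; lia.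
- move=> g hg; rewrite /chi; case: eqP => [_|/eqP c0]; first by move/RtoC_inj; lra.
  by apply: Cinv_nz; exact: cinz.
- by move=> x _; exact: (@thetaf_vlim p phi B).
move=> g hg; have [h [ha hb hc hd det]] := ent g hg.
have jE x : autj g x != 0%R -> zr (g 1%R 0%R) * ratr x + zr (g 1%R 1%R) <> 0.
  move=> hj e; case/eqP: hj; apply: (fmorph_inj (ratr : rat -> R)).
  by rewrite rmorph0; apply: etrans (ratr_autj g x) _; rewrite e.
(* With c = 0, ad = 1 and the congruences leave only translations, for which the multiplier is 1 and
   the error is 0. *)
case: (boolP (g 1%R 0%R == 0%R)) => c0.
  have e0 := eqP c0.
  have [a1 d1] : g 0%R 0%R = 1%R /\ g 1%R 1%R = 1%R.
    move: det; rewrite e0 mulr0 subr0 => det.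
    have : (absz (g 0%R 0%R) * absz (g 1%R 1%R) == 1)%N by rewrite -abszM det.
    rewrite muln_eq1 => /andP [/eqP h1 /eqP h2].
    (* The value -1 is excluded because 4p does not divide 2. *)
    have E (u v : int) : absz u = 1%N -> u = (1 + Posz (4 * p) * v)%R -> u = 1%R.
      move=> hu; rewrite (_ : (4 * p)%N = (p * 4)%N) ?PoszM -?mulrA; last by rewrite mulnC.
      rewrite mulrCA; move: (Posz p * v)%R => w e; lia.
    by split; [exact: E h1 ha | exact: E h2 hd].
  exists (fun=> RtoC 0); first by move=> x _; exact: ana_const.
  move=> x _ hj.
  have hy : ratr (moebius g x) = ratr x + zr (Posz (4 * p) * h 0%R 1%R)%R.
    have F (X Y : R) : (1 * X + Y) / (0 * X + 1) = X + Y by field; lra.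
    by rewrite -hb; apply: etrans (ratr_moebius g x) _; rewrite a1 d1 e0; exact: F.
  rewrite (thetalim_shift _ _ hp hphi hB hy) /chi c0.
  have -> : autpow g x (ratr (- (1 / 2%:R))%R) = RtoC 1.
    have ej : autj g x = 1%R by rewrite /autj e0 d1 mul0r add0r.
    rewrite /autpow ej half rmorph1 -[(1%R : R)]/1 Rabs_R1 ln_1.
    by case: Rlt_dec => ?; [lra | rewrite /= !Cmult_0_r Cplus_0_r Cmult_0_r Cexp_0].
  have -> : (/ RtoC 1 = RtoC 1)%C by field.
  by ring.
exists (modh p phi L dd (2 * p * absz (g 1%R 0%R)) (g 0%R 0%R) (g 1%R 0%R) (g 1%R 1%R) (c_sign (g 1%R 0%R))).
  move=> x hx; apply: (ana_modh phi L dd hp c0 det ha hb hc hd (sgn_spec _ c0) (sgn_K _ c0)).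
  by apply: hx; apply/eqP.
move=> x _ hj.
have hj' := jE x hj.
rewrite -(thetalim_cocycle L dd hp hphi hB c0 det ha hb hc hd (sgn_spec _ c0) (sgn_K _ c0) hj' (ratr_moebius g x)).
rewrite /Cminus; congr Cplus; rewrite /chi (negbTE c0).
have -> : (/ / chi_inv p g = chi_inv p g)%C by have nz := cinz g hg c0; field.
rewrite -[X in (- X)%C]/(chi_inv p g * autpow g x (ratr (- (1 / 2%:R))%R) * thetalim p phi L dd (moebius g x))%C.
have := @kap_autpow p (g 0%R 0%R) (g 0%R 1%R) _ (g 1%R 1%R) _ _ hp c0 hj' (gnz g hg c0).
rewrite -/(chi_inv p g) -half -ratr_autj => E.
have -> : (chi_inv p g * autpow g x (ratr (- (1 / 2%:R))%R))%C = (- (RtoC (zr (c_sign (g 1%R 0%R))) / g0 p (2 * p * absz (g 1%R 0%R)) (g 0%R 0%R) (g 1%R 0%R) * kap (RtoC (modT p (g 1%R 0%R) (g 1%R 1%R) (ratr x)))))%C.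
  rewrite /autpow; apply: etrans E _.
  by rewrite /modT -(ratr_autj g x).
ring.
Qed.

(** * Principal values on the torus *)

Lemma bigC_scalr (T : eqType) (s : seq T) (f : T -> C) a :
  \big[Cplus/RtoC 0]_(x <- s) (f x * a)%C = ((\big[Cplus/RtoC 0]_(x <- s) f x) * a)%C.
Proof.
rewrite Cmult_comm -bigC_scal; apply: eq_bigr => x _; exact: Cmult_comm.
Qed.

Lemma is_RInt_Cbig (T : eqType) (s : seq T) (f : T -> R -> C) (l : T -> C) a b :
  (forall x, x \in s -> is_RInt (f x : R -> CV) a b (l x)) ->
  is_RInt (fun t => \big[Cplus/RtoC 0]_(x <- s) f x t : CV) a b (\big[Cplus/RtoC 0]_(x <- s) l x).
Proof.
elim: s => [|x s IH] h.
  rewrite big_nil; apply: (is_RInt_ext (V := CV) (fun=> RtoC 0)); first by move=> t _; rewrite big_nil.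
  have := is_RInt_const (V := CV) a b (RtoC 0); rewrite scalCE Cmult_0_r; exact.
rewrite big_cons.
apply: (is_RInt_ext (V := CV) (fun t => plus (f x t : CV) (\big[Cplus/RtoC 0]_(y <- s) f y t : CV))).
  by move=> t _; rewrite big_cons.
apply: (is_RInt_plus (V := CV)); first exact: h (mem_head _ _).
by apply: IH => y hy; apply: h; rewrite inE hy orbT.
Qed.

Lemma is_sum_over_tail (T : eqType) (P : T -> Prop) (f : T -> C) (g : T -> R) l (s0 s : seq T) e :
  is_sum_over P f l -> (forall x, P x -> Cmod (f x) <= g x) ->
  (forall s, uniq s -> (forall x, x \in s -> P x) -> (forall x, x \in s -> x \notin s0) -> \big[Rplus/0]_(x <- s) g x <= e) ->
  uniq s -> (forall x, x \in s -> P x) -> {subset s0 <= s} ->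
  Cmod (\big[Cplus/RtoC 0]_(x <- s) f x - l) <= e.
Proof.
move=> hl hg ht us ps sub; apply: le_epsilon => d /hl [s1 [u1 p1 h1]].
have ut := undup_uniq (s ++ s1).
have pt x : x \in undup (s ++ s1) -> P x by rewrite mem_undup mem_cat => /orP [/ps|/p1].
have {}h1 := h1 _ ut pt (fun x hx => etrans (mem_undup _ _) (etrans (mem_cat _ _ _) (introT orP (or_intror hx)))).
apply: Rle_trans (Cmod_le_dist _ (\big[Cplus/RtoC 0]_(x <- undup (s ++ s1)) f x) _) _.
apply: Rplus_le_compat; last exact: Rlt_le.
rewrite Cmod_switch (bigC_subset f us ut) => [|x hx]; last by rewrite mem_undup mem_cat hx.
have -> (a b : C) : (a + b - a)%C = b by ring.
apply: Rle_trans (Cmod_bigsum _ _) _.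
apply: Rle_trans (ht [seq x <- undup (s ++ s1) | x \notin s] _ _ _).
- by apply: bigR_le => x; rewrite mem_filter => /andP [_ /pt /hg].
- exact: filter_uniq.
- by move=> x; rewrite mem_filter => /andP [_ /pt].
- by move=> x; rewrite mem_filter => /andP [hx _]; apply: contra hx; exact: sub.
Qed.

(** The finite partial sums converge uniformly along [fin_filter P], because the tail of [b] times
    the bound [G] does not depend on the point. *)
Lemma RInt_sum (T : eqType) (P : T -> Prop) (b : T -> C) (f : T -> R -> C) (h : R -> C) (al be G : R) :
  al <= be -> 0 <= G -> summable P b ->
  (forall x t, al <= t <= be -> continuous (f x : R -> CV) t /\ Cmod (f x t) <= G) ->
  (forall t, al <= t <= be -> is_sum_over P (fun x => b x * f x t)%C (h t)) ->
  is_sum_over P (fun x => b x * RInt (V := CV) (f x) al be)%C (RInt (V := CV) h al be).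
Proof.
move=> hab G0 hb hf hh.
(* Clamping to the interval turns uniform convergence there into uniform convergence on the whole
   line, the form in which [filterlim_RInt] takes it. *)
pose cl t := Rmax al (Rmin be t).
have hcl t : al <= cl t <= be.
  split; first exact: Rmax_l.
  apply: Rmax_lub => //; exact: Rmin_l.
have clE t : Rmin al be < t < Rmax al be -> cl t = t.
  rewrite Rmin_left // Rmax_right // => -[h1 h2]; rewrite /cl Rmin_right ?Rmax_right //; lra.
have FF := fin_filter_proper P.
pose S (s : seq T) (t : R) : C := \big[Cplus/RtoC 0]_(x <- s) (b x * f x (cl t))%C.
have iS s : is_RInt (S s : R -> CV) al be (\big[Cplus/RtoC 0]_(x <- s) (b x * RInt (V := CV) (f x) al be)%C).
  apply: is_RInt_Cbig => x _.
  have ex : ex_RInt (f x : R -> CV) al be.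
    apply: (ex_RInt_continuous (V := CV)) => t; rewrite Rmin_left // Rmax_right // => ht; exact: (proj1 (hf x t ht)).
  apply: (is_RInt_ext (V := CV) (fun t => (b x * f x t)%C)); first by move=> t /clE ->.
  rewrite -RInt_Cscal //; apply: RInt_correct.
  apply: (ex_RInt_continuous (V := CV)) => t; rewrite Rmin_left // Rmax_right // => ht.
  by apply: continuous_Cmult; [exact: continuous_const | exact: (proj1 (hf x t ht))].
have unif : filterlim (S : seq T -> fct_UniformSpace R CV) (fin_filter P) (locally ((fun t => h (cl t)) : fct_UniformSpace R CV)).
  apply/filterlim_locally => eps.
  have e1 : 0 < eps / (2 * (G + 1)) by apply: Rdiv_lt_0_compat; [exact: cond_pos | lra].
  have [s0 [u0 p0 h0]] := summable_tail hb e1.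
  exists s0; split=> // s us ps sub t.
  apply: ball_Cmod.
  apply: Rle_lt_trans (_ : eps / 2 < eps); last by have := cond_pos eps; lra.
  apply: (is_sum_over_tail (g := fun x => (G + 1) * Cmod (b x)) (hh (cl t) (hcl t)) _ _ us ps sub).
    move=> x _; rewrite Cmod_mult Rmult_comm; apply: Rmult_le_compat_r; first exact: Cmod_ge_0.
    have := proj2 (hf x _ (hcl t)); lra.
  move=> s' us' ps' ds'; rewrite bigR_scal.
  have := h0 s' us' ps' ds' => /Rlt_le h1.
  have -> : eps / 2 = (G + 1) * (eps / (2 * (G + 1))) by field; lra.
  by apply: Rmult_le_compat_l; lra.
have [I [hI1 hI2]] := filterlim_RInt (V := CV) S al be (fin_filter P) FF _ _ iS unif.
have -> : RInt (V := CV) h al be = I.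
  apply: (is_RInt_unique (V := CV)); apply: (is_RInt_ext (V := CV)) hI2 => t /clE -> //.
by apply/is_sum_overP.
Qed.

Definition cut (eps t : R) := eps <= t <= PI - eps \/ PI + eps <= t <= 2 * PI - eps.

Definition tame (eps G : R) (g : C -> C) := forall t, cut eps t ->
  continuous (fun u => g (Cis u) : CV) t /\ Cmod (g (Cis t)) <= G.

Lemma Cmod_Cis t : Cmod (Cis t) = 1.
Proof. by rewrite -Cexp_iR Cmod_Cexp !ReImE /= -[RHS]exp_0; congr exp; ring. Qed.

Lemma continuous_Cis t : continuous (fun u => Cis u : CV) t.
Proof.
apply: (continuous_ext (fun u => Cexp (RtoC u * Ci) : CV)).
  by move=> u; rewrite -Cexp_iR Cmult_comm.
by apply: continuous_Cexp; exact: continuous_derive (is_derive_lin _ t).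
Qed.

Lemma tame_integrand eps G g t : tame eps G g -> cut eps t ->
  continuous (fun u => g (Cis u) * (Ci * Cis u) : CV)%C t /\ Cmod (g (Cis t) * (Ci * Cis t)) <= G.
Proof.
move=> hg /hg [h1 h2]; split.
  apply: continuous_Cmult => //; apply: continuous_Cmult; [exact: continuous_const | exact: continuous_Cis].
by rewrite Cmod_mult (Cmod_mult Ci) Cmod_Ci Cmod_Cis !Rmult_1_r.
Qed.

Lemma circle_sum (T : eqType) (P : T -> Prop) (b : T -> C) (g : T -> C -> C) (H : C -> C) (eps G : R) :
  0 < eps < PI / 2 -> 0 <= G -> summable P b -> (forall x, tame eps G (g x)) ->
  (forall t, cut eps t -> is_sum_over P (fun x => b x * g x (Cis t))%C (H (Cis t))) ->
  is_sum_over P (fun x => b x * circle_int eps (g x))%C (circle_int eps H).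
Proof.
move=> he G0 hb hg hH.
pose k x t := (g x (Cis t) * (Ci * Cis t))%C.
have hk x t : cut eps t -> continuous (k x : R -> CV) t /\ Cmod (k x t) <= G by exact: tame_integrand.
have hs t : cut eps t -> is_sum_over P (fun x => b x * k x t)%C (H (Cis t) * (Ci * Cis t))%C.
  move=> /hH h; rewrite Cmult_comm; apply: is_sum_over_ext (is_sum_over_scal _ h) => x _; rewrite /k; ring.
have s1 := @RInt_sum _ P b k _ eps (PI - eps) G (ltac:(lra)) G0 hb (fun x t ht => hk x t (or_introl ht)) (fun t ht => hs t (or_introl ht)).
have s2 := @RInt_sum _ P b k _ (PI + eps) (2 * PI - eps) G (ltac:(lra)) G0 hb (fun x t ht => hk x t (or_intror ht)) (fun t ht => hs t (or_intror ht)).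
apply: is_sum_over_ext (is_sum_over_plus s1 s2) => x _.
by rewrite /circle_int Cmult_plus_distr_l.
Qed.

Lemma circle_bound eps G g : 0 < eps < PI / 2 -> 0 <= G -> tame eps G g -> Cmod (circle_int eps g) <= 2 * PI * G.
Proof.
move=> he G0 hg; have hp := PI_RGT_0.
have aux al be : al <= be -> (forall t, al <= t <= be -> cut eps t) ->
   Cmod (RInt (V := CV) (fun u => g (Cis u) * (Ci * Cis u))%C al be) <= (be - al) * G.
  move=> hab hc; set k := (fun u : R => _).
  have hk t : al <= t <= be -> continuous (k : R -> CV) t /\ Cmod (k t) <= G.
    by move=> /hc; exact: tame_integrand.
  rewrite -Cmod_normE.
  apply: (norm_RInt_le_const (V := CV) k al be _ G) => // [t /hk [_]|]; first by rewrite Cmod_normE.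
  apply: (RInt_correct (V := CV)); apply: (ex_RInt_continuous (V := CV)) => t.
  by rewrite Rmin_left // Rmax_right // => /hk [].
apply: Rle_trans (Cmod_triangle _ _) _.
have h1 := aux eps (PI - eps) (ltac:(lra)) (fun t ht => or_introl ht).
have h2 := aux (PI + eps) (2 * PI - eps) (ltac:(lra)) (fun t ht => or_intror ht).
nra.
Qed.

Definition Cprod n (f : 'I_n -> C) : C := \big[Cmult/RtoC 1]_(j < n) f j.

Lemma CprodS n (f : 'I_n.+1 -> C) : Cprod f = (f ord0 * Cprod (fun j => f (lift ord0 j)))%C.
Proof. by rewrite /Cprod big_ord_recl. Qed.

Lemma Cprod_bound n (f : 'I_n -> C) (B : R) : (forall j, Cmod (f j) <= B) -> Cmod (Cprod f) <= B ^ n.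
Proof.
elim: n f => [|n IH] f h; first by rewrite /Cprod big_ord0 Cmod_1 /=; lra.
rewrite CprodS Cmod_mult; apply: Rmult_le_compat => //; try exact: Cmod_ge_0.
exact: IH.
Qed.

Lemma summable_mult (T : eqType) (P : T -> Prop) (b c : T -> C) (B : R) : 0 <= B ->
  summable P b -> (forall x, Cmod (c x) <= B) -> summable P (fun x => b x * c x)%C.
Proof.
move=> B0 [S hS] hc; exists (B * S) => s us ps.
apply: Rle_trans (_ : B * \big[Rplus/0]_(x <- s) Cmod (b x) <= _); last by apply: Rmult_le_compat_l => //; exact: hS.
rewrite -bigR_scal; apply: bigR_le => x _; rewrite Cmod_mult Rmult_comm.
by apply: Rmult_le_compat_r; [exact: Cmod_ge_0 | exact: hc].
Qed.

Definition on_cut eps n (w : 'I_n -> C) := forall j, exists2 t, cut eps t & w j = Cis t.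

Lemma fcons0 n z (w : 'I_n -> C) : fcons z w ord0 = z.
Proof. by rewrite /fcons unlift_none. Qed.
Lemma fconsS n z (w : 'I_n -> C) j : fcons z w (lift ord0 j) = w j.
Proof. by rewrite /fcons liftK. Qed.

(** Induction on the number of variables. For a fixed outer variable its factor is absorbed into the
    coefficients, which stay summable by tameness; no theorem on iterated integrals is involved. *)
Lemma torus_sum (T : eqType) (P : T -> Prop) (eps G : R) n (a : T -> C) (g : 'I_n -> T -> C -> C) (F : ('I_n -> C) -> C) :
  0 < eps < PI / 2 -> 0 <= G -> summable P a -> (forall j x, tame eps G (g j x)) ->
  (forall w, on_cut eps w -> is_sum_over P (fun x => a x * Cprod (fun j => g j x (w j)))%C (F w)) ->
  is_sum_over P (fun x => a x * Cprod (fun j => circle_int eps (g j x)))%C (torus_int eps F).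
Proof.
move=> he G0; have hp := PI_RGT_0.
elim: n a g F => [|n IH] a g F ha hg hF.
  have h := hF (fun=> RtoC 1) (ltac:(by case)).
  by apply: is_sum_over_ext h => x _; rewrite /Cprod !big_ord0.
rewrite [torus_int _ _]/=.
have gb j x : Cmod (circle_int eps (g j x)) <= 2 * PI * G by exact: circle_bound.
pose b x := (a x * Cprod (fun j => circle_int eps (g (lift ord0 j) x)))%C.
have hb : summable P b.
  apply: (@summable_mult _ P a _ ((2 * PI * G) ^ n)) => //; first by apply: pow_le; nra.
  by move=> x; apply: Cprod_bound.
have H := @circle_sum _ P b (fun x => g ord0 x) (fun z => torus_int eps (fun w : 'I_n -> C => F (fcons z w))) eps G he G0 hb (hg ord0).
apply: is_sum_over_ext (H _) => [x _|t ht].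
  by rewrite /b CprodS; ring.
have ha' : summable P (fun x => a x * g ord0 x (Cis t))%C.
  by apply: (@summable_mult _ P a _ G) => // x; exact: (proj2 (hg ord0 x t ht)).
have := IH (fun x => a x * g ord0 x (Cis t))%C (fun j => g (lift ord0 j)) (fun w => F (fcons (Cis t) w)) ha' (fun j => hg (lift ord0 j)).
move=> H1; apply: is_sum_over_ext (H1 _) => [x _|w hw]; first by rewrite /b -!Cmult_assoc; congr Cmult; exact: Cmult_comm.
have hw' : on_cut eps (fcons (Cis t) w).
  move=> j; case: (unliftP ord0 j) => [i ->|->]; first by rewrite fconsS.
  by rewrite fcons0; exists t.
apply: is_sum_over_ext (hF _ hw') => x _.
rewrite CprodS fcons0 -Cmult_assoc; congr (_ * (_ * _))%C.
by apply: eq_bigr => j _; rewrite fconsS.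
Qed.

(** * Vertex factors on the cut circle *)

Lemma Cis_add x y : Cis (x + y) = (Cis x * Cis y)%C.
Proof. by rewrite -!Cexp_iR -Cexp_add; congr Cexp; rewrite RtoC_plus; ring. Qed.

Lemma Cis_opp x : Cis (- x) = (/ Cis x)%C.
Proof. by rewrite -!Cexp_iR -Cexp_opp; congr Cexp; rewrite RtoC_opp; ring. Qed.

Lemma Cis_neq0 x : Cis x <> RtoC 0.
Proof. by rewrite -Cexp_iR; exact: Cexp_neq0. Qed.

Lemma Cpowz_Cis t m : Cpowz (Cis t) m = Cis (zr m * t).
Proof.
have h n : Cpow (Cis t) n = Cis (INR n * t).
  by rewrite -!Cexp_iR Cexp_pow; congr Cexp; rewrite RtoC_mult; ring.
case: m => n; first by rewrite /= h zr_Posz.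
rewrite -[Cpowz _ _]/(/ Cpow (Cis t) n.+1)%C h -Cis_opp zr_Negz S_INR; congr Cis; ring.
Qed.

Lemma Cis_diff t : (Cis t - / Cis t)%C = (2 * Ci * RtoC (sin t))%C.
Proof. by rewrite -Cis_opp /Cis cos_neg sin_neg RtoC_opp; ring. Qed.

Definition vfac (d : nat) (m : int) (z : C) : C :=
  (Cpow (z - / z) 2 * Cpow (/ (z - / z)) d * Cpowz z m * / z)%C.

Lemma vfac_Cis d m t :
  (vfac d m (Cis t) * (Ci * Cis t) = Ci * (Cpow (2 * Ci * RtoC (sin t)) 2 * Cpow (/ (2 * Ci * RtoC (sin t))) d) * Cis (zr m * t))%C.
Proof. by rewrite /vfac Cis_diff Cpowz_Cis; have := @Cis_neq0 t; move: (Cis t) => z hz; field. Qed.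

Lemma sin_cut eps t : 0 < eps < PI / 2 -> cut eps t -> sin eps <= Rabs (sin t).
Proof.
move=> he; have hp := PI_RGT_0.
have aux u : eps <= u <= PI - eps -> sin eps <= sin u.
  move=> hu; have [h|h] := Rle_or_lt u (PI / 2); first by apply: sin_incr_1; lra.
  by rewrite -(sin_PI_x u); apply: sin_incr_1; lra.
case=> ht; first by apply: Rle_trans (Rle_abs _); exact: aux.
have -> : sin t = - sin (t - PI) by rewrite -neg_sin; congr sin; ring.
rewrite Rabs_Ropp; apply: Rle_trans (Rle_abs _); apply: aux; lra.
Qed.

Lemma sin_cut_neq0 eps t : 0 < eps < PI / 2 -> cut eps t -> sin t <> 0.
Proof.
move=> he hc h; have := sin_cut he hc; rewrite h Rabs_R0.
have : 0 < sin eps by apply: sin_gt_0; lra.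
lra.
Qed.

Lemma sin2i_neq0 t : sin t <> 0 -> (2 * Ci * RtoC (sin t))%C <> RtoC 0.
Proof.
move=> h; apply: Cmult_neq_0; last by move/RtoC_inj.
by apply: Cmult_neq_0; [move/RtoC_inj; lra | move=> /(congr1 Im) /=; lra].
Qed.

Lemma continuous_Cpow (f : R -> C) n t : continuous (f : R -> CV) t -> continuous (fun u => Cpow (f u) n : CV) t.
Proof.
move=> h; elim: n => [|n IH] /=; first exact: continuous_const.
exact: continuous_Cmult.
Qed.

Lemma continuous_sinC t : continuous (fun u => (2 * Ci * RtoC (sin u))%C : CV) t.
Proof.
apply: continuous_Cmult; first exact: continuous_const.
by apply: continuous_RtoC; exact: continuous_sin.
Qed.

Lemma continuous_Cis_lin a t : continuous (fun u => Cis (a * u) : CV) t.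
Proof.
apply: (continuous_comp (fun u => a * u) (fun u => Cis u : CV)); last exact: continuous_Cis.
by apply: (ex_derive_continuous (V := R_NormedModule)); auto_derive.
Qed.

Lemma Cmod_pow (z : C) n : Cmod (Cpow z n) = Cmod z ^ n.
Proof. by elim: n => [|n IH] /=; rewrite ?Cmod_1 // Cmod_mult IH. Qed.

Lemma vfac_tame d m eps : 0 < eps < PI / 2 -> (d <= 3)%N -> tame eps (4 * (1 + / (2 * sin eps)) ^ 3) (vfac d m).
Proof.
move=> he hd t ht; have hp := PI_RGT_0.
have se : 0 < sin eps by apply: sin_gt_0; lra.
have st := sin_cut he ht; have snz := sin_cut_neq0 he ht.
split.
  apply: (continuous_ext (fun u => Cpow (2 * Ci * RtoC (sin u)) 2 * Cpow (/ (2 * Ci * RtoC (sin u))) d * Cis (zr m * u) * Cis ((-1) * u) : CV)%C).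
    move=> u; rewrite /vfac Cis_diff Cpowz_Cis -Cis_opp; congr (_ * Cis _)%C; ring.
  apply: continuous_Cmult; last exact: continuous_Cis_lin.
  apply: continuous_Cmult; last exact: continuous_Cis_lin.
  apply: continuous_Cmult; apply: continuous_Cpow; first exact: continuous_sinC.
  apply: continuous_Cinv; [exact: continuous_sinC | exact: sin2i_neq0].
have c0 : Cmod (2 * Ci * RtoC (sin t)) = 2 * Rabs (sin t).
  by rewrite Cmod_mult Cmod_R Cmod_mult Cmod_Ci Cmod_R Rabs_pos_eq; lra.
rewrite /vfac Cis_diff Cpowz_Cis -Cis_opp Cmod_mult Cmod_Cis Cmod_mult Cmod_Cis !Rmult_1_r (Cmod_mult (Cpow _ _)) !Cmod_pow Cmod_inv ?c0; last exact: sin2i_neq0.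
have a0 : 0 < Rabs (sin t) by lra.
apply: Rmult_le_compat.
- exact: pow2_ge_0.
- by apply: pow_le; left; apply: Rinv_0_lt_compat; lra.
- have : Rabs (sin t) <= 1 by apply: Rabs_le; have := SIN_bound t; lra.
  by move=> h; rewrite /=; nra.
have q1 : / (2 * Rabs (sin t)) <= 1 + / (2 * sin eps).
  have : / (2 * Rabs (sin t)) <= / (2 * sin eps) by apply: Rinv_le_contravar; lra.
  lra.
have q0 : 0 < / (2 * sin eps) by apply: Rinv_0_lt_compat; lra.
apply: Rle_trans (_ : (1 + / (2 * sin eps)) ^ d <= _).
  by apply: pow_incr; split=> //; left; apply: Rinv_0_lt_compat; lra.
by apply: Rle_pow; [lra | apply/leP].
Qed.

Definition arcs (eps : R) (k : R -> C) : C :=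
  (RInt (V := CV) k eps (PI - eps) + RInt (V := CV) k (PI + eps) (2 * PI - eps))%C.

Definition cont_cut eps (k : R -> C) := forall t, cut eps t -> continuous (k : R -> CV) t.

Section Arcs.
Variable eps : R.
Hypothesis he : 0 < eps < PI / 2.
Implicit Types k l : R -> C.

Let ex1 k : cont_cut eps k -> ex_RInt (k : R -> CV) eps (PI - eps).
Proof.
move=> h; apply: (ex_RInt_continuous (V := CV)) => t.
by rewrite Rmin_left ?Rmax_right; try lra; move=> ht; apply: h; left.
Qed.
Let ex2 k : cont_cut eps k -> ex_RInt (k : R -> CV) (PI + eps) (2 * PI - eps).
Proof.
move=> h; apply: (ex_RInt_continuous (V := CV)) => t.
by rewrite Rmin_left ?Rmax_right; try lra; move=> ht; apply: h; right.
Qed.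

Lemma arcs_ext k l : (forall t, cut eps t -> k t = l t) -> arcs eps k = arcs eps l.
Proof.
move=> h; congr Cplus; apply: (RInt_ext (V := CV)) => t; rewrite Rmin_left ?Rmax_right; try lra; move=> ht; apply: h; [left|right]; lra.
Qed.

Lemma arcs_plus k l : cont_cut eps k -> cont_cut eps l -> arcs eps (fun t => k t + l t)%C = (arcs eps k + arcs eps l)%C.
Proof.
move=> hk hl; rewrite /arcs.
have -> : RInt (V := CV) (fun t => k t + l t)%C eps (PI - eps) = (RInt (V := CV) k eps (PI - eps) + RInt (V := CV) l eps (PI - eps))%C.
  exact: (RInt_plus (V := CV) k l _ _ (ex1 hk) (ex1 hl)).
have -> : RInt (V := CV) (fun t => k t + l t)%C (PI + eps) (2 * PI - eps) = (RInt (V := CV) k (PI + eps) (2 * PI - eps) + RInt (V := CV) l (PI + eps) (2 * PI - eps))%C.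
  exact: (RInt_plus (V := CV) k l _ _ (ex2 hk) (ex2 hl)).
ring.
Qed.

Lemma arcs_scal k c : cont_cut eps k -> arcs eps (fun t => c * k t)%C = (c * arcs eps k)%C.
Proof.
move=> hk; rewrite /arcs (RInt_Cscal c (ex1 hk)) (RInt_Cscal c (ex2 hk)); ring.
Qed.

Lemma arcs_reflect k : cont_cut eps k -> arcs eps (fun t => k (2 * PI - t)) = arcs eps k.
Proof.
move=> hk.
have R1 a b a' b' : a' = 2 * PI - b -> b' = 2 * PI - a -> ex_RInt (k : R -> CV) a' b' ->
    RInt (V := CV) (fun t => k (2 * PI - t)) a b = RInt (V := CV) k a' b'.
  move=> -> -> h; apply: (is_RInt_unique (V := CV)).
  have := is_RInt_swap (V := CV) _ _ _ _ (RInt_correct (V := CV) _ _ _ h).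
  have -> : 2 * PI - a = -1 * a + 2 * PI by ring.
  have -> : 2 * PI - b = -1 * b + 2 * PI by ring.
  move=> /(is_RInt_comp_lin (V := CV)) /(is_RInt_opp (V := CV)); rewrite opp_opp.
  apply: (is_RInt_ext (V := CV)) => t _; rewrite scalCE.
  have -> : -1 * t + 2 * PI = 2 * PI - t by ring.
  have E (z : C) : (- (RtoC (-1) * z) = z)%C by apply: Ceq; rewrite !ReImE; ring.
  exact: E.
rewrite /arcs (R1 _ _ (PI + eps) (2 * PI - eps)) ?(R1 _ _ eps (PI - eps)); try ring.
- exact: ex1.
- exact: ex2.
Qed.

Lemma arcs_const_le k G : 0 <= G -> cont_cut eps k -> (forall t, cut eps t -> Cmod (k t) <= G) -> Cmod (arcs eps k) <= 2 * PI * G.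
Proof.
move=> G0 hk hG; have hp := PI_RGT_0.
have h1 : Cmod (RInt (V := CV) k eps (PI - eps)) <= (PI - eps - eps) * G.
  rewrite -Cmod_normE; apply: (norm_RInt_le_const (V := CV) k eps (PI - eps) _ G) => [|t ht|]; first lra.
    by rewrite Cmod_normE; apply: hG; left.
  exact: RInt_correct (ex1 hk).
have h2 : Cmod (RInt (V := CV) k (PI + eps) (2 * PI - eps)) <= (2 * PI - eps - (PI + eps)) * G.
  rewrite -Cmod_normE; apply: (norm_RInt_le_const (V := CV) k (PI + eps) (2 * PI - eps) _ G) => [|t ht|]; first lra.
    by rewrite Cmod_normE; apply: hG; right.
  exact: RInt_correct (ex2 hk).
apply: Rle_trans (Cmod_triangle _ _) _; nra.
Qed.

End Arcs.

Definition Aint (eps : R) (m : int) : C := arcs eps (fun t => Ci * Cis (zr m * t))%C.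
(** The central vertex: the only factor with poles, simple ones at 1 and -1. The factors of degree 1
    and 2 reduce to [Aint]. *)
Definition Jint (eps : R) (m : int) : C := arcs eps (fun t => Ci * / (2 * Ci * RtoC (sin t)) * Cis (zr m * t))%C.

Lemma cont_A eps m : cont_cut eps (fun t => Ci * Cis (zr m * t))%C.
Proof. by move=> t _; apply: continuous_Cmult; [exact: continuous_const | exact: continuous_Cis_lin]. Qed.

Lemma cont_J eps m : 0 < eps < PI / 2 -> cont_cut eps (fun t => Ci * / (2 * Ci * RtoC (sin t)) * Cis (zr m * t))%C.
Proof.
move=> he t ht; apply: continuous_Cmult; last exact: continuous_Cis_lin.
apply: continuous_Cmult; first exact: continuous_const.
apply: continuous_Cinv; [exact: continuous_sinC | apply: sin2i_neq0; exact: sin_cut_neq0 ht].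
Qed.

Lemma Aint_bound eps m : 0 < eps < PI / 2 -> Cmod (Aint eps m) <= 2 * PI.
Proof.
move=> he; rewrite -[X in _ <= X]Rmult_1_r; apply: arcs_const_le => //; first lra.
  exact: cont_A.
by move=> t _; rewrite Cmod_mult Cmod_Ci Cmod_Cis; lra.
Qed.

Lemma Cis_2sin m t : (2 * Ci * RtoC (sin t) * Cis (zr m * t) = Cis (zr (m + 1)%R * t) - Cis (zr (m - 1)%R * t))%C.
Proof.
have -> : zr (m + 1)%R * t = zr m * t + t by rewrite zrD (_ : zr 1 = 1) //; ring.
have -> : zr (m - 1)%R * t = zr m * t + - t by rewrite zrD zrN (_ : zr 1 = 1) //; ring.
by rewrite !Cis_add Cis_opp -Cis_diff; ring.
Qed.

(** Multiplying by z - 1/z cancels the pole. Together with the oddness [Jint_opp] this recursion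
    determines every [Jint] from the regular integrals [Aint], already before the cut shrinks. *)
Lemma Jint_rec eps m : 0 < eps < PI / 2 -> (Jint eps (m + 1)%R - Jint eps (m - 1)%R = Aint eps m)%C.
Proof.
move=> he.
have -> : (Jint eps (m + 1)%R - Jint eps (m - 1)%R = Jint eps (m + 1)%R + (-1) * Jint eps (m - 1)%R)%C by ring.
rewrite /Jint -(arcs_scal he _ (@cont_J eps (m - 1)%R he)) -(arcs_plus he); last 2 first.
- exact: cont_J.
- by move=> t ht; apply: continuous_Cmult; [exact: continuous_const | exact: (@cont_J eps _ he t ht)].
apply: (arcs_ext he) => t ht.
have nz := sin2i_neq0 (sin_cut_neq0 he ht).
transitivity (Ci * / (2 * Ci * RtoC (sin t)) * (Cis (zr (m + 1)%R * t) - Cis (zr (m - 1)%R * t)))%C; first by ring.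
by rewrite -Cis_2sin; move: (2 * Ci * RtoC (sin t))%C nz => X nz; field.
Qed.

Lemma Jint_opp eps m : 0 < eps < PI / 2 -> Jint eps (- m)%R = (- Jint eps m)%C.
Proof.
move=> he; rewrite /Jint -(arcs_reflect he (@cont_J eps m he)).
have -> (z : C) : (- z = (-1) * z)%C by ring.
rewrite -(arcs_scal he).
  apply: (arcs_ext he) => t ht.
  have nz := sin2i_neq0 (sin_cut_neq0 he ht).
  have -> : sin (2 * PI - t) = - sin t by rewrite sin_minus sin_2PI cos_2PI; ring.
  have -> : Cis (zr m * (2 * PI - t)) = Cis (zr (- m)%R * t).
    rewrite zrN (_ : zr m * (2 * PI - t) = 2 * PI * zr m + - zr m * t); last by ring.
    by rewrite Cis_add -cis2_Cis cis2_zr Cmult_1_l.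
  rewrite RtoC_opp; move: (RtoC (sin t)) nz => X nz.
  have cz : Ci <> RtoC 0 by move=> /(congr1 Im) /=; lra.
  have xz : X <> RtoC 0 by move=> e; apply: nz; rewrite e; ring.
  by field; split=> //; split.
move=> t ht.
have ht' : cut eps (2 * PI - t) by case: ht => ht; [right | left]; lra.
apply: (continuous_comp (fun u => 2 * PI - u) (fun u => Ci * / (2 * Ci * RtoC (sin u)) * Cis (zr m * u) : CV)%C); last exact: (@cont_J eps m he _ ht').
by apply: (ex_derive_continuous (V := R_NormedModule)); auto_derive.
Qed.

Lemma vfac2 eps m : 0 < eps < PI / 2 -> circle_int eps (vfac 2 m) = Aint eps m.
Proof.
move=> he; apply: (arcs_ext he) => t ht; rewrite vfac_Cis.
have nz := sin2i_neq0 (sin_cut_neq0 he ht).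
by rewrite /=; move: (2 * Ci * RtoC (sin t))%C nz => X nz; field.
Qed.

Lemma vfac1 eps m : 0 < eps < PI / 2 -> circle_int eps (vfac 1 m) = (Aint eps (m + 1)%R - Aint eps (m - 1)%R)%C.
Proof.
move=> he.
have -> : (Aint eps (m + 1)%R - Aint eps (m - 1)%R = Aint eps (m + 1)%R + (-1) * Aint eps (m - 1)%R)%C by ring.
rewrite /Aint -(arcs_scal he _ (@cont_A eps (m - 1)%R)) -(arcs_plus he); last 2 first.
- exact: cont_A.
- by move=> t ht; apply: continuous_Cmult; [exact: continuous_const | exact: (@cont_A eps _ t ht)].
apply: (arcs_ext he) => t ht; rewrite vfac_Cis.
have nz := sin2i_neq0 (sin_cut_neq0 he ht).
transitivity (Ci * (Cis (zr (m + 1)%R * t) - Cis (zr (m - 1)%R * t)))%C; last by ring.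
by rewrite -Cis_2sin /=; move: (2 * Ci * RtoC (sin t))%C nz => X nz; field.
Qed.

Lemma vfac3 eps m : 0 < eps < PI / 2 -> circle_int eps (vfac 3 m) = Jint eps m.
Proof.
move=> he; apply: (arcs_ext he) => t ht; rewrite vfac_Cis.
have nz := sin2i_neq0 (sin_cut_neq0 he ht).
by rewrite /=; move: (2 * Ci * RtoC (sin t))%C nz => X nz; field.
Qed.

Lemma at_right_continuous (A : R -> C) : continuous (A : R -> CV) 0 -> filterlim (A : R -> CV) (at_right 0) (locally (A 0 : CV)).
Proof. move=> c; refine (filterlim_filter_le_1 _ _ c); exact: filter_le_within. Qed.

Lemma small_eps (Q : R -> Prop) : (forall eps, 0 < eps < PI / 2 -> Q eps) -> at_right 0 Q.
Proof. by move=> h; apply: (@at_right0 _ (PI / 2)) => //; have := PI_RGT_0; lra. Qed.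

Lemma Aint_lim m : filterlim (fun eps => Aint eps m : CV) (at_right 0) (locally ((if m == 0%R then RtoC (2 * PI) * Ci else RtoC 0)%C : CV)).
Proof.
case: eqP => [->|/eqP m0].
  (* The cuts around 1 and -1 remove the total angle 4 eps. *)
  pose A (eps : R) := (RtoC (2 * PI) * Ci + RtoC eps * (-4 * Ci))%C.
  have E eps : A eps = Aint eps 0%R.
    have c x y : RInt (V := CV) (fun t => Ci * Cis (zr 0%R * t))%C x y = (RtoC (y - x) * Ci)%C.
      transitivity (RInt (V := CV) (fun=> Ci) x y).
        by apply: (RInt_ext (V := CV)) => t _; rewrite (_ : zr 0%R * t = 0) ?Cis_0 ?Cmult_1_r // (_ : zr 0%R = 0) //; ring.
      by rewrite (RInt_const (V := CV)) scalCE.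
    rewrite /Aint /arcs !c /A -Cmult_plus_distr_r -RtoC_plus.
    have -> : PI - eps - eps + (2 * PI - eps - (PI + eps)) = 2 * PI + eps * (-4) by ring.
    by rewrite (RtoC_plus (2 * PI)) (RtoC_mult eps) (RtoC_opp 4); ring.
  refine (filterlim_ext _ _ E _).
  have -> : (RtoC (2 * PI) * Ci)%C = A 0 by rewrite /A; ring.
  apply: at_right_continuous.
  by apply: continuous_Cplus; [exact: continuous_const | exact: continuous_derive (is_derive_lin _ 0)].
have z0 : zr m <> 0 by move=> h; move: m0; rewrite (zr_inj (h : zr m = zr 0)).
have Znz : RtoC (zr m) <> RtoC 0 by move/RtoC_inj.
pose G t := (/ RtoC (zr m) * Cis (zr m * t))%C.
have dG t : is_derive (G : R -> CV) t (Ci * Cis (zr m * t))%C.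
  have h := is_derive_Cexp (is_derive_lin (Ci * RtoC (zr m)) t).
  apply: (is_derive_ext (V := CV) (fun u => (/ RtoC (zr m) * Cexp (RtoC u * (Ci * RtoC (zr m))))%C)).
    by move=> u; rewrite /G -Cexp_iR; congr (_ * Cexp _)%C; rewrite RtoC_mult; ring.
  have := is_derive_Cmult (is_derive_const (V := CV) (/ RtoC (zr m))%C t) h.
  have -> : (zero * Cexp (RtoC t * (Ci * RtoC (zr m))) + / RtoC (zr m) * (Ci * RtoC (zr m) * Cexp (RtoC t * (Ci * RtoC (zr m)))))%C = (Ci * Cis (zr m * t))%C.
    rewrite -[zero]/(RtoC 0) -Cexp_iR (_ : (Ci * RtoC (zr m * t) = RtoC t * (Ci * RtoC (zr m)))%C); last by rewrite RtoC_mult; ring.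
    by field.
  by [].
have I x y : RInt (V := CV) (fun t => Ci * Cis (zr m * t))%C x y = (G y - G x)%C.
  apply: (is_RInt_unique (V := CV)); apply: (is_RInt_derive (V := CV) G) => t _; first exact: dG.
  by apply: continuous_Cmult; [exact: continuous_const | exact: continuous_Cis_lin].
pose A (eps : R) := (G (PI - eps)%coqR - G eps + (G (2 * PI - eps)%coqR - G (PI + eps)%coqR))%C.
have E eps : A eps = Aint eps m by rewrite /Aint /arcs !I.
refine (filterlim_ext _ _ E _).
have -> : RtoC 0 = A 0.
  rewrite /A !Rminus_0_r Rplus_0_r /G.
  have -> : Cis (zr m * (2 * PI)) = Cis (zr m * 0).
    by rewrite (_ : zr m * (2 * PI) = 2 * PI * zr m) -?cis2_Cis ?cis2_zr ?Rmult_0_r ?Cis_0 //; ring.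
  ring.
apply: at_right_continuous.
have cG u v : continuous (fun e => G (u * e + v) : CV) 0.
  apply: (continuous_comp (fun e => u * e + v) (G : R -> CV)); last exact: continuous_derive (dG _).
  by apply: (ex_derive_continuous (V := R_NormedModule)); auto_derive.
have sub (f g : R -> C) : continuous (f : R -> CV) 0 -> continuous (g : R -> CV) 0 -> continuous (fun e => f e - g e : CV)%C 0.
  by move=> hf hg; exact: (continuous_minus (V := CV)).
apply: (continuous_ext (fun e : R => ((G (-1 * e + PI)%coqR - G (1 * e + 0)%coqR) + (G (-1 * e + 2 * PI)%coqR - G (1 * e + PI)%coqR))%C : CV)).
  move=> e; rewrite /A; congr (_ - _ + (_ - _))%C; congr G; ring.
by apply: continuous_Cplus; apply: sub.
Qed.

(** The limit of the vertex integral divided by 2 pi i; the last branch is the one for degree 3. *)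
Definition lam_loc (d : nat) (m : int) : R :=
  if d == 1%N then (if m == (-1)%R then 1 else if m == 1%R then -1 else 0)
  else if d == 2%N then (if m == 0%R then 1 else 0)
  else if odd (absz m) then sg m / 2 else 0.

Lemma Jint_lim m : filterlim (fun eps => Jint eps m : CV) (at_right 0) (locally ((RtoC (2 * PI) * Ci * RtoC (lam_loc 3 m))%C : CV)).
Proof.
have J0 eps : 0 < eps < PI / 2 -> Jint eps 0%R = RtoC 0.
  move=> he; have := Jint_opp 0%R he; rewrite oppr0; move: (Jint eps 0%R) => z h.
  apply: Ceq; move: (congr1 Re h) (congr1 Im h); rewrite !ReImE /=; lra.
have J1 eps : 0 < eps < PI / 2 -> Jint eps 1%R = (RtoC (/ 2) * Aint eps 0%R)%C.
  move=> he; have := Jint_rec 0%R he; rewrite add0r sub0r (Jint_opp 1%R he) => <-.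
  apply: Ceq; rewrite !ReImE /=; field.
have pos n : filterlim (fun eps => Jint eps (Posz n) : CV) (at_right 0) (locally ((RtoC (2 * PI) * Ci * RtoC (lam_loc 3 (Posz n)))%C : CV)).
  suff [] : filterlim (fun eps => Jint eps (Posz n) : CV) (at_right 0) (locally ((RtoC (2 * PI) * Ci * RtoC (lam_loc 3 (Posz n)))%C : CV)) /\
    filterlim (fun eps => Jint eps (Posz n.+1) : CV) (at_right 0) (locally ((RtoC (2 * PI) * Ci * RtoC (lam_loc 3 (Posz n.+1)))%C : CV)) by [].
  elim: n => [|n [IH1 IH2]]; split=> //.
  - rewrite /lam_loc /= Cmult_0_r.
    apply: (filterlim_ext_loc (fun=> RtoC 0 : CV)); last exact: filterlim_const.
    by apply: small_eps => eps he; rewrite J0.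
  - rewrite /lam_loc /=.
    have -> : (RtoC (2 * PI) * Ci * RtoC (1 / 2))%C = (RtoC (/ 2) * (RtoC (2 * PI) * Ci))%C by rewrite /Rdiv Rmult_1_l; ring.
    apply: (filterlim_ext_loc (fun eps => (RtoC (/ 2) * Aint eps 0%R)%C : CV)); first by apply: small_eps => eps he; rewrite J1.
    by apply: filterlim_Cscal; exact: Aint_lim 0%R.
  have -> : lam_loc 3 (Posz n.+2) = lam_loc 3 (Posz n).
    by rewrite /lam_loc /= negbK; case: (n) => //= k; case: ifP.
  have := @Aint_lim (Posz n.+1); rewrite [_ == _]/= => hA.
  rewrite -(Cplus_0_r (_ * RtoC (lam_loc 3 (Posz n)))).
  apply: (filterlim_ext_loc (fun eps => (Jint eps (Posz n) + Aint eps (Posz n.+1))%C : CV)); last exact: filterlim_Cplus.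
  apply: small_eps => eps he; rewrite -(Jint_rec (Posz n.+1) he).
  have -> : (Posz n.+1 + 1)%R = Posz n.+2 by lia.
  have -> : (Posz n.+1 - 1)%R = Posz n by lia.
  have c (x y : C) : (x + (y - x) = y)%C by ring.
  exact: c.
case: m => n; first exact: pos.
have -> : Negz n = (- Posz n.+1)%R by rewrite NegzE.
have -> : (RtoC (2 * PI) * Ci * RtoC (lam_loc 3 (- Posz n.+1)%R))%C = ((-1) * (RtoC (2 * PI) * Ci * RtoC (lam_loc 3 (Posz n.+1))))%C.
  have -> : lam_loc 3 (- Posz n.+1)%R = - lam_loc 3 (Posz n.+1).
    by rewrite /lam_loc /= ; case: ifP => _; field.
  by rewrite RtoC_opp; ring.
apply: (filterlim_ext_loc (fun eps => ((-1) * Jint eps (Posz n.+1))%C : CV)); last by apply: filterlim_Cscal; exact: (pos n.+1).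
apply: small_eps => eps he; rewrite (Jint_opp _ he).
have c (x : C) : ((-1) * x = - x)%C by ring.
exact: c.
Qed.

(** Linear growth in m, uniform in the cut, is all that domination needs against the Gaussian decay
    of the theta series. *)
Lemma Jint_bound eps m : 0 < eps < PI / 2 -> Cmod (Jint eps m) <= 2 * PI * (1 + Rabs (zr m)).
Proof.
move=> he; have hp := PI_RGT_0.
have pos n : Cmod (Jint eps (Posz n)) <= 2 * PI * (1 + INR n) /\ Cmod (Jint eps (Posz n.+1)) <= 2 * PI * (1 + INR n.+1).
  elim: n => [|n [IH1 IH2]]; split=> //.
  - have := Jint_opp 0%R he; rewrite oppr0; move: (Jint eps 0%R) => z h.
    have -> : z = RtoC 0 by apply: Ceq; move: (congr1 Re h) (congr1 Im h); rewrite !ReImE /=; lra.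
    by rewrite Cmod_0 /=; lra.
  - have := Jint_rec 0%R he; rewrite add0r sub0r (Jint_opp 1%R he) => E.
    have {}E : Jint eps 1%R = (RtoC (/ 2) * Aint eps 0%R)%C by rewrite -E; apply: Ceq; rewrite !ReImE /=; field.
    rewrite E Cmod_mult Cmod_R Rabs_pos_eq; last lra.
    by have := Aint_bound 0%R he; rewrite /=; lra.
  have := Jint_rec (Posz n.+1) he.
  have -> : (Posz n.+1 + 1)%R = Posz n.+2 by lia.
  have -> : (Posz n.+1 - 1)%R = Posz n by lia.
  move=> E; have -> : Jint eps (Posz n.+2) = (Jint eps (Posz n) + Aint eps (Posz n.+1))%C by rewrite -E; ring.
  apply: Rle_trans (Cmod_triangle _ _) _; have := Aint_bound (Posz n.+1) he; rewrite !S_INR; nra.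
case: m => n; first by rewrite zr_Posz Rabs_pos_eq; [exact: (proj1 (pos n)) | exact: pos_INR].
rewrite zr_Negz Rabs_Ropp Rabs_pos_eq; last by have := pos_INR n; lra.
by rewrite NegzE (Jint_opp _ he) Cmod_opp -S_INR; exact: (proj2 (pos n)).
Qed.

Lemma vfac_lim d m : d \in [:: 1; 2; 3]%N -> filterlim (fun eps => circle_int eps (vfac d m) : CV) (at_right 0)
  (locally ((RtoC (2 * PI) * Ci * RtoC (lam_loc d m))%C : CV)).
Proof.
rewrite !inE => /or3P [] /eqP ->.
- have -> : (RtoC (2 * PI) * Ci * RtoC (lam_loc 1 m))%C = ((if (m + 1)%R == 0%R then RtoC (2 * PI) * Ci else RtoC 0) + (-1) * (if (m - 1)%R == 0%R then RtoC (2 * PI) * Ci else RtoC 0))%C.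
    rewrite /lam_loc /= addr_eq0 subr_eq0; case: eqP => [->|_] /=; first by ring.
    by case: eqP => _; rewrite ?(RtoC_opp 1); ring.
  apply: (filterlim_ext_loc (fun eps => (Aint eps (m + 1)%R + (-1) * Aint eps (m - 1)%R)%C : CV)).
    apply: small_eps => eps he; rewrite (vfac1 _ he).
    have c (x y : C) : (x + (-1) * y = x - y)%C by ring.
    exact: c.
  by apply: filterlim_Cplus; [|apply: filterlim_Cscal]; exact: Aint_lim.
- have -> : (RtoC (2 * PI) * Ci * RtoC (lam_loc 2 m))%C = (if m == 0%R then RtoC (2 * PI) * Ci else RtoC 0)%C.
    by rewrite /lam_loc /=; case: eqP => _; ring.
  apply: (filterlim_ext_loc (fun eps => Aint eps m : CV)); last exact: Aint_lim.
  by apply: small_eps => eps he; rewrite vfac2.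
apply: (filterlim_ext_loc (fun eps => Jint eps m : CV)); last exact: Jint_lim.
by apply: small_eps => eps he; rewrite vfac3.
Qed.

Lemma vfac_bound d m eps : d \in [:: 1; 2; 3]%N -> 0 < eps < PI / 2 -> Cmod (circle_int eps (vfac d m)) <= 4 * PI * (1 + Rabs (zr m)).
Proof.
have hp := PI_RGT_0; have m0 := Rabs_pos (zr m).
rewrite !inE => /or3P [] /eqP -> he.
- rewrite (vfac1 _ he); apply: Rle_trans (Cmod_triangle _ _) _; rewrite Cmod_opp.
  have := Aint_bound (m + 1)%R he; have := Aint_bound (m - 1)%R he; nra.
- by rewrite (vfac2 _ he); have := Aint_bound m he; nra.
by rewrite (vfac3 _ he); have := Jint_bound m he; nra.
Qed.

(** Exchanging the roles of the ends of an edge in one of two half-products gives a product over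
    oriented edges of the factor at the origin, where each vertex occurs as often as its degree. *)
Lemma Rfun_prod N (e : rel 'I_N) (w : 'I_N -> C) : symmetric e -> irreflexive e ->
  (forall j, (w j - / w j)%C <> RtoC 0) ->
  Rfun e w = Cprod (fun j => Cpow (w j - / w j) 2 * Cpow (/ (w j - / w j)) (deg e j))%C.
Proof.
move=> es ei hw; rewrite /Rfun /Cprod [RHS]big_split; apply: (f_equal2 Cmult) => //.
set x := (fun j => (w j - / w j)%C).
pose y j := (/ x j)%C.
have -> : \big[Cmult/RtoC 1]_(p : 'I_N * 'I_N | (p.1 < p.2)%N && e p.1 p.2) (RtoC 1 / (x p.1 * x p.2))%C =
   (\big[Cmult/RtoC 1]_(p : 'I_N * 'I_N | (p.1 < p.2)%N && e p.1 p.2) y p.1 * \big[Cmult/RtoC 1]_(p : 'I_N * 'I_N | (p.1 < p.2)%N && e p.1 p.2) y p.2)%C.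
  rewrite -big_split; apply: eq_bigr => p _; have h1 := hw p.1; have h2 := hw p.2.
  by rewrite /y /=; change (x p.1 <> RtoC 0) in h1; change (x p.2 <> RtoC 0) in h2; field.
have -> : \big[Cmult/RtoC 1]_(p : 'I_N * 'I_N | (p.1 < p.2)%N && e p.1 p.2) y p.2 = \big[Cmult/RtoC 1]_(p : 'I_N * 'I_N | (p.2 < p.1)%N && e p.1 p.2) y p.1.
  rewrite (reindex_inj (h := fun p : 'I_N * 'I_N => (p.2, p.1))) /=; last by move=> [a b] [a' b'] [-> ->].
  by apply: eq_bigl => p; rewrite es.
transitivity (\big[Cmult/RtoC 1]_(p : 'I_N * 'I_N | e p.1 p.2) y p.1).
  rewrite [RHS](bigID (fun p : 'I_N * 'I_N => (p.1 < p.2)%N)); apply: (f_equal2 Cmult); apply: eq_bigl => p.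
    by rewrite andbC.
  case: (ltngtP p.1 p.2) => h; rewrite ?andbT ?andbF //.
  by rewrite (ord_inj h : p.1 = p.2) ei.
rewrite -(pair_big_dep xpredT (fun j k => e j k) (fun j _ => y j)) /=.
apply: eq_bigr => j _; rewrite big_const /deg cardsE -[#|[pred k | e j k]|]/#|e j|.
by elim: #|e j| => //= n ->.
Qed.

Lemma Rprod_le n (f g : 'I_n -> R) : (forall j, 0 <= f j <= g j) ->
  0 <= \big[Rmult/1]_(j < n) f j <= \big[Rmult/1]_(j < n) g j.
Proof.
elim: n f g => [|n IH] f g h; first by rewrite !big_ord0; lra.
rewrite !big_ord_recl; have := h ord0; have := IH _ _ (fun j => h (lift ord0 j)).
move: (\big[_/_]_(_ < n) _) (\big[_/_]_(_ < n) _) => a b.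
move: (f ord0) (g ord0) => c d h1 h2.
have H : 0 <= c * b <= d * a by nra.
exact: H.
Qed.

Lemma Cmod_Cprod n (f : 'I_n -> C) : Cmod (Cprod f) = \big[Rmult/1]_(j < n) Cmod (f j).
Proof.
elim: n f => [|n IH] f; first by rewrite /Cprod !big_ord0 Cmod_1.
by rewrite CprodS Cmod_mult IH big_ord_recl.
Qed.

(** Enclose the finitely many vectors in a box; the sum over the box is the product of the sums over
    the coordinates. *)
Lemma vec_sum_bound N (h : int -> R) S (s : seq 'cV[int]_N) : (forall x, 0 <= h x) ->
  (forall s, uniq s -> \big[Rplus/0]_(x <- s) h x <= S) -> uniq s ->
  \big[Rplus/0]_(m <- s) \big[Rmult/1]_(j < N) h (m j ord0) <= S ^ N.
Proof.
move=> h0 hS us.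
have [M hM] : exists M, forall m, m \in s -> forall j, m j ord0 \in int_box M.
  elim: s {us} => [|m s [M IH]]; first by exists 0%N.
  pose B := \max_(j < N) (absz (m j ord0)).+1.
  have mono k x : x \in int_box k -> x \in int_box (maxn k B).
    rewrite mem_cat => /orP [] /mapP [i]; rewrite mem_iota add0n => /andP [_ hi] ->; apply: int_box_mem;
    by rewrite leq_max hi.
  exists (maxn M B) => m'; rewrite inE => /orP [/eqP ->|/IH hm] j; last by apply: mono; exact: hm.
  have : ((absz (m j ord0)).+1 <= B)%N by exact: (leq_bigmax j).
  by move=> hb; apply: int_box_mem; move: hb; case: (m j ord0) => k /= hb; lia.
set b := int_box M in hM; have ub : uniq b := int_box_uniq M.
pose V (f : {ffun 'I_N -> 'I_(size b)}) : 'cV[int]_N := (\col_j nth 0%R b (f j))%R.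
pose vs := map V (enum {: {ffun 'I_N -> 'I_(size b)}}).
have uvs : uniq vs.
  rewrite map_inj_uniq ?enum_uniq // => f f' e; apply/ffunP => j; apply: val_inj; apply/eqP.
  by rewrite -(nth_uniq 0%R _ _ ub) ?ltn_ord //; have := congr1 (fun v : 'cV_N => v j ord0) e; rewrite !mxE => ->.
have sub : {subset s <= vs}.
  move=> m ms; have lt j : (index (m j ord0) b < size b)%N by rewrite index_mem; exact: hM.
  apply/mapP; exists [ffun j => Ordinal (lt j)]; first by rewrite mem_enum.
  by apply/colP => j; rewrite mxE ffunE /= nth_index //; exact: hM.
have p0 (m : 'cV[int]_N) : 0 <= \big[Rmult/1]_(j < N) h (m j ord0).
  by apply: (proj1 (@Rprod_le N (fun j => h (m j ord0)) (fun j => h (m j ord0)) _)) => j; have := h0 (m j ord0); lra.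
apply: Rle_trans (bigR_subset us uvs sub p0) _.
rewrite big_map big_enum /=.
have -> : \big[Rplus/0]_(f : {ffun 'I_N -> 'I_(size b)}) \big[Rmult/1]_(j < N) h (V f j ord0) =
   \big[Rmult/1]_(j < N) \big[Rplus/0]_(k < size b) h (nth 0%R b k).
  rewrite bigA_distr_bigA; apply: eq_bigr => f _; apply: eq_bigr => j _; by rewrite mxE.
have E : \big[Rplus/0]_(k < size b) h (nth 0%R b k) = \big[Rplus/0]_(x <- b) h x by rewrite (big_nth 0%R) big_mkord.
rewrite E big_const card_ord.
have S1 := hS b ub; have S0 : 0 <= \big[Rplus/0]_(x <- b) h x by apply: bigR_ge0.
elim: N {s us hM V vs uvs sub p0} => [|n IH] /=; first by lra.
apply: Rmult_le_compat => //; elim: n {IH} => [|n IH] /=; first lra.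
by apply: Rmult_le_pos.
Qed.

Lemma posdef_unit N (A : 'M[R]_N) : positive_definite A -> (A^T = A)%R -> A \in unitmx.
Proof.
move=> hA sym; rewrite -row_free_unit -kermx_eq0; apply/eqP/row_matrixP => i; rewrite row0.
apply/eqP/negPn/negP => nz.
set v := row i (kermx A) in nz.
have vA : (v *m A = 0)%R by rewrite /v -row_mul mulmx_ker row0.
have vt : (v^T != 0)%R by rewrite -[X in _ != X]trmx0 (inj_eq trmx_inj).
by have := hA _ vt; rewrite trmxK vA mul0mx mxE Order.POrderTheory.ltxx.
Qed.

Lemma invform_ge N (M : 'M[int]_N) (m : 'cV[int]_N) j : (M^T = M)%R -> positive_definite (mxR M) ->
  0 < zr (M j j) /\ zr (m j ord0) ^ 2 <= zr (M j j) * invform M m.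
Proof.
move=> sym hM; set A := mxR M.
have symA : (A^T = A)%R by rewrite /A /mxR; apply/matrixP => i k; rewrite !mxE -[in RHS]sym mxE.
have uA := posdef_unit hM symA.
pose q (x : 'cV[R]_N) := ((x^T *m A *m x) ord0 ord0)%R.
have q0 x : (0 <= q x)%R.
  case: (eqVneq x 0%R) => [->|nz]; first by rewrite /q mulmx0 mxE.
  by apply: Order.POrderTheory.ltW; exact: hM.
pose u : 'cV[R]_N := (delta_mx j ord0)%R.
have un : (u != 0)%R.
  apply/eqP => /colP /(_ j); rewrite !mxE !eqxx /= => /eqP; by rewrite oner_eq0.
have qu : q u = zr (M j j).
  rewrite /q /u trmx_delta -rowE -colE !mxE //.
have Mj : (0 < zr (M j j))%R by rewrite -qu; exact: hM.
have Mj' : 0 < zr (M j j) by apply/RltP.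
split=> //.
pose x := (invmx A *m mxR m)%R.
have Ax : (A *m x = mxR m)%R by rewrite /x mulKVmx.
have qx : q x = invform M m.
  by rewrite /q /invform -mulmxA Ax /x trmx_mul trmx_inv symA.
have bl (a : R) : q (x + a *: u)%R = q x + 2 * a * zr (m j ord0) + a ^ 2 * zr (M j j).
  have e1 : ((u^T *m A *m x) ord0 ord0 = zr (m j ord0))%R by rewrite -mulmxA Ax /u trmx_delta -rowE !mxE.
  have e2 : ((x^T *m A *m u) ord0 ord0 = zr (m j ord0))%R.
    by rewrite -{1}symA -trmx_mul Ax /u -colE !mxE.
  have -> : q (x + a *: u)%R = (q x + a * (x^T *m A *m u) ord0 ord0 + (a * (u^T *m A *m x) ord0 ord0 + a * (a * q u)))%R.
    have tE : ((x + a *: u)^T = x^T + a *: u^T)%R by apply/matrixP => i k; rewrite !mxE.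
    rewrite /q tE !mulmxDl !mulmxDr -!scalemxAl -!scalemxAr.
    move: (x^T *m A *m x)%R (x^T *m A *m u)%R (u^T *m A *m x)%R (u^T *m A *m u)%R => X Y Z W.
    by rewrite !mxE.
  rewrite e1 e2 qu.
  have F (X Y Z W : R) : X + Y * Z + (Y * Z + Y * (Y * W)) = X + 2 * Y * Z + Y ^ 2 * W by ring.
  exact: F.
(* The parameter at which the quadratic polynomial [bl] is minimal. *)
have /RleP := q0 (x + (- (zr (m j ord0) / zr (M j j))) *: u)%R.
rewrite bl qx; set y := zr (m j ord0); move: Mj'; set k := zr (M j j) => k0 h.
have {}h : 0 <= k * (invform M m + 2 * - (y / k) * y + (- (y / k)) ^ 2 * k) by apply: Rmult_le_pos; [lra | exact: h].
have E : k * (invform M m + 2 * - (y / k) * y + (- (y / k)) ^ 2 * k) = k * invform M m - y ^ 2 by field; lra.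
lra.
Qed.

Lemma filterlim_Cprod (U : Type) (F : (U -> Prop) -> Prop) {FF : Filter F} n (f : 'I_n -> U -> C) (l : 'I_n -> C) :
  (forall j, filterlim (f j : U -> CV) F (locally (l j : CV))) ->
  filterlim (fun x => Cprod (fun j => f j x) : CV) F (locally (Cprod l : CV)).
Proof.
elim: n f l => [|n IH] f l h.
  have -> : Cprod l = RtoC 1 by rewrite /Cprod big_ord0.
  refine (filterlim_ext _ _ _ (filterlim_const (RtoC 1 : CV))) => x; by rewrite /Cprod big_ord0.
rewrite CprodS.
refine (filterlim_ext _ _ _ (filterlim_Cmult (h ord0) (IH _ _ (fun j => h (lift ord0 j))))) => x.
by rewrite CprodS.
Qed.

Lemma CprodM n (f g : 'I_n -> C) : Cprod (fun j => f j * g j)%C = (Cprod f * Cprod g)%C.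
Proof. by rewrite /Cprod big_split. Qed.

Lemma Cprod_cst n (c : C) : Cprod (fun _ : 'I_n => c) = Cpow c n.
Proof. by elim: n => [|n IH]; [rewrite /Cprod big_ord0 | rewrite CprodS IH]. Qed.

Lemma Cmod_qpow tau r : Cmod (qpow tau r) = exp (- (2 * PI * r * Im tau)).
Proof.
rewrite /qpow Cmod_Cexp; congr exp.
have -> : (RtoC 2 * RtoC PI * Ci * RtoC r * tau = RtoC (2 * PI * r) * (Ci * tau))%C.
  by rewrite (RtoC_mult (2 * PI)) (RtoC_mult 2); ring.
by rewrite re_scal_l !ReImE /=; ring.
Qed.

Lemma lam_loc_bound d m : Rabs (lam_loc d m) <= 1.
Proof.
rewrite /lam_loc; case: ifP => _; first by case: ifP => _; [|case: ifP => _]; apply: Rabs_le; lra.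
case: ifP => _; first by case: ifP => _; apply: Rabs_le; lra.
case: ifP => _; last by apply: Rabs_le; lra.
have := sg_bound m => h; rewrite Rabs_div; last lra.
by rewrite (Rabs_pos_eq 2); lra.
Qed.

Lemma Rsum_le_ord n (f g : 'I_n -> R) : (forall j, f j <= g j) -> \big[Rplus/0]_(j < n) f j <= \big[Rplus/0]_(j < n) g j.
Proof. by move=> h; rewrite -[X in X <= _]big_enum -[X in _ <= X]big_enum; apply: bigR_le => j _. Qed.

Lemma exp_sum_ord n (k : R) (f : 'I_n -> R) : exp (- (k * \big[Rplus/0]_(j < n) f j)) = \big[Rmult/1]_(j < n) exp (- (k * f j)).
Proof.
elim: n f => [|n IH] f; first by rewrite !big_ord0 Rmult_0_r Ropp_0 exp_0.
rewrite !big_ord_recl -IH -exp_plus; congr exp.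
set X := \big[_/_]_(_ < n) _; have F (a : R) : - (k * (a + X)) = - (k * a) + - (k * X) by ring.
exact: F.
Qed.

(** * Exchange of the principal value with the theta series *)

Section PV.
Variables (N : nat) (e : rel 'I_N) (M : 'M[int]_N) (tau : C) (P : 'cV[int]_N -> Prop) (cst : R) (r : 'cV[int]_N -> R) (v0 : 'I_N).
Hypotheses (es : symmetric e) (ei : irreflexive e) (hdeg : forall j, deg e j \in [:: 1; 2; 3]%N)
  (sym : (M^T = M)%R) (hM : positive_definite (mxR M)) (hcst : 0 < cst) (htau : 0 < Im tau)
  (hr : forall m, r m = cst * invform M m).

Let a m := qpow tau (r m).

(** Summing [invform_ge] over j bounds the squared length of m by the trace of M times the inverse
    form. The power of q is therefore at most a product of one-variable Gaussians, each absorbing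
    the linear growth of its vertex integral. *)
Lemma qpow_vec_bound : exists h : int -> R, exists S : R,
  [/\ forall x, 0 <= h x, forall s, uniq s -> \big[Rplus/0]_(x <- s) h x <= S &
      forall (m : 'cV[int]_N) (b : 'I_N -> R), (forall j, 0 <= b j <= 4 * PI * (1 + Rabs (zr (m j ord0)))) ->
        Cmod (a m) * \big[Rmult/1]_(j < N) b j <= \big[Rmult/1]_(j < N) h (m j ord0)].
Proof.
have hp := PI_RGT_0.
pose Mx := \big[Rplus/0]_(j < N) zr (M j j).
have Mx0 : 0 <= Mx.
  rewrite /Mx -big_enum; apply: bigR_ge0 => j _; have := proj1 (invform_ge 0%R j sym hM); lra.
pose K := 2 * PI * cst * Im tau.
have K0 : 0 < K by rewrite /K; apply: Rmult_lt_0_compat => //; nra.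
(* The rate left to each coordinate: k Mx <= K, and the added 1 keeps the denominator positive. *)
pose k := K / (Mx + 1).
have k0 : 0 < k by apply: Rdiv_lt_0_compat; lra.
pose h (x : int) := 4 * PI * exp (2 ^ 2 / (4 * k)) * exp (- Rabs (zr x)).
have c0 : 0 <= 4 * PI * exp (2 ^ 2 / (4 * k)) by have := exp_pos (2 ^ 2 / (4 * k)); nra.
exists h, (4 * PI * exp (2 ^ 2 / (4 * k)) * 4); split.
- by move=> x; apply: Rmult_le_pos => //; left; exact: exp_pos.
- by move=> s us; rewrite bigR_scal; apply: Rmult_le_compat_l => //; exact: int_exp_bound.
move=> m b hb.
pose Q := invform M m.
have Q0 : 0 <= Q.
  have [m0 h0] := invform_ge m v0 sym hM; rewrite -/Q in h0.
  have := pow2_ge_0 (zr (m v0 ord0)) => s0.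
  have := Rmult_le_compat_l _ _ _ (Rlt_le _ _ (Rinv_0_lt_compat _ m0)) (Rle_trans _ _ _ s0 h0).
  by rewrite Rmult_0_r -Rmult_assoc Rinv_l ?Rmult_1_l //; lra.
have sumle : \big[Rplus/0]_(j < N) (zr (m j ord0)) ^ 2 <= Mx * Q.
  have -> : Mx * Q = \big[Rplus/0]_(j < N) (Q * zr (M j j)).
    by rewrite Rmult_comm /Mx -[X in _ * X = _]big_enum -[X in _ = X]big_enum bigR_scal.
  by apply: Rsum_le_ord => j; have := proj2 (invform_ge m j sym hM); rewrite -/Q; lra.
have am : Cmod (a m) <= \big[Rmult/1]_(j < N) exp (- (k * zr (m j ord0) ^ 2)).
  rewrite -exp_sum_ord /a Cmod_qpow hr -/Q; apply: exp_le.
  have -> : - (2 * PI * (cst * Q) * Im tau) = - (K * Q) by rewrite /K; ring.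
  apply: Ropp_le_contravar; apply: Rle_trans (Rmult_le_compat_l _ _ _ (Rlt_le _ _ k0) sumle) _.
  have -> : k * (Mx * Q) = K * Q * (Mx / (Mx + 1)) by rewrite /k; field; lra.
  have : Mx / (Mx + 1) <= 1 by apply: (Rmult_le_reg_r (Mx + 1)); [lra | rewrite /Rdiv Rmult_assoc Rinv_l; lra].
  have : 0 <= K * Q by nra.
  nra.
have b0 : 0 <= \big[Rmult/1]_(j < N) b j by apply: (proj1 (@Rprod_le N b b _)) => j; have := hb j; lra.
apply: Rle_trans (Rmult_le_compat_r _ _ _ b0 am) _.
rewrite -[_ * _]big_split /=.
apply: (proj2 (@Rprod_le N _ _ _)) => j.
set x := zr (m j ord0); have hbj := hb j; rewrite -/x in hbj.
have x0 := Rabs_pos x; have e0 := exp_pos (- (k * x ^ 2)).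
have g := gauss_le 2 (Rabs x) k0; rewrite pow2_abs in g.
have H : 0 <= exp (- (k * x ^ 2)) * b j <= h (m j ord0).
  split; first nra.
  apply: Rle_trans (_ : exp (- (k * x ^ 2)) * (4 * PI * exp (Rabs x)) <= _).
    apply: Rmult_le_compat_l; first lra; have := exp_ineq1_le (Rabs x); nra.
  rewrite /h -/x.
  have -> : exp (- (k * x ^ 2)) * (4 * PI * exp (Rabs x)) = 4 * PI * (exp (- (k * x ^ 2)) * exp (Rabs x)) by ring.
  rewrite (Rmult_assoc (4 * PI)) -!exp_plus; apply: Rmult_le_compat_l; first lra.
  by apply: exp_le; lra.
exact: H.
Qed.

Lemma vec_dominated (f : 'cV[int]_N -> 'I_N -> C) : (forall m j, Cmod (f m j) <= 4 * PI * (1 + Rabs (zr (m j ord0)))) ->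
  summable P (fun m => a m * Cprod (f m))%C.
Proof.
move=> hf; have [h [S [h0 hS hb]]] := qpow_vec_bound.
apply: (summable_le (g := fun m : 'cV[int]_N => \big[Rmult/1]_(j < N) h (m j ord0))).
  move=> m _; rewrite Cmod_mult Cmod_Cprod; apply: hb => j; split; [exact: Cmod_ge_0 | exact: hf].
by exists (S ^ N) => s us _; apply: vec_sum_bound.
Qed.

Let one_le x : 1 <= 4 * PI * (1 + Rabs x).
Proof. by have := Rabs_pos x; have := PI2_1; nra. Qed.

Definition PV_integrand (w : 'I_N -> C) : C :=
  (Rfun e w * sum_over P (fun m => qpow tau (r m) * monomial w m) * \big[Cmult/RtoC 1]_(j < N) Cinv (w j))%C.

Lemma PV_value : exists S, is_sum_over P (fun m => qpow tau (r m) * Cprod (fun j => RtoC (lam_loc (deg e j) (m j ord0))))%C S /\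
  PV_torus PV_integrand = (Cpow (RtoC 2 * RtoC PI * Ci) N * S)%C.
Proof.
have hp := PI_RGT_0.
have bl (m : 'cV[int]_N) j : Cmod (RtoC (lam_loc (deg e j) (m j ord0))) <= 4 * PI * (1 + Rabs (zr (m j ord0))).
  by rewrite Cmod_R; apply: Rle_trans (lam_loc_bound _ _) _; exact: one_le.
have [S hS] := summable_sum (vec_dominated bl).
exists S; split=> //.
have E2 : (RtoC 2 * RtoC PI * Ci = RtoC (2 * PI) * Ci)%C by rewrite RtoC_mult.
have hS2 : is_sum_over P (fun m => a m * Cprod (fun j => RtoC (2 * PI) * Ci * RtoC (lam_loc (deg e j) (m j ord0))))%C (Cpow (RtoC 2 * RtoC PI * Ci) N * S)%C.
  apply: is_sum_over_ext (is_sum_over_scal _ hS) => m _.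
  rewrite (CprodM (fun=> RtoC (2 * PI) * Ci)%C (fun j => RtoC (lam_loc (deg e j) (m j ord0)))) Cprod_cst -E2.
  by move: (Cpow _ _) (Cprod _) (a m) => x y z; ring.
apply: rlimE.
have [h [B [h0 hB hb]]] := qpow_vec_bound.
(* The cut shrinks under the sum: termwise limits come from [vfac_lim], domination uniform in the
   cut from [vfac_bound]. *)
refine (@tannery _ R (at_right 0) _ P (fun eps m => a m * Cprod (fun j => circle_int eps (vfac (deg e j) (m j ord0))))%C _
  (fun m : 'cV[int]_N => \big[Rmult/1]_(j < N) h (m j ord0)) _ _ _ _ _ _ _ hS2).
- by exists (B ^ N) => s us _; apply: vec_sum_bound.
- apply: small_eps => eps he m _; rewrite Cmod_mult Cmod_Cprod; apply: hb => j; split; first exact: Cmod_ge_0.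
  exact: vfac_bound.
- move=> m _; rewrite Cmod_mult Cmod_Cprod; apply: hb => j; split; first exact: Cmod_ge_0.
  rewrite Cmod_mult Cmod_R (Cmod_mult (RtoC _)) Cmod_Ci Cmod_R Rmult_1_r (Rabs_pos_eq (2 * PI)); last lra.
  apply: Rle_trans (_ : 2 * PI * 1 <= _); first by apply: Rmult_le_compat_l; [lra | exact: lam_loc_bound].
  by have := Rabs_pos (zr (m j ord0)); move: (Rabs _) => y y0; nra.
- by move=> m _; apply: filterlim_Cscal; apply: filterlim_Cprod => j; exact: vfac_lim.
(* For a fixed cut the integrand is bounded, so the torus integral and the theta series may be
   exchanged. *)
apply: small_eps => eps he.
have d3 j : (deg e j <= 3)%N by have := hdeg j; rewrite !inE => /or3P [] /eqP ->.
have G0 : 0 <= 4 * (1 + / (2 * sin eps)) ^ 3.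
  have se : 0 < sin eps by apply: sin_gt_0; lra.
  have q0 : 0 < / (2 * sin eps) by apply: Rinv_0_lt_compat; lra.
  by apply: Rmult_le_pos; [lra | apply: pow_le; lra].
have sa : summable P a.
  have h1 (m : 'cV[int]_N) (j : 'I_N) : Cmod (RtoC 1) <= 4 * PI * (1 + Rabs (zr (m j ord0))) by rewrite Cmod_1; exact: one_le.
  have [X hX] := vec_dominated h1; exists X => s us ps; apply: Rle_trans (hX s us ps).
  by apply: bigR_le => m _; rewrite Cprod_cst Cpow_1_l Cmult_1_r; exact: Rle_refl.
apply: (torus_sum he G0 sa) => [j m|w hw]; first exact: vfac_tame.
have w1 j : Cmod (w j) = 1 by have [t _ ->] := hw j; exact: Cmod_Cis.
have wnz j : (w j - / w j)%C <> RtoC 0.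
  by have [t ht ->] := hw j; rewrite Cis_diff; apply: sin2i_neq0; exact: sin_cut_neq0 ht.
have mon m : Cmod (monomial w m) = 1.
  rewrite -[monomial w m]/(Cprod (fun j => Cpowz (w j) (m j ord0))) Cmod_Cprod.
  rewrite big1 // => j _; have [t _ ->] := hw j; rewrite Cpowz_Cis; exact: Cmod_Cis.
have sm : summable P (fun m => a m * monomial w m)%C.
  by apply: (@summable_mult _ P a _ 1) => // [|m]; [lra | rewrite mon; lra].
have [L hL] := summable_sum sm.
rewrite /PV_integrand (sum_overE hL) (Rfun_prod es ei wnz).
set A := Cprod _; set D := \big[Cmult/RtoC 1]_(j < N) Cinv (w j).
have -> : (A * L * D = (A * D) * L)%C by ring.
apply: is_sum_over_ext (is_sum_over_scal (A * D)%C hL) => m _.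
have -> : (A * D * (a m * monomial w m) = a m * (A * monomial w m * D))%C by ring.
by rewrite /A /D -[monomial w m]/(Cprod (fun j => Cpowz (w j) (m j ord0))) -[\big[Cmult/RtoC 1]_(j < N) _]/(Cprod (fun j => Cinv (w j))) -!CprodM.
Qed.

End PV.

(** * Reduction to false theta functions *)

Lemma is_sum_finite (T : eqType) (f : T -> C) (L : seq T) : uniq L -> (forall x, x \notin L -> f x = RtoC 0) ->
  is_sum_over TT f (\big[Cplus/RtoC 0]_(x <- L) f x).
Proof.
move=> uL h eps he; exists L; split=> // s us _ sub.
rewrite (bigC_subset f uL us sub) [X in (_ + X)%C]big1_seq; last first.
  by move=> x /andP [_]; rewrite mem_filter => /andP [/h].
by have -> (z : C) : (z + 0 - z = 0)%C by [ring]; rewrite Cmod_0.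
Qed.

(** The converse of [is_sum_over_reindex]: absolute summability supplies a sum on the smaller index
    set, and uniqueness identifies it. *)
Lemma is_sum_over_comp (T T' : eqType) (P : T -> Prop) (P' : T' -> Prop) (h : T' -> T) (f : T -> C) l :
  (forall y, P' y -> P (h y)) -> (forall y y', P' y -> P' y' -> h y = h y' -> y = y') ->
  (forall x, P x -> f x <> RtoC 0 -> exists2 y, P' y & h y = x) ->
  summable P f -> is_sum_over P f l -> is_sum_over P' (fun y => f (h y)) l.
Proof.
move=> hP inj surj [B hB] hl.
have [l' hl'] : exists l', is_sum_over P' (fun y => f (h y)) l'.
  apply: summable_sum; exists B => s us ps.
  rewrite -(big_map h xpredT (fun x => Cmod (f x))); apply: hB.
    by rewrite map_inj_in_uniq // => x y /ps px /ps py; exact: inj.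
  by move=> x /mapP [y /ps /hP py ->].
by rewrite (is_sum_over_unique hl (is_sum_over_reindex hP inj surj hl')).
Qed.

Lemma bounded_finite (f : int -> C) (L : seq int) : (forall x, x \notin L -> f x = RtoC 0) ->
  exists B, forall x, Cmod (f x) <= B.
Proof.
move=> h; exists (\big[Rplus/0]_(x <- L) Cmod (f x)) => x.
have nn s : 0 <= \big[Rplus/0]_(y <- s) Cmod (f y) by apply: bigR_ge0 => y _; exact: Cmod_ge_0.
case: (boolP (x \in L)) => [|/h ->]; last by rewrite Cmod_0.
elim: L {h} => // y L IH; rewrite inE big_cons => /orP [/eqP ->|/IH h]; first by have := nn L; lra.
by have := Cmod_ge_0 (f y); lra.
Qed.

Lemma thetaf_sum D phi B dd K tau : 0 < D -> 0 < Im tau -> (forall n, Cmod (phi n) <= B) ->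
  (forall n, n \notin int_box K -> dd n = RtoC 0) ->
  is_sum_over TT (fun n => (RtoC (sg n) * phi n + dd n) * qE (tau / RtoC D) (zr n))%C (thetaf D phi (int_box K) dd tau).
Proof.
move=> hD ht hB hd.
have h1 := FT_sum hD ht (cf_bound hB).
have h2 : is_sum_over TT (fun n => dd n * qE (tau / RtoC D) (zr n))%C (\big[Cplus/RtoC 0]_(n <- int_box K) (dd n * qE (tau / RtoC D) (zr n))%C).
  apply: is_sum_finite; first exact: int_box_uniq.
  by move=> n /hd ->; ring.
by apply: is_sum_over_ext (is_sum_over_plus h1 h2) => n _; rewrite /fT /cf; ring.
Qed.

Lemma thetaf_linear (I : eqType) (s : seq I) D (a : I -> C) (phi dd : I -> int -> C) B K tau : 0 < D -> 0 < Im tau ->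
  (forall i n, Cmod (phi i n) <= B i) -> (forall i n, n \notin int_box K -> dd i n = RtoC 0) ->
  thetaf D (fun n => \big[Cplus/RtoC 0]_(i <- s) (a i * phi i n)%C) (int_box K) (fun n => \big[Cplus/RtoC 0]_(i <- s) (a i * dd i n)%C) tau =
  \big[Cplus/RtoC 0]_(i <- s) (a i * thetaf D (phi i) (int_box K) (dd i) tau)%C.
Proof.
move=> hD ht hB hd.
have bd n : Cmod (\big[Cplus/RtoC 0]_(i <- s) (a i * phi i n)%C) <= \big[Rplus/0]_(i <- s) (Cmod (a i) * B i).
  apply: Rle_trans (Cmod_bigsum _ _) _; apply: bigR_le => i _; rewrite Cmod_mult.
  by apply: Rmult_le_compat_l; [exact: Cmod_ge_0 | exact: hB].
have hd' n : n \notin int_box K -> \big[Cplus/RtoC 0]_(i <- s) (a i * dd i n)%C = RtoC 0.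
  by move=> hn; rewrite big1 // => i _; rewrite hd //; ring.
apply: (is_sum_over_unique (thetaf_sum hD ht bd hd')).
have h : is_sum_over TT (fun n => \big[Cplus/RtoC 0]_(i <- s) (a i * ((RtoC (sg n) * phi i n + dd i n) * qE (tau / RtoC D) (zr n)))%C) (\big[Cplus/RtoC 0]_(i <- s) (a i * thetaf D (phi i) (int_box K) (dd i) tau)%C).
  by apply: is_sum_over_big => i _; apply: is_sum_over_scal; exact: (thetaf_sum hD ht (hB i) (hd i)).
apply: is_sum_over_ext h => n _.
rewrite -bigC_scal -big_split -bigC_scalr; apply: eq_bigr => i _ /=; ring.
Qed.

Section QuadTheta.
Variables (A kk Q p : nat) (B : int) (psi : int -> C).
Hypotheses (hA : (0 < A)%N) (hk : (0 < kk)%N) (hQ : (0 < Q)%N) (hp : (2 * p = kk * A * Q)%N)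
  (hpsi : forall n, psi (n + Posz Q)%R = psi n).

Let qn (n : int) : int := ((n - Posz kk * B) %/ Posz (kk * A))%Z.

(** [psi] transported along n -> kk (A n + B), the completed square. The scaling by kk allows the
    exponent to be written as n^2/4p with the modulus 2p = kk A Q that is a period of [phiQ]. *)
Definition phiQ (n : int) : C := if (Posz (kk * A) %| (n - Posz kk * B)%R)%Z then psi (qn n) else RtoC 0.
Definition ddQ (n : int) : C := ((RtoC (sg (qn n)) - RtoC (sg n)) * phiQ n)%C.

Let kA0 : Posz (kk * A) != 0%R.
Proof. by rewrite eqz_nat muln_eq0 negb_or -!lt0n hk. Qed.
Let qn_h n : qn (Posz (kk * A) * n + Posz kk * B)%R = n.
Proof. by rewrite /qn addrK mulKz. Qed.
Let dv_h n : (Posz (kk * A) %| (Posz (kk * A) * n + Posz kk * B - Posz kk * B)%R)%Z.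
Proof. by rewrite addrK dvdz_mulr. Qed.

Lemma phiQ_periodic n : phiQ (n + Posz (2 * p))%R = phiQ n.
Proof.
have E : (n + Posz (2 * p) - Posz kk * B = Posz Q * Posz (kk * A) + (n - Posz kk * B))%R.
  by rewrite hp PoszM addrAC addrC mulrC.
have D : (Posz (kk * A) %| (n + Posz (2 * p) - Posz kk * B)%R)%Z = (Posz (kk * A) %| (n - Posz kk * B)%R)%Z.
  by rewrite E; apply/dvdz_mod0P/dvdz_mod0P; rewrite modzMDl.
by rewrite /phiQ D /qn E divzMDl // [(Posz Q + _)%R]addrC hpsi.
Qed.

Lemma phiQ_bound b : (forall n, Cmod (psi n) <= b) -> forall n, Cmod (phiQ n) <= b.
Proof.
move=> hb n; rewrite /phiQ; case: ifP => _; first exact: hb.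
by rewrite Cmod_0; apply: Rle_trans (hb 0%R); exact: Cmod_ge_0.
Qed.

(* The sign of n differs from that of its affine image only near the origin. *)
Lemma ddQ_support n K : (2 * kk * absz B < K)%N -> n \notin int_box K -> ddQ n = RtoC 0.
Proof.
move=> hK hn; rewrite /ddQ /phiQ; case: ifP => [/dvdzP [q hq]|_]; last by ring.
have -> : qn n = q by rewrite /qn hq mulzK.
have out : (n >= Posz K)%R \/ (n < - Posz K)%R.
  case: n hn hq => m hn _; [left | right]; case: (ltnP m K) => hm; try lia.
    by rewrite int_box_mem in hn.
  by rewrite int_box_mem in hn.
have [kB1 kB2] : (Posz kk * B <= Posz (kk * absz B))%R /\ (- Posz (kk * absz B) <= Posz kk * B)%R by nia.
rewrite -mulnA in hK; move: hq kA0 hK kB1 kB2 out; move: (Posz kk * B)%R (kk * absz B)%N (kk * A)%N => X Y Z hq Z0 hK kB1 kB2 out.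
suff -> : sg q = sg n by ring.
have sp (m : int) : (0 < m)%R -> sg m = 1 by case: m => [[|m]|m].
have sn (m : int) : (m < 0)%R -> sg m = -1 by case: m => [[|m]|m].
case: out => hout; first by rewrite !sp //; [lia | nia].
by rewrite !sn //; [lia | nia].
Qed.

Lemma quad_theta K b tau : (2 * kk * absz B < K)%N -> 0 < Im tau -> (forall n, Cmod (psi n) <= b) ->
  is_sum_over TT (fun n => RtoC (sg n) * psi n * qE (tau / RtoC (2 * INR p)) (zr (Posz (kk * A) * n + Posz kk * B)%R))%C
    (thetaf (2 * INR p) phiQ (int_box K) ddQ tau).
Proof.
move=> hK ht hb.
have p0 : (0 < p)%N by move: hA hk hQ hp; case: p => // ; case: kk => // k; case: A => // a; case: Q.
have P0 : 0 < INR p by apply: lt_0_INR; lia.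
have D0 : 0 < 2 * INR p by lra.
have hd n : n \notin int_box K -> ddQ n = RtoC 0 by exact: ddQ_support.
have S := thetaf_sum D0 ht (phiQ_bound hb) hd.
have [c hc] : exists c, forall n, Cmod (RtoC (sg n) * phiQ n + ddQ n) <= c.
  have [c hc] := bounded_finite hd; exists (b + c) => n.
  apply: Rle_trans (Cmod_triangle _ _) _; have := hc n; have := cf_bound (phiQ_bound hb) n; rewrite /cf; lra.
have sm := FT_summable D0 ht hc.
pose h (n : int) := (Posz (kk * A) * n + Posz kk * B)%R.
have hin : forall y y', TT y -> TT y' -> h y = h y' -> y = y'.
  by move=> y y' _ _ /addIr /(mulfI kA0).
have hsur x : TT x -> ((RtoC (sg x) * phiQ x + ddQ x) * qE (tau / RtoC (2 * INR p)) (zr x))%C <> RtoC 0 -> exists2 y, TT y & h y = x.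
  move=> _; rewrite /ddQ /phiQ; case: ifP => [/dvdzP [q hq] _|_]; last by case; ring.
  by exists q => //; rewrite /h mulrC -hq subrK.
have := is_sum_over_comp (P' := TT) (h := h) (fun _ _ => Logic.I) hin hsur sm S.
apply: is_sum_over_ext => n _; rewrite /ddQ /phiQ dv_h qn_h -/(h n); ring.
Qed.
End QuadTheta.

Lemma qform_affine (K : comPzRingType) n (A : 'M[K]_n) (x : 'cV[K]_n) (j : 'I_n) (a : K) : (A^T = A)%R ->
  (((x + a *: delta_mx j ord0)^T *m A *m (x + a *: delta_mx j ord0)) ord0 ord0 =
   (x^T *m A *m x) ord0 ord0 + a * (A *m x) j ord0 + (a * (A *m x) j ord0 + a * (a * A j j)))%R.
Proof.
move=> symA; set u : 'cV[K]_n := (delta_mx j ord0)%R.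
have e1 : ((u^T *m A *m x) ord0 ord0 = (A *m x) j ord0)%R by rewrite -mulmxA /u trmx_delta -rowE mxE.
have e2 : ((x^T *m A *m u) ord0 ord0 = (A *m x) j ord0)%R.
  by rewrite -{1}symA -trmx_mul /u -colE !mxE.
have e3 : ((u^T *m A *m u) ord0 ord0 = A j j)%R by rewrite /u trmx_delta -rowE -colE !mxE.
have tE : ((x + a *: u)^T = x^T + a *: u^T)%R by apply/matrixP => i k; rewrite !mxE.
rewrite tE !mulmxDl !mulmxDr -!scalemxAl -!scalemxAr -e3 -{1}e2 -e1.
move: (x^T *m A *m x)%R (x^T *m A *m u)%R (u^T *m A *m x)%R (u^T *m A *m u)%R => X Y Z W.
by rewrite !mxE.
Qed.

(** * Expansion over the exponents away from the centre *)

Section StarSum.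
Variables (N : nat) (e : rel 'I_N) (M : 'M[int]_N) (c : 'I_N).
Hypotheses (es : symmetric e) (ei : irreflexive e) (hc : deg e c = 3%N)
  (hd : forall j, j != c -> deg e j \in [:: 1; 2]%N)
  (sym : (M^T = M)%R) (hM : positive_definite (mxR M)).

Let D : int := (\det M)%R.
(** Equal to (det M)^2 M^-1: integral, and positive definite without discussing the sign of the
    determinant. *)
Definition scaled_inv : 'M[int]_N := ((\det M) *: \adj M)%R.
Let U := scaled_inv.

Let symR : ((mxR M)^T = mxR M)%R.
Proof. by apply/matrixP => i k; rewrite !mxE -[in RHS]sym mxE. Qed.
Let uM : mxR M \in unitmx := posdef_unit hM symR.
Let detR : (\det (mxR M))%R = zr D.
Proof. by rewrite /mxR det_map_mx. Qed.
Let D0 : zr D <> 0.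
Proof. by move: uM; rewrite unitmxE detR unitfE => /eqP. Qed.

Lemma scaled_inv_sym : (U^T = U)%R.
Proof.
rewrite /U /scaled_inv; have -> : ((\det M *: \adj M)^T = \det M *: (\adj M)^T)%R by apply/matrixP => i k; rewrite !mxE.
by rewrite trmx_adj sym.
Qed.

Lemma scaled_invE : mxR U = ((zr D * zr D)%R *: invmx (mxR M))%R.
Proof.
have adjE : (\adj (mxR M))%R = (zr D *: invmx (mxR M))%R.
  rewrite /invmx uM detR scalerA mulfV ?scale1r //; exact/eqP.
by rewrite /U /scaled_inv /mxR map_mxZ map_mx_adj -/(mxR M) adjE scalerA.
Qed.

Definition qf (m : 'cV[int]_N) : int := ((m^T *m U *m m) ord0 ord0)%R.

Lemma qf_invform m : invform M m = zr (qf m) / zr D ^ 2.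
Proof.
have -> : zr (qf m) = (((mxR m)^T *m mxR U *m mxR m) ord0 ord0)%R.
  have -> : ((mxR m)^T = mxR m^T)%R by apply/matrixP => i k; rewrite !mxE.
  have -> : (mxR m^T *m mxR U *m mxR m = mxR (m^T *m U *m m))%R by rewrite /mxR !map_mxM.
  by rewrite [RHS]mxE.
rewrite scaled_invE -scalemxAr -scalemxAl mxE -/(invform M m).
move: (invform M m) => X; have F : X = zr D * zr D * X / zr D ^ 2 by field.
exact: F.
Qed.

(** Exponent n at the centre and -1, 0 or 1 elsewhere, the only values on which factors of degree 1
    and 2 do not vanish. *)
Definition vec (f : {ffun 'I_N -> 'I_3}) (n : int) : 'cV[int]_N :=
  (\col_j if j == c then n else Posz (f j) - 1)%R.

Lemma vec_add f n k : vec f (n + k)%R = (vec f n + k *: delta_mx c ord0)%R.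
Proof.
by apply/colP => j; rewrite !mxE andbT; case: eqP => _; rewrite ?mulr1 ?mulr0 ?addr0.
Qed.

Definition fA : int := U c c.
Definition fB f : int := ((U *m vec f 0) c ord0)%R.
Definition fC f : int := qf (vec f 0%R).

Lemma qf_vec f n : zr (qf (vec f n)) = zr fA * zr n ^ 2 + 2 * zr (fB f) * zr n + zr (fC f).
Proof.
rewrite -[n]add0r vec_add /qf (qform_affine _ _ _ scaled_inv_sym) -/(qf _) -/(fB f) -/fA -/(fC f) add0r.
by rewrite !zrD !zrM; ring.
Qed.

Lemma fA_gt0 : (0 < fA)%R.
Proof.
have [m0 h] := invform_ge (delta_mx c ord0)%R c sym hM.
rewrite mxE !eqxx /= in h.
have qA : qf (delta_mx c ord0)%R = fA.
  by rewrite /qf /fA trmx_delta -rowE -colE; move: (U) => V; rewrite !mxE.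
rewrite qf_invform qA in h.
have p2 : 0 < zr D ^ 2 by rewrite -Rsqr_pow2; apply: Rsqr_pos_lt.
have i2 := Rinv_0_lt_compat _ p2.
case: (fA) h => n h.
  case: n h => // h; exfalso; move: h; rewrite (_ : zr (Posz 0) = 0) // (_ : zr _ = 1) // /Rdiv !Rmult_0_l Rmult_0_r; lra.
exfalso; move: h; rewrite (_ : zr (Posz _) = 1) // zr_Negz.
have n0 := pos_INR n; rewrite /Rdiv.
have : 0 <= zr (M c c) * ((INR n + 1) * / zr D ^ 2) by apply: Rmult_le_pos; [lra | apply: Rmult_le_pos; lra].
lra.
Qed.

(** The value of [f] at the centre does not enter [vec]; requiring it to be 1 makes each vector
    count once. *)
Definition Lam (f : {ffun 'I_N -> 'I_3}) : C :=
  if val (f c) == 1%N then \big[Cmult/RtoC 1]_(j < N | j != c) RtoC (lam_loc (deg e j) (Posz (f j) - 1)%R) else RtoC 0.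

Lemma lam_split (m : 'cV[int]_N) :
  Cprod (fun j => RtoC (lam_loc (deg e j) (m j ord0))) =
  \big[Cplus/RtoC 0]_(f : {ffun 'I_N -> 'I_3}) (if m == vec f (m c ord0) then Lam f * RtoC (lam_loc 3 (m c ord0)) else RtoC 0)%C.
Proof.
have prodE : Cprod (fun j => RtoC (lam_loc (deg e j) (m j ord0))) =
   (RtoC (lam_loc 3 (m c ord0)) * \big[Cmult/RtoC 1]_(j < N | j != c) RtoC (lam_loc (deg e j) (m j ord0)))%C.
  by rewrite /Cprod (bigD1 c) //= hc.
have mv f j : m == vec f (m c ord0) -> j != c -> m j ord0 = (Posz (f j) - 1)%R.
  by move=> /eqP e1 hj; rewrite {1}e1 mxE (negbTE hj).
case: (boolP [forall j, (j == c) || (-1 <= m j ord0 <= 1)%R]) => [/forallP h|].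
  pose f0 := [ffun j => if j == c then (inord 1 : 'I_3) else inord (absz (m j ord0 + 1)%R)].
  have f0j j : j != c -> (Posz (f0 j) - 1)%R = m j ord0.
    by move=> hj; rewrite /f0 ffunE (negbTE hj) inordK; have := h j; rewrite (negbTE hj) /=; lia.
  have f0c : val (f0 c) == 1%N by rewrite /f0 ffunE eqxx /= inordK.
  have m0 : m == vec f0 (m c ord0).
    by apply/eqP/colP => j; rewrite mxE; case: eqP => [->|/eqP hj] //; rewrite f0j.
  rewrite (bigD1 f0) //= m0 big1 ?Cplus_0_r => [|f hf].
    rewrite prodE Cmult_comm /Lam f0c; congr Cmult; apply: eq_bigr => j hj; by rewrite f0j.
  case: ifP => // mf; rewrite /Lam; case: eqP => [fc|_]; last by ring.
  case/eqP: hf; apply/ffunP => j; apply: val_inj; have [->|hj] := eqVneq j c; first by rewrite fc (eqP f0c).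
  by move: (f0j j hj); rewrite (mv f j mf hj) => /addIr [] H; exact: esym H.
rewrite negb_forall => /existsP [j]; rewrite negb_or => /andP [hj hm].
rewrite big1 => [|f _].
  rewrite prodE (bigD1 j) //= (_ : lam_loc (deg e j) (m j ord0) = 0); first by ring.
  have [n1 n2 n3] : [/\ m j ord0 == (-1)%R = false, m j ord0 == 1%R = false & m j ord0 == 0%R = false] by split; lia.
  by have := hd hj; rewrite !inE /lam_loc => /orP [] /eqP -> /=; rewrite ?n1 ?n2 ?n3.
case: ifP => // mf; exfalso; move: hm; rewrite (mv f j mf hj).
by case: (f j) => v hv /=; lia.
Qed.

Section Sum.
Variables (P : 'cV[int]_N -> Prop) (inP : 'cV[int]_N -> bool) (cst : R) (r : 'cV[int]_N -> R) (kk Q p K : nat).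
Hypotheses (hP : forall m, P m <-> inP m) (hcst : 0 < cst) (hr : forall m, r m = cst * invform M m)
  (hk : (0 < kk)%N) (hQ : (0 < Q)%N) (Qeven : ~~ odd Q) (hp : (2 * p = kk * absz fA * Q)%N)
  (hcq : INR kk * zr D ^ 2 = 2 * cst * INR Q)
  (per : forall f n, inP (vec f (n + Posz Q)%R) = inP (vec f n))
  (hKb : forall f, (2 * kk * absz (fB f) < K)%N).

Definition psi_c (f : {ffun 'I_N -> 'I_3}) (n : int) : C :=
  RtoC (if odd (absz n) && inP (vec f n) then / 2 else 0).
Definition star_theta (f : {ffun 'I_N -> 'I_3}) : C -> C :=
  thetaf (2 * INR p) (phiQ (absz fA) kk (fB f) (psi_c f)) (int_box K) (ddQ (absz fA) kk (fB f) (psi_c f)).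
(** The constant left when the square in the central exponent is completed. *)
Definition star_exp (f : {ffun 'I_N -> 'I_3}) : R := cst * (zr fA * zr (fC f) - zr (fB f) ^ 2) / (zr fA * zr D ^ 2).

Lemma psi_c_periodic f n : psi_c f (n + Posz Q)%R = psi_c f n.
Proof.
by rewrite /psi_c per (_ : odd (absz (n + Posz Q)%R) = odd (absz n)) //; move: Qeven; lia.
Qed.

Lemma psi_c_bound f n : Cmod (psi_c f n) <= 1.
Proof. by rewrite /psi_c Cmod_R; case: ifP => _; apply: Rabs_le; lra. Qed.

Lemma star_theta_qm f : quantum_modular (1 / 2%:R)%R (fun=> True) (star_theta f).
Proof.
have a0 : (0 < absz fA)%N by have := fA_gt0; lia.
apply: (@thetaf_quantum_modular _ _ 1).
- by have : (0 < kk * absz fA * Q)%N; [rewrite !muln_gt0 hk a0 | lia].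
- exact: (@phiQ_periodic (absz fA) kk Q p (fB f) (psi_c f) a0 hk hp (psi_c_periodic f)).
- by apply: phiQ_bound; exact: psi_c_bound.
Qed.

Lemma qpow_add tau x y : qpow tau (x + y) = (qpow tau x * qpow tau y)%C.
Proof. by rewrite /qpow -Cexp_add; congr Cexp; rewrite RtoC_plus; ring. Qed.

(** For fixed [f] only the central exponent varies, and [quad_theta] applies: the weight sgn(n)/2 on
    odd n splits into the sign and the periodic [psi_c]. *)
Lemma star_sum tau S : 0 < Im tau ->
  is_sum_over P (fun m => qpow tau (r m) * Cprod (fun j => RtoC (lam_loc (deg e j) (m j ord0))))%C S ->
  S = \big[Cplus/RtoC 0]_(f : {ffun 'I_N -> 'I_3}) (Lam f * (qpow tau (star_exp f) * star_theta f tau))%C.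
Proof.
move=> ht hS.
have a0 : (0 < absz fA)%N by have := fA_gt0; lia.
have aE : Posz (absz fA) = fA by have := fA_gt0; lia.
have zA : 0 < zr fA by rewrite -aE zr_Posz; apply: lt_0_INR; lia.
have p0 : (0 < p)%N by have : (0 < kk * absz fA * Q)%N; [rewrite !muln_gt0 hk a0 | lia].
have ip : 0 < INR p by apply: lt_0_INR; lia.
have iQ : 0 < INR Q by apply: lt_0_INR; lia.
have ik : 0 < INR kk by apply: lt_0_INR; lia.
have p2 : 2 * INR p = INR kk * zr fA * INR Q.
  by have := congr1 INR hp; rewrite !mult_INR -aE zr_Posz => <-.
pose G m : C := (qpow tau (r m) * RtoC (if inP m then 1 else 0)%coqR)%C.
have hS' : is_sum_over TT (fun m : 'cV[int]_N => G m * Cprod (fun j => RtoC (lam_loc (deg e j) (m j ord0))))%C S.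
  apply: (is_sum_over_reindex (h := id) (P' := P)) => // [m _|].
    rewrite /G; case: ifP => [/hP hm|_] h0; first by exists m.
    by case: h0; ring.
  by apply: is_sum_over_ext hS => m /hP; rewrite /G => ->; rewrite Cmult_1_r.
have one f : is_sum_over TT (fun m : 'cV[int]_N => if m == vec f (m c ord0) then Lam f * RtoC (lam_loc 3 (m c ord0)) * G m else RtoC 0)%C (Lam f * (qpow tau (star_exp f) * star_theta f tau))%C.
  apply: (is_sum_over_reindex (h := vec f) (P' := TT)) => //.
  - by move=> n n' _ _ /colP /(_ c); rewrite !mxE eqxx.
  - by move=> m _; case: eqP => // ->; exists (m c ord0) => //; rewrite mxE eqxx.
  have H := @quad_theta (absz fA) kk Q p (fB f) (psi_c f) a0 hk hQ hp K 1 tau (hKb f) ht (psi_c_bound f).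
  have {}H := is_sum_over_scal (Lam f * qpow tau (star_exp f))%C H.
  rewrite Cmult_assoc; apply: is_sum_over_ext H => n _.
  have vc : vec f n c ord0 = n by rewrite mxE eqxx.
  rewrite vc eqxx /G.
  have -> : RtoC (lam_loc 3 n) = (RtoC (sg n) * RtoC (if odd (absz n) then / 2 else 0)%coqR)%C.
    by rewrite -RtoC_mult /lam_loc /=; congr RtoC; case: ifP => _; field.
  have -> : psi_c f n = (RtoC (if odd (absz n) then / 2 else 0)%coqR * RtoC (if inP (vec f n) then 1 else 0)%coqR)%C.
    by rewrite -RtoC_mult /psi_c; congr RtoC; case: (odd _); case: (inP _) => /=; ring.
  have -> : qpow tau (r (vec f n)) = (qpow tau (star_exp f) * qE (tau / RtoC (2 * INR p)) (zr (Posz (kk * absz fA) * n + Posz kk * fB f)%R))%C.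
    have -> : r (vec f n) = star_exp f + cst * (zr fA * zr n + zr (fB f)) ^ 2 / (zr fA * zr D ^ 2).
      by rewrite hr qf_invform qf_vec /star_exp; field; split=> //; lra.
    rewrite qpow_add; congr Cmult; rewrite /qpow /qE; congr Cexp.
    rewrite PoszM aE zrD !zrM zr_Posz.
    have -> : (INR kk * zr fA * zr n + INR kk * zr (fB f)) ^ 2 = INR kk ^ 2 * (zr fA * zr n + zr (fB f)) ^ 2 by ring.
    (* The purpose of [hcq]: it makes cst/(A (det M)^2) equal to kk^2/4p. *)
    have -> : cst * (zr fA * zr n + zr (fB f)) ^ 2 / (zr fA * zr D ^ 2) = / 2 * (INR kk ^ 2 * (zr fA * zr n + zr (fB f)) ^ 2) / (2 * INR p).
      rewrite p2; have -> : cst = INR kk * zr D ^ 2 / (2 * INR Q) by rewrite hcq; field; lra.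
      by field; repeat split=> //; lra.
    have pz : RtoC (2 * INR p) <> RtoC 0 by move/RtoC_inj; lra.
    move: (INR kk ^ 2 * _) => X; rewrite RtoC_div; last lra.
    rewrite (RtoC_mult (/ 2)) RtoC_inv; last lra.
    by move: pz; move: (RtoC (2 * INR p)) => Y pz; field; exact: pz.
  ring.
have H : is_sum_over TT (fun m : 'cV[int]_N => \big[Cplus/RtoC 0]_(f : {ffun 'I_N -> 'I_3}) (if m == vec f (m c ord0) then Lam f * RtoC (lam_loc 3 (m c ord0)) * G m else RtoC 0)%C)
   (\big[Cplus/RtoC 0]_(f : {ffun 'I_N -> 'I_3}) (Lam f * (qpow tau (star_exp f) * star_theta f tau))%C).
  by apply: is_sum_over_big => f _; exact: one.
apply: (is_sum_over_unique hS'); apply: is_sum_over_ext H => m _.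
rewrite lam_split -bigC_scal; apply: eq_bigr => f _; case: ifP => _; ring.
Qed.

End Sum.
End StarSum.

(** * Star graphs *)

Lemma consecutiveE (T : eqType) (s : seq T) (x y : T) : uniq s ->
  consecutive s x y = [&& x \in s, y \in s & (index y s == (index x s).+1) || (index x s == (index y s).+1)].
Proof.
move=> us.
have one a b : infix [:: a; b] s = [&& a \in s, b \in s & index b s == (index a s).+1].
  apply/infixP/and3P => [[s1 [s2 hs]]|[ha hb /eqP hi]].
    have : uniq (s1 ++ a :: b :: s2) by rewrite -hs.
    rewrite cat_uniq => /and3P [_ /hasPn h /= /andP [ab _]]; rewrite inE negb_or in ab.
    have a1 : a \notin s1 by apply: h; rewrite mem_head.
    have b1 : b \notin s1 by apply: h; rewrite !inE eqxx orbT.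
    case/andP: ab => ab _.
    rewrite hs !mem_cat !inE !eqxx ?orbT; split=> //.
    by rewrite /= !index_cat (negbTE a1) (negbTE b1) /= !eqxx (negbTE ab); apply/eqP; lia.
  have hn : ((index a s).+1 < size s)%N by rewrite -hi index_mem.
  exists (take (index a s) s), (drop (index a s).+2 s).
  rewrite -{1}(cat_take_drop (index a s) s); congr cat.
  rewrite (drop_nth a) ?index_mem // nth_index //; congr cons.
  by rewrite (drop_nth a) // -hi nth_index.
rewrite /consecutive !one; case: (x \in s); case: (y \in s) => //=.
Qed.

Lemma path_deg (N : nat) (e : rel 'I_N) (q : seq 'I_N) (x : 'I_N) :
  uniq q -> x \in q -> (0 < index x q)%N -> (forall y, e x y = consecutive q x y) ->
  deg e x = (if (index x q).+1 == size q then 1 else 2)%N.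
Proof.
move=> uq xq i0 ex; have i1 : (index x q < size q)%N by rewrite index_mem.
set i := index x q in i0 i1 *.
have E y : e x y = (y == nth x q i.-1) || ((i.+1 < size q)%N && (y == nth x q i.+1)).
  rewrite ex consecutiveE // xq /= -/i.
  apply/andP/orP => [[yq] /orP [] /eqP h|[/eqP ->|/andP [h /eqP ->]]].
  - by right; rewrite -h index_mem yq nth_index // eqxx.
  - by left; rewrite h /= nth_index // eqxx.
  - have h : (i.-1 < size q)%N by lia.
    rewrite mem_nth // index_uniq //; split=> //; apply/orP; right; lia.
  by rewrite mem_nth // index_uniq // eqxx.
rewrite /deg; case: eqP => hi.
  rewrite (_ : [set k | e x k] = [set nth x q i.-1]) ?cards1 //.
  by apply/setP => y; rewrite !inE E hi ltnn orbF.
have hi1 : (i.+1 < size q)%N by lia.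
rewrite (_ : [set k | e x k] = [set nth x q i.-1; nth x q i.+1]); last first.
  by apply/setP => y; rewrite !inE E hi1.
have i2 : (i.-1 < size q)%N by lia.
rewrite cards2 nth_uniq //.
by have -> : (i.-1 != i.+1)%N by lia.
Qed.

(** With the centre placed in front, every leg vertex has a predecessor; only the last one lacks a
    successor. *)
Lemma leg_deg (N : nat) (e : rel 'I_N) (c : 'I_N) (p : seq 'I_N) (x : 'I_N) :
  uniq (c :: p) -> x \in p -> (forall y, e x y = consecutive (c :: p) x y) ->
  deg e x = (if (index x (c :: p)).+1 == size (c :: p) then 1 else 2)%N.
Proof.
move=> up xp; apply: path_deg => //; first by rewrite inE xp orbT.
by rewrite /=; case: eqP => // cx; move: up; rewrite /= cx xp.
Qed.

(** The structure extracted from the star: a label constant along edges away from the centre, with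
    at most one leaf for each label. *)
Definition star_legs (N : nat) (e : rel 'I_N) (c : 'I_N) (lab : 'I_N -> seq 'I_N) : Prop :=
  [/\ forall j, j != c -> deg e j \in [:: 1; 2]%N,
      forall x y, x != c -> y != c -> e x y -> lab x = lab y &
      forall x y, x != c -> y != c -> deg e x = 1%N -> deg e y = 1%N -> lab x = lab y -> x = y].

Lemma three_leg_star_legs (N : nat) (e : rel 'I_N) : three_leg_star e ->
  exists (c : 'I_N) (lab : 'I_N -> seq 'I_N),
    [/\ symmetric e, irreflexive e, deg e c = 3%N & star_legs e c lab].
Proof.
move=> [c [p1 [p2 [p3 [[n1 n2 n3] un cov E]]]]]; exists c.
have [cN up] : c \notin p1 ++ p2 ++ p3 /\ uniq (p1 ++ p2 ++ p3) by apply/andP.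
move: (cN); rewrite !mem_cat !negb_or => /and3P [c1 c2 c3].
move: (up); rewrite !cat_uniq => /and3P [u1 d1 /and3P [u2 d2 u3]].
have dis (p p' : seq 'I_N) : ~~ has (mem p) p' -> forall x, x \in p -> x \notin p'.
  by move=> /hasPn h x xp; apply/negP => /h; rewrite /= xp.
have {}d1 := dis _ _ d1; have {}d2 := dis _ _ d2.
have d12 x : x \in p1 -> x \notin p2 by move/d1; rewrite mem_cat negb_or => /andP [].
have d13 x : x \in p1 -> x \notin p3 by move/d1; rewrite mem_cat negb_or => /andP [].
have uc p : c \notin p -> uniq p -> uniq (c :: p) by move=> /= -> ->.
have {}E x y : e x y = [|| consecutive (c :: p1) x y, consecutive (c :: p2) x y | consecutive (c :: p3) x y] by exact: E.
have con p x y : uniq (c :: p) -> x != c -> x \notin p -> consecutive (c :: p) x y = false.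
  by move=> u xc xp; rewrite consecutiveE // inE (negbTE xc) (negbTE xp).
have cons_sym (s : seq 'I_N) x y : consecutive s x y = consecutive s y x by rewrite /consecutive orbC.
pose lab x := if x \in p1 then p1 else if x \in p2 then p2 else p3.
have labP x : x != c -> [/\ x \in lab x, uniq (c :: lab x) & forall y, e x y = consecutive (c :: lab x) x y].
  move=> xc; have := cov x; rewrite inE (negbTE xc) /= !mem_cat /lab.
  case h1: (x \in p1) => /=.
    split=> // [|y]; first exact: uc.
    by rewrite E (@con p2) ?(@con p3) ?orbF //; [exact: uc|exact: d13|exact: uc|exact: d12].
  case h2: (x \in p2) => /= h3.
    split=> // [|y]; first exact: uc.
    by rewrite E (@con p1) ?(@con p3) ?orbF //; [exact: uc|exact: d2|exact: uc|rewrite h1].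
  split=> // [|y]; first exact: uc.
  by rewrite E (@con p1) ?(@con p2) //; [exact: uc|rewrite h2|exact: uc|rewrite h1].
have lab_mem x y : x != c -> y \in lab x -> lab y = lab x.
  move=> xc; have := cov x; rewrite inE (negbTE xc) /= !mem_cat /lab.
  case: ifP => [_ _ -> //|_]; case: ifP => [_ _ y2|_ /= _ y3].
    by rewrite y2; case: ifP => // /d12; rewrite y2.
  by case: ifP => [/d13|_]; [rewrite y3|case: ifP => // /d2; rewrite y3].
exists lab; split.
- by move=> x y; rewrite !E !(cons_sym _ x y).
- move=> x; have no p : c \notin p -> uniq p -> consecutive (c :: p) x x = false.
    by move=> h1 h2; rewrite consecutiveE ?uc // orbb (ltn_eqF (ltnSn _)) !andbF.
  by rewrite E !no.
- have hd p y : p != [::] -> c \notin p -> uniq p -> consecutive (c :: p) c y = (y == head c p).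
    case: p => // h t _ hc hu; rewrite consecutiveE ?uc // mem_head /= eqxx.
    apply/andP/eqP => [[]|->].
      case: (eqVneq c y) => [//|cy] _; case: (eqVneq h y) => [-> //|hy]; rewrite /= ?orbF.
      by [].
    rewrite !inE !eqxx orbT; split=> //; case: (eqVneq c h) => // ch.
    by move: hc; rewrite ch mem_head.
  have hm p : p != [::] -> head c p \in p by case: p => // h t _; rewrite mem_head.
  rewrite /deg (_ : [set k | e c k] = [set head c p1; head c p2; head c p3]).
    have n12 : head c p1 != head c p2 by apply/eqP => h; have := d12 _ (hm _ n1); rewrite h hm.
    have n13 : head c p1 != head c p3 by apply/eqP => h; have := d13 _ (hm _ n1); rewrite h hm.
    have n23 : head c p2 != head c p3 by apply/eqP => h; have := d2 _ (hm _ n2); rewrite h hm.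
    by rewrite setUC cardsU1 !inE negb_or eq_sym n13 eq_sym n23 cards2 n12.
  by apply/setP => y; rewrite !inE E !hd // orbA.
split.
- move=> j jc; have [h1 h2 h3] := labP j jc.
  by rewrite (leg_deg h2 h1 h3); case: eqP.
- move=> x y xc yc; have [h1 h2 h3] := labP x xc.
  rewrite h3 consecutiveE // => /and3P [_]; rewrite inE (negbTE yc) /= => yl _.
  by rewrite (lab_mem x y).
- move=> x y xc yc; have [h1 h2 h3] := labP x xc; have [g1 g2 g3] := labP y yc.
  rewrite (leg_deg h2 h1 h3) (leg_deg g2 g1 g3) => hx hy lxy.
  rewrite -lxy in hy g1.
  have /eqP ix : ((index x (c :: lab x)).+1 == size (c :: lab x)) by move: hx; case: eqP.
  have /eqP iy : ((index y (c :: lab x)).+1 == size (c :: lab x)) by move: hy; case: eqP.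
  rewrite -(@nth_index _ c x (c :: lab x)) ?inE ?h1 ?orbT // -(@nth_index _ c y (c :: lab x)) ?inE ?g1 ?orbT //.
  by congr nth; apply: succn_inj; rewrite ix iy.
Qed.

(** * Equality of the exponents in the unimodular case *)

Section StarDisc.
Variables (N : nat) (e : rel 'I_N) (M : 'M[int]_N) (c : 'I_N) (lab : 'I_N -> seq 'I_N).
Hypotheses (hleg : star_legs e c lab) (sym : (M^T = M)%R) (hM : positive_definite (mxR M))
  (off : forall j k, j != c -> k != c -> j != k -> M j k = (if e j k then - 1 else 0)%R)
  (det1 : (\det M = 1)%R).

(** Nonvanishing of each local factor. The leaf condition is put as a square, the form in which
    products of leaf values are seen to be signs. *)
Lemma Lam_leaves f : Lam e c f <> RtoC 0 -> forall j, j != c ->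
  (deg e j = 1%N -> ((vec c f 0 j ord0) * (vec c f 0 j ord0) = 1)%R) /\ (deg e j = 2%N -> vec c f 0 j ord0 = 0%R).
Proof.
move=> h j hj; rewrite !mxE (negbTE hj).
have {}h : lam_loc (deg e j) (Posz (f j) - 1)%R <> 0.
  move=> h0; apply: h; rewrite /Lam; case: ifP => // _.
  by rewrite (bigD1 j) //= h0; ring.
split=> hd; move: h; rewrite hd /lam_loc /=; case: (f j) => v hv /=.
  by case: eqP => [->//|_]; case: eqP => [->//|].
by case: eqP.
Qed.

(* The vector [y = A U u - b U e_c] vanishes at the centre, the discriminant
   [A C - b^2] equals [y . u], and off the centre [M y = A u].  Two admissible [u]
   differ by a sign [eta] constant on each leg; multiplying [y] by [eta] solves the
   same equations for the other [u]. *)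
Lemma star_disc_const f g : Lam e c f <> RtoC 0 -> Lam e c g <> RtoC 0 ->
  (fA M c * fC M c f - fB M c f * fB M c f = fA M c * fC M c g - fB M c g * fB M c g)%R.
Proof.
move=> hf hg; have [hd hlab huniq] := hleg.
have lin (a b : int) (V W : 'cV[int]_N) j : ((a *: V + b *: W)%R j ord0 = a * V j ord0 + b * W j ord0)%R by rewrite !mxE.
have lin' (a b : int) (V W : 'cV[int]_N) j : ((a *: V - b *: W)%R j ord0 = a * V j ord0 - b * W j ord0)%R by rewrite !mxE.
pose U := scaled_inv M; pose ec : 'cV[int]_N := (delta_mx c ord0)%R.
have Us : (U^T = U)%R := scaled_inv_sym sym.
have UE : U = (\adj M)%R by rewrite /U /scaled_inv det1 scale1r.
have UM : (U *m M = 1%:M)%R by rewrite UE mul_adj_mx det1.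
have MU : (M *m U = 1%:M)%R by rewrite UE mul_mx_adj det1.
have ecU : ((U *m ec) c ord0 = fA M c)%R by rewrite /ec -colE mxE.
have ecj j : j != c -> ec j ord0 = 0%R by rewrite mxE => /negbTE ->.
pose y h : 'cV[int]_N := (fA M c *: (U *m vec c h 0) - fB M c h *: (U *m ec))%R.
have yc h : y h c ord0 = 0%R.
  rewrite /y lin' ecU -/(fB M c h).
  by rewrite mulrC subrr.
have My h : (M *m y h = fA M c *: vec c h 0 - fB M c h *: ec)%R.
  by rewrite /y mulmxBr -!scalemxAr !mulmxA MU !mul1mx.
have disc h : (fA M c * fC M c h - fB M c h * fB M c h = \sum_j y h j ord0 * vec c h 0 j ord0)%R.
  have -> : fC M c h = (\sum_j (U *m vec c h 0) j ord0 * vec c h 0 j ord0)%R.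
    rewrite /fC /qf -mulmxA mxE; apply: eq_bigr => j _.
    by rewrite mulrC; congr (_ * _)%R; rewrite mxE.
  have -> : (fB M c h * fB M c h = fB M c h * \sum_j (U *m ec) j ord0 * vec c h 0 j ord0)%R.
    congr (_ * _)%R; rewrite {1}/fB mxE; apply: eq_bigr => j _.
    by rewrite /ec -colE -/U -[in LHS]Us; move: (U) => V; rewrite !mxE.
  rewrite !mulr_sumr -sumrB; apply: eq_bigr => j _.
  by rewrite /y lin' mulrBl !mulrA.
(* The sign of a leg is the quotient of the two leaf values on it, written as a product since both
   are 1 or -1; the default is 1. *)
pose eta j : int := if [pick l | [&& l != c, deg e l == 1%N & lab l == lab j]] is Some l
   then (vec c f 0 l ord0 * vec c g 0 l ord0)%R else 1%R.
have sq (a b : int) : (a * a = 1 -> b * b = 1 -> (a * b) * (a * b) = 1)%R.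
  by move=> ha hb; rewrite mulrACA ha hb.
have eta2 j : (eta j * eta j = 1)%R.
  rewrite /eta; case: pickP => [l /and3P [l1 /eqP l2 _]|_] //.
  by apply: sq; [exact: (Lam_leaves hf l1).1 | exact: (Lam_leaves hg l1).1].
have eta_u j : j != c -> vec c g 0 j ord0 = (eta j * vec c f 0 j ord0)%R.
  move=> jc; have [f1 f2] := Lam_leaves hf jc; have [g1 g2] := Lam_leaves hg jc.
  have := hd j jc; rewrite !inE => /orP [] /eqP dj; last by rewrite f2 // g2 // mulr0.
  rewrite /eta; case: pickP => [l /and3P [l1 /eqP l2 /eqP l3]|/(_ j)]; last by rewrite jc dj !eqxx.
  by rewrite (huniq l j) // mulrAC f1 // mul1r.
pose z : 'cV[int]_N := (\col_j (eta j * y f j ord0))%R.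
have Mz j : j != c -> (M *m z)%R j ord0 = (fA M c * vec c g 0 j ord0)%R.
  move=> jc; rewrite eta_u // mulrCA.
  have -> : (fA M c * vec c f 0 j ord0 = (M *m y f) j ord0)%R.
    by rewrite My lin' ecj // mulr0 subr0.
  rewrite !mxE mulr_sumr; apply: eq_bigr => k _; rewrite mxE.
  have [->|kc] := eqVneq k c; first by rewrite yc !mulr0.
  have [->|kj] := eqVneq j k; first by rewrite mulrCA.
  rewrite off //; case: ifP => ejk; last by rewrite !mul0r mulr0.
  by rewrite /eta (hlab j k) // -/(eta k) mulrCA.
(* The equation M z = A u + b e_c determines z up to b, and the vanishing of z at the centre
   determines b because A is positive. *)
have zE : z = y g.
  set b := (M *m z)%R c ord0.
  have E : (M *m z = fA M c *: vec c g 0 + b *: ec)%R.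
    apply/colP => j; rewrite lin.
    have [->|jc] := eqVneq j c; last by rewrite Mz // ecj // mulr0 addr0.
    by rewrite -/b [vec _ _ _ _ _]mxE [ec _ _]mxE !eqxx mulr0 add0r mulr1.
  have Z : z = (fA M c *: (U *m vec c g 0) + b *: (U *m ec))%R.
    by rewrite -[LHS]mul1mx -UM -mulmxA E mulmxDr -!scalemxAr.
  have zc : (fA M c * fB M c g + b * fA M c = 0)%R.
    have := congr1 (fun v : 'cV[int]_N => v c ord0) Z.
    rewrite /= [X in X = _]mxE yc mulr0 lin ecU -/(fB M c g).
    by move=> <-.
  have A0 := fA_gt0 c sym hM.
  rewrite Z /y -scaleNr; congr (_ + _ *: _)%R.
  by move: zc A0; move: (fA M c) (fB M c g) => a b'; nia.
rewrite !disc; apply: eq_bigr => j _; rewrite -zE [z _ _]mxE.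
have [->|jc] := eqVneq j c; first by rewrite yc !mulr0 !mul0r.
by rewrite eta_u // mulrACA eta2 mul1r.
Qed.
End StarDisc.

Section IsRat.
Definition is_rat (x : R) := exists q : rat, ratr q = x.
Lemma is_rat_int n : is_rat (zr n).
Proof. by exists (n%:~R)%R; rewrite rmorph_int. Qed.
Lemma is_rat_plus x y : is_rat x -> is_rat y -> is_rat (x + y).
Proof. by move=> [a <-] [b <-]; exists (a + b)%R; rewrite rmorphD. Qed.
Lemma is_rat_mult x y : is_rat x -> is_rat y -> is_rat (x * y).
Proof. by move=> [a <-] [b <-]; exists (a * b)%R; rewrite rmorphM. Qed.
Lemma is_rat_inv x : is_rat x -> is_rat (/ x).
Proof. by move=> [a <-]; exists (a^-1)%R; rewrite fmorphV. Qed.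
Lemma is_rat_opp x : is_rat x -> is_rat (- x).
Proof. by move=> [a <-]; exists (- a)%R; rewrite rmorphN. Qed.
Lemma is_rat_nat n : is_rat (INR n).
Proof. by rewrite -zr_Posz; exact: is_rat_int. Qed.
Lemma is_rat_pow x n : is_rat x -> is_rat (x ^ n).
Proof. by move=> h; elim: n => [|n IH] /=; [exact: (is_rat_nat 1) | exact: is_rat_mult]. Qed.

Lemma star_exp_rat N (M : 'M[int]_N) c cst f : is_rat cst -> is_rat (star_exp M c cst f).
Proof.
move=> h; apply: is_rat_mult; last by apply/is_rat_inv/is_rat_mult; [|apply: is_rat_pow]; exact: is_rat_int.
apply: is_rat_mult => //; apply: is_rat_plus; first by apply: is_rat_mult; exact: is_rat_int.
by apply/is_rat_opp/is_rat_pow; exact: is_rat_int.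
Qed.
End IsRat.

(** * The two series as sums of false theta functions *)

Section Main.
Variables (N : nat) (e : rel 'I_N) (M : 'M[int]_N) (c : 'I_N) (lab : 'I_N -> seq 'I_N).
Hypotheses (es : symmetric e) (ei : irreflexive e) (hc : deg e c = 3%N) (hleg : star_legs e c lab)
  (hpl : plumbing_matrix e M).

Let sym : (M^T = M)%R. Proof. by case: hpl. Qed.
Let hM : positive_definite (mxR M). Proof. by case: hpl. Qed.
Let hd : forall j, j != c -> deg e j \in [:: 1; 2]%N. Proof. by case: hleg. Qed.
Let hdeg j : deg e j \in [:: 1; 2; 3]%N.
Proof.
have [->|/hd] := eqVneq j c; first by rewrite hc.
by rewrite !inE => /orP [] ->; rewrite ?orbT.
Qed.
Let D0 : (\det M != 0)%R.
Proof.
have symR : ((mxR M)^T = mxR M)%R by apply/matrixP => i k; rewrite !mxE -[in RHS]sym mxE.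
have := posdef_unit hM symR; rewrite unitmxE unitfE /mxR det_map_mx.
by apply: contra => /eqP ->.
Qed.
Let A0 : (0 < absz (fA M c))%N.
Proof. by have := fA_gt0 c sym hM; lia. Qed.

Definition cutoff (kk : nat) : nat := (\max_(f : {ffun 'I_N -> 'I_3}) (2 * kk * absz (fB M c f))).+1.
Lemma cutoffP kk f : (2 * kk * absz (fB M c f) < cutoff kk)%N.
Proof. by rewrite ltnS; exact: (leq_bigmax f). Qed.

(** Cramer's rule: m = M k is solvable over the integers when det M divides adj(M) m. In this form
    the periodicity in the central exponent is visible. *)
Definition lattice_mem (m : 'cV[int]_N) : bool := [forall i, (\det M %| (\adj M *m m)%R i ord0)%Z].
(** For det M = 1 the matrix maps the integer vectors onto themselves, so the coset in the
    definition of Zhat_0 is a condition on parities. *)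
Definition parity_mem (m : 'cV[int]_N) : bool := [forall j, odd (absz (m j ord0)) == odd (deg e j)].

Let addcE (V W : 'cV[int]_N) i : ((V + W)%R i ord0 = V i ord0 + W i ord0)%R.
Proof. by rewrite mxE. Qed.
Let muln2E (V : 'cV[int]_N) i : ((V *+ 2)%R i ord0 = V i ord0 + V i ord0)%R.
Proof. by rewrite mulr2n addcE. Qed.

Lemma lattice_memP m : (exists k : 'cV[int]_N, m = M *m k)%R <-> lattice_mem m.
Proof.
split=> [[k ->]|/forallP h].
  by apply/forallP => i; rewrite mulmxA mul_adj_mx mul_scalar_mx mxE dvdz_mulr.
exists (\col_i ((\adj M *m m)%R i ord0 %/ \det M)%Z)%R.
set k := (\col_i _)%R.
have E : (\adj M *m m = \det M *: k)%R.
  apply/colP => i; rewrite [RHS]mxE [k _ _]mxE mulrC divzK //; exact: h.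
have : (\det M *: m = \det M *: (M *m k))%R.
  by rewrite scalemxAr -E mulmxA mul_mx_adj mul_scalar_mx.
move=> /colP H; apply/colP => i; move: (H i); rewrite [LHS]mxE [RHS]mxE.
by move/(mulfI D0).
Qed.

(** A multiple of det M would do as a period; the factor 2 makes it even, as the oddness condition
    at the centre demands, and the square fits [hcq]. *)
Lemma lattice_mem_add f n : let Q := (2 * absz (\det M)%R * absz (\det M)%R)%N in
  lattice_mem (vec c f (n + Posz Q)%R) = lattice_mem (vec c f n).
Proof.
move=> Q; apply: eq_forallb => i; rewrite vec_add mulmxDr addcE.
rewrite rpredDr // -scalemxAr mxE; apply: dvdz_mulr.
by rewrite /Q PoszM; apply: dvdz_mull; rewrite dvdzE.
Qed.

Lemma parity_memP m : (\det M = 1)%R -> (exists k : 'cV[int]_N, m = (M *m k) *+ 2 + delta e)%R <-> parity_mem m.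
Proof.
move=> d1; split=> [[k ->]|/forallP h].
  apply/forallP => j; rewrite addcE muln2E [delta e _ _]mxE.
  by move: ((M *m k)%R j ord0) (deg e j) => x d; case: (odd d) => /=; lia.
pose h' : 'cV[int]_N := (\col_j ((m j ord0 - Posz (odd (deg e j))) %/ 2)%Z)%R.
exists (\adj M *m h')%R; rewrite mulmxA mul_mx_adj d1 mul1mx.
apply/colP => j; rewrite addcE muln2E [delta e _ _]mxE [h' _ _]mxE.
move: (h j); move: (m j ord0) (deg e j) => x d; case: (odd d) => /=; lia.
Qed.

Lemma parity_mem_add f n : parity_mem (vec c f (n + Posz 2)%R) = parity_mem (vec c f n).
Proof.
apply: eq_forallb => j; rewrite !mxE; case: ifP => // _; congr (_ == _); lia.
Qed.

(** The common form of both series, which differ only in the lattice, in the scale [cst] of the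
    exponent, and in the resulting [kk], [Q] and [p]. *)
Lemma star_PV tau P (inP : 'cV[int]_N -> bool) cst r kk Q p K :
  (forall m : 'cV_N, P m <-> inP m) -> 0 < cst -> (forall m : 'cV_N, r m = cst * invform M m) ->
  (0 < kk)%N -> (0 < Q)%N -> ~~ odd Q -> (2 * p = kk * absz (fA M c) * Q)%N ->
  INR kk * zr (\det M)%R ^ 2 = 2 * cst * INR Q ->
  (forall f, (2 * kk * absz (fB M c f) < K)%N) -> 0 < Im tau ->
  forall pref, (qpow tau pref / Cpow (RtoC 2 * RtoC PI * Ci) N * PV_torus (PV_integrand e tau P r))%C =
  \big[Cplus/RtoC 0]_(f : {ffun 'I_N -> 'I_3}) (Lam e c f * qpow tau (pref + star_exp M c cst f) * star_theta M c inP kk p K f tau)%C.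
Proof.
move=> hP hcst hr hk hQ Qe hp hcq hK ht pref.
have [S [hS ->]] := PV_value P c es ei hdeg sym hM hcst ht hr.
rewrite (star_sum hc hd sym hM hP hr hk hQ Qe hp hcq hK ht hS).
have n0 : Cpow (RtoC 2 * RtoC PI * Ci) N <> RtoC 0.
  apply: Cpow_nz; have pi0 := PI_RGT_0.
  by apply: Cmult_neq_0; [apply: Cmult_neq_0; move/RtoC_inj; lra | case=> ?; lra].
have -> (x y z : C) : y <> RtoC 0 -> (x / y * (y * z) = x * z)%C by move=> hy; field.
  rewrite -bigC_scal; apply: eq_bigr => f _; rewrite qpow_add.
  have R (a b d t : C) : (a * (b * (d * t)) = b * (a * d) * t)%C by ring.
  exact: R.
exact: n0.
Qed.

Lemma Zser_quantum :
  exists (r : nat) (lam : 'I_r -> C) (rho : 'I_r -> rat) (f : 'I_r -> C -> C),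
      (forall j, quantum_modular (1 / 2%:R)%R (fun=> True) (f j)) /\
      forall tau : C, Rlt 0 (Im tau) ->
        Zser e M tau =
        \big[Cplus/RtoC 0]_(j < r)
          (lam j * qpow tau (ratr (rho j)) * f j tau)%C.
Proof.
set d := absz (\det M)%R; have d0 : (0 < d)%N by move: D0; rewrite /d; lia.
(* For cst = 1/2 and kk = 2 the relation kk (det M)^2 = 2 cst Q forces this Q, and 2p = kk A Q then
   gives p. *)
pose Q := (2 * d * d)%N; pose p := (2 * absz (fA M c) * d * d)%N.
have hQ : (0 < Q)%N by rewrite /Q; lia.
have Qe : ~~ odd Q by rewrite /Q -mulnA oddM.
have hp : (2 * p = 2 * absz (fA M c) * Q)%N by rewrite /p /Q; lia.
have hcq : INR 2 * zr (\det M)%R ^ 2 = 2 * (/ 2) * INR Q.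
  rewrite /Q !mult_INR -(zr_Posz d) /d; have [->|->] : Posz (absz (\det M)%R) = (\det M)%R \/ Posz (absz (\det M)%R) = (- \det M)%R by lia.
    by rewrite /=; field.
  by rewrite zrN /=; field.
pose pref := ((- 3 * INR N + zr (\tr M)%R) / 2)%coqR.
have rat_exp (f : {ffun 'I_N -> 'I_3}) : is_rat (pref + star_exp M c (/ 2) f).
  have h2 : is_rat (/ 2) by apply: is_rat_inv; exact: (is_rat_nat 2).
  apply: is_rat_plus; last exact: star_exp_rat.
  apply: is_rat_mult => //; apply: is_rat_plus; last exact: is_rat_int.
  by apply: is_rat_mult; [exact: (is_rat_int (- 3%:Z)%R) | exact: is_rat_nat].
have [rho hrho] := fin_all_exists rat_exp.
exists #|{: {ffun 'I_N -> 'I_3}}|, (fun j => Lam e c (enum_val j)), (fun j => rho (enum_val j)),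
  (fun j => star_theta M c lattice_mem 2 p (cutoff 2) (enum_val j)); split=> [j|tau ht].
  by apply: (star_theta_qm hc sym hM (cutoff 2) _ hQ Qe hp) => // f n; exact: lattice_mem_add.
pose r (m : 'cV[int]_N) := (invform M m / 2)%coqR.
have hr m : r m = / 2 * invform M m by rewrite /r; lra.
have h2 : 0 < / 2 by lra.
have H := star_PV lattice_memP h2 hr (isT : (0 < 2)%N) hQ Qe hp hcq (@cutoffP 2) ht pref.
rewrite /Zser -/pref; apply: etrans H _.
rewrite (big_enum_val (A := {: {ffun 'I_N -> 'I_3}})) /=.
by apply: eq_bigr => j _; rewrite hrho.
Qed.

(** All f of nonzero weight share one power of q. They also share p and the box of corrections, so
    by [thetaf_linear] the sum is a single [thetaf], and no comparison of multipliers is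
    required. *)
Lemma Zhat0_quantum : (\det M = 1)%R ->
  exists (rho : rat) (f : C -> C),
       quantum_modular (1 / 2%:R)%R (fun=> True) f /\
       forall tau : C, Rlt 0 (Im tau) ->
         Zhat0 e M tau = (qpow tau (ratr rho) * f tau)%C.
Proof.
move=> d1.
(* Here cst = 1/4, kk = 1 and Q = 2, the period of the parity condition, so the modulus is p = A. *)
pose a := absz (fA M c); have hp : (2 * a = 1 * absz (fA M c) * 2)%N by rewrite /a; lia.
have hcq : INR 1 * zr (\det M)%R ^ 2 = 2 * (/ 4) * INR 2.
  by rewrite d1 (_ : zr 1%R = 1) //=; field.
pose pref := ((- 3 * INR N + zr (\tr M)%R) / 4)%coqR.
have h4 : is_rat (/ 4) by have := is_rat_inv (is_rat_nat 4); rewrite (_ : INR 4 = 4) //=; ring.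
have [E [rE hE]] : exists E, is_rat E /\ forall f, Lam e c f <> RtoC 0 -> star_exp M c (/ 4) f = E.
  have off j k : j != c -> k != c -> j != k -> M j k = (if e j k then - 1 else 0)%R.
    by move=> _ _; case: hpl => _ h _; exact: h.
  (* If all weights vanish the condition on E is void, and 0 serves as a rational exponent. *)
  case: (classic (exists f, Lam e c f <> RtoC 0)) => [[g hg]|no]; last first.
    by exists 0; split; [exact: (is_rat_nat 0) | move=> f hf; case: no; exists f].
  exists (star_exp M c (/ 4) g); split=> [|f hf]; first exact: star_exp_rat.
  have := congr1 zr (star_disc_const hleg sym hM off d1 hf hg).
  have X (x y : int) : zr (x - y)%R = zr x - zr y by rewrite zrD zrN.
  by rewrite !X !zrM /star_exp => h; congr (_ * _ / _); simpl; lra.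
have [rho hrho] : is_rat (pref + E).
  apply: is_rat_plus => //; apply: is_rat_mult => //; apply: is_rat_plus; last exact: is_rat_int.
  by apply: is_rat_mult; [exact: (is_rat_int (- 3%:Z)%R) | exact: is_rat_nat].
pose s := index_enum {ffun 'I_N -> 'I_3}.
pose K := cutoff 1.
pose phi f := phiQ (absz (fA M c)) 1 (fB M c f) (psi_c c parity_mem f).
pose dd f := ddQ (absz (fA M c)) 1 (fB M c f) (psi_c c parity_mem f).
have phi1 f n : Cmod (phi f n) <= 1 by apply: phiQ_bound; exact: psi_c_bound.
exists rho, (thetaf (2 * INR a) (fun n => \big[Cplus/RtoC 0]_(f <- s) (Lam e c f * phi f n)%C) (int_box K)
  (fun n => \big[Cplus/RtoC 0]_(f <- s) (Lam e c f * dd f n)%C)); split=> [|tau ht].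
  apply: (@thetaf_quantum_modular a _ (\big[Rplus/0]_(f <- s) (Cmod (Lam e c f) * 1))) => // n.
    apply: eq_bigr => f _; congr Cmult.
    apply: (phiQ_periodic (Q := 2) _ A0 _ hp) => // m.
    by apply: (psi_c_periodic hc sym hM _ _ _ hp) => // g k; exact: parity_mem_add.
  apply: Rle_trans (Cmod_bigsum _ _) _; apply: bigR_le => f _; rewrite Cmod_mult.
  by apply: Rmult_le_compat_l; [exact: Cmod_ge_0 | exact: phi1].
have a2 : 0 < 2 * INR a by have : 0 < INR a; [apply: lt_0_INR; move: A0; rewrite /a; lia | lra].
have hdd f n : n \notin int_box K -> dd f n = RtoC 0.
  by apply: (ddQ_support _ A0 _ _ hp) => //; exact: cutoffP.
rewrite (thetaf_linear s (Lam e c) a2 ht phi1 hdd) -bigC_scal.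
pose r (m : 'cV[int]_N) := (invform M m / 4)%coqR.
have hr m : r m = / 4 * invform M m by rewrite /r; lra.
have q0 : 0 < / 4 by lra.
have H := star_PV (fun m => parity_memP m d1) q0 hr (isT : (0 < 1)%N) (isT : (0 < 2)%N) (isT : ~~ odd 2) hp hcq (@cutoffP 1) ht pref.
rewrite /Zhat0 -/pref; apply: etrans H _.
apply: eq_bigr => f _; rewrite hrho.
case: (classic (Lam e c f = RtoC 0)) => [->|/hE ->]; first by ring.
have X (x y z : C) : (x * y * z = y * (x * z))%C by ring.
exact: X.
Qed.
End Main.

Local Open Scope ring_scope.

Theorem theorem4p2 (N : nat) (e : rel 'I_N) (M : 'M[int]_N)
    (he : three_leg_star e) (hM : plumbing_matrix e M) :
  (exists (r : nat) (lam : 'I_r -> C) (rho : 'I_r -> rat) (f : 'I_r -> C -> C),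
      (forall j, quantum_modular (1 / 2%:R) (fun=> True) (f j)) /\
      forall tau : C, Rlt 0 (Im tau) ->
        Zser e M tau =
        \big[Cplus/RtoC 0]_(j < r)
          (lam j * qpow tau (ratr (rho j)) * f j tau)%C) /\
  (\det M = 1 ->
     exists (rho : rat) (f : C -> C),
       quantum_modular (1 / 2%:R) (fun=> True) f /\
       forall tau : C, Rlt 0 (Im tau) ->
         Zhat0 e M tau = (qpow tau (ratr rho) * f tau)%C).
Proof.
have [c [lab [es ei hc hleg]]] := three_leg_star_legs he.
split; first exact: Zser_quantum es ei hc hleg hM.
exact: Zhat0_quantum es ei hc hleg hM.
Qed.
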